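(* Let $(\mathcal D,\mathcal D_*,\Theta)$ be a purely contractive analytic function and let the triple $((G_1,G_2),(W_1,W_2),\Theta)$ be admissible. Define the pair $(\mathbf T_1,\mathbf T_2)$ of commuting contractions on $$\mathbb H=\big(H^2(\mathcal D_* )\oplus\overline{\Delta_\Theta L^2(\mathcal D)}\big)\ominus\{\Theta f\oplus\Delta_\Theta f:f\in H^2(\mathcal D)\}$$ by $(\mathbf T_1,\mathbf T_2)=P_{\mathbb H}\big(M_{G_1^*+zG_2}\oplus W_1,\;M_{G_2^*+zG_1}\oplus W_2\big)|_{\mathbb H}$. A (closed) subspace $\mathbb H'$ of $\mathbb H$ is jointly invariant under $(\mathbf T_1,\mathbf T_2)$ if and only if there exist a Hilbert space $\mathcal F$, two contractive analytic functions $(\mathcal D,\mathcal F,\Theta')$ and $(\mathcal F,\mathcal D_*,\Theta'')$ such that $\Theta=\Theta''\Theta'$ is a regular factorization, two contractions $G_1',G_2'\in\mathcal B(\mathcal F)$, and a pair $(W_1',W_2')$ of unitary operators on $\overline{\Delta_{\Theta'}L^2(\mathcal D)}$ with $$W_1'W_2'=W_2'W_1'=M_\zeta|_{\overline{\Delta_{\Theta'}L^2(\mathcal D)}},$$ such that, with $Z$ the unitary operator associated with the regular factorization $\Theta=\Theta''\Theta'$, $$\mathbb H'=\{\Theta''f\oplus Z^{-1}(\Delta_{\Theta''}f\oplus g): f\in H^2(\mathcal F),\,g\in\overline{\Delta_{\Theta'}L^2(\mathcal D)}\}\ominus\{\Theta h\oplus\Delta_\Theta h:h\in H^2(\mathcal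 D)\},$$ $$\mathbb H'':=\mathbb H\ominus\mathbb H'=\big(H^2(\mathcal D_* )\oplus Z^{-1}(\overline{\Delta_{\Theta''}L^2(\mathcal F)}\oplus\{0\})\big)\ominus\{\Theta''f\oplus Z^{-1}(\Delta_{\Theta''}f\oplus0):f\in H^2(\mathcal F)\},$$ and for every $f\in H^2(\mathcal F)$, $g\in\overline{\Delta_{\Theta'}L^2(\mathcal D)}$ and $(i,j)=(1,2),(2,1)$, $$\begin{bmatrix}M_{G_i^*+zG_j}&0\\0&W_i\end{bmatrix}\begin{bmatrix}\Theta''f\\Z^{-1}(\Delta_{\Theta''}f\oplus g)\end{bmatrix}=\begin{bmatrix}\Theta''M_{G_i'^*+zG_j'}f\\Z^{-1}(\Delta_{\Theta''}M_{G_i'^*+zG_j'}f\oplus W_i'g)\end{bmatrix}.$$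
   Context: $H^2(\mathcal E)\subset L^2(\mathcal E)$ are the $\mathcal E$-valued Hardy space of the unit disk $\mathbb D$ and the $L^2$-space on the unit circle $\mathbb T$; $M_\varphi$ is multiplication by $\varphi$; $M_z$ (on $H^2$) and $M_\zeta$ (on $L^2$) are multiplication by the coordinate function. A contractive analytic function $(\mathcal D,\mathcal D_*,\Theta)$ is an analytic $\mathcal B(\mathcal D,\mathcal D_* )$-valued function $\Theta$ on $\mathbb D$ with $\|\Theta(z)\|\le1$; it is purely contractive if $\|\Theta(0)\xi\|<\|\xi\|$ for all nonzero $\xi\in\mathcal D$; $\Delta_\Theta(\zeta)=(I-\Theta(\zeta)^*\Theta(\zeta))^{1/2}$ for a.e. $\zeta\in\mathbb T$. Admissible triple. Let $(\mathcal D,\mathcal D_*,\Theta)$ be a contractive analytic function, $(G_1,G_2)$ a pair of contractions on $\mathcal D_*$, $(W_1,W_2)$ a pair of commuting unitaries on $\overline{\Delta_\Theta L^2(\mathcal D)}$. Put $\mathcal Q=\{\Theta f\oplus\Delta_\Theta f:f\in H^2(\mathcal D)\}$ and $\mathcal H_\Theta=(H^2(\mathcal D_* )\oplus\overline{\Delta_\Theta L^2(\mathcal D)})\ominus\mathcal Q$. The triple $((G_1,G_2),(W_1,W_2),\Theta)$ is admissible if, for $(i,j)=(1,2),(2,1)$: (1) $M_{G_i^*+zG_j}\oplus W_i$ is a contraction; (2) $W_1W_2=W_2W_1=M_\zeta|_{\overline{\Delta_\Theta L^2(\mathcal D)}}$; (3) $\mathcal Q$ is jointly invariant under $M_{G_1^*+zG_2}\oplus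 W_1$, $M_{G_2^*+zG_1}\oplus W_2$ and $M_z\oplus M_\zeta|_{\overline{\Delta_\Theta L^2(\mathcal D)}}$; (4) $(M_{G_i^*+zG_j}^*\oplus W_i^* )(M_{G_j^*+zG_i}^*\oplus W_j^* )|_{\mathcal H_\Theta}=(M_z^*\oplus M_\zeta^*|_{\overline{\Delta_\Theta L^2(\mathcal D)}})|_{\mathcal H_\Theta}$. Regular factorization. If $\Theta=\Theta''\Theta'$ with contractive analytic functions $(\mathcal D,\mathcal F,\Theta')$, $(\mathcal F,\mathcal D_*,\Theta'')$, then for a.e. $\zeta\in\mathbb T$ the map $Z(\zeta):\Delta_\Theta(\zeta)v\mapsto\Delta_{\Theta''}(\zeta)\Theta'(\zeta)v\oplus\Delta_{\Theta'}(\zeta)v$ ($v\in\mathcal D$) extends to an isometry from $\overline{\Delta_\Theta(\zeta)\mathcal D}$ into $\overline{\Delta_{\Theta''}(\zeta)\mathcal F}\oplus\overline{\Delta_{\Theta'}(\zeta)\mathcal D}$; the factorization is regular if this isometry is onto for a.e. $\zeta\in\mathbb T$. In that case $Z$ denotes the induced (pointwise) unitary operator from $\overline{\Delta_\Theta L^2(\mathcal D)}$ onto $\overline{\Delta_{\Theta''}L^2(\mathcal F)}\oplus\overline{\Delta_{\Theta'}L^2(\mathcal D)}$. *)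

(* Defs.v *)
From HB Require Import structures.
From mathcomp Require Import all_boot all_order all_algebra sesquilinear complex.
From mathcomp Require Import generic_quotient ring lra.
From mathcomp Require Import all_classical all_reals all_analysis measurable_realfun.
Set Implicit Arguments.
Unset Strict Implicit.
Unset Printing Implicit Defensive.
Import Order.TTheory GRing.Theory Num.Theory.
Import numFieldNormedType.Exports.
Local Open Scope classical_set_scope.
Local Open Scope ring_scope.
Local Open Scope complex_scope.

Section DotTriangle.
Context (C : numClosedFieldType) (V : lmodType C) (f : {dot V for @Num.conj C}).

Lemma dot_CauchySchwarz (u v : V) :
  `|f u v| <= sqrtC (f u u) * sqrtC (f v v).
Proof.
rewrite -(sqrCK (normr_ge0 _)) -sqrtCM ?nnegrE ?dnorm_ge0//.
rewrite ler_sqrtC ?nnegrE ?exprn_ge0 ?mulr_ge0 ?dnorm_ge0//.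
have [->|vN0] := eqVneq v 0; first by rewrite linear0r normr0 expr0n/= mulr_ge0 ?dnorm_ge0.
pose a := f u v / f v v; pose w := u - a *: v.
have fvv : f v v != 0 by rewrite dnorm_eq0.
have wv : f w v = 0 by rewrite linearBl/= linearZl_LR/= divfK// subrr.
have uE : u = w + a *: v by rewrite subrK.
have -> : f u v = a * f v v by rewrite divfK.
have -> : f u u = f w w + `|a| ^+ 2 * f v v.
  rewrite {1 2}uE hnormDd; last by rewrite linearZr_LR/= wv mulr0.
  by congr (_ + _); exact: dnormZ.
rewrite mulrDl normrM exprMn [`|f v v|]ger0_norm ?dnorm_ge0//.
by rewrite [f v v ^+ 2]expr2 mulrA lerDr mulr_ge0 ?dnorm_ge0.
Qed.

Lemma dot_triangle (u v : V) :
  sqrtC (f (u + v) (u + v)) <= sqrtC (f u u) + sqrtC (f v v).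
Proof.
rewrite -ler_sqr ?nnegrE ?addr_ge0 ?sqrtC_ge0 ?dnorm_ge0//.
rewrite sqrrD !sqrtCK dnormD addrAC lerD2r lerD2l.
rewrite -mulr_natl -ler_pdivrMl// (le_trans _ (dot_CauchySchwarz u v))//.
by rewrite mulrC -ReE; case: (leif_Re_Creal (f u v)).
Qed.

End DotTriangle.

HB.mixin Record NormedModule_hasInner (R : realType) V
    & NormedModule R[i] V := {
  inner : {dot V for @Num.conj R[i]};
  norm_inner : forall x : V, `|x| ^+ 2 = inner x x }.

#[short(type="preHilbertType")]
HB.structure Definition PreHilbert (R : realType) :=
  {V of NormedModule R[i] V & NormedModule_hasInner R V}.

(* Separability is part of the structure: over a nonseparable space a bounded
   analytic operator function need not have boundary values almost everywhere. *)
HB.mixin Record Topological_isSeparable T & Topological T := {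
  separable_dense : exists S : set T, countable S /\ dense S }.

#[short(type="sepHilbertType")]
HB.structure Definition SepHilbert (R : realType) :=
  {V of PreHilbert R V & CompleteNormedModule R[i] V
      & Topological_isSeparable V}.

(* The inner product, linear in its first argument, defines the norm and the
   topology. *)
HB.factory Record Lmodule_hasInner (R : realType) V & GRing.Lmodule R[i] V := {
  inner : {dot V for @Num.conj R[i]} }.

HB.builders Context R V & Lmodule_hasInner R V.

Let nrm (x : V) : R[i] := sqrtC (inner x x).

Let nrmZ (l : R[i]) x : nrm (l *: x) = `|l| * nrm x.
Proof. by rewrite /nrm dnormZ sqrtCM ?nnegrE ?exprn_ge0 ?dnorm_ge0 ?sqrCK. Qed.

Let nrm0 x : nrm x = 0 -> x = 0.
Proof. by move=> /eqP; rewrite sqrt_dnorm_eq0 => /eqP. Qed.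

HB.instance Definition _ :=
  @Lmodule_isNormed.Build R[i] V nrm (dot_triangle inner) nrmZ nrm0.

Let nrmE (x : V) : `|x| ^+ 2 = inner x x.
Proof. by rewrite sqrtCK. Qed.

HB.instance Definition _ := @NormedModule_hasInner.Build R V inner nrmE.

HB.end.

(* An alias of the product that carries the Hilbert direct sum norm instead of
   the sup norm. *)
Definition dsum (U V : Type) : Type := (U * V)%type.
Definition dsum_pair (U V : Type) (u : U) (v : V) : dsum U V := (u, v).
Notation "u ⊕ v" := (dsum_pair u v) (at level 50, left associativity) : ring_scope.

Section DirectSum.
Context (R : realType) (U V : preHilbertType R).

HB.instance Definition _ := GRing.Lmodule.copy (dsum U V) (U * V)%type.

Definition dsum_inner (x y : dsum U V) : R[i] :=
  inner x.1 y.1 + inner x.2 y.2.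

Let dsum_inner_bilinear :
  bilinear_for (GRing.Scale.Law.clone _ _ *%R _)
    (GRing.Scale.Law.clone _ _ (@Num.conj R[i] \; *%R) _) dsum_inner.
Proof.
split=> [z a x y|z a x y] /=; rewrite /dsum_inner.
  by rewrite !linearPl/= mulrDr addrACA.
by rewrite !linearPr/= mulrDr addrACA.
Qed.

HB.instance Definition _ :=
  bilinear_isBilinear.Build _ _ _ _ _ _ dsum_inner dsum_inner_bilinear.

Let dsum_inner_herm x y :
  dsum_inner x y = (-1) ^+ false * Num.conj (dsum_inner y x).
Proof.
rewrite /dsum_inner expr0 mul1r rmorphD/=.
by rewrite (hermC inner x.1) (hermC inner x.2) !expr0 !mul1r.
Qed.

HB.instance Definition _ :=
  isHermitianSesquilinear.Build _ _ _ _ dsum_inner dsum_inner_herm.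

Let dsum_inner_gt0 x : x != 0 -> 0 < dsum_inner x x.
Proof.
move=> x0; rewrite lt_def addr_ge0 ?dnorm_ge0// andbT.
rewrite paddr_eq0 ?dnorm_ge0// !dnorm_eq0.
by apply: contra x0 => /andP[/eqP x1 /eqP x2]; rewrite [x]surjective_pairing x1 x2.
Qed.

HB.instance Definition _ := isDotProduct.Build _ _ dsum_inner dsum_inner_gt0.

HB.instance Definition _ := @Lmodule_hasInner.Build R (dsum U V) dsum_inner.

End DirectSum.

Section RealInner.
Context (R : realType) (V : preHilbertType R).
Implicit Types x y z : V.

Local Notation rdot x y := (complex.Re (inner x y)).

Lemma inner_conj x y : inner x y = (inner y x)^*.
Proof. by rewrite (hermC inner) expr0 mul1r. Qed.

Lemma rdotC x y : rdot x y = rdot y x.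
Proof. by rewrite inner_conj; case: (inner y x). Qed.

Lemma Im_inner x y : complex.Im (inner x y) = rdot x ('i%C *: y).
Proof.
rewrite linearZr_LR/=; case: (inner x y) => a b /=.
by rewrite mul0r sub0r mulN1r opprK.
Qed.

Lemma rdot_norm x : complex.Re (`|x| ^+ 2) = rdot x x.
Proof. by rewrite norm_inner. Qed.

Lemma rdot_ge0 x : 0 <= rdot x x.
Proof. by have := dnorm_ge0 inner x; rewrite lecE => /andP[]. Qed.

Lemma inner_rdot x : inner x x = (rdot x x)%:C.
Proof. by rewrite RRe_real// ger0_real ?dnorm_ge0. Qed.

Lemma rdotD x y z : rdot (x + y) z = rdot x z + rdot y z.
Proof. by rewrite linearDl/= raddfD. Qed.

Lemma rdotN x z : rdot (- x) z = - rdot x z.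
Proof. by rewrite linearNl/= raddfN. Qed.

Lemma rdotDD x y : rdot (x + y) (x + y) = rdot x x + 2 * rdot x y + rdot y y.
Proof. by rewrite rdotD ![rdot _ (x + y)]rdotC !rdotD [rdot y x]rdotC; ring. Qed.

Lemma rdotBB x y : rdot (x - y) (x - y) = rdot x x - 2 * rdot x y + rdot y y.
Proof.
by rewrite rdotDD [rdot x (- y)]rdotC !rdotN [rdot y x]rdotC [rdot y (- y)]rdotC rdotN; ring.
Qed.

Lemma normr_rdot x y : `|rdot x y| <= rdot x x + rdot y y.
Proof.
have := rdot_ge0 (x + y); have := rdot_ge0 (x - y).
have := rdot_ge0 x; have := rdot_ge0 y.
by rewrite rdotBB rdotDD ler_norml => *; apply/andP; split; lra.
Qed.

Lemma rdotZ (a : R[i]) x : rdot (a *: x) (a *: x) = complex.Re (`|a| ^+ 2) * rdot x x.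
Proof.
rewrite (dnormZ inner) [in LHS]inner_rdot -[`|a| ^+ 2]RRe_real ?ger0_real ?exprn_ge0//.
by rewrite -rmorphM.
Qed.

End RealInner.

Section ComplexIntegral.
Context d (T : measurableType d) (R : realType).
Variable mu : {measure set T -> \bar R}.
Implicit Types f g : T -> R[i].

Definition cmeasurable f : Prop :=
  measurable_fun setT (fun t => complex.Re (f t)) /\
  measurable_fun setT (fun t => complex.Im (f t)).

Definition cintegrable f : Prop :=
  mu.-integrable setT (fun t => (complex.Re (f t))%:E) /\
  mu.-integrable setT (fun t => (complex.Im (f t))%:E).

Definition cintegral f : R[i] :=
  (\int[mu]_t complex.Re (f t)) +i* (\int[mu]_t complex.Im (f t)).

Lemma cintegralP (a : R[i]) f g : cintegrable f -> cintegrable g ->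
  cintegral (fun t => a * f t + g t) = a * cintegral f + cintegral g.
Proof.
move=> [fr fi] [gr gi]; case: a => a b; rewrite /cintegral.
have key (p q : R) (u v w : T -> R) :
    mu.-integrable setT (EFin \o u) -> mu.-integrable setT (EFin \o v) ->
    mu.-integrable setT (EFin \o w) ->
  \int[mu]_t (p * u t + q * v t + w t) =
  p * (\int[mu]_t u t) + q * (\int[mu]_t v t) + \int[mu]_t w t.
  move=> iu iv iw.
  have ipu : mu.-integrable setT (EFin \o (fun t => p * u t)).
    exact: (integrableZl measurableT p iu).
  have iqv : mu.-integrable setT (EFin \o (fun t => q * v t)).
    exact: (integrableZl measurableT q iv).
  rewrite RintegralD//; last first.
    exact: (integrableD measurableT ipu iqv).
  by rewrite RintegralD// !RintegralZl.
have -> : (fun t => complex.Re ((a +i* b) * f t + g t)) =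
   (fun t => a * complex.Re (f t) + (- b) * complex.Im (f t) + complex.Re (g t)).
  by apply/funext => t; case: (f t) => ? ?; case: (g t) => ? ? /=; rewrite mulNr.
have -> : (fun t => complex.Im ((a +i* b) * f t + g t)) =
   (fun t => a * complex.Im (f t) + b * complex.Re (f t) + complex.Im (g t)).
  by apply/funext => t; case: (f t) => ? ?; case: (g t).
by rewrite !key// mulNr.
Qed.

Lemma cintegral_conj f : cintegrable f ->
  cintegral (fun t => (f t)^*) = (cintegral f)^*.
Proof.
move=> [fr fi]; rewrite /cintegral /=; congr (_ +i* _).
  by apply: eq_Rintegral => t _; case: (f t).
rewrite -mulN1r -RintegralZl//.
by apply: eq_Rintegral => t _; case: (f t) => a b /=; rewrite mulN1r.
Qed.

Lemma ae_cintegral f g : cmeasurable f -> cmeasurable g ->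
  f = g %[ae mu] -> cintegral f = cintegral g.
Proof.
move=> [fr fi] [gr gi] fg; rewrite /cintegral /Rintegral.
by congr (fine _ +i* fine _); apply: ae_eq_integral => //;
  first [exact/measurable_EFinP | by apply: filterS fg => t + Dt => /(_ Dt) ->].
Qed.

End ComplexIntegral.

Section SquareIntegrable.
Context d (T : measurableType d) (R : realType).
Variable mu : {measure set T -> \bar R}.
Variable E : sepHilbertType R.
Implicit Types f g : T -> E.

(* Weak measurability; it coincides with strong measurability, E being
   separable. *)
Definition l2fun f : Prop :=
  (forall v : E, cmeasurable (fun t => inner (f t) v)) /\
  (\int[mu]_t (complex.Re (`|f t| ^+ 2))%:E < +oo)%E.

Local Notation rdot x y := (complex.Re (inner x y)).

Let measurable_rdot f :
  (forall v : E, measurable_fun setT (fun t => rdot (f t) v)) ->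
  measurable_fun setT (fun t => rdot (f t) (f t)).
Proof.
move=> mf mD; apply: (measurability _ (RGenOInfty.measurableE R)) => //.
move=> /= _ [_ [a ->] <-]; rewrite setTI.
have [S [Sc Sd]] := separable_dense (s := E).
have /countable_injP[k kinj] := Sc.
pose F n := [set t | exists u, [/\ S u, k u = n &
  a < 2 * rdot (f t) u - rdot u u]].
rewrite (_ : _ @^-1` _ = \bigcup_n F n).
  apply: bigcupT_measurable => n.
  have [[u [Su kun]]|nou] := pselect (exists u, S u /\ k u = n); last first.
    rewrite (_ : F n = set0) //; apply/seteqP; split => // t [u [Su kun _]].
    by apply: nou; exists u.
  rewrite (_ : F n = (fun t => 2 * rdot (f t) u - rdot u u) @^-1` `]a, +oo[).
    rewrite -[X in measurable X]setTI.
    suff : measurable_fun setT (fun t => 2 * rdot (f t) u - rdot u u).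
      by apply => //; exact: measurable_itv.
    apply: measurable_funB => //; apply: measurable_funM => //; exact: mf.
  apply/seteqP; split=> [t [v [Sv kvn]]|t]; rewrite /= in_itv/= andbT.
    suff -> : u = v by [].
    by apply: kinj; rewrite ?inE// kun kvn.
  by move=> ?; exists u.
apply/seteqP; split=> [t|t [n _ [u [_ _ au]]]]; rewrite /= in_itv/= andbT.
  move=> aft.
  pose e := Num.sqrt (rdot (f t) (f t) - a).
  have e0 : 0 < e by rewrite sqrtr_gt0 subr_gt0.
  have [||u [bu Su]] := Sd (ball (f t) e%:C).
  - by exists (f t); apply: ballxx; rewrite ltcR.
  - exact: ball_open.
  exists (k u) => //; exists u; split => //.
  move: bu; rewrite -ball_normE/= => bu.
  have : complex.Re (`|f t - u| ^+ 2) < e ^+ 2.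
    have : `|f t - u| ^+ 2 < e%:C ^+ 2.
      by rewrite ltr_pXn2r// ?nnegrE// lecR ltW.
    rewrite -[`|f t - u| ^+ 2]RRe_real ?ger0_real ?exprn_ge0//.
    by rewrite -rmorphXn ltcR.
  rewrite rdot_norm rdotBB sqr_sqrtr ?subr_ge0 ?ltW//.
  by lra.
by apply: (lt_le_trans au); have := rdot_ge0 (f t - u); rewrite rdotBB; lra.
Qed.

Lemma l2fun_measurable f g : (forall v : E, cmeasurable (fun t => inner (f t) v)) ->
  (forall v : E, cmeasurable (fun t => inner (g t) v)) ->
  cmeasurable (fun t => inner (f t) (g t)).
Proof.
have key (h k : T -> E) :
  (forall v : E, cmeasurable (fun t => inner (h t) v)) ->
  (forall v : E, cmeasurable (fun t => inner (k t) v)) ->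
  measurable_fun setT (fun t => rdot (h t) (k t)).
  move=> mh mk.
  have -> : (fun t => rdot (h t) (k t)) = (fun t => 2^-1 *
      (rdot (h t + k t) (h t + k t) - (rdot (h t) (h t) + rdot (k t) (k t)))).
    by apply/funext => t; rewrite rdotDD; field.
  have mR x : (forall v : E, cmeasurable (fun t => inner (x t) v)) ->
      forall v : E, measurable_fun setT (fun t => rdot (x t) v).
    by move=> mx v; case: (mx v).
  apply: measurable_funM => //; apply: measurable_funB.
    apply: measurable_rdot => v.
    under eq_fun do rewrite rdotD.
    by apply: measurable_funD; exact: mR.
  by apply: measurable_funD; apply: measurable_rdot; exact: mR.
move=> mf mg; split; first exact: key.
under eq_fun do rewrite Im_inner.
apply: key => // v.
have [m1 m2] := mg v.
rewrite /cmeasurable.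
have -> : (fun t => complex.Re (inner ('i%C *: g t) v)) =
  (fun t => - complex.Im (inner (g t) v)).
  apply/funext => t; rewrite linearZl_LR/=; case: (inner (g t) v) => a b /=.
  by rewrite mul0r sub0r mul1r.
have -> : (fun t => complex.Im (inner ('i%C *: g t) v)) =
  (fun t => complex.Re (inner (g t) v)).
  apply/funext => t; rewrite linearZl_LR/=; case: (inner (g t) v) => a b /=.
  by rewrite mul0r add0r mul1r.
by split => //; exact: measurable_funN.
Qed.

Let l2_sq f : l2fun f ->
  mu.-integrable setT (fun t => (rdot (f t) (f t))%:E).
Proof.
move=> [mf foo]; apply/integrableP; split.
  by apply/measurable_EFinP; case: (l2fun_measurable mf mf).
under eq_integral do rewrite gee0_abs ?lee_fin ?rdot_ge0//.
by move: foo; under eq_integral do rewrite rdot_norm.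
Qed.

Let l2_intP f : (forall v : E, cmeasurable (fun t => inner (f t) v)) ->
  mu.-integrable setT (fun t => (rdot (f t) (f t))%:E) -> l2fun f.
Proof.
move=> mf /integrableP[_ foo]; split => //.
move: foo; under eq_integral do rewrite gee0_abs ?lee_fin ?rdot_ge0//.
by under [in X in _ -> X]eq_integral do rewrite rdot_norm.
Qed.

Lemma l2fun_cintegrable f g : l2fun f -> l2fun g ->
  cintegrable mu (fun t => inner (f t) (g t)).
Proof.
move=> lf lg; have [mr mi] := l2fun_measurable lf.1 lg.1.
have ifg := integrableD measurableT (l2_sq lf) (l2_sq lg).
split; apply: (le_integrable measurableT _ _ ifg).
- exact/measurable_EFinP.
- move=> t _ /=; rewrite lee_fin (le_trans (normr_rdot _ _))// ler_norm//.
- exact/measurable_EFinP.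
- move=> t _ /=; rewrite lee_fin Im_inner (le_trans (normr_rdot _ _))//.
  suff -> : rdot ('i%C *: g t) ('i%C *: g t) = rdot (g t) (g t) by exact: ler_norm.
  have i1 : `|'i%C| = 1 :> R[i] by rewrite normc_def/= expr0n expr1n add0r sqrtr1.
  by rewrite rdotZ i1 expr1n mul1r.
Qed.

Lemma l2fun0 : l2fun (fun=> 0).
Proof.
split.
  move=> v; rewrite /cmeasurable; under eq_fun do rewrite linear0l/=.
  by under [X in _ /\ measurable_fun _ X]eq_fun do rewrite linear0l/=.
under eq_integral do rewrite normr0 expr0n/=.
by rewrite integral0.
Qed.

Lemma l2funP (a : R[i]) f g : l2fun f -> l2fun g ->
  l2fun (fun t => a *: f t + g t).
Proof.
move=> lf lg.
have mfg (v : E) : cmeasurable (fun t => inner (a *: f t + g t) v).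
  have [fr fi] := lf.1 v; have [gr gi] := lg.1 v.
  rewrite /cmeasurable; case: a => a b.
  have -> : (fun t => rdot ((a +i* b) *: f t + g t) v) = (fun t =>
     a * rdot (f t) v - b * complex.Im (inner (f t) v) + rdot (g t) v).
    apply/funext => t; rewrite linearPl/=.
    by case: (inner (f t) v) => ? ?; case: (inner (g t) v).
  have -> : (fun t => complex.Im (inner ((a +i* b) *: f t + g t) v)) = (fun t =>
     a * complex.Im (inner (f t) v) + b * rdot (f t) v + complex.Im (inner (g t) v)).
    apply/funext => t; rewrite linearPl/=.
    by case: (inner (f t) v) => ? ?; case: (inner (g t) v).
  by split; apply: measurable_funD => //;
    [apply: measurable_funB|apply: measurable_funD];
    apply: measurable_funM.
apply: l2_intP => //.
have h1 := integrableZl measurableT (2 * complex.Re (`|a| ^+ 2)) (l2_sq lf).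
have h2 := integrableZl measurableT 2 (l2_sq lg).
apply: (le_integrable measurableT _ _ (integrableD measurableT h1 h2)).
  by apply/measurable_EFinP; case: (l2fun_measurable mfg mfg).
move=> t _ /=; rewrite lee_fin !ger0_norm ?rdot_ge0//; last first.
  rewrite addr_ge0// !mulr_ge0// ?rdot_ge0//.
  have : 0 <= `|a| ^+ 2 by rewrite exprn_ge0.
  by rewrite lecE => /andP[].
rewrite rdotDD rdotZ -mulrA -rdotZ.
by have := rdot_ge0 (a *: f t - g t); rewrite rdotBB; lra.
Qed.

End SquareIntegrable.

Section L2.
Context d (T : measurableType d) (R : realType).
Variable mu : {measure set T -> \bar R}.
Variable E : sepHilbertType R.

Definition l2_fun : Type := {f : T -> E | `[< l2fun mu f >]}.
HB.instance Definition _ := Choice.on l2_fun.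

Definition l2_ae_eq (f g : l2_fun) : bool := `[< sval f = sval g %[ae mu] >].

Let l2_ae_eq_refl : reflexive l2_ae_eq.
Proof. by move=> f; apply/asboolP; exact: aeW. Qed.

Let l2_ae_eq_sym : symmetric l2_ae_eq.
Proof.
by move=> f g; apply/idP/idP => /asboolP fg; apply/asboolP; exact: ae_eq_sym.
Qed.

Let l2_ae_eq_trans : transitive l2_ae_eq.
Proof.
by move=> g f h /asboolP fg /asboolP gh; apply/asboolP; exact: ae_eq_trans gh.
Qed.

Canonical l2_ae_eq_equiv :=
  EquivRel l2_ae_eq l2_ae_eq_refl l2_ae_eq_sym l2_ae_eq_trans.

Local Open Scope quotient_scope.

Definition L2 : Type := {eq_quot l2_ae_eq}.
HB.instance Definition _ := Choice.on L2.
HB.instance Definition _ := EqQuotient.on L2.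

Definition L2_repr (f : L2) : T -> E := sval (repr f).
Local Coercion L2_repr : L2 >-> Funclass.

Let L2cls (g : T -> E) (lg : l2fun mu g) : L2 :=
  \pi_(L2) (exist _ g (asboolT lg) : l2_fun).

Let L2clsE (g : T -> E) (lg : l2fun mu g) : (L2cls lg : T -> E) = g %[ae mu].
Proof.
rewrite /L2_repr /L2cls; set x : l2_fun := exist _ _ _.
have /eqmodP/asboolP : repr (\pi_(L2) x) = x %[mod L2] by rewrite reprK.
by [].
Qed.

Definition L2_zero : L2 := L2cls (l2fun0 mu E).

(* The class of the functions equal to g almost everywhere, for g equal almost
   everywhere to a measurable square-integrable function. *)
Definition L2of (g : T -> E) : L2 :=
  xget L2_zero [set h : L2 | (h : T -> E) = g %[ae mu]].

Implicit Types f g h : L2.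

Lemma L2_reprP f : l2fun mu f.
Proof. exact/asboolP/(svalP (repr f)). Qed.

Lemma L2_eq f g : (f : T -> E) = g %[ae mu] -> f = g.
Proof.
move=> fg; rewrite -(reprK f) -(reprK g); apply/eqmodP.
exact/asboolP.
Qed.

Lemma L2ofK (g : T -> E) : l2fun mu g -> (L2of g : T -> E) = g %[ae mu].
Proof.
move=> lg; rewrite /L2of; case: xgetP => [h _ //|/(_ (L2cls lg))[]].
exact: L2clsE.
Qed.

Let addL f g : L2 := L2of (fun t => f t + g t).
Let oppL f : L2 := L2of (fun t => - f t).
Let scaleL (a : R[i]) f : L2 := L2of (fun t => a *: f t).

Lemma L2D f g : l2fun mu (fun t => f t + g t).
Proof.
have := l2funP 1 (L2_reprP f) (L2_reprP g).
by under eq_fun do rewrite scale1r.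
Qed.

Let lscale (a : R[i]) f : l2fun mu (fun t => a *: f t).
Proof.
have := l2funP a (L2_reprP f) (l2fun0 mu E).
by under eq_fun do rewrite addr0.
Qed.

Let lopp f : l2fun mu (fun t => - f t).
Proof. by under eq_fun do rewrite -scaleN1r; exact: lscale. Qed.

Let L20E : (L2_zero : T -> E) = (fun=> 0) %[ae mu].
Proof.
exact: L2clsE.
Qed.

Let addA : associative addL.
Proof.
move=> f g h; apply: L2_eq.
near=> t => _.
rewrite /addL (near (L2ofK (L2D f (addL g h))) t)// (near (L2ofK (L2D g h)) t)//.
rewrite (near (L2ofK (L2D (addL f g) h)) t)// (near (L2ofK (L2D f g)) t)//.
by rewrite addrA.
Unshelve. all: by end_near. Qed.

Let addC : commutative addL.
Proof. by move=> f g; rewrite /addL; congr L2of; apply/funext => t; rewrite addrC. Qed.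

Let add0 : left_id L2_zero addL.
Proof.
move=> f; apply: L2_eq; near=> t => _.
by rewrite /addL (near (L2ofK (L2D _ f)) t)// (near L20E t)// add0r.
Unshelve. all: by end_near. Qed.

Let addN : left_inverse L2_zero oppL addL.
Proof.
move=> f; apply: L2_eq; near=> t => _.
rewrite /addL (near (L2ofK (L2D _ f)) t)// (near (L2ofK (lopp f)) t)//.
by rewrite (near L20E t)// addNr.
Unshelve. all: by end_near. Qed.

HB.instance Definition _ := GRing.isZmodule.Build L2 addA addC add0 addN.

Let scaleA (a b : R[i]) f : scaleL a (scaleL b f) = scaleL (a * b) f.
Proof.
apply: L2_eq; near=> t => _; rewrite /scaleL (near (L2ofK (lscale a _)) t)//.
by rewrite (near (L2ofK (lscale b f)) t)// (near (L2ofK (lscale (a * b) f)) t)// scalerA.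
Unshelve. all: by end_near. Qed.

Let scale1 : left_id 1 scaleL.
Proof.
move=> f; apply: L2_eq; near=> t => _.
by rewrite /scaleL (near (L2ofK (lscale 1 f)) t)// scale1r.
Unshelve. all: by end_near. Qed.

Let scaleDr : right_distributive scaleL +%R.
Proof.
move=> a f g; apply: L2_eq; near=> t => _.
rewrite /GRing.add/= /addL /scaleL (near (L2ofK (lscale a _)) t)//.
rewrite (near (L2ofK (L2D f g)) t)// (near (L2ofK (L2D _ _)) t)//.
by rewrite (near (L2ofK (lscale a f)) t)// (near (L2ofK (lscale a g)) t)// scalerDr.
Unshelve. all: by end_near. Qed.

Let scaleDl f : {morph scaleL^~ f : a b / a + b}.
Proof.
move=> a b; apply: L2_eq; near=> t => _.
rewrite [in RHS]/GRing.add/= /addL /scaleL (near (L2ofK (lscale (a + b) f)) t)//.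
rewrite (near (L2ofK (L2D _ _)) t)// (near (L2ofK (lscale a f)) t)//.
by rewrite (near (L2ofK (lscale b f)) t)// scalerDl.
Unshelve. all: by end_near. Qed.

HB.instance Definition _ :=
  GRing.Zmodule_isLmodule.Build R[i] L2 scaleA scale1 scaleDr scaleDl.

Lemma L2P (a : R[i]) f g :
  ((a *: f + g : L2) : T -> E) = (fun t => a *: f t + g t) %[ae mu].
Proof.
near=> t => _; rewrite [in LHS]/GRing.add/= /addL.
rewrite (near (L2ofK (L2D _ g)) t)//.
by rewrite [in LHS]/GRing.scale/= /scaleL (near (L2ofK (lscale a f)) t).
Unshelve. all: by end_near. Qed.

Definition L2_inner f g : R[i] := cintegral mu (fun t => inner (f t) (g t)).

Let mL2 f g := l2fun_measurable (L2_reprP f).1 (L2_reprP g).1.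
Let iL2 f g := l2fun_cintegrable (L2_reprP f) (L2_reprP g).

Let L2_inner_herm f g : L2_inner f g = (-1) ^+ false * Num.conj (L2_inner g f).
Proof.
rewrite expr0 mul1r /L2_inner [RHS](_ : _ = (L2_inner g f)^*)//.
rewrite -cintegral_conj//; congr cintegral.
by apply/funext => t; rewrite inner_conj.
Qed.

Let L2_inner_linearl h (a : R[i]) f g :
  L2_inner (a *: f + g) h = a * L2_inner f h + L2_inner g h.
Proof.
rewrite /L2_inner -cintegralP//.
have fgE : (fun t => a * inner (f t) (h t) + inner (g t) (h t)) =
    (fun t => inner (a *: f t + g t) (h t)).
  by apply/funext => t; rewrite linearPl.
rewrite fgE; apply: ae_cintegral => //.
  exact: l2fun_measurable (l2funP a (L2_reprP f) (L2_reprP g)).1 (L2_reprP h).1.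
by near=> t => _; rewrite (near (L2P a f g) t).
Unshelve. all: by end_near. Qed.

Let L2_inner_bilinear :
  bilinear_for (GRing.Scale.Law.clone _ _ *%R _)
    (GRing.Scale.Law.clone _ _ (@Num.conj R[i] \; *%R) _) L2_inner.
Proof.
split=> [h a f g|h a f g] /=; first exact: L2_inner_linearl.
rewrite L2_inner_herm [L2_inner h f]L2_inner_herm [L2_inner h g]L2_inner_herm.
by rewrite !expr0 !mul1r L2_inner_linearl rmorphD rmorphM.
Qed.

HB.instance Definition _ :=
  bilinear_isBilinear.Build _ _ _ _ _ _ L2_inner L2_inner_bilinear.

HB.instance Definition _ :=
  isHermitianSesquilinear.Build _ _ _ _ L2_inner L2_inner_herm.

Let L2_inner_gt0 f : f != 0 -> 0 < L2_inner f f.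
Proof.
move=> f0.
have E0 : L2_inner f f = (\int[mu]_t complex.Re (inner (f t) (f t)))%:C.
  rewrite /L2_inner /cintegral [X in _ +i* X](_ : _ = 0)//.
  under eq_Rintegral do rewrite inner_rdot/=.
  by rewrite /Rintegral integral0.
rewrite E0 ltcR lt_def Rintegral_ge0 ?andbT; last first.
  by move=> t _; exact: rdot_ge0.
apply: contra f0 => /eqP i0; apply/eqP/L2_eq.
have [m _] := mL2 f f.
have [ii _] := iL2 f f.
have mff : measurable_fun setT (fun t => (complex.Re (inner (f t) (f t)))%:E).
  exact/measurable_EFinP.
have [+ _] := ae_eq_integral_abs mu measurableT mff.
under eq_integral do rewrite gee0_abs ?lee_fin ?rdot_ge0//.
have -> : (\int[mu]_t (complex.Re (inner (f t) (f t)))%:E = 0)%E.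
  by rewrite -[LHS]fineK ?integrable_fin_num//; congr EFin.
move=> /(_ erefl); apply: filterS2 L20E => t + + _; rewrite /cst => -> // /(_ I)[] r0.
by apply/eqP; rewrite -(dnorm_eq0 inner) inner_rdot r0.
Qed.

HB.instance Definition _ := isDotProduct.Build _ _ L2_inner L2_inner_gt0.

HB.instance Definition _ := @Lmodule_hasInner.Build R L2 L2_inner.

End L2.
Coercion L2_repr : L2 >-> Funclass.

(* The unit circle with normalized arc length is parametrized by [0, 1] through
   t |-> circle_pt t = exp (2 i pi t). *)
Definition circle_pt (R : realType) (t : R) : R[i] :=
  cos (2 * pi * t) +i* sin (2 * pi * t).

Definition circle_measure (R : realType) :
    {measure set (measurableTypeR R) -> \bar R} :=
  [the {measure set (measurableTypeR R) -> \bar R} of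
    mrestr (@lebesgue_measure R) (@measurable_itv R `[0, 1])].

Notation L2T E := (L2 (circle_measure _) E).

Section Operators.
Context (R : realType).

Definition contractive (U V : preHilbertType R) (A : U -> V) : Prop :=
  forall x, `|A x| <= `|x|.

Definition orthodiff (U : preHilbertType R) (A B : set U) : set U :=
  [set x | A x /\ forall y, B y -> inner x y = 0].

Definition closed_subspace (U : preHilbertType R) (S : set U) : Prop :=
  [/\ S 0, forall (a : R[i]) x y, S x -> S y -> S (a *: x + y) & closed S].

(* orthoproj, adjoint and psqrt choose the unique object with the characteristic
   property, which exists when S is a closed subspace of a Hilbert space and A is
   a bounded operator (a bounded positive one for psqrt). *)
Definition orthoproj (U : preHilbertType R) (S : set U) (x : U) : U :=
  xget 0 [set y | S y /\ forall s, S s -> inner (x - y) s = 0].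

(* The adjoint of A : S -> V, where S is a closed subspace of U: adjoint S A y is
   the Riesz representative in S of the functional u |-> <A u, y> on S. *)
Definition adjoint (U V : preHilbertType R) (S : set U) (A : U -> V) (y : V) : U :=
  xget 0 [set x | S x /\ forall u, S u -> inner (A u) y = inner u x].

(* An operator on a closed subspace S of U is represented by a function on U of
   which only the values on S matter. *)
Definition unitary_on (U : preHilbertType R) (S : set U) (W : U -> U) : Prop :=
  [/\ forall x, S x -> S (W x),
      forall (a : R[i]) x y, S x -> S y -> W (a *: x + y) = a *: W x + W y,
      forall x y, S x -> S y -> inner (W x) (W y) = inner x y &
      forall y, S y -> exists2 x, S x & W x = y].

Definition psqrt (U : preHilbertType R) (A : U -> U) : U -> U :=
  get [set B : U -> U | [/\ linear B, continuous B,
    forall x, 0 <= inner (B x) x & forall x, B (B x) = A x]].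

Definition osum (U V U' V' : preHilbertType R) (A : U -> U') (B : V -> V')
  (x : dsum U V) : dsum U' V' := A x.1 ⊕ B x.2.

(* The multiplication operator of a field A of operators on the circle. *)
Definition mulop (E F : sepHilbertType R) (A : R -> E -> F) (f : L2T E) : L2T F :=
  L2of (circle_measure R) (fun t => A t (f t)).

Definition Mzeta (E : sepHilbertType R) : L2T E -> L2T E :=
  mulop (fun t x => circle_pt t *: x).

(* The function f on the circle stands for z |-> \sum_n z ^ n a_n on the disk. *)
Definition Hardy2 (E : sepHilbertType R) : set (L2T E) :=
  [set f | exists a : nat -> E,
     cvgn (series (fun n => `|a n| ^+ 2)) /\
     series (fun n => L2of (circle_measure R) (fun t => circle_pt t ^+ n *: a n))
       @ \oo --> f].

(* M_{G1^* + z G2} *)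
Definition pencil (E : sepHilbertType R) (G1 G2 : E -> E) : L2T E -> L2T E :=
  mulop (fun t x => adjoint setT G1 x + circle_pt t *: G2 x).

End Operators.

Section ContractiveAnalytic.
Context (R : realType).

(* Strong convergence of the power series on the open disk is equivalent to its
   convergence in operator norm. *)
Definition contractive_analytic (D F : sepHilbertType R)
    (Θ : R[i] -> {linear D -> F}) : Prop :=
  (exists A : nat -> {linear D -> F}, (forall n, continuous (A n)) /\
     forall (z : R[i]) x, `|z| < 1 ->
       series (fun n => z ^+ n *: A n x) @ \oo --> Θ z x) /\
  (forall z : R[i], `|z| < 1 -> contractive (Θ z)).

Definition purely_contractive (D F : sepHilbertType R) (Θ : R[i] -> {linear D -> F}) : Prop :=
  forall x, x != 0 -> `|Θ 0 x| < `|x|.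

(* The boundary values of Θ, defined for almost every t. *)
Definition bdry (D F : sepHilbertType R) (Θ : R[i] -> {linear D -> F})
    (t : R) (x : D) : F :=
  lim (Θ (r%:C * circle_pt t) x @[r --> (1 : R)^'-]).

Definition Delta (D F : sepHilbertType R) (Θ : R[i] -> {linear D -> F})
    (t : R) : D -> D :=
  psqrt (fun x => x - adjoint setT (bdry Θ t) (bdry Θ t x)).

Definition DeltaL2 (D F : sepHilbertType R) (Θ : R[i] -> {linear D -> F}) :
    set (L2T D) := closure (range (mulop (Delta Θ))).

End ContractiveAnalytic.

Section Model.
Context (R : realType) (D Dstar : sepHilbertType R).
Variable Θ : R[i] -> {linear D -> Dstar}.

Definition Kspace : set (dsum (L2T Dstar) (L2T D)) :=
  [set u ⊕ v | u in @Hardy2 R Dstar & v in DeltaL2 Θ].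

Definition Qspace : set (dsum (L2T Dstar) (L2T D)) :=
  [set mulop (bdry Θ) f ⊕ mulop (Delta Θ) f | f in @Hardy2 R D].

Definition Hspace : set (dsum (L2T Dstar) (L2T D)) := orthodiff Kspace Qspace.

(* The two indices 1, 2 are the two elements of 'I_2, so that (i, j) ranges over
   (1, 2), (2, 1) when i != j. *)
Record admissible (G : 'I_2 -> {linear Dstar -> Dstar})
    (W : 'I_2 -> L2T D -> L2T D) : Prop := Admissible {
  adm_G : forall i, contractive (G i);
  adm_W : forall i, unitary_on (DeltaL2 Θ) (W i);
  adm_contr : forall i j, i != j -> forall x, Kspace x ->
    `|osum (pencil (G i) (G j)) (W i) x| <= `|x|;
  adm_shift : forall i j, i != j -> forall v, DeltaL2 Θ v ->
    W i (W j v) = Mzeta v;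
  adm_inv : forall i j, i != j -> forall x, Qspace x ->
    Qspace (osum (pencil (G i) (G j)) (W i) x);
  adm_inv_shift : forall x, Qspace x -> Qspace (osum (@Mzeta R _) (@Mzeta R _) x);
  adm_adj : forall i j, i != j -> forall x, Hspace x ->
    osum (adjoint (@Hardy2 R _) (pencil (G i) (G j))) (adjoint (DeltaL2 Θ) (W i))
      (osum (adjoint (@Hardy2 R _) (pencil (G j) (G i))) (adjoint (DeltaL2 Θ) (W j)) x) =
    osum (adjoint (@Hardy2 R _) (@Mzeta R _)) (adjoint (DeltaL2 Θ) (@Mzeta R _)) x }.

(* T_i on Hspace, for {i, j} the two indices. *)
Definition model_op (G : 'I_2 -> {linear Dstar -> Dstar})
    (W : 'I_2 -> L2T D -> L2T D) (i j : 'I_2) :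
    dsum (L2T Dstar) (L2T D) -> dsum (L2T Dstar) (L2T D) :=
  fun x => orthoproj Hspace (osum (pencil (G i) (G j)) (W i) x).

End Model.

Section Factorization.
Context (R : realType) (D F Dstar : sepHilbertType R).
Variable Θ : R[i] -> {linear D -> Dstar}.
Variable Θ'' : R[i] -> {linear F -> Dstar}.
Variable Θ' : R[i] -> {linear D -> F}.

(* The extension by continuity, to the closure of the range of Delta Θ t, of
   the isometry Delta Θ t v |-> Delta Θ'' t (Θ' v) ⊕ Delta Θ' t v: its graph is
   the closure of the graph of this isometry. *)
Definition Zfiber (t : R) (x : D) : dsum F D :=
  xget 0 [set y | closure
    [set (Delta Θ t v, Delta Θ'' t (bdry Θ' t v) ⊕ Delta Θ' t v) | v in setT]
    (x, y)].

Definition regular_factorization : Prop :=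
  (forall z x, `|z| < 1 -> Θ z x = Θ'' z (Θ' z x)) /\
  {ae circle_measure R, forall t : R, forall u v,
     closure (range (Delta Θ'' t)) u -> closure (range (Delta Θ' t)) v ->
     exists2 x, closure (range (Delta Θ t)) x & Zfiber t x = u ⊕ v}.

Definition Zop (f : L2T D) : dsum (L2T F) (L2T D) :=
  mulop (fun t x => (Zfiber t x).1) f ⊕ mulop (fun t x => (Zfiber t x).2) f.

Definition Zinv (y : dsum (L2T F) (L2T D)) : L2T D :=
  xget 0 [set f | DeltaL2 Θ f /\ Zop f = y].

End Factorization.

(* Main.v *)
Require Import Defs.
From HB Require Import structures.
From mathcomp Require Import all_boot all_order all_algebra sesquilinear complex.
From mathcomp Require Import ring lra zify.
From mathcomp Require Import all_classical all_reals all_analysis measurable_realfun.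
Set Implicit Arguments.
Unset Strict Implicit.
Unset Printing Implicit Defensive.
Import Order.TTheory GRing.Theory Num.Theory.
Import numFieldNormedType.Exports.
Local Open Scope classical_set_scope.
Local Open Scope ring_scope.
Local Open Scope complex_scope.

(* With U the multiplication by the coordinate, A_1 and A_2 the operators
   M_(G_1^* + z G_2) ⊕ W_1 and M_(G_2^* + z G_1) ⊕ W_2, and Q the range of
   h |-> Theta h ⊕ Delta h, a subspace H' of the model space is invariant exactly
   when L = H' ⊕ Q is invariant under A_1 and A_2; it is then invariant under U, since
   the adjoint of U restricted to the model space is A_1^* A_2^*.  By the Wold
   decomposition L = (sum_n U^n F) ⊕ R with F = L ⊖ U L, where R reduces U and is
   contained in 0 ⊕ L2.  The vectors a of F satisfy <U^n a, b> = 0 for n <> 0, hence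
   <a(t), b(t)> = <a, b> for almost every t: their first components are the boundary
   values of a contractive analytic Theta'', and their second components form a field
   Y with |Y a| = |Delta'' a|.  Decomposing Theta h ⊕ Delta h (h in D) along
   L = (sum_n U^n F) ⊕ R gives Theta' and a field with values in R of pointwise
   norm |Delta' h|.  Comparing inner products shows that Z maps Y f to
   Delta'' f ⊕ 0 and R onto 0 ⊕ closure (Delta' L2), so that the factorization is
   regular.  The identity <A_i x, y> = <U x, A_j y> yields A_i F in F + U F, the
   coefficients being the compression of A_i to F and the adjoint of that of A_j;
   this produces G'_1 and G'_2, and W'_i is W_i restricted to R. *)

(** The objects live at three levels: functions in the disk, operator fields on the circle known
    almost everywhere, and operators on L2. Theta' and Theta'' arise as operators between Hardy
    spaces, whereas the statement asks for analytic functions whose radial limits reproduce these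
    operators; a Fatou theorem for L2 functions with values in a separable Hilbert space, proved
    with the Poisson kernel, makes the passage. Null sets depend on the vector at first;
    separability reduces them to countably many, so that one null set serves all vectors. This is
    also why the wandering subspace must be shown separable before it can serve as the space F.
    Defect functions are compared through inner products in L2; fibres return in the regularity,
    where surjectivity of Z at almost every point is shown equivalent to surjectivity of Z on L2.
    The constancy of <a(t), b(t)> comes from the fact that <U^n a, b> is the Fourier coefficient of
    index -n of this function, so that only its mean survives. *)

Notation rdot x y := (complex.Re (inner x y)).

(** * Hilbert spaces *)

Section ComplexModulus.
Context (R : realType).
Implicit Types (z w : R[i]) (e b c : R).

Definition cmod z : R := complex.Re `|z|.

Lemma cmodE z : `|z| = (cmod z)%:C.
Proof. by rewrite /cmod RRe_real// ger0_real. Qed.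

Lemma cmod_ge0 z : 0 <= cmod z.
Proof. by rewrite -lecR -cmodE normr_ge0. Qed.

Lemma cmodM z w : cmod (z * w) = cmod z * cmod w.
Proof. by apply: complexI; rewrite rmorphM/= -!cmodE normrM. Qed.

Lemma cmodD z w : cmod (z + w) <= cmod z + cmod w.
Proof. by rewrite -lecR rmorphD/= -!cmodE ler_normD. Qed.

Lemma cmodN z : cmod (- z) = cmod z.
Proof. by rewrite /cmod normrN. Qed.

Lemma cmod1 : cmod 1 = 1.
Proof. by rewrite /cmod normr1. Qed.

Lemma cmodX z n : cmod (z ^+ n) = cmod z ^+ n.
Proof. by elim: n => [|n IH]; rewrite ?expr0 ?cmod1// !exprS cmodM IH. Qed.

Lemma cmod_real e : cmod e%:C = `|e|.
Proof. by rewrite /cmod normc_def/= expr0n/= addr0 sqrtr_sqr. Qed.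

Lemma cmod_conj z : cmod z^* = cmod z.
Proof. by case: z => a b; rewrite /cmod !normc_def/= sqrrN. Qed.

Lemma cmod_eq0 z : cmod z = 0 -> z = 0.
Proof. by move=> z0; apply/eqP; rewrite -normr_eq0 cmodE z0. Qed.

Lemma Re_le_cmod z : `|complex.Re z| <= cmod z.
Proof.
by case: z => a b; rewrite /cmod normc_def/= -sqrtr_sqr ler_wsqrtr// lerDl sqr_ge0.
Qed.

Lemma Im_le_cmod z : `|complex.Im z| <= cmod z.
Proof.
by case: z => a b; rewrite /cmod normc_def/= -sqrtr_sqr ler_wsqrtr// lerDr sqr_ge0.
Qed.

Lemma cmod_le_ReIm z : cmod z <= `|complex.Re z| + `|complex.Im z|.
Proof.
case: z => a b; have -> : a +i* b = a%:C + b%:C * 'i%C.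
  by apply/eqP; rewrite eq_complex/= !mulr0 !mul0r !mulr1 !subr0 !addr0 !add0r !eqxx.
apply: (le_trans (cmodD _ _)); rewrite cmodM !cmod_real /= !mulr0 !mul0r !mulr1 subr0 addr0 !add0r.
by rewrite addr0 [cmod 'i%C](_ : _ = 1) ?mulr1// /cmod normc_def/= expr0n expr1n/= add0r sqrtr1.
Qed.

Lemma gt0_complex_real (e : R[i]) : 0 < e -> exists2 r : R, 0 < r & e = r%:C.
Proof.
move=> e0; have ee : e = (complex.Re e)%:C by rewrite RRe_real// gtr0_real.
by exists (complex.Re e) => //; rewrite -ltcR -ee.
Qed.

Lemma quadratic_ge0_linear_eq0 b c : (forall t : R, 0 <= b * t + c * t ^+ 2) -> b = 0.
Proof.
move=> H; apply/eqP; rewrite -[_ == _]negbK; apply/negP => b0.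
(* With this [k] the value at [t = - b / k] is [(b / k) ^+ 2 * (c - k)], negative unless [b = 0]. *)
have [k kE] : {k : R | k = `|c| + 1} by exists (`|c| + 1).
have k0 : 0 < k by rewrite kE ltr_wpDl.
have := H (- b / k).
have -> : b * (- b / k) + c * (- b / k) ^+ 2 = (b / k) ^+ 2 * (c - k).
  by field; rewrite gt_eqF.
apply/negP; rewrite -ltNge pmulr_rlt0; last first.
  by rewrite exprn_even_gt0// mulf_neq0// invr_eq0 gt_eqF.
by rewrite subr_lt0 kE ltr_pwDr// ler_norm.
Qed.

Lemma cmod_eq0_small z : (forall e, 0 < e -> cmod z < e) -> z = 0.
Proof.
move=> H; apply: cmod_eq0; apply/eqP; rewrite eq_le cmod_ge0 andbT.
by apply/ler_addgt0Pr => e e0; rewrite add0r ltW// H.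
Qed.

End ComplexModulus.

Section RealNorm.
Context (R : realType) (V : preHilbertType R).
Implicit Types (x y z : V) (a : R[i]) (e : R).

(** The norm as an element of [R]: [|x|] takes its values in [R[i]], and the estimates need a
    totally ordered field. *)
Definition hn x : R := Num.sqrt (rdot x x).

Lemma hn_ge0 x : 0 <= hn x. Proof. exact: sqrtr_ge0. Qed.

Lemma hn_sqr x : hn x ^+ 2 = rdot x x.
Proof. by rewrite sqr_sqrtr// rdot_ge0. Qed.

Lemma hnE x : `|x| = (hn x)%:C.
Proof.
apply/eqP; rewrite -(@eqrXn2 _ 2%N)//; last by rewrite lecR hn_ge0.
by rewrite norm_inner inner_rdot -rmorphXn/= hn_sqr.
Qed.

Lemma hnD x y : hn (x + y) <= hn x + hn y.
Proof. by rewrite -lecR rmorphD/= -!hnE ler_normD. Qed.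

Lemma hnZ a x : hn (a *: x) = cmod a * hn x.
Proof. by apply: complexI; rewrite rmorphM/= -!hnE -cmodE normrZ. Qed.

Lemma hnN x : hn (- x) = hn x.
Proof. by apply: complexI; rewrite -!hnE normrN. Qed.

Lemma hnC x y : hn (x - y) = hn (y - x).
Proof. by rewrite -hnN opprB. Qed.

Lemma hn0 : hn (0 : V) = 0.
Proof. by apply: complexI; rewrite -!hnE normr0. Qed.

Lemma hn_eq0 x : hn x = 0 -> x = 0.
Proof. by move=> x0; apply/eqP; rewrite -normr_eq0 hnE x0. Qed.

Lemma rdot0 x : rdot x x <= 0 -> x = 0.
Proof.
move=> x0; apply: hn_eq0; apply/eqP; rewrite -sqrf_eq0 hn_sqr eq_le x0.
exact: rdot_ge0.
Qed.

Lemma hn_tri y x z : hn (x - z) <= hn (x - y) + hn (y - z).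
Proof. by have := hnD (x - y) (y - z); rewrite addrA subrK. Qed.

Lemma hn_lt x e : 0 < e -> (hn x < e) = (rdot x x < e ^+ 2).
Proof. by move=> e0; rewrite -hn_sqr ltr_pXn2r// nnegrE ?hn_ge0// ltW. Qed.

Lemma hn_le_sqr x e : 0 <= e -> (hn x <= e) = (rdot x x <= e ^+ 2).
Proof. by move=> e0; rewrite -hn_sqr ler_pXn2r// nnegrE ?hn_ge0. Qed.

Lemma cinner_le x y : cmod (inner x y) <= hn x * hn y.
Proof.
rewrite -lecR rmorphM/= -cmodE -!hnE; have := dot_CauchySchwarz inner x y.
by rewrite -!norm_inner !sqrCK.
Qed.

Lemma rdot_le x y : rdot x y <= hn x * hn y.
Proof. exact: le_trans (ler_norm _) (le_trans (Re_le_cmod _) (cinner_le _ _)). Qed.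

Lemma innerZl a x y : inner (a *: x) y = a * inner x y.
Proof. by rewrite linearZl_LR. Qed.

Lemma innerZr a x y : inner x (a *: y) = a^* * inner x y.
Proof. by rewrite inner_conj innerZl rmorphM/= -inner_conj. Qed.

Lemma innerRr (t : R) x y : inner x (t%:C *: y) = t%:C * inner x y.
Proof. by rewrite innerZr conj_Creal// complex_real. Qed.

Lemma innerDl x y z : inner (x + y) z = inner x z + inner y z.
Proof. by rewrite linearDl. Qed.

Lemma innerDr x y z : inner x (y + z) = inner x y + inner x z.
Proof. by rewrite linearDr. Qed.

Lemma innerBl x y z : inner (x - y) z = inner x z - inner y z.
Proof. by rewrite linearBl. Qed.

Lemma innerBr x y z : inner x (y - z) = inner x y - inner x z.
Proof. by rewrite linearBr. Qed.

Lemma inner_eq0 x y : rdot x y = 0 -> rdot x ('i%C *: y) = 0 -> inner x y = 0.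
Proof. by rewrite -Im_inner; case: (inner x y) => p q /= -> ->. Qed.

Lemma inner_ext x y : (forall v, inner x v = inner y v) -> x = y.
Proof.
move=> H; apply/eqP; rewrite -subr_eq0; apply/eqP/rdot0.
by rewrite linearBl/= H subrr.
Qed.

Lemma parallelogram x y :
  rdot (x + y) (x + y) + rdot (x - y) (x - y) = 2 * (rdot x x + rdot y y).
Proof. by rewrite rdotDD rdotBB; ring. Qed.

Lemma inner0C x y : inner x y = 0 -> inner y x = 0.
Proof. by move=> xy; rewrite inner_conj xy conjc0. Qed.

Lemma rdot_pythagoras x y : inner x y = 0 ->
  rdot (x + y) (x + y) = rdot x x + rdot y y.
Proof. by move=> xy; rewrite rdotDD xy/= mulr0 addr0. Qed.

Lemma hn_eq0_small x : (forall e, 0 < e -> hn x < e) -> x = 0.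
Proof.
move=> H; apply: hn_eq0; apply/eqP; rewrite eq_le hn_ge0 andbT.
by apply/ler_addgt0Pr => e e0; rewrite add0r ltW// H.
Qed.

Definition hcvg (u : nat -> V) (l : V) :=
  forall e, 0 < e -> exists N, forall n, (N <= n)%N -> hn (u n - l) < e.

Definition hcauchy (u : nat -> V) :=
  forall e, 0 < e -> exists N, forall m n, (N <= m)%N -> (N <= n)%N ->
    hn (u m - u n) < e.

(** Completeness is stated for subsets, so that projecting onto a closed subspace of L2 requires no
    type for that subspace. *)
Definition hcomplete (S : set V) :=
  forall u, (forall n, S (u n)) -> hcauchy u -> exists2 l, S l & hcvg u l.

Definition subsp (S : set V) :=
  S 0 /\ forall a x y, S x -> S y -> S (a *: x + y).

Lemma cvg_hn T (F : set_system T) {FF : Filter F} (f : T -> V) l :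
  f @ F --> l <-> forall e, 0 < e -> \forall x \near F, hn (f x - l) < e.
Proof.
split=> [/cvgrPdist_lt H e e0|H].
  have e0' : 0 < e%:C :> R[i] by rewrite ltcR.
  by apply: filterS (H _ e0') => x; rewrite hnE ltcR hnC.
apply/cvgrPdist_lt => e /gt0_complex_real[{}e e0 ->].
by apply: filterS (H _ e0) => x; rewrite hnE ltcR hnC.
Qed.

Lemma cvgn_hn (u : nat -> V) l : u @ \oo --> l <-> hcvg u l.
Proof.
split=> [/cvg_hn H e /H [N _ NH]|H]; first by exists N => n Nn; exact: NH.
by apply/cvg_hn => e /H [N NH]; exists N.
Qed.

Lemma closure_hn (S : set V) x :
  closure S x <-> forall e, 0 < e -> exists2 y, S y & hn (y - x) < e.
Proof.
split=> [H e e0|H B /nbhs_ballP [e /= /gt0_complex_real[{}e e0 ->] eB]].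
  have [|y [Sy]] := H (ball x e%:C); first by apply: nbhsx_ballx; rewrite ltcR.
  by rewrite -ball_normE/= hnE ltcR hnC => ?; exists y.
have [y Sy xy] := H _ e0; exists y; split => //; apply: eB.
by rewrite -ball_normE/= hnE ltcR hnC.
Qed.

Lemma closed_hn (S : set V) : closed S <->
  forall x, (forall e, 0 < e -> exists2 y, S y & hn (y - x) < e) -> S x.
Proof. by split=> H x /closure_hn; exact: H. Qed.

Lemma closure_seq (S : set V) x : closure S x ->
  exists2 u, (forall n, S (u n)) & hcvg u x.
Proof.
move=> /closure_hn H.
have /choice[u uP] n : exists y, S y /\ hn (y - x) < n.+1%:R^-1.
  by have [|y ? ?] := H n.+1%:R^-1; [rewrite invr_gt0|exists y].
exists u; first by move=> n; case: (uP n).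
move=> e e0; exists (Num.bound e^-1) => n kn; apply: lt_trans (proj2 (uP n)) _.
rewrite invf_plt ?posrE//; apply: lt_le_trans (archi_boundP _) _.
  by rewrite invr_ge0 ltW.
by rewrite ler_nat ltnW.
Qed.

Lemma seq_closure (S : set V) u x : (forall n, S (u n)) -> hcvg u x -> closure S x.
Proof.
move=> Su ux; apply/closure_hn => e /ux [N NH].
by exists (u N) => //; exact: NH.
Qed.

Lemma closed_seq (S : set V) u x : closed S -> (forall n, S (u n)) -> hcvg u x -> S x.
Proof. by move=> cS Su ux; apply: cS; exact: seq_closure Su ux. Qed.

Lemma hcvg_unique u l l' : hcvg u l -> hcvg u l' -> l = l'.
Proof.
move=> ul ul'; apply/eqP; rewrite -subr_eq0; apply/eqP/hn_eq0_small => e e0.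
have e2 : 0 < e / 2 by rewrite divr_gt0.
have [N HN] := ul _ e2; have [M HM] := ul' _ e2.
apply: le_lt_trans (hn_tri (u (maxn N M)) _ _) _.
rewrite [e](splitr e) hnC ltrD//; first by apply: HN; rewrite leq_maxl.
by apply: HM; rewrite leq_maxr.
Qed.

Lemma hcvg_cst x : hcvg (fun=> x) x.
Proof. by move=> e e0; exists 0%N => n _; rewrite subrr hn0. Qed.

Lemma hcvgP a u v l m : hcvg u l -> hcvg v m -> hcvg (fun n => a *: u n + v n) (a *: l + m).
Proof.
move=> ul vm e e0; pose k := cmod a + 1.
have k0 : 0 < k by rewrite ltr_wpDl// cmod_ge0.
have [|N HN] := ul (e / 2 / k); first by rewrite !divr_gt0.
have [|M HM] := vm (e / 2); first by rewrite !divr_gt0.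
exists (maxn N M) => n; rewrite geq_max => /andP[Nn Mn].
have -> : a *: u n + v n - (a *: l + m) = a *: (u n - l) + (v n - m).
  by rewrite scalerBr opprD addrACA.
apply: le_lt_trans (hnD _ _) _; rewrite hnZ [e](splitr e) ler_ltD ?HM//.
rewrite (@le_trans _ _ (k * (e / 2 / k)))//; last by rewrite mulrC divfK ?gt_eqF.
by rewrite ler_pM ?cmod_ge0 ?hn_ge0 ?ltW ?HN// /k ltrDl.
Qed.

Lemma hcvgD u v l m : hcvg u l -> hcvg v m -> hcvg (fun n => u n + v n) (l + m).
Proof.
move=> ul vm; have := hcvgP 1 ul vm; rewrite scale1r.
by under eq_fun do rewrite scale1r.
Qed.

Lemma hcvgB u v l m : hcvg u l -> hcvg v m -> hcvg (fun n => u n - v n) (l - m).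
Proof.
move=> ul vm; have := hcvgP (-1) vm ul; rewrite scaleN1r addrC.
by under eq_fun do rewrite scaleN1r addrC.
Qed.

Lemma hcvg_cauchy u l : hcvg u l -> hcauchy u.
Proof.
move=> ul e e0; have [|N HN] := ul (e / 2); first by rewrite divr_gt0.
exists N => m n Nm Nn; apply: le_lt_trans (hn_tri l _ _) _.
by rewrite [hn (l - _)]hnC [e](splitr e) ltrD ?HN.
Qed.

Lemma hcvg_sub u l (phi : nat -> nat) : (forall n, (n <= phi n)%N) ->
  hcvg u l -> hcvg (u \o phi) l.
Proof.
move=> np ul e /ul[N HN]; exists N => n Nn; apply: HN.
exact: leq_trans (np n).
Qed.

Lemma hcvg_inner u l y : hcvg u l ->
  forall e, 0 < e -> exists N, forall n, (N <= n)%N -> cmod (inner (u n) y - inner l y) < e.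
Proof.
move=> ul e e0; pose k := hn y + 1.
have k0 : 0 < k by rewrite ltr_wpDl// hn_ge0.
have [|N HN] := ul (e / k); first by rewrite divr_gt0.
exists N => n Nn; rewrite -linearBl/=; apply: le_lt_trans (cinner_le _ _) _.
apply: (@le_lt_trans _ _ (hn (u n - l) * k)); first by rewrite ler_wpM2l ?hn_ge0// lerDl.
by rewrite -ltr_pdivlMr// HN.
Qed.

Lemma hcvg_orth u l y : hcvg u l -> (forall n, inner (u n) y = 0) -> inner l y = 0.
Proof.
move=> ul H; apply: cmod_eq0_small => e /(hcvg_inner y ul) [N HN].
by have := HN _ (leqnn N); rewrite H sub0r cmodN.
Qed.

Lemma hcvg_hn_le u l c : hcvg u l -> (forall n, hn (u n) <= c) -> hn l <= c.
Proof.
move=> ul H; apply/ler_addgt0Pr => e /ul[N HN].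
have := HN _ (leqnn N) => /ltW le; rewrite -[l](subrK (u N)).
by apply: le_trans (hnD _ _) _; rewrite addrC lerD// hnC.
Qed.

Lemma subspZ S a x : subsp S -> S x -> S (a *: x).
Proof. by move=> [S0 SP] Sx; have := SP a x 0 Sx S0; rewrite addr0. Qed.

Lemma subspD S x y : subsp S -> S x -> S y -> S (x + y).
Proof. by move=> [S0 SP] Sx Sy; have := SP 1 x y Sx Sy; rewrite scale1r. Qed.

Lemma subspB S x y : subsp S -> S x -> S y -> S (x - y).
Proof. by move=> [S0 SP] Sx Sy; have := SP (-1) y x Sy Sx; rewrite scaleN1r addrC. Qed.

Lemma subsp_sum S (I : Type) (r : seq I) (u : I -> V) : subsp S ->
  (forall i, S (u i)) -> S (\sum_(i <- r) u i).
Proof.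
move=> sS Su; elim: r => [|i r IH]; first by rewrite big_nil; case: sS.
by rewrite big_cons; exact: subspD.
Qed.

Lemma subsp_closure (S : set V) : subsp S -> subsp (closure S).
Proof.
move=> sS; split; first by apply: subset_closure; case: sS.
move=> a x y /closure_seq[u Su ux] /closure_seq[v Sv vy].
by apply: seq_closure (hcvgP a ux vy) => n; case: sS => _; exact.
Qed.

Lemma closed_subspaceE S : closed_subspace S <-> subsp S /\ closed S.
Proof. by split=> [[? ? ?]|[[? ?] ?]]; split. Qed.

Lemma complete_closed (S C : set V) : hcomplete C -> S `<=` C -> closed S -> hcomplete S.
Proof.
move=> cC SC cS u Su /cC[|l _ ul]; first by move=> n; exact: SC.
by exists l => //; exact: closed_seq ul.
Qed.

Lemma closed_complete (S : set V) : hcomplete S -> closed S.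
Proof.
move=> cS x /closure_seq[u Su ux].
have [l Sl ul] := cS _ Su (hcvg_cauchy ux).
by rewrite (hcvg_unique ux ul).
Qed.

(** First variation: the distance from [x] to [y + t s] is minimal at [t = 0], so the real part of
    the inner product with [s] vanishes; replacing [s] by [i s] gives the imaginary part. *)
Lemma min_orth (S : set V) x y : subsp S -> S y ->
  (forall s, S s -> rdot (x - y) (x - y) <= rdot (x - s) (x - s)) ->
  forall s, S s -> inner (x - y) s = 0.
Proof.
move=> sS Sy H.
have key s : S s -> rdot (x - y) s = 0.
  move=> Ss; suff : - 2 * rdot (x - y) s = 0 by lra.
  apply: (@quadratic_ge0_linear_eq0 _ _ (rdot s s)) => t.
  have := H (y + t%:C *: s); rewrite opprD addrA (rdotBB (x - y) (t%:C *: s)).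
  have -> : rdot (t%:C *: s) (t%:C *: s) = t ^+ 2 * rdot s s.
    by rewrite rdotZ -[`|_|]/`|t%:C| cmodE cmod_real -rmorphXn/= real_normK ?num_real.
  have -> : rdot (x - y) (t%:C *: s) = t * rdot (x - y) s.
    rewrite linearZr_LR/=; case: (inner _ _) => ? ? /=; ring.
  by move=> /(_ (subspD sS Sy (subspZ t%:C sS Ss))); lra.
by move=> s Ss; apply: inner_eq0; apply: key => //; exact: subspZ.
Qed.

Lemma projection (S : set V) x : subsp S -> hcomplete S ->
  exists2 y, S y & forall s, S s -> inner (x - y) s = 0.
Proof.
move=> sS cS.
pose A := [set rdot (x - s) (x - s) | s in S].
have A0 : A !=set0 by exists (rdot (x - 0) (x - 0)), 0 => //; case: sS.
have lA : has_lbound A by exists 0 => _ [s _ <-]; exact: rdot_ge0.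
have hA : has_inf A by [].
have dle s : S s -> inf A <= rdot (x - s) (x - s) by move=> Ss; apply: ge_inf => //; exists s.
have /choice[u uP] n : exists s, S s /\ rdot (x - s) (x - s) < inf A + n.+1%:R^-1.
  have [|_ [s Ss <-] sd] := @inf_adherent _ A n.+1%:R^-1 _ hA; first by rewrite invr_gt0.
  by exists s.
have uS n : S (u n) by case: (uP n).
(* The midpoint of [u m] and [u n] lies in [S], so by the parallelogram law their distance is
   controlled by the excess of both over the infimum. *)
have par m n : rdot (u m - u n) (u m - u n) <= 2 * (m.+1%:R^-1 + n.+1%:R^-1).
  have := parallelogram (x - u m) (x - u n).
  have -> : x - u m - (x - u n) = u n - u m by rewrite opprB [u n - x]addrC addrACA subrr add0r addrC.
  have -> : x - u m + (x - u n) = 2%:C *: (x - 2^-1%:C *: (u m + u n)).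
    rewrite scalerBr scalerA -rmorphM/= divff ?pnatr_eq0// scale1r.
    by rewrite [2](_ : _ = 1 + 1)// rmorphD/= scalerDl !scale1r opprD addrACA.
  rewrite rdotZ cmodE -rmorphXn/= cmod_real ger0_norm// -[rdot (u m - u n) _]hn_sqr hnC hn_sqr.
  have Sm : S (2^-1%:C *: (u m + u n)) by apply: subspZ => //; exact: subspD.
  move: (dle _ Sm) (uP m).2 (uP n).2; rewrite expr2.
  move: (inf A) (m.+1%:R^-1) (n.+1%:R^-1) => p q r.
  by move=> *; lra.
have cu : hcauchy u.
  move=> e e0; have ee : 0 < e ^+ 2 / 4 by rewrite divr_gt0// exprn_gt0.
  exists (Num.bound (e ^+ 2 / 4)^-1) => m n Nm Nn; rewrite hn_lt//.
  apply: le_lt_trans (par _ _) _.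
  have H k : (Num.bound (e ^+ 2 / 4)^-1 <= k)%N -> k.+1%:R^-1 < e ^+ 2 / 4.
    move=> Nk; rewrite invf_plt ?posrE//; apply: lt_le_trans (archi_boundP _) _.
      by rewrite invr_ge0 ltW.
    by rewrite ler_nat ltnW.
  by have h1 := H _ Nm; have h2 := H _ Nn; rewrite mulrDr [ltRHS](_ : _ = 2 * (e ^+ 2 / 4) + 2 * (e ^+ 2 / 4)); [rewrite ltrD// ltr_pM2l|field].
have [y Sy uy] := cS _ uS cu.
exists y => // s; apply: min_orth => // s' Ss'.
apply: le_trans (dle _ Ss').
apply/ler_addgt0Pr => e e0.
have i0 : 0 <= inf A by apply: lb_le_inf => // _ [s0 _ <-]; exact: rdot_ge0.
have c2 : Num.sqrt (inf A + e) ^+ 2 = inf A + e by rewrite sqr_sqrtr// addr_ge0// ltW.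
rewrite -c2 -hn_le_sqr ?sqrtr_ge0//.
pose N := Num.bound e^-1.
have xy : hcvg (fun n => x - u (n + N)%N) (x - y).
  apply: hcvgB; first exact: hcvg_cst.
  by apply: (hcvg_sub _ uy) => n; rewrite leq_addr.
apply: (hcvg_hn_le xy) => n; rewrite hn_le_sqr ?sqrtr_ge0// c2 ltW//.
apply: lt_le_trans (uP _).2 _; rewrite lerD2l invf_ple ?posrE//.
apply: ltW; apply: lt_le_trans (archi_boundP _) _; first by rewrite invr_ge0 ltW.
by rewrite ler_nat (leq_trans (leq_addl n N)).
Qed.

End RealNorm.

Section Completeness.
Context (R : realType).

Lemma sepHilbert_complete (V : sepHilbertType R) : hcomplete [set: V].
Proof.
move=> u _ cu; suff /cauchy_cvgP/cvgn_hn ul : cauchy (u @ \oo).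
  by exists (lim (u @ \oo)).
apply/cauchyP => e /gt0_complex_real[{}e e0 ->]; have [N HN] := cu _ e0.
exists (u N); exists N => // n Nn /=.
by rewrite -ball_normE/= hnE ltcR HN//=.
Qed.

Lemma inv_nat_lt (e : R) : 0 < e -> exists N, forall n, (N <= n)%N -> n.+1%:R^-1 < e.
Proof.
move=> e0; exists (Num.bound e^-1) => k Nk.
rewrite invf_plt ?posrE//; apply: lt_le_trans (archi_boundP _) _.
  by rewrite invr_ge0 ltW.
by rewrite ler_nat ltnW.
Qed.

Lemma hcomplete_cvg (V : preHilbertType R) : hcomplete [set: V] ->
  forall F : set_system V, ProperFilter F -> cauchy F -> cvg F.
Proof.
move=> cV F FF /cauchyP cF.
have /choice[u uP] n : exists x : V, F [set y | hn (x - y) < n.+1%:R^-1].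
  have [|x Fx] := cF (n.+1%:R^-1)%:C; first by rewrite ltcR invr_gt0.
  exists x; apply: filterS Fx => y; rewrite -ball_normE/= hnE ltcR//.
have uu m n : hn (u m - u n) < m.+1%:R^-1 + n.+1%:R^-1.
  have [y [my ny]] := filter_ex (filterI (uP m) (uP n)).
  by apply: le_lt_trans (hn_tri y _ _) _; rewrite ltrD// hnC.
have [//||l _ ul] := cV u.
  move=> e e0; have [|N HN] := inv_nat_lt (e := e / 2); first by rewrite divr_gt0.
  exists N => m n Nm Nn; apply: lt_trans (uu m n) _.
  by rewrite [e](splitr e) ltrD ?HN.
apply/cvg_ex; exists l; apply/cvgrPdist_lt => e /gt0_complex_real[{}e e0 ->].
have e2 : 0 < e / 2 by rewrite divr_gt0.
have [N HN] := inv_nat_lt e2; have [M HM] := ul _ e2.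
apply: filterS (uP (maxn N M)) => y uy; rewrite hnE ltcR.
apply: le_lt_trans (hn_tri (u (maxn N M)) _ _) _.
rewrite [e](splitr e) ltrD//.
  by rewrite hnC HM// leq_maxr.
by apply: lt_trans uy _; rewrite HN// leq_maxl.
Qed.

End Completeness.

(** * Bounded operators, the Riesz representation and adjoints *)

Section BoundedOperators.
Context (R : realType).
Implicit Types U V : preHilbertType R.

Definition hbounded U V (C : R) (A : U -> V) := forall x, hn (A x) <= C * hn x.

Lemma contractiveE U V (A : U -> V) : contractive A <-> hbounded 1 A.
Proof.
by split=> H x; have := H x; rewrite !hnE lecR mul1r.
Qed.

Lemma op_add U V (A : U -> V) : linear A -> forall x y, A (x + y) = A x + A y.
Proof. by move=> lA x y; have := lA 1 x y; rewrite !scale1r. Qed.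

Lemma op_zero U V (A : U -> V) : linear A -> A 0 = 0.
Proof.
by move=> lA; have := op_add lA 0 0; rewrite addr0 => /eqP; rewrite -subr_eq subrr => /eqP.
Qed.

Lemma op_scale U V (A : U -> V) : linear A -> forall a x, A (a *: x) = a *: A x.
Proof. by move=> lA a x; have := lA a x 0; rewrite (op_zero lA) !addr0. Qed.

Lemma op_opp U V (A : U -> V) : linear A -> forall x, A (- x) = - A x.
Proof. by move=> lA x; rewrite -scaleN1r (op_scale lA) scaleN1r. Qed.

Lemma op_sub U V (A : U -> V) : linear A -> forall x y, A (x - y) = A x - A y.
Proof. by move=> lA x y; rewrite (op_add lA) (op_opp lA). Qed.

Lemma op_sum U V (A : U -> V) : linear A -> forall (I : Type) (r : seq I) (u : I -> U),
  A (\sum_(i <- r) u i) = \sum_(i <- r) A (u i).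
Proof.
move=> lA I r u; elim: r => [|i r IH]; first by rewrite !big_nil (op_zero lA).
by rewrite !big_cons (op_add lA) IH.
Qed.

Lemma hbounded_cvg U V C (A : U -> V) u l : linear A -> hbounded C A -> hcvg u l ->
  hcvg (A \o u) (A l).
Proof.
move=> lA bA ul e e0; have k0 : 0 < `|C| + 1 by rewrite ltr_wpDl.
have [|N HN] := ul (e / (`|C| + 1)); first by rewrite divr_gt0.
exists N => n Nn /=; rewrite -(op_sub lA); apply: le_lt_trans (bA _) _.
apply: (@le_lt_trans _ _ ((`|C| + 1) * hn (u n - l))).
  by rewrite ler_wpM2r ?hn_ge0// ler_wpDr// ler_norm.
by rewrite mulrC -ltr_pdivlMr// HN.
Qed.

Lemma hbounded_continuous U V C (A : U -> V) : linear A -> hbounded C A -> continuous A.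
Proof.
move=> lA bA x; apply/cvg_hn => e e0; have k0 : 0 < `|C| + 1 by rewrite ltr_wpDl.
have := @cvg_hn _ U _ (nbhs x) _ id x => -[/(_ (fun _ => id)) H _].
have /H : 0 < e / (`|C| + 1) by rewrite divr_gt0.
apply: filterS => y xy /=; rewrite -(op_sub lA); apply: le_lt_trans (bA _) _.
apply: (@le_lt_trans _ _ ((`|C| + 1) * hn (y - x))).
  by rewrite ler_wpM2r ?hn_ge0// ler_wpDr// ler_norm.
by rewrite mulrC -ltr_pdivlMr.
Qed.

Lemma continuous_hbounded U V (A : U -> V) : linear A -> continuous A ->
  exists2 C, 0 <= C & hbounded C A.
Proof.
move=> lA /(_ 0) /cvg_hn /(_ 1 ltr01) /nbhs_ballP[e /= /gt0_complex_real[{}e e0 ->] H].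
pose d := e / 2.
have d0 : 0 < d by rewrite divr_gt0.
exists d^-1; first by rewrite invr_ge0 ltW.
move=> x; have [->|x0] := eqVneq x 0.
  by rewrite (op_zero lA) !hn0 mulr0.
have hx : 0 < hn x.
  by rewrite lt_def hn_ge0 andbT; apply: contraNneq x0 => /hn_eq0 ->.
have dx : 0 <= d / hn x by rewrite divr_ge0// ltW.
have : hn (A ((d / hn x)%:C *: x) - A 0) < 1.
  apply: H; rewrite -ball_normE/= sub0r hnE ltcR hnN hnZ cmod_real ger0_norm//.
  by rewrite divfK ?gt_eqF// /d ltr_pdivrMr// ltr_pMr// ltr1n.
rewrite (op_zero lA) subr0 (op_scale lA) hnZ cmod_real ger0_norm//.
by rewrite mulrAC ltr_pdivrMr// mul1r -ltr_pdivlMl// => /ltW.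
Qed.

Lemma riesz (V : preHilbertType R) (C : R) (phi : V -> R[i]) : hcomplete [set: V] ->
  (forall a x y, phi (a *: x + y) = a * phi x + phi y) ->
  (forall x, cmod (phi x) <= C * hn x) ->
  exists y, forall x, phi x = inner x y.
Proof.
move=> cV lphi bphi.
have phi0 : phi 0 = 0.
  by have := lphi 1 0 0; rewrite scale1r mul1r addr0 => /eqP; rewrite -subr_eq subrr eq_sym => /eqP.
have phiZ a x : phi (a *: x) = a * phi x by have := lphi a x 0; rewrite phi0 !addr0.
have phiB x y : phi (x - y) = phi x - phi y.
  by have := lphi (-1) y x; rewrite scaleN1r mulN1r addrC [- _ + _]addrC.
pose N := [set x | phi x = 0].
have sN : subsp N.
  by split => // a x y x0 y0; rewrite /N/= lphi x0 y0 mulr0 addr0.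
have cN : hcomplete N.
  apply: (complete_closed cV) => //; apply/closed_hn => x H /=.
  apply: cmod_eq0_small => e e0; have k0 : 0 < `|C| + 1 by rewrite ltr_wpDl.
  have [|y /= Ny xy] := H (e / (`|C| + 1)); first by rewrite divr_gt0.
  rewrite -[phi x]subr0 -Ny -phiB; apply: le_lt_trans (bphi _) _.
  apply: (@le_lt_trans _ _ ((`|C| + 1) * hn (x - y))).
    by rewrite ler_wpM2r ?hn_ge0// ler_wpDr// ler_norm.
  by rewrite mulrC -ltr_pdivlMr// hnC.
have [[x0 x00]|no] := pselect (exists x, phi x <> 0); last first.
  exists 0 => x; rewrite linear0r; apply: contrapT => px; apply: no; by exists x.
have [y Ny yP] := projection x0 sN cN.
pose w := x0 - y.
have pw : phi w != 0 by rewrite phiB Ny subr0; apply/eqP.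
have w0 : inner w w != 0.
  rewrite dnorm_eq0; apply: contraNneq pw => ->; by rewrite phi0.
exists ((phi w / inner w w)^* *: w) => x; rewrite innerZr conjCK.
(* The vector on the right lies in the kernel of [phi], to which [w] is orthogonal. *)
have /inner0C : inner w (x - (phi x / phi w) *: w) = 0.
  by apply: yP; rewrite /N/= phiB phiZ divfK// subrr.
rewrite innerBl innerZl => /eqP; rewrite subr_eq0 => /eqP ->.
by field; rewrite pw w0.
Qed.

Lemma adjP U V (C : R) (A : U -> V) : hcomplete [set: U] -> linear A -> hbounded C A ->
  forall u y, inner (A u) y = inner u (adjoint setT A y).
Proof.
move=> cU lA bA u y; rewrite /adjoint; case: xgetP => [x _ [_]|]; first exact.
have [|x|x xP] := @riesz U (C * hn y) (fun u => inner (A u) y) cU.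
- by move=> a x z; rewrite lA linearPl.
- apply: le_trans (cinner_le _ _) _; rewrite mulrAC ler_wpM2r ?hn_ge0//.
- by move=> /(_ x)[]; split => // v _; rewrite xP.
Qed.

Lemma adj_unique U V (A : U -> V) (B : V -> U) :
  (forall u y, inner (A u) y = inner u (B y)) -> adjoint setT A = B.
Proof.
move=> H; apply/funext => y; rewrite /adjoint; case: xgetP => [x _ [_ xP]|/(_ (B y))[]//].
by apply: inner_ext => v; rewrite inner_conj -xP// H [RHS]inner_conj.
Qed.

Lemma adj_linear U V (A : U -> V) (B : V -> U) :
  (forall u y, inner (A u) y = inner u (B y)) -> linear B.
Proof.
move=> H a x y; apply: inner_ext => v; rewrite inner_conj -H innerDr innerZr !H.
by rewrite rmorphD rmorphM/= conjcK -!inner_conj innerDl innerZl.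
Qed.

Lemma adj_bounded U V C (A : U -> V) (B : V -> U) : 0 <= C ->
  (forall u y, inner (A u) y = inner u (B y)) -> hbounded C A -> hbounded C B.
Proof.
move=> C0 H bA y; have [->|By] := eqVneq (hn (B y)) 0; first by rewrite mulr_ge0 ?hn_ge0.
have By0 : 0 < hn (B y) by rewrite lt_def By hn_ge0.
rewrite -(ler_pM2r By0) -expr2 hn_sqr -H; apply: le_trans (rdot_le _ _) _.
by rewrite mulrAC ler_wpM2r ?hn_ge0// -[_ * hn (B y)]mulrC mulrC.
Qed.

End BoundedOperators.

(** * Positive operators and their square roots *)

Section PositiveOperators.
Context (R : realType) (V : preHilbertType R) (S : V -> V).
Hypotheses (lS : linear S) (pS : forall x, 0 <= inner (S x) x).

(** Polarization: the quadratic form of [S] is real at [x + w], for [w = z] and for [w = i z]. *)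
Lemma pos_sa x z : inner (S x) z = inner x (S z).
Proof.
have Im0 w : complex.Im (inner (S w) w) = 0.
  by have := pS w; rewrite lecE => /andP[/eqP].
have key w : complex.Im (inner (S x) w) + complex.Im (inner (S w) x) = 0.
  have := Im0 (x + w); rewrite (op_add lS) !innerDl !innerDr !raddfD/= !Im0.
  by rewrite add0r addr0.
have := key ('i%C *: z); have := key z.
rewrite (op_scale lS) innerZl innerZr [inner x (S z)]inner_conj.
case: (inner (S x) z) => p q; case: (inner (S z) x) => r s /= k1 k2.
by apply/eqP; rewrite eq_complex/=; apply/andP; split; apply/eqP; lra.
Qed.

(** The form is nonnegative at [x + t S x] for every real [t], and its coefficient of degree one in
    [t] is twice the squared norm of [S x]. *)
Lemma pos_eq0 x : inner (S x) x = 0 -> S x = 0.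
Proof.
move=> Sx; apply: rdot0; suff -> : rdot (S x) (S x) = 0 by [].
suff : 2 * rdot (S x) (S x) = 0 by lra.
apply: (@quadratic_ge0_linear_eq0 _ _ (rdot (S (S x)) (S x))) => t.
have := pS (x + t%:C *: S x).
rewrite lecE => /andP[_] /=; rewrite (op_add lS) (op_scale lS).
rewrite !innerDl !innerDr !innerZl !innerRr Sx (pos_sa (S x) x) !raddfD/=.
case: (inner (S x) (S x)) => ? ?.
by case: (inner (S (S x)) (S x)) => ? ? /=; lra.
Qed.

End PositiveOperators.

Section PositiveSquareRoot.
Context (R : realType) (V : preHilbertType R).
Variable T : V -> V.
Hypotheses (cV : hcomplete [set: V]) (lT : linear T) (bT : hbounded 1 T).
Hypothesis sT : forall x y, inner (T x) y = inner x (T y).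

(* The square root of I - T is I - Y, where Y = (T + Y^2) / 2 is the limit of
   the iteration from 0; y bounds it. *)
Fixpoint sqrt_iter n : V -> V :=
  if n is m.+1 then fun x => 2^-1%:C *: (T x + sqrt_iter m (sqrt_iter m x))
  else fun=> 0.

Fixpoint sqrt_bnd n : R :=
  if n is m.+1 then (1 + sqrt_bnd m ^+ 2) / 2 else 0.

Local Notation Y := sqrt_iter.
Local Notation y := sqrt_bnd.

Lemma sqrt_bnd_itv n : 0 <= y n <= 1.
Proof.
elim: n => [|n /andP[y0 y1]] /=; first by rewrite lexx ler01.
have := exprn_ile1 2 y0 y1; have := sqr_ge0 (y n) => *.
by apply/andP; split; lra.
Qed.

Lemma sqrt_bndS n : y n <= y n.+1.
Proof.
have /andP[y0 y1] := sqrt_bnd_itv n; have := sqr_ge0 (1 - y n) => /=.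
by rewrite sqrrB expr1n mul1r => *; lra.
Qed.

Lemma sqrt_bnd_mono m n : (m <= n)%N -> y m <= y n.
Proof. by apply: (homo_leq (lexx) le_trans) => k; exact: sqrt_bndS. Qed.

Lemma sqrt_iter_linear n : linear (Y n).
Proof.
elim: n => [|n IH] a x z /=; first by rewrite scaler0 addr0.
rewrite lT !IH scalerA [a * _]mulrC -scalerA -scalerDr; congr (_ *: _).
by rewrite scalerDr addrACA.
Qed.

Lemma sqrt_iter_bounded n : hbounded (y n) (Y n).
Proof.
elim: n => [|n IH] x /=; first by rewrite hn0 mul0r.
have /andP[y0 y1] := sqrt_bnd_itv n.
rewrite hnZ cmod_real ger0_norm ?invr_ge0//.
have h1 := bT x; have h2 := IH (Y n x); have h3 := hnD (T x) (Y n (Y n x)).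
have h4 : y n * hn (Y n x) <= y n * (y n * hn x) by rewrite ler_wpM2l.
by rewrite mulrC ler_pdivrMr// -mulrA [_^-1 * _]mulrC mulrA divfK//; nra.
Qed.

(** The increments are dominated by those of the same iteration with [T] replaced by 1, which
    increases and stays below 1; so the iterates converge even when [T] has norm 1. The difference
    of squares is split without commuting the iterates. *)
Lemma sqrt_iterS n x : hn (Y n.+1 x - Y n x) <= (y n.+1 - y n) * hn x.
Proof.
elim: n x => [|n IH] x.
  change (hn (2^-1%:C *: (T x + 0) - 0) <= ((1 + 0 ^+ 2) / 2 - 0) * hn x).
  rewrite addr0 subr0 expr0n/= addr0 subr0 hnZ cmod_real ger0_norm ?invr_ge0//.
  by rewrite mul1r ler_wpM2l ?invr_ge0//; have := bT x; rewrite mul1r.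
have /andP[y0 y1] := sqrt_bnd_itv n; have /andP[z0 z1] := sqrt_bnd_itv n.+1.
have d0 : 0 <= y n.+1 - y n by rewrite subr_ge0 sqrt_bndS.
have -> : Y n.+2 x - Y n.+1 x = 2^-1%:C *: ((Y n.+1 (Y n.+1 x) - Y n (Y n.+1 x)) +
     Y n (Y n.+1 x - Y n x)).
  rewrite [Y n.+2 x]/= -/(Y n.+1) [X in _ - X]/= -scalerBr; congr (_ *: _).
  rewrite (op_sub (@sqrt_iter_linear n)) opprD addrACA subrr add0r.
  by rewrite addrA subrK.
rewrite hnZ cmod_real ger0_norm ?invr_ge0//.
have h1 := hnD (Y n.+1 (Y n.+1 x) - Y n (Y n.+1 x)) (Y n (Y n.+1 x - Y n x)).
have h2 := IH (Y n.+1 x).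
have h3 : (y n.+1 - y n) * hn (Y n.+1 x) <= (y n.+1 - y n) * (y n.+1 * hn x).
  by rewrite ler_wpM2l// sqrt_iter_bounded.
have h4 := sqrt_iter_bounded n (Y n.+1 x - Y n x).
have h5 : y n * hn (Y n.+1 x - Y n x) <= y n * ((y n.+1 - y n) * hn x).
  by rewrite ler_wpM2l.
have -> : y n.+2 - y n.+1 = 2^-1 * (y n.+1 ^+ 2 - y n ^+ 2).
  by rewrite [y n.+2]/= -/(y n.+1) [X in _ - X]/=; field.
rewrite -mulrA ler_wpM2l ?invr_ge0//; apply: (le_trans h1).
rewrite subr_sqr; move: (y n.+1) (y n) (hn _) (hn _) (hn _) (hn _) h2 h3 h4 h5 => *; lra.
Qed.

Lemma sqrt_iter_cauchy_bnd m n x : (m <= n)%N -> hn (Y n x - Y m x) <= (y n - y m) * hn x.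
Proof.
move=> /subnKC <-; elim: (n - m)%N => [|k IH]; first by rewrite addn0 !subrr hn0 mul0r.
rewrite addnS; apply: le_trans (hn_tri (Y (m + k) x) _ _) _.
apply: le_trans (lerD (sqrt_iterS _ _) IH) _.
by rewrite -mulrDl addrA subrK.
Qed.

Lemma sqrt_iter_cauchy x : hcauchy (Y^~ x).
Proof.
move=> e e0; have k0 : 0 < hn x + 1 by rewrite ltr_wpDl ?hn_ge0.
have hs : has_sup (range y).
  by split; [exists (y 0%N), 0%N|exists 1 => _ [n _ <-]; case/andP: (sqrt_bnd_itv n)].
have [|_ [N _ <-] HN] := @sup_adherent _ _ (e / 2 / (hn x + 1)) _ hs; first by rewrite !divr_gt0.
have yle n : y n <= sup (range y) by apply: sup_upper_bound => //; exists n.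
have key n : (N <= n)%N -> hn (Y n x - Y N x) < e / 2.
  move=> Nn; apply: le_lt_trans (sqrt_iter_cauchy_bnd x Nn) _.
  have yN := sqrt_bnd_mono Nn; have := yle n => yn.
  apply: (@le_lt_trans _ _ ((y n - y N) * (hn x + 1))).
    by rewrite ler_wpM2l ?subr_ge0// lerDl.
  by rewrite -ltr_pdivlMr//; move: (_ / (_ + 1)) HN => c; lra.
exists N => m n Nm Nn; apply: le_lt_trans (hn_tri (Y N x) _ _) _.
by rewrite [e](splitr e) ltrD ?key// hnC key.
Qed.

Definition sqrt_lim x : V := xget 0 [set l | hcvg (Y^~ x) l].

Lemma sqrt_limP x : hcvg (Y^~ x) (sqrt_lim x).
Proof.
rewrite /sqrt_lim; case: xgetP => [? _ //|]; have [//|l _ ul] := cV (u := Y^~ x) _ (@sqrt_iter_cauchy x).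
by move=> /(_ l).
Qed.

Local Notation L := sqrt_lim.

Lemma sqrt_lim_linear : linear L.
Proof.
move=> a x z; apply: (hcvg_unique (sqrt_limP _)).
move=> e /(hcvgP a (sqrt_limP x) (sqrt_limP z)) [N HN].
by exists N => n /HN; rewrite sqrt_iter_linear.
Qed.

Lemma sqrt_lim_bounded : hbounded 1 L.
Proof.
move=> x; apply: (hcvg_hn_le (sqrt_limP x)) => n.
apply: le_trans (sqrt_iter_bounded _ _) _.
by rewrite ler_wpM2r ?hn_ge0//; case/andP: (sqrt_bnd_itv n).
Qed.

Lemma sqrt_iter_sa n x z : inner (Y n x) z = inner x (Y n z).
Proof.
elim: n x z => [|n IH] x z /=; first by rewrite linear0l linear0r.
by rewrite innerZl innerRr innerDl innerDr sT !IH.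
Qed.

Lemma sqrt_lim_sa x z : inner (L x) z = inner x (L z).
Proof.
apply/eqP; rewrite -subr_eq0; apply/eqP/cmod_eq0_small => e e0.
have e2 : 0 < e / 2 by rewrite divr_gt0.
have [N HN] := hcvg_inner z (sqrt_limP x) e2.
have [M HM] := hcvg_inner x (sqrt_limP z) e2.
have := HN _ (leq_maxl N M); have := HM _ (leq_maxr N M).
rewrite -cmod_conj rmorphB/= -!inner_conj -sqrt_iter_sa -cmodN opprB => h1 h2.
have -> : inner (L x) z - inner x (L z) = (inner (L x) z - inner (Y (maxn N M) x) z) +
    (inner (Y (maxn N M) x) z - inner x (L z)) by rewrite addrA subrK.
apply: le_lt_trans (cmodD _ _) _; by rewrite [e](splitr e) ltrD// -cmodN opprB.
Qed.

(** Each iterate is a polynomial in [T]. *)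
Lemma sqrt_lim_commute (S : V -> V) C : linear S -> hbounded C S ->
  (forall x, S (T x) = T (S x)) -> forall x, S (L x) = L (S x).
Proof.
move=> lS bS ST x.
have SY n z : S (Y n z) = Y n (S z).
  elim: n z => [|n IH] z /=; first exact: op_zero.
  by rewrite (op_scale lS) (op_add lS) ST !IH.
apply: (hcvg_unique (hbounded_cvg lS bS (sqrt_limP x))).
move=> e /(sqrt_limP (S x)) [N HN]; exists N => n /HN /=.
by rewrite SY.
Qed.

Lemma sqrt_limE x : 2%:C *: L x = T x + L (L x).
Proof.
have h1 : hcvg (fun n => 2%:C *: Y n.+1 x + 0) (2%:C *: L x + 0).
  by apply: hcvgP (hcvg_cst 0); apply: (hcvg_sub _ (sqrt_limP x)) => n.
have h2 : hcvg (fun n => Y n (Y n x)) (L (L x)).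
  move=> e e0; have e2 : 0 < e / 2 by rewrite divr_gt0.
  have [N HN] := sqrt_limP x e2; have [M HM] := sqrt_limP (L x) e2.
  exists (maxn N M) => n; rewrite geq_max => /andP[Nn Mn].
  apply: le_lt_trans (hn_tri (Y n (L x)) _ _) _; rewrite [e](splitr e) ltrD ?HM//.
  rewrite -(op_sub (@sqrt_iter_linear n)); apply: le_lt_trans (sqrt_iter_bounded _ _) _.
  apply: le_lt_trans (HN _ Nn); rewrite ler_piMl ?hn_ge0//.
  by case/andP: (sqrt_bnd_itv n).
have h3 := hcvgD (hcvg_cst (T x)) h2.
rewrite -[LHS]addr0; apply: (hcvg_unique h1) => e /h3[N HN]; exists N => n /HN.
suff -> : 2%:C *: Y n.+1 x + 0 = T x + Y n (Y n x) by [].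
by rewrite addr0 /= scalerA -rmorphM/= divff ?pnatr_eq0// scale1r.
Qed.

Definition psqrt_val x : V := x - L x.
Local Notation B := psqrt_val.

Lemma psqrt_val_linear : linear B.
Proof. by move=> a x z; rewrite /B sqrt_lim_linear opprD addrACA scalerBr. Qed.

Lemma psqrt_val_bounded : hbounded 2 B.
Proof.
move=> x; apply: le_trans (hnD _ _) _; rewrite hnN.
by have := sqrt_lim_bounded x; rewrite mul1r; lra.
Qed.

Lemma psqrt_val_sa x z : inner (B x) z = inner x (B z).
Proof. by rewrite innerBl innerBr sqrt_lim_sa. Qed.

Lemma inner_sa_real (S : V -> V) x : (forall x z, inner (S x) z = inner x (S z)) ->
  inner (S x) x = (rdot (S x) x)%:C.
Proof.
move=> sS; apply/esym/RRe_real/CrealP => /=.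
by rewrite [LHS](_ : _ = (inner (S x) x)^*)// -inner_conj sS.
Qed.

Lemma psqrt_val_ge0 x : 0 <= inner (B x) x.
Proof.
rewrite (inner_sa_real _ psqrt_val_sa) lecR innerBl raddfB/= subr_ge0.
apply: le_trans (rdot_le _ _) _; rewrite -[leRHS]hn_sqr expr2 ler_wpM2r ?hn_ge0//.
by have := sqrt_lim_bounded x; rewrite mul1r.
Qed.

Lemma psqrt_valK x : B (B x) = x - T x.
Proof.
rewrite /B (op_sub sqrt_lim_linear).
have -> : L (L x) = 2%:C *: L x - T x by rewrite sqrt_limE addrC addKr.
rewrite [2](_ : _ = 1 + 1)// rmorphD/= scalerDl !scale1r.
by rewrite opprB -[L x + L x - _]addrA [L x + (_ - _)]addrC addrK addrA subrK.
Qed.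

(** Another positive root [C] commutes with [T], which equals [I - C^2], hence with [B]. For
    [z = B x - C x] this gives [(B + C) z = 0], so both forms vanish at [z], then [B z = C z = 0],
    and the squared norm of [z] is 0 by self-adjointness. *)
Lemma psqrt_unique (C : V -> V) : linear C -> continuous C ->
  (forall x, 0 <= inner (C x) x) -> (forall x, C (C x) = x - T x) -> C = B.
Proof.
move=> lC cC pC C2; have [c c0 bC] := continuous_hbounded lC cC.
have CT x : C (T x) = T (C x).
  have TE z : T z = z - C (C z) by rewrite C2 opprB addrC subrK.
  by rewrite !TE (op_sub lC).
have CB x : C (B x) = B (C x).
  by rewrite /B (op_sub lC) (sqrt_lim_commute lC bC CT).
have BC x : (B x - C x) = 0.
  pose z := B x - C x.
  have Cz : inner (C z) z + inner (B z) z = 0.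
    rewrite -innerDl /z (op_sub lC) (op_sub psqrt_val_linear) CB psqrt_valK C2.
    by rewrite addrA subrK subrr linear0l.
  have /eqP := Cz; rewrite paddr_eq0 ?pC ?psqrt_val_ge0// => /andP[/eqP C0 /eqP B0].
  have Cz0 := pos_eq0 lC pC C0; have Bz0 := pos_eq0 psqrt_val_linear psqrt_val_ge0 B0.
  apply: rdot0; rewrite -/z {2}/z innerBr -psqrt_val_sa -(pos_sa lC pC) Cz0 Bz0.
  by rewrite linear0l subrr.
by apply/funext => x; apply/eqP; rewrite eq_sym -subr_eq0 BC.
Qed.

Lemma psqrtE : psqrt (fun x => x - T x) = B.
Proof.
rewrite /psqrt; case: xgetP => [C _ [lC cC pC C2]|/(_ B)[]]; first exact: psqrt_unique.
split; [exact: psqrt_val_linear| |exact: psqrt_val_ge0|exact: psqrt_valK].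
exact: hbounded_continuous psqrt_val_linear psqrt_val_bounded.
Qed.

End PositiveSquareRoot.

(** * Square integrable functions and fields of operators *)

Section Subsequences.
Context (R : realType).

Lemma subseq_choice (P : nat -> nat -> Prop) :
  (forall n, exists N, forall m, (N <= m)%N -> P n m) ->
  exists phi : nat -> nat, [/\ forall n, (phi n < phi n.+1)%N, forall n, (n <= phi n)%N &
    forall n m, (phi n <= m)%N -> P n m].
Proof.
(* These partial sums increase strictly and dominate both [n] and [N n]. *)
move=> /choice[N NP]; pose phi n := (\sum_(k < n.+1) (N k).+1)%N.
have phiS n : (phi n < phi n.+1)%N by rewrite /phi [X in (_ < X)%N]big_ord_recr/= addnS ltnS leq_addr.
exists phi; split => //; first by elim=> [//|n IH]; exact: leq_ltn_trans (phiS n).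
move=> n m; rewrite /phi big_ord_recr/= => nm; apply: NP.
by apply: leq_trans nm; rewrite addnS leqW// leq_addl.
Qed.

Lemma pow2_small (e : R) : 0 < e -> exists N, forall n, (N <= n)%N -> 2^-1 ^+ n < e.
Proof.
move=> /inv_nat_lt[N HN]; exists N => n /HN; apply: le_lt_trans.
rewrite exprVn lef_pV2 ?posrE ?exprn_gt0// -natrX ler_nat; exact: ltn_expl.
Qed.

Lemma geo_telescope (V : preHilbertType R) (u : nat -> V) (c : R) : 0 <= c ->
  (forall n, hn (u n.+1 - u n) <= 2^-1 ^+ n * c) ->
  forall m n, (n <= m)%N -> hn (u m - u n) <= 2 * 2^-1 ^+ n * c.
Proof.
move=> c0 H m n /subnKC <-; move: (m - n)%N => k.
suff : hn (u (n + k)%N - u n) <= 2 * (2^-1 ^+ n - 2^-1 ^+ (n + k)) * c.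
  move=> /le_trans; apply; rewrite ler_wpM2r// ler_wpM2l// gerBl.
  by rewrite exprn_ge0// invr_ge0.
elim: k => [|k IH]; first by rewrite addn0 !subrr hn0 mulr0 mul0r.
rewrite addnS; apply: le_trans (hn_tri (u (n + k)%N) _ _) _.
apply: le_trans (lerD (H _) IH) _; rewrite -mulrDl ler_wpM2r// exprS.
by move: (_ ^+ n) (_ ^+ (n + k)) => a b; lra.
Qed.

Lemma geo_cauchy (V : preHilbertType R) (u : nat -> V) (c : R) :
  (forall m n, (n <= m)%N -> hn (u m - u n) <= 2 * 2^-1 ^+ n * c) -> hcauchy u.
Proof.
move=> H e e0; have k0 : 0 < 4 * (`|c| + 1) by rewrite mulr_gt0// ltr_wpDl.
have [|N HN] := pow2_small (e := e / (4 * (`|c| + 1))); first by rewrite divr_gt0.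
have key n : (N <= n)%N -> hn (u n - u N) < e / 2.
  move=> /H /le_lt_trans; apply; have := HN N (leqnn N).
  rewrite ltr_pdivlMr// => lt1; have : 2^-1 ^+ N * c <= 2^-1 ^+ N * (`|c| + 1).
    by rewrite ler_wpM2l ?exprn_ge0 ?invr_ge0// ler_wpDr// ler_norm.
  by move: lt1; rewrite -mulrA; move: (_ * c) => *; lra.
exists N => m n Nm Nn; apply: le_lt_trans (hn_tri (u N) _ _) _.
by rewrite [e](splitr e) ltrD ?key// hnC key.
Qed.

Lemma hcauchy_sub_cvg (V : preHilbertType R) (u : nat -> V) l (phi : nat -> nat) :
  (forall n, (n <= phi n)%N) -> hcauchy u -> hcvg (u \o phi) l -> hcvg u l.
Proof.
move=> np cu ul e e0; have e2 : 0 < e / 2 by rewrite divr_gt0.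
have [N HN] := cu _ e2; have [M HM] := ul _ e2; exists N => n Nn.
apply: le_lt_trans (hn_tri (u (phi (maxn N M))) _ _) _.
rewrite [e](splitr e) ltrD//; last by apply: HM; rewrite leq_maxr.
by apply: HN => //; rewrite (leq_trans _ (np _))// leq_maxl.
Qed.

End Subsequences.

Section L2Complete.
Context d (T : measurableType d) (R : realType).
Variable mu : {measure set T -> \bar R}.
Variable E : sepHilbertType R.
Implicit Types (f g : T -> E) (u v w : L2 mu E) (G : T -> R).

Definition wmeas f := forall v : E, cmeasurable (fun t => inner (f t) v).

Lemma aeE f g : f = g %[ae mu] <-> {ae mu, forall t, f t = g t}.
Proof. by split; apply: filterS => t; [apply|]. Qed.

Lemma ae_and (P Q : T -> Prop) : {ae mu, forall t, P t} -> {ae mu, forall t, Q t} ->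
  {ae mu, forall t, P t /\ Q t}.
Proof. exact: filterI. Qed.

Lemma inner_L2E u v : inner u v = cintegral mu (fun t => inner (u t) (v t)).
Proof. by []. Qed.

Lemma L2_rdot_integrable u : mu.-integrable setT (fun t => (rdot (u t) (u t))%:E).
Proof. by case: (l2fun_cintegrable (L2_reprP u) (L2_reprP u)). Qed.

Lemma L2_rdotE u : (rdot u u)%:E = (\int[mu]_t (rdot (u t) (u t))%:E)%E.
Proof. by rewrite inner_L2E/= fineK// integrable_fin_num// L2_rdot_integrable. Qed.

Lemma wmeas_rdot f : wmeas f -> measurable_fun setT (fun t => rdot (f t) (f t)).
Proof. by move=> mf; case: (l2fun_measurable mf mf). Qed.

Lemma l2fun_wmeas u : wmeas u. Proof. by case: (L2_reprP u). Qed.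

Lemma ae_le_Rint f G : wmeas f -> mu.-integrable setT (EFin \o G) ->
  {ae mu, forall t, rdot (f t) (f t) <= G t} ->
  (\int[mu]_t (rdot (f t) (f t))%:E <= \int[mu]_t (G t)%:E)%E.
Proof.
move=> mf iG fG.
have G0 : {ae mu, forall t, 0 <= G t}.
  by apply: filterS fG => t; apply: le_trans; exact: rdot_ge0.
have mG : measurable_fun setT (EFin \o G) by case/integrableP: iG.
have -> : (\int[mu]_t (G t)%:E = \int[mu]_t `|(G t)%:E|)%E.
  apply: ae_eq_integral => //; first exact: measurableT_comp.
  by apply: filterS G0 => t Gt _ /=; rewrite ger0_norm.
apply: ae_ge0_le_integral => //.
- by move=> t _; rewrite lee_fin rdot_ge0.
- by apply/measurable_EFinP; exact: wmeas_rdot.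
- exact: measurableT_comp.
- by apply: filterS fG => t ft _; rewrite lee_fin (le_trans ft)// ler_norm.
Qed.

Lemma l2fun_bound f G : wmeas f -> mu.-integrable setT (EFin \o G) ->
  {ae mu, forall t, rdot (f t) (f t) <= G t} -> l2fun mu f.
Proof.
move=> mf iG fG; split => //; under eq_integral do rewrite rdot_norm.
apply: le_lt_trans (ae_le_Rint mf iG fG) _.
have /fin_numPlt/andP[_ //] : (\int[mu]_t (G t)%:E)%E \is a fin_num.
exact: integrable_fin_num.
Qed.

Lemma L2_rdot_le u G : mu.-integrable setT (EFin \o G) ->
  {ae mu, forall t, rdot (u t) (u t) <= G t} -> rdot u u <= \int[mu]_t G t.
Proof.
move=> iG uG; rewrite -lee_fin L2_rdotE /Rintegral fineK ?integrable_fin_num//.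
by apply: ae_le_Rint => //; exact: l2fun_wmeas.
Qed.

Lemma L2of_ae u g : {ae mu, forall t, g t = u t} -> L2of mu g = u.
Proof.
move=> gu; apply: L2_eq; rewrite /L2of; case: xgetP => [h _ /aeE hg|/(_ u)[]].
  by apply/aeE; apply: filterS2 hg gu => t -> ->.
by apply/aeE; apply: filterS gu => t ->.
Qed.

Lemma L2P_ae (a : R[i]) u v : {ae mu, forall t, (a *: u + v : L2 mu E) t = a *: u t + v t}.
Proof. by apply/aeE; exact: L2P. Qed.

Lemma L2Z_ae (a : R[i]) u : {ae mu, forall t, (a *: u : L2 mu E) t = a *: u t}.
Proof.
have h0 : {ae mu, forall t, (0 : L2 mu E) t = 0}.
  have := L2P_ae (-1) 0 0; have := L2P_ae 1 0 0.
  rewrite !scaler0 !addr0; apply: filterS2 => t.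
  by rewrite scaleN1r addNr => _ ->.
have := L2P_ae a u 0; rewrite addr0.
by apply: filterS2 h0 => t -> ->; rewrite addr0.
Qed.

Lemma L2D_ae u v : {ae mu, forall t, (u + v : L2 mu E) t = u t + v t}.
Proof. by have := L2P_ae 1 u v; rewrite scale1r; apply: filterS => t ->; rewrite scale1r. Qed.

Lemma L2B_ae u v : {ae mu, forall t, (u - v : L2 mu E) t = u t - v t}.
Proof.
have := L2P_ae (-1) v u; rewrite scaleN1r addrC.
by apply: filterS => t ->; rewrite scaleN1r addrC.
Qed.

(* The integrable function G = sum_n 4^n |v_n|^2 dominates. *)
Lemma fast_ae (v : nat -> L2 mu E) : (forall n, rdot (v n) (v n) <= 8^-1 ^+ n) ->
  exists G, [/\ mu.-integrable setT (EFin \o G), forall t, 0 <= G t &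
    {ae mu, forall t, forall n, rdot (v n t) (v n t) <= 4^-1 ^+ n * G t}].
Proof.
move=> bv.
pose h n t := (4 ^+ n * rdot (v n t) (v n t))%:E.
have h0 n t : (0 <= h n t)%E by rewrite lee_fin mulr_ge0 ?exprn_ge0 ?rdot_ge0.
have mh n : measurable_fun setT (h n).
  apply/measurable_EFinP; apply: measurable_funM => //.
  by apply: wmeas_rdot; exact: l2fun_wmeas.
pose S t := (\big[+%E/0%R]_(0 <= n <oo) h n t)%E.
have S0 t : (0 <= S t)%E by apply: nneseries_ge0.
have mS : measurable_fun setT S.
  have := @ge0_emeasurable_sum _ T R setT h xpredT (fun k x _ _ => h0 k x) (fun k _ => mh k).
  by apply: eq_measurable_fun => t _; apply: eq_eseriesl.
have iS : mu.-integrable setT S.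
  apply/integrableP; split => //.
  under eq_integral do rewrite gee0_abs//.
  rewrite integral_nneseries//.
  apply: (@le_lt_trans _ _ 2%:E); last exact: ltry.
  apply: lime_le; first by apply: is_cvg_nneseries => n _ _; exact: integral_ge0.
  apply: nearW => n.
  apply: (@le_trans _ _ (\sum_(0 <= k < n) (2^-1 ^+ k : R)%:E)%E).
    apply: lee_sum => k _; rewrite /h.
    under eq_integral do rewrite EFinM.
    rewrite ge0_integralZl//; last 2 first.
    - by apply/measurable_EFinP; apply: wmeas_rdot; exact: l2fun_wmeas.
    - by move=> t _; rewrite lee_fin rdot_ge0.
    rewrite -L2_rdotE -EFinM lee_fin.
    have -> : 2^-1 ^+ k = 4 ^+ k * 8^-1 ^+ k :> R.
      by rewrite -exprMn; congr (_ ^+ _); field.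
    by rewrite ler_wpM2l ?exprn_ge0.
  rewrite sumEFin lee_fin.
  suff -> : \sum_(0 <= k < n) (2^-1 ^+ k : R) = 2 - 2 * 2^-1 ^+ n.
    by rewrite gerBl mulr_ge0// exprn_ge0// invr_ge0.
  elim: n => [|n IH]; first by rewrite big_nil expr0; lra.
  by rewrite big_nat_recr//= IH exprS; move: (_ ^+ n) => a; lra.
exists (fine \o S); split.
- apply: (le_integrable measurableT _ _ iS).
    by apply/measurable_EFinP; apply: measurableT_comp => //; exact: measurable_fine.
  by move=> t _ /=; have := S0 t; case: (S t) => [r| |]//= _; rewrite normr0 leey.
- by move=> t; rewrite /= fine_ge0.
- have := integrable_ae measurableT iS; apply: filterS => t /(_ I) fS n.
  rewrite exprVn -ler_pdivrMl ?invr_gt0 ?exprn_gt0// invrK.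
  rewrite -lee_fin /= fineK//.
  have := @nneseries_lim_ge R (h^~ t) xpredT 0 n.+1 (fun k _ _ => h0 k t).
  apply: le_trans; rewrite big_nat_recr//= leeDr//.
  by apply: sume_ge0 => k _.
Qed.

Lemma measurable_real_cvg (h : nat -> T -> R) (f : T -> R) :
  (forall n, measurable_fun setT (h n)) ->
  (forall t e, 0 < e -> exists N, forall n, (N <= n)%N -> `|h n t - f t| < e) ->
  measurable_fun setT f.
Proof.
move=> mh hf; apply: (measurable_fun_cvg mh) => t _.
apply/cvgrPdist_lt => e /(hf t)[N HN]; exists N => // n /HN.
by rewrite distrC.
Qed.

Lemma wmeas_lim (h : nat -> T -> E) f : (forall n, wmeas (h n)) ->
  (forall t, hcvg (h^~ t) (f t)) -> wmeas f.
Proof.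
move=> mh hf v; split.
  apply: (measurable_real_cvg (fun n => (mh n v).1)) => t e /(hcvg_inner v (hf t)) [N HN].
  exists N => n /HN; apply: le_lt_trans; rewrite -raddfB/=; exact: Re_le_cmod.
apply: (measurable_real_cvg (fun n => (mh n v).2)) => t e /(hcvg_inner v (hf t)) [N HN].
exists N => n /HN; apply: le_lt_trans; rewrite -raddfB/=; exact: Im_le_cmod.
Qed.

Lemma wmeas_scale (k : T -> R[i]) f : cmeasurable k -> wmeas f -> wmeas (fun t => k t *: f t).
Proof.
move=> [kr ki] mf v; have [fr fi] := mf v; split.
  rewrite [X in measurable_fun _ X](_ : _ = (fun t => complex.Re (k t) * complex.Re (inner (f t) v) -
     complex.Im (k t) * complex.Im (inner (f t) v))); last first.
    by apply/funext => t; rewrite innerZl; case: (k t) (inner _ _) => ? ? [].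
  by apply: measurable_funB; apply: measurable_funM.
rewrite [X in measurable_fun _ X](_ : _ = (fun t => complex.Re (k t) * complex.Im (inner (f t) v) +
   complex.Im (k t) * complex.Re (inner (f t) v))); last first.
  by apply/funext => t; rewrite innerZl; case: (k t) (inner _ _) => ? ? [].
by apply: measurable_funD; apply: measurable_funM.
Qed.

Lemma wmeas_comb (a : R[i]) f g : wmeas f -> wmeas g -> wmeas (fun t => a *: f t + g t).
Proof.
have ca : cmeasurable (fun _ : T => a) by split; exact: measurable_cst.
move=> mf mg v; have [fr fi] := wmeas_scale ca mf v; have [gr gi] := mg v; split.
  rewrite [X in measurable_fun _ X](_ : _ = (fun t => rdot (a *: f t) v + rdot (g t) v)).
    exact: measurable_funD.
  by apply/funext => t; rewrite innerDl raddfD.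
rewrite [X in measurable_fun _ X](_ : _ = (fun t => complex.Im (inner (a *: f t) v) + complex.Im (inner (g t) v))).
  exact: measurable_funD.
by apply/funext => t; rewrite innerDl raddfD.
Qed.

Lemma wmeas_cst (x : E) : wmeas (fun=> x).
Proof. by move=> v; split; exact: measurable_cst. Qed.

Lemma wmeas_restr (A : set T) f : measurable A -> wmeas f ->
  wmeas (fun t => (\1_A t : R)%:C *: f t).
Proof.
move=> mA mf; apply: wmeas_scale => //; split => /=; last exact: measurable_cst.
exact: measurable_indic.
Qed.

Lemma ae_measurable (P : T -> Prop) : {ae mu, forall t, P t} ->
  exists A : set T, [/\ measurable A, {ae mu, forall t, A t} & forall t, A t -> P t].
Proof.
move=> [N [mN N0 PN]]; exists (~` N); split; first exact: measurableC.
  by exists N; split => // t /= /contrapT.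
by move=> t /= Nt; apply: contrapT => Pt; apply: Nt; exact: PN.
Qed.

(** All functions are cut off by the indicator of a measurable set of full measure on which the
    limit exists; outside it they vanish, so convergence holds everywhere. *)
Lemma ae_wlim (h : nat -> T -> E) f : (forall n, wmeas (h n)) ->
  {ae mu, forall t, hcvg (h^~ t) (f t)} ->
  exists2 g, wmeas g & {ae mu, forall t, f t = g t}.
Proof.
move=> mh /ae_measurable[A [mA aA AP]].
exists (fun t => (\1_A t : R)%:C *: f t); last first.
  by apply: filterS aA => t At; rewrite indicE mem_set// scale1r.
apply: (wmeas_lim (h := fun n t => (\1_A t : R)%:C *: h n t)).
  by move=> n; exact: wmeas_restr.
move=> t; have [At|At] := pselect (A t).
  rewrite indicE mem_set// => e /(AP t At)[N HN]; exists N => n /HN.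
  by rewrite !scale1r.
rewrite indicE memNset// => e e0; exists 0%N => n _.
by rewrite !scale0r subrr hn0.
Qed.

Lemma integrable_scale (c : R) G : mu.-integrable setT (EFin \o G) ->
  mu.-integrable setT (EFin \o (fun t => c * G t)).
Proof. by move=> iG; exact: (integrableZl measurableT c iG). Qed.

Lemma rdot_le_hn8 (V : preHilbertType R) (x : V) n : hn x < 8^-1 ^+ n -> rdot x x <= 8^-1 ^+ n.
Proof.
move=> /ltW x8; rewrite -hn_sqr expr2 (le_trans _ x8)// ler_piMl ?hn_ge0//.
by rewrite (le_trans x8)// exprn_ile1// ?invr_ge0// invf_le1// ler1n.
Qed.

Lemma quarter_sqr n : 4^-1 ^+ n = (2^-1 ^+ n) ^+ 2 :> R.
Proof. by rewrite exprAC; congr (_ ^+ _); rewrite expr2 -invfM -natrM. Qed.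

(** Distances below [8^-1 ^+ n] leave room for the weights [4 ^+ n] of [fast_ae], which makes the
    pointwise distances decay geometrically. *)
Lemma ae_subseq (u : nat -> L2 mu E) (l : L2 mu E) : hcvg u l ->
  exists2 phi : nat -> nat, forall n, (n <= phi n)%N &
    {ae mu, forall t, hcvg (fun n => u (phi n) t) (l t)}.
Proof.
move=> ul; have [|phi [_ np phiP]] := @subseq_choice (fun n m => hn (u m - l) < 8^-1 ^+ n).
  by move=> n; apply: ul; rewrite exprn_gt0// invr_gt0.
exists phi => //.
have [|G [iG G0 vG]] := @fast_ae (fun n => u (phi n) - l).
  by move=> n; apply: rdot_le_hn8; exact: phiP.
have /ae_foralln uB : forall n, {ae mu, forall t, (u (phi n) - l : L2 mu E) t = u (phi n) t - l t}.
  by move=> n; exact: L2B_ae.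
apply: filterS2 uB vG => t uB vG e e0.
have c0 : 0 < Num.sqrt (G t) + 1 by rewrite ltr_wpDl ?sqrtr_ge0.
have [|N HN] := pow2_small (e := e / (Num.sqrt (G t) + 1)); first by rewrite divr_gt0.
exists N => n /HN; rewrite ltr_pdivlMr// => lt1; apply: le_lt_trans lt1.
rewrite -uB hn_le_sqr; last by rewrite mulr_ge0 ?exprn_ge0 ?invr_ge0 ?ltW.
apply: (le_trans (vG n)); rewrite exprMn -quarter_sqr ler_wpM2l ?exprn_ge0 ?invr_ge0//.
rewrite -{1}(sqr_sqrtr (G0 t)) ler_pXn2r ?nnegrE ?sqrtr_ge0 ?(ltW c0)//.
by rewrite lerDl.
Qed.

(** Riesz-Fischer: along a subsequence with increments below [8^-1 ^+ n] the functions converge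
    almost everywhere, with a geometric bound; the whole Cauchy sequence follows its subsequence. *)
Lemma L2_complete : hcomplete [set: L2 mu E].
Proof.
move=> u _ cu.
have [|phi [phiS np phiP]] := @subseq_choice (fun n m => forall k, (m <= k)%N -> hn (u k - u m) < 8^-1 ^+ n).
  move=> n; have [|N HN] := cu (8^-1 ^+ n); first by rewrite exprn_gt0// invr_gt0.
  by exists N => m Nm k mk; apply: HN => //; exact: leq_trans mk.
pose w n : L2 mu E := u (phi n).
have [|G [iG G0 vG]] := @fast_ae (fun n => w n.+1 - w n).
  by move=> n; apply: rdot_le_hn8; apply: phiP => //; exact/ltnW.
have /ae_foralln wB : forall n, {ae mu, forall t, (w n.+1 - w n : L2 mu E) t = w n.+1 t - w n t}.
  by move=> n; exact: L2B_ae.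
have tele : {ae mu, forall t, forall m n, (n <= m)%N ->
    hn (w m t - w n t) <= 2 * 2^-1 ^+ n * Num.sqrt (G t)}.
  apply: filterS2 wB vG => t wB vG; apply: geo_telescope; first exact: sqrtr_ge0.
  move=> n; rewrite -wB hn_le_sqr; last by rewrite mulr_ge0 ?exprn_ge0 ?invr_ge0 ?sqrtr_ge0.
  by rewrite exprMn -quarter_sqr sqr_sqrtr.
pose f0 t := xget 0 [set l | hcvg (fun n => w n t) l].
have f0P : {ae mu, forall t, hcvg (fun n => w n t) (f0 t)}.
  apply: filterS tele => t /geo_cauchy ct; rewrite /f0; case: xgetP => [//|].
  have [//|l _ wl] := sepHilbert_complete (u := fun n => w n t) _ ct.
  by move=> /(_ l).
have [f mf ff0] := ae_wlim (fun n => @l2fun_wmeas (w n)) f0P.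
have key : {ae mu, forall t, forall n, rdot (f t - w n t) (f t - w n t) <= 4 * 4^-1 ^+ n * G t}.
  apply: filterS3 tele f0P ff0 => t tt f0t <- n.
  rewrite -hn_sqr quarter_sqr -[in leRHS](sqr_sqrtr (G0 t)).
  have -> : 4 * (2^-1 ^+ n) ^+ 2 * Num.sqrt (G t) ^+ 2 = (2 * 2^-1 ^+ n * Num.sqrt (G t)) ^+ 2.
    by rewrite !exprMn; congr (_ * _ * _); rewrite expr2 -natrM.
  rewrite ler_pXn2r ?nnegrE ?hn_ge0 ?mulr_ge0 ?exprn_ge0 ?invr_ge0 ?sqrtr_ge0//.
  have sh : hcvg (fun m => w (m + n)%N t - w n t) (f0 t - w n t).
    apply: hcvgB (hcvg_cst _).
    by apply: (hcvg_sub (phi := fun m => (m + n)%N) _ f0t) => m; rewrite leq_addr.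
  by apply: (hcvg_hn_le sh) => m; apply: tt; rewrite leq_addl.
have iGn n : mu.-integrable setT (EFin \o (fun t => 4 * 4^-1 ^+ n * G t)).
  exact: integrable_scale.
(* Only the difference with [w 0] is dominated by an integrable function; adding [w 0] back shows
   that [f] is square integrable. *)
have lf0 : l2fun mu (fun t => f t - w 0 t).
  apply: (l2fun_bound _ (iGn 0%N)); last by apply: filterS key.
  by under eq_fun do rewrite addrC -scaleN1r; apply: wmeas_comb => //; exact: l2fun_wmeas.
have lf : l2fun mu f.
  have := l2funP 1 lf0 (L2_reprP (w 0)).
  by under eq_fun do rewrite scale1r subrK.
pose l := L2of mu f.
have lE : {ae mu, forall t, l t = f t} by apply/aeE; exact: L2ofK.
exists l => //; apply: (hcauchy_sub_cvg np cu) => e e0.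
pose I := \int[mu]_t G t.
have I0 : 0 <= I by apply: Rintegral_ge0.
have c0 : 0 < 2 * (Num.sqrt I + 1) by rewrite mulr_gt0// ltr_wpDl ?sqrtr_ge0.
have [|N HN] := pow2_small (e := e / (2 * (Num.sqrt I + 1))); first by rewrite divr_gt0.
exists N => n /HN; rewrite ltr_pdivlMr// => lt1; apply: le_lt_trans lt1.
rewrite hnC hn_le_sqr; last by rewrite mulr_ge0 ?exprn_ge0 ?invr_ge0 ?ltW.
apply: (@le_trans _ _ (\int[mu]_t (4 * 4^-1 ^+ n * G t))).
  apply: L2_rdot_le => //; apply: filterS3 key lE (L2B_ae l (w n)) => t kt lt wt.
  by rewrite [X in inner X X]wt lt.
rewrite RintegralZl// -/I quarter_sqr !exprMn [4 * _]mulrC -mulrA ler_wpM2l ?exprn_ge0 ?invr_ge0//.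
rewrite [2 ^+ 2](_ : _ = 4); last by rewrite expr2 -natrM.
rewrite ler_wpM2l// -{1}(sqr_sqrtr I0) ler_pXn2r ?nnegrE ?sqrtr_ge0 ?addr_ge0 ?sqrtr_ge0//.
by rewrite lerDl.
Qed.

End L2Complete.

Section DirectSumTheory.
Context (R : realType) (U V : preHilbertType R).
Implicit Types x y : dsum U V.

Lemma inner_dsumE x y : inner x y = inner x.1 y.1 + inner x.2 y.2.
Proof. by []. Qed.

Lemma rdot_dsumE x : rdot x x = rdot x.1 x.1 + rdot x.2 x.2.
Proof. by rewrite inner_dsumE raddfD. Qed.

Lemma hn_dsum1 x : hn x.1 <= hn x.
Proof. by rewrite ler_wsqrtr// rdot_dsumE lerDl rdot_ge0. Qed.

Lemma hn_dsum2 x : hn x.2 <= hn x.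
Proof. by rewrite ler_wsqrtr// rdot_dsumE lerDr rdot_ge0. Qed.

Lemma hn_dsum_le x : hn x <= hn x.1 + hn x.2.
Proof.
rewrite hn_le_sqr ?addr_ge0 ?hn_ge0// rdot_dsumE -!hn_sqr sqrrD addrAC lerDl.
by rewrite mulrn_wge0// mulr_ge0 ?hn_ge0.
Qed.

Lemma dsumP (a : R[i]) (u u' : U) (v v' : V) :
  a *: (u ⊕ v) + (u' ⊕ v') = (a *: u + u') ⊕ (a *: v + v').
Proof. by []. Qed.

Lemma dsumD (u u' : U) (v v' : V) : (u ⊕ v) + (u' ⊕ v') = (u + u') ⊕ (v + v').
Proof. by []. Qed.

Lemma dsumE x : x = x.1 ⊕ x.2. Proof. exact: surjective_pairing. Qed.

Lemma hcvg_dsum1 (u : nat -> dsum U V) x : hcvg u x -> hcvg (fun n => (u n).1) x.1.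
Proof. by move=> ux e /ux[N HN]; exists N => n /HN; apply: le_lt_trans (hn_dsum1 (u n - x)). Qed.

Lemma hcvg_dsum2 (u : nat -> dsum U V) x : hcvg u x -> hcvg (fun n => (u n).2) x.2.
Proof. by move=> ux e /ux[N HN]; exists N => n /HN; apply: le_lt_trans (hn_dsum2 (u n - x)). Qed.

Lemma hcvg_dsum (u : nat -> U) (v : nat -> V) (x : U) (y : V) : hcvg u x -> hcvg v y ->
  hcvg (fun n => u n ⊕ v n) (x ⊕ y).
Proof.
move=> ux vy e e0; have e2 : 0 < e / 2 by rewrite divr_gt0.
have [N HN] := ux _ e2; have [M HM] := vy _ e2.
exists (maxn N M) => n; rewrite geq_max => /andP[Nn Mn].
apply: le_lt_trans (hn_dsum_le _) _; rewrite [e](splitr e) ltrD//; [exact: HN|exact: HM].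
Qed.

Lemma hcauchy_dsum (u : nat -> dsum U V) : hcauchy u ->
  hcauchy (fun n => (u n).1) /\ hcauchy (fun n => (u n).2).
Proof.
move=> cu; split => e /cu[N HN]; exists N => m n Nm Nn.
  by apply: le_lt_trans (hn_dsum1 (u m - u n)) _; exact: HN.
by apply: le_lt_trans (hn_dsum2 (u m - u n)) _; exact: HN.
Qed.

Lemma dsum_complete (A : set U) (B : set V) : hcomplete A -> hcomplete B ->
  hcomplete [set x : dsum U V | A x.1 /\ B x.2].
Proof.
move=> cA cB u Su /hcauchy_dsum[c1 c2].
have [|a Aa ua] := cA _ _ c1; first by move=> n; case: (Su n).
have [|b Bb ub] := cB _ _ c2; first by move=> n; case: (Su n).
by exists (a ⊕ b) => // e /(hcvg_dsum ua ub)[N HN]; exists N => n /HN; rewrite -dsumE.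
Qed.

End DirectSumTheory.

Section Separability.
Context (R : realType).

Definition hseparable (V : preHilbertType R) (s : nat -> V) :=
  forall x e, 0 < e -> exists n, hn (s n - x) < e.

Lemma dense_seq (V : sepHilbertType R) : exists s : nat -> V, hseparable s.
Proof.
have [S [Sc Sd]] := separable_dense (s := V).
have /countable_injP[k kinj] := Sc.
exists (fun n => xget 0 [set x | S x /\ k x = n]) => x e e0.
have [||u [bu Su]] := Sd (ball x e%:C).
- by exists x; apply: ballxx; rewrite ltcR.
- exact: ball_open.
exists (k u); case: xgetP => [y _ [Sy kyu]|/(_ u)[]//].
have -> : y = u by apply: kinj; rewrite ?inE.
by move: bu; rewrite -ball_normE/= hnE ltcR hnC.
Qed.

Lemma dense_orth (V : preHilbertType R) (s : nat -> V) x : hseparable s ->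
  (forall n, inner (s n) x = 0) -> x = 0.
Proof.
move=> sd H; apply: hn_eq0_small => e /(sd x)[n sx]; apply: le_lt_trans sx.
rewrite hn_le_sqr ?hn_ge0// hn_sqr rdotBB H/= mulr0 subr0 lerDr; exact: rdot_ge0.
Qed.

Lemma dense_seq_cvg (V : preHilbertType R) (s : nat -> V) x : hseparable s ->
  exists k : nat -> nat, hcvg (s \o k) x.
Proof.
move=> sd; have /choice[k kP] n : exists m, hn (s m - x) < n.+1%:R^-1.
  by apply: sd; rewrite invr_gt0.
exists k => e /inv_nat_lt[N HN]; exists N => n /HN; apply: lt_trans; exact: kP.
Qed.

End Separability.

(** * Measurable fields of bounded operators *)

Section Fields.
Context d (T : measurableType d) (R : realType).
Variable mu : {measure set T -> \bar R}.
Implicit Types E F H : sepHilbertType R.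

(** The everywhere defined notion, stable under adjoints, compositions and limits with no null set
    to keep track of. *)
Definition mfield E F (C : R) (A : T -> E -> F) :=
  [/\ forall t, linear (A t), forall t, hbounded C (A t) & forall x, wmeas (A^~ x)].

(* An operator field known only almost everywhere, as boundary values are. *)
Definition cfield E F (C : R) (A : T -> E -> F) :=
  {ae mu, forall t, linear (A t) /\ hbounded C (A t)} /\
  forall x, exists2 g, wmeas g & {ae mu, forall t, A t x = g t}.

Lemma cmeasurable_conj (f : T -> R[i]) : cmeasurable f -> cmeasurable (fun t => Num.conj (f t)).
Proof.
move=> [fr fi]; split.
  by rewrite [X in measurable_fun _ X](_ : _ = (fun t => complex.Re (f t)))//; apply/funext => t; case: (f t).
rewrite [X in measurable_fun _ X](_ : _ = (fun t => - complex.Im (f t))).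
  exact: measurable_funN.
by apply/funext => t; case: (f t).
Qed.

Lemma mfield_adj E F C (A : T -> E -> F) : 0 <= C -> mfield C A ->
  mfield C (fun t => adjoint setT (A t)).
Proof.
move=> C0 [lA bA mA]; have aP t := adjP (@sepHilbert_complete R E) (lA t) (bA t).
split=> [t|t|x v]; first exact: adj_linear (aP t).
  exact: adj_bounded (aP t) (bA t).
under eq_fun do rewrite inner_conj -aP.
exact: (cmeasurable_conj (mA v x)).
Qed.

(** Moving the operator to the test vector leaves the inner product of [f t] with the adjoint field
    at [v], a pairing of two weakly measurable functions. *)
Lemma mfield_app E F C (A : T -> E -> F) f : 0 <= C -> mfield C A -> wmeas f ->
  wmeas (fun t => A t (f t)).
Proof.
move=> C0 mA mf v; have [lA bA _] := mA; have [_ _ mB] := mfield_adj C0 mA.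
under eq_fun do rewrite (adjP (@sepHilbert_complete R E) (lA _) (bA _)).
exact: (l2fun_measurable mf (mB v)).
Qed.

Lemma hbounded_comp E F H C C' (A : E -> F) (B : F -> H) : 0 <= C' -> hbounded C A ->
  hbounded C' B -> hbounded (C' * C) (B \o A).
Proof.
move=> C0 bA bB x; apply: le_trans (bB _) _.
by rewrite -mulrA ler_wpM2l.
Qed.

Lemma linear_comp E F H (A : E -> F) (B : F -> H) : linear A -> linear B -> linear (B \o A).
Proof. by move=> lA lB a x y /=; rewrite lA lB. Qed.

Lemma mfield_comp E F H C C' (A : T -> E -> F) (B : T -> F -> H) : 0 <= C' ->
  mfield C A -> mfield C' B -> mfield (C' * C) (fun t => B t \o A t).
Proof.
move=> C0 [lA bA mA] mB; have [lB bB _] := mB.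
split=> [t|t|x]; [exact: linear_comp|exact: hbounded_comp|].
exact: (mfield_app C0 mB (mA x)).
Qed.

Lemma mfield_cfield E F C (A B : T -> E -> F) : mfield C B ->
  {ae mu, forall t, A t = B t} -> cfield C A.
Proof.
move=> [lB bB mB] AB; split; first by apply: filterS AB => t ->.
by move=> x; exists (B^~ x) => //; apply: filterS AB => t ->.
Qed.

Lemma linear_cst0 E F : linear (fun _ : E => 0 : F).
Proof. by move=> a x y; rewrite scaler0 addr0. Qed.

(** The exceptional null set depends on the vector. Those of a dense sequence are collected into
    one, on which the field is replaced by 0; the other vectors are reached by continuity. *)
Lemma cfield_mfield E F C (A : T -> E -> F) : 0 <= C -> cfield C A ->
  exists2 B, mfield C B & {ae mu, forall t, A t = B t}.
Proof.
move=> C0 [lbA mA]; have [s sd] := dense_seq E.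
have /choice[g gP] n : exists g, wmeas g /\ {ae mu, forall t, A t (s n) = g t}.
  by have [g ? ?] := mA (s n); exists g.
have /ae_foralln ag : forall n, {ae mu, forall t, A t (s n) = g n t} by move=> n; case: (gP n).
have [N [mN aN NP]] := ae_measurable (ae_and lbA ag).
pose B t x := (\1_N t : R)%:C *: A t x.
have BN t : N t -> B t = A t.
  by move=> Nt; apply/funext => x; rewrite /B indicE mem_set// scale1r.
have BN0 t : ~ N t -> B t = fun=> 0.
  by move=> Nt; apply/funext => x; rewrite /B indicE memNset// scale0r.
exists B; last by apply: filterS aN => t /BN ->.
split=> [t|t|x].
- have [Nt|Nt] := pselect (N t); first by rewrite BN//; case: (NP _ Nt) => -[].
  by rewrite BN0//; exact: linear_cst0.
- have [Nt|Nt] := pselect (N t); first by rewrite BN//; case: (NP _ Nt) => -[].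
  by rewrite BN0// => x; rewrite hn0 mulr_ge0 ?hn_ge0.
have [k kx] := dense_seq_cvg x sd.
apply: (wmeas_lim (h := fun n t => (\1_N t : R)%:C *: g (k n) t)).
  by move=> n; apply: wmeas_restr => //; case: (gP (k n)).
move=> t; have [Nt|Nt] := pselect (N t); last first.
  by rewrite BN0// => e e0; exists 0%N => n _; rewrite indicE memNset// scale0r subrr hn0.
have [[lt bt] gt] := NP _ Nt.
rewrite BN// => e /(hbounded_cvg lt bt kx)[M HM]; exists M => n /HM /=.
by rewrite indicE mem_set// scale1r gt.
Qed.

Lemma mfield_lim E F C (A : nat -> T -> E -> F) (B : T -> E -> F) :
  (forall n, mfield C (A n)) -> (forall t x, hcvg (fun n => A n t x) (B t x)) -> mfield C B.
Proof.
move=> mA AB; split=> [t a x y|t x|x].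
- apply: hcvg_unique (AB t _) _ => e /(hcvgP a (AB t x) (AB t y))[N HN]; exists N => n /HN.
  by have [lA _ _] := mA n; rewrite lA.
- by apply: (hcvg_hn_le (AB t x)) => n; have [_ bA _] := mA n; exact: bA.
- by apply: wmeas_lim (fun t => AB t x) => n; have [_ _] := mA n; exact.
Qed.

Lemma l2fun_field E F C (A : T -> E -> F) (f : L2 mu E) : 0 <= C -> mfield C A ->
  l2fun mu (fun t => A t (f t)).
Proof.
move=> C0 mA; have [lA bA _] := mA.
apply: (l2fun_bound (G := fun t => C ^+ 2 * rdot (f t) (f t))).
- by apply: (mfield_app C0 mA); exact: l2fun_wmeas.
- by apply: integrable_scale; exact: L2_rdot_integrable.
- apply: aeW => t; rewrite -!hn_sqr -exprMn ler_pXn2r ?nnegrE ?mulr_ge0 ?hn_ge0//.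
  exact: bA.
Qed.

End Fields.

Section Multiplication.
Context (R : realType).
Local Notation mu := (circle_measure R).
Implicit Types E F H : sepHilbertType R.

Lemma mulop_ae E F C (A : R -> E -> F) : 0 <= C -> cfield mu C A ->
  forall f : L2T E, {ae mu, forall t, mulop A f t = A t (f t)}.
Proof.
move=> C0 /(cfield_mfield C0)[B mB AB] f.
have lB := l2fun_field f C0 mB.
have /aeE LB := L2ofK lB.
rewrite /mulop (L2of_ae (u := L2of mu (fun t => B t (f t)))).
  by apply: filterS2 AB LB => t -> ->.
by apply: filterS2 AB LB => t -> ->.
Qed.

Lemma mulop_linear E F C (A : R -> E -> F) : 0 <= C -> cfield mu C A -> linear (@mulop R E F A).
Proof.
move=> C0 cA a f g; apply/L2_eq/aeE; have hA := mulop_ae C0 cA; have [lb _] := cA.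
apply: filterS3 (hA (a *: f + g)) (hA f) (filterI (hA g) (filterI lb (filterI (L2P_ae a f g) (L2P_ae a (mulop A f) (mulop A g))))).
by move=> t -> Af [Ag [[lA _] [-> ->]]]; rewrite lA Af Ag.
Qed.

Lemma mulop_bounded E F C (A : R -> E -> F) : 0 <= C -> cfield mu C A -> hbounded C (@mulop R E F A).
Proof.
move=> C0 cA; suff H (f : L2T E) : hn (mulop A f) <= C * hn f by [].
rewrite hn_le_sqr ?mulr_ge0 ?hn_ge0// exprMn hn_sqr.
have -> : C ^+ 2 * rdot f f = \int[mu]_t (C ^+ 2 * rdot (f t) (f t)).
  by rewrite RintegralZl//; exact: L2_rdot_integrable.
apply: L2_rdot_le; first by apply: integrable_scale; exact: L2_rdot_integrable.
have [lb _] := cA; apply: filterS2 lb (mulop_ae C0 cA f) => t [_ bA] ->.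
by rewrite -!hn_sqr -exprMn ler_pXn2r ?nnegrE ?mulr_ge0 ?hn_ge0.
Qed.

End Multiplication.

(** * The Poisson integral on the circle *)

#[export] Instance circle_ae_filter (R : realType) :
  @Filter R (nbhs (almost_everywhere (circle_measure R))).
Proof. exact: (ae_filter_ringOfSetsType (circle_measure R)). Qed.

Section CircleMeasure.
Context (R : realType).
Local Notation mu := (circle_measure R).
Local Notation leb := (@lebesgue_measure R).

Lemma circle_measureE (A : set R) : mu A = leb (A `&` `[0, 1]%classic).
Proof. by []. Qed.

Lemma circle_itvC : mu (~` `[0, 1]%classic) = 0%E.
Proof. by rewrite circle_measureE setICl measure0. Qed.

Lemma circle_measure_le (A : set R) : measurable A -> (mu A <= leb A)%E.
Proof.
by move=> mA; apply: le_measure; rewrite ?inE//; exact: measurableI.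
Qed.

Lemma circle_measureT : mu setT = 1%E.
Proof.
rewrite circle_measureE setTI.
by rewrite lebesgue_measure_itv/= lte_fin ltr01 sube0.
Qed.

Lemma circle_ae_itv : {ae mu, forall t, 0 < t < 1}.
Proof.
exists (~` `]0, 1[%classic); split; first exact: measurableC.
  rewrite circle_measureE (_ : _ `&` _ = [set 0] `|` [set 1]).
    by apply: null_set_setU => //; exact: lebesgue_measure_set1.
  apply/seteqP; split => [x /= []|x /= [->|->]]; rewrite !in_itv/=.
  - move=> x01 /andP[x0 x1]; move/negP: x01; rewrite negb_and -!leNgt => /orP[x0'|x1'].
      by left; apply/eqP; rewrite eq_le x0' x0.
    by right; apply/eqP; rewrite eq_le x1' x1.
  - by rewrite ltxx lexx ler01.
  - by rewrite ltxx andbF lexx ler01.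
by move=> x /=; rewrite in_itv/=.
Qed.

Lemma circle_ae (P : R -> Prop) : {ae leb, forall t, P t} -> {ae mu, forall t, P t}.
Proof.
move=> [N [mN N0 PN]]; exists N; split => //; apply/eqP; rewrite eq_le measure_ge0 andbT.
by rewrite -N0 circle_measure_le.
Qed.

Lemma circle_aeS (P Q : R -> Prop) : (forall t, P t -> Q t) ->
  {ae mu, forall t, P t} -> {ae mu, forall t, Q t}.
Proof.
move=> PQ [N [mN N0 PN]]; exists N; split => // t /= nQ; apply: PN => /= Pt.
by apply: nQ; exact: PQ.
Qed.

Lemma circle_integrable_cst (c : R) : mu.-integrable setT (EFin \o fun=> c).
Proof.
apply/integrableP; split; first exact/measurable_EFinP.
rewrite /= integral_cst//= ?circle_measureT ?mule1 ?ltry//.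
Qed.

Lemma circle_integral (f : R -> \bar R) : mu.-integrable setT f ->
  (\int[mu]_t f t = \int[leb]_(t in `[0%R, 1%R]) f t)%E.
Proof.
move=> mf; rewrite (@negligible_integral _ (measurableTypeR R) R mu setT (~` `[0, 1]%classic) f)//; last 2 first.
- exact: measurableC.
- exact: circle_itvC.
rewrite setDE setTI setCK; apply: eq_measure_integral => A mA A01.
by rewrite circle_measureE setIidl.
Qed.

Lemma circle_integrable_bound (f : R -> R) (M : R) : measurable_fun setT f ->
  (forall t, `|f t| <= M) -> mu.-integrable setT (EFin \o f).
Proof.
move=> mf bf; apply: (le_integrable measurableT _ _ (circle_integrable_cst M)).
  exact/measurable_EFinP.
by move=> t _ /=; rewrite lee_fin (le_trans (bf t))// ler_norm.
Qed.

End CircleMeasure.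

Section Characters.
Context (R : realType).
Local Notation mu := (circle_measure R).
Local Notation leb := (@lebesgue_measure R).
Implicit Types (s t r : R) (m n : int).

Lemma circle_ptD s t : circle_pt (s + t) = circle_pt s * circle_pt t.
Proof.
rewrite /circle_pt mulrDr cosD sinD; apply/eqP; rewrite eq_complex/=.
by rewrite eqxx/= addrC.
Qed.

Lemma circle_pt0 : circle_pt (0 : R) = 1.
Proof. by rewrite /circle_pt mulr0 cos0 sin0. Qed.

Lemma circle_ptN s : circle_pt (- s) = Num.conj (circle_pt s).
Proof. by rewrite /circle_pt mulrN cosN sinN. Qed.

Lemma cmod_circle_pt s : cmod (circle_pt s) = 1.
Proof. by rewrite /cmod normc_def/= cos2Dsin2 sqrtr1. Qed.

(** The character zeta^n. The integer multiplies the parameter of the circle, so negative exponents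
    are treated like the others. *)
Definition chi n s : R[i] := circle_pt (n%:~R * s).

Lemma chiD m n s : chi (m + n) s = chi m s * chi n s.
Proof. by rewrite /chi intrD mulrDl circle_ptD. Qed.

Lemma chi0 s : chi 0 s = 1. Proof. by rewrite /chi mul0r circle_pt0. Qed.

Lemma chiN n s : chi (- n) s = Num.conj (chi n s).
Proof. by rewrite /chi intrN mulNr circle_ptN. Qed.

Lemma chi1 s : chi 1 s = circle_pt s. Proof. by rewrite /chi mul1r. Qed.

Lemma chi_nat (n : nat) s : chi n s = circle_pt s ^+ n.
Proof.
elim: n => [|n IH]; first by rewrite chi0 expr0.
by rewrite -addn1 PoszD chiD IH chi1 exprD expr1.
Qed.

Lemma cmod_chi n s : cmod (chi n s) = 1. Proof. exact: cmod_circle_pt. Qed.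

Lemma chiVK n s : chi n s * chi (- n) s = 1. Proof. by rewrite -chiD subrr chi0. Qed.

Lemma continuous_scale_trig (a : R) (f : R -> R) : continuous f -> continuous (fun s => f (a * s)).
Proof.
move=> cf s; apply: (@continuous_comp _ _ _ ( *%R a) f); last exact: cf.
exact: mulrl_continuous.
Qed.

Lemma chi_measurable n : @cmeasurable _ (measurableTypeR R) R (chi n).
Proof.
split.
  apply: continuous_measurable_fun => s; rewrite /chi/=.
  under eq_fun do rewrite mulrA.
  by apply: continuous_scale_trig; exact: continuous_cos.
apply: continuous_measurable_fun => s; rewrite /chi/=.
under eq_fun do rewrite mulrA.
by apply: continuous_scale_trig; exact: continuous_sin.
Qed.

Lemma integral_trig (a : R) (f F : R -> R) : a != 0 -> continuous f ->
  (forall x : R, is_derive x 1 F (f x)) ->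
  (\int[leb]_(t in `[0%R, 1%R]) (f (a * t))%:E = (a^-1 * (F a - F 0))%:E)%E.
Proof.
move=> a0 cf dF.
have dG (x : R) : is_derive x 1 (fun t => a^-1 * F (a * t)) (f (a * x)).
  have h1 : is_derive x 1 ( *%R a) a.
    have -> : ( *%R a) = (a *: (@id R)) by apply/funext => y.
    rewrite -[X in is_derive _ _ _ X]mulr1; exact: is_deriveZ.
  have := is_deriveZ a^-1 (is_derive1_comp (dF (a * x)) h1).
  by rewrite /GRing.scale/= mulrCA mulVf// mulr1.
have cG : continuous (fun t => a^-1 * F (a * t)).
  by move=> x; apply: differentiable_continuous; apply/derivable1_diffP; case: (dG x).
rewrite (continuous_FTC2 (F := fun t => a^-1 * F (a * t))) ?ltr01//.
- by rewrite mulr1 mulr0 -EFinB -mulrBr.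
- by apply: continuous_subspaceT; exact: continuous_scale_trig.
- split=> [x _||]; first by case: (dG x).
    by apply: cvg_at_right_filter; exact: cG.
  by apply: cvg_at_left_filter; exact: cG.
- by move=> x _; rewrite derive1E; case: (dG x).
Qed.

Lemma cos_int n : cos (2 * pi * n%:~R) = 1 :> R.
Proof.
have H (k : nat) : cos (2 * pi * k%:R) = 1 :> R.
  rewrite [X in cos X](_ : _ = 0 + pi *+ 2 *+ k); last by rewrite add0r mulr_natl mulr_natr.
  by rewrite (periodicn (@cosD2pi R)) cos0.
case: n => k; first exact: H.
by rewrite NegzE intrN mulrN cosN; exact: H.
Qed.

Lemma sin_int n : sin (2 * pi * n%:~R) = 0 :> R.
Proof.
have := cos2Dsin2 (2 * pi * n%:~R : R); rewrite cos_int expr1n => /eqP.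
by rewrite -subr_eq0 addrAC subrr add0r sqrf_eq0 => /eqP.
Qed.

Lemma circle_Rintegral (f : R -> R) (M : R) : measurable_fun setT f -> (forall t, `|f t| <= M) ->
  \int[mu]_t f t = fine (\int[leb]_(t in `[0%R, 1%R]) (f t)%:E).
Proof.
move=> mf bf; rewrite /Rintegral circle_integral//.
exact: circle_integrable_bound bf.
Qed.

Lemma cintegral_chi n : cintegral mu (chi n) = (n == 0)%:R.
Proof.
have [->|n0] := eqVneq n 0.
  rewrite /cintegral (_ : (fun t => complex.Re (chi 0 t)) = cst 1); last first.
    by apply/funext => t; rewrite chi0.
  rewrite (_ : (fun t => complex.Im (chi 0 t)) = cst 0); last first.
    by apply/funext => t; rewrite chi0.
  by rewrite !Rintegral_cst//= circle_measureT/= !mul1r !mul0r.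
have a0 : 2 * pi * n%:~R != 0 :> R.
  by rewrite !mulf_neq0// ?intr_eq0// gt_eqF// pi_gt0.
have [mr mi] := chi_measurable n; apply/eqP; rewrite eq_complex/=; apply/andP; split; apply/eqP.
- have bR t : `|complex.Re (chi n t)| <= 1 by rewrite (le_trans (Re_le_cmod _))// cmod_chi.
  rewrite (circle_Rintegral mr bR).
  rewrite /chi/=; under eq_integral do rewrite mulrA.
  by rewrite (integral_trig (F := sin))// ?sin_int ?sin0 ?subrr ?mulr0//; exact: continuous_cos.
- have bI t : `|complex.Im (chi n t)| <= 1 by rewrite (le_trans (Im_le_cmod _))// cmod_chi.
  rewrite (circle_Rintegral mi bI).
  rewrite /chi/=; under eq_integral do rewrite mulrA.
  have dF (x : R) : is_derive x 1 (fun x => - cos x) (sin x).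
    by rewrite -[sin x]opprK; exact: is_deriveN.
  rewrite (integral_trig (F := fun x => - cos x))//; last exact: continuous_sin.
  by rewrite cos_int cos0 subrr mulr0.
Qed.

End Characters.

Section PoissonKernel.
Context (R : realType).
Local Notation mu := (circle_measure R).
Implicit Types (s t r : R).

Definition pois_q r t s : R[i] := r%:C * circle_pt (t - s).

(** The Poisson kernel as the real part of (1 + q) / (1 - q), written as 2 Re (1 / (1 - q)) - 1;
    this form expands at once into the geometric series in q and its conjugate. *)
Definition poisson r t s : R := 2 * complex.Re (1 - pois_q r t s)^-1 - 1.

Definition pois_sum N r t s : R[i] :=
  \sum_(n < N) pois_q r t s ^+ n + \sum_(n < N) Num.conj (pois_q r t s) ^+ n.+1.

Lemma cmod_pois_q r t s : 0 <= r -> cmod (pois_q r t s) = r.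
Proof. by move=> r0; rewrite /pois_q cmodM cmod_circle_pt mulr1 cmod_real ger0_norm. Qed.

Lemma pois_q_sqr r t s : complex.Re (pois_q r t s) ^+ 2 + complex.Im (pois_q r t s) ^+ 2 = r ^+ 2.
Proof.
rewrite /pois_q/= !mul0r subr0 addr0 !exprMn -mulrDr cos2Dsin2 mulr1//.
Qed.

Lemma pois_q_neq1 r t s : 0 <= r < 1 -> 1 - pois_q r t s != 0.
Proof.
move=> /andP[r0 r1]; rewrite subr_eq0; apply: contraTneq r1 => q1.
by rewrite -(cmod_pois_q t s r0) -q1 cmod1 ltxx.
Qed.

Lemma cmodV (z : R[i]) : cmod z^-1 = (cmod z)^-1.
Proof. by rewrite /cmod normfV cmodE -fmorphV/=. Qed.

Lemma cmod_pois_inv r t s : 0 <= r < 1 -> cmod (1 - pois_q r t s)^-1 <= (1 - r)^-1.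
Proof.
move=> /andP[r0 r1]; rewrite cmodV lef_pV2 ?posrE ?subr_gt0//.
  have := cmodD (1 - pois_q r t s) (pois_q r t s); rewrite subrK cmod1 cmod_pois_q//; lra.
rewrite lt_def cmod_ge0 andbT; apply/eqP => /cmod_eq0 /eqP.
by apply/negP; rewrite pois_q_neq1// r0.
Qed.

Lemma poissonE r t s : 0 <= r < 1 ->
  poisson r t s = (1 - r ^+ 2) / ((1 - r) ^+ 2 + 4 * r * sin (pi * (t - s)) ^+ 2).
Proof.
move=> r01; have := pois_q_neq1 t s r01; rewrite /poisson.
have := pois_q_sqr r t s.
have : complex.Re (pois_q r t s) = r * (1 - 2 * sin (pi * (t - s)) ^+ 2).
  rewrite /pois_q/= mul0r subr0; congr (_ * _).
  have -> : 2 * pi * (t - s) = pi * (t - s) *+ 2 by rewrite -mulrA mulr_natl.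
  by rewrite cos_mulr2n cos2sin2; move: (_ ^+ 2) => x; lra.
case: (pois_q r t s) => a b /= aE ab q1.
have d0 : (1 - a) ^+ 2 + b ^+ 2 != 0.
  apply: contraNneq q1 => H.
  have /eqP := H; rewrite paddr_eq0 ?sqr_ge0// !sqrf_eq0 => /andP[/eqP a1 /eqP b0].
  by rewrite eq_complex/= a1 b0 subr0 !eqxx.
have dE : (1 - a) ^+ 2 + b ^+ 2 = (1 - r) ^+ 2 + 4 * r * sin (pi * (t - s)) ^+ 2.
  have -> : b ^+ 2 = r ^+ 2 - a ^+ 2 by rewrite -ab addrC addKr.
  by rewrite aE; ring.
by rewrite -dE sub0r sqrrN -ab; field.
Qed.

Lemma pois_den_gt0 r t s : 0 <= r < 1 -> 0 < (1 - r) ^+ 2 + 4 * r * sin (pi * (t - s)) ^+ 2.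
Proof.
move=> /andP[r0 r1]; have := sqr_ge0 (sin (pi * (t - s))); move: (sin _ ^+ 2) => x x0.
by rewrite ltr_wpDr ?exprn_gt0 ?subr_gt0// !mulr_ge0.
Qed.

Lemma poisson_ge0 r t s : 0 <= r < 1 -> 0 <= poisson r t s.
Proof.
move=> r01; rewrite poissonE// divr_ge0 ?(ltW (pois_den_gt0 _ _ _))//.
by move/andP: r01 => [r0 r1]; rewrite subr_ge0 exprn_ile1// ltW.
Qed.

Lemma poisson_le r t s : 0 <= r < 1 -> poisson r t s <= 2 / (1 - r).
Proof.
move=> r01; rewrite poissonE// ler_pdivrMr ?pois_den_gt0//.
have := sqr_ge0 (sin (pi * (t - s))); move: (sin _ ^+ 2) => x x0.
have /andP[r0 r1] := r01; have e0 : 0 < 1 - r by rewrite subr_gt0.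
have -> : 2 / (1 - r) * ((1 - r) ^+ 2 + 4 * r * x) =
   2 * (1 - r) + 8 * r * x / (1 - r) by field; rewrite gt_eqF.
apply: (@le_trans _ _ (2 * (1 - r))); first by nra.
by rewrite lerDl !mulr_ge0// invr_ge0 ltW.
Qed.

(** For [r] at least 1/2 one has [1 + r <= 4 r], so the factor [1 + r] of the numerator is absorbed
    by the sine term of the denominator. *)
Lemma poisson_far r t s (x : R) : 2^-1 <= r < 1 -> 0 < x -> x <= sin (pi * (t - s)) ^+ 2 ->
  poisson r t s <= (1 - r) / x.
Proof.
move=> /andP[r2 r1] x0 sx; have r0 : 0 <= r by apply: le_trans r2; rewrite invr_ge0.
have r01 : 0 <= r < 1 by rewrite r0.
rewrite poissonE// ler_pdivrMr ?pois_den_gt0// mulrAC ler_pdivlMr//.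
have e0 : 0 < 1 - r by rewrite subr_gt0.
have -> : 1 - r ^+ 2 = (1 - r) * (1 + r) by ring.
rewrite -[_ * _ * x]mulrA ler_pM2l//.
apply: (@le_trans _ _ (4 * r * x)); first by nra.
by rewrite ler_wpDl ?sqr_ge0// ler_wpM2l// mulr_ge0.
Qed.

Lemma poisson_sum N r t s : 0 <= r < 1 ->
  cmod ((poisson r t s)%:C - pois_sum N r t s) <= 2 * r ^+ N / (1 - r).
Proof.
move=> r01; have /andP[r0 r1] := r01; have q1 := pois_q_neq1 t s r01.
have qi := cmod_pois_inv t s r01; have cq := cmod_pois_q t s r0.
rewrite /poisson /pois_sum; move: (pois_q r t s) q1 qi cq => q q1 qi cq.
have PE : (2 * complex.Re (1 - q)^-1 - 1)%:C = (1 - q)^-1 + Num.conj (1 - q)^-1 - 1.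
  case: ((1 - q)^-1) => a b; apply/eqP; rewrite eq_complex/=; apply/andP; split; apply/eqP; ring.
have geo (z : R[i]) : 1 - z != 0 -> \sum_(n < N) z ^+ n = (1 - z)^-1 - z ^+ N * (1 - z)^-1.
  move=> z1; apply: (mulfI z1); rewrite mulrBr mulfV// mulrCA mulfV// mulr1.
  rewrite -[in RHS](expr1n _ N) subrXX; congr (_ * _).
  by apply: eq_bigr => i _; rewrite expr1n mul1r.
have cq1 : 1 - Num.conj q != 0.
  by rewrite -[1]conjC1 -rmorphB conjC_eq0.
have qi' : cmod (1 - Num.conj q)^-1 <= (1 - r)^-1.
  by rewrite -[1]conjC1 -rmorphB -fmorphV cmod_conj.
have -> : \sum_(n < N) Num.conj q ^+ n.+1 = Num.conj q * \sum_(n < N) Num.conj q ^+ n.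
  by rewrite mulr_sumr; apply: eq_bigr => i _; rewrite exprS.
have cinv : Num.conj (1 - q)^-1 = (1 - Num.conj q)^-1.
  by rewrite fmorphV/= rmorphB/= conjC1.
rewrite PE !geo// cinv.
(* The -1 removes the constant term, counted in both series; each tail has modulus at most
   [r ^+ N / (1 - r)]. *)
have -> : (1 - q)^-1 + (1 - Num.conj q)^-1 - 1 - ((1 - q)^-1 - q ^+ N / (1 - q) +
    Num.conj q * ((1 - Num.conj q)^-1 - Num.conj q ^+ N / (1 - Num.conj q))) =
    q ^+ N / (1 - q) + Num.conj q ^+ N.+1 / (1 - Num.conj q).
  by rewrite exprS; field; rewrite q1 cq1.
apply: le_trans (cmodD _ _) _; rewrite !cmodM !cmodX cmod_conj cq.
have rN : r ^+ N.+1 <= r ^+ N by rewrite exprS ler_piMl ?exprn_ge0// ltW.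
rewrite -mulrA [2 * _]mulrDl !mul1r lerD// ler_pM ?cmod_ge0 ?exprn_ge0//.
Qed.

End PoissonKernel.

Section SineLowerBound.
Context (R : realType).

(** The sine vanishes again at [|x| = 1]. For fixed [t] in ]0, 1[ and [s] in ]0, 1[ the difference
    [t - s] keeps the distance min (t, 1 - t) from 1 and -1, so with this [d] the wrap-around of the
    circle never has to be treated. *)
Lemma sin_lower (d : R) : 0 < d -> exists2 c, 0 < c & forall x, `|x| <= 1 - d -> c * x ^+ 2 <= sin (pi * x) ^+ 2.
Proof.
move=> d0; have pi0 := pi_gt0 R; have pi2 := pi_ge2 R.
have [d1|d1] := leP 1 d.
  exists 1 => // x; rewrite lerBrDr => xd.
  suff -> : x = 0 by rewrite mulr0 sin0 expr0n mulr0.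
  apply/eqP; rewrite -normr_eq0; apply/eqP; have := normr_ge0 x; lra.
have c4 : 0 < cos (pi / 4 : R) by apply: cos_gt0_pihalf; apply/andP; split; lra.
have s4 : 0 < sin (pi / 4 : R) by apply: sin_gt0_pi; apply/andP; split; lra.
have sd : 0 < sin (pi * (d / 2)) by apply: sin_gt0_pi; apply/andP; split; nra.
(* The three bounds serve the ranges [0, 1/4] (mean value theorem, with the cosine above cos (pi /
   4)), [1/4, 1/2] and [1/2, 1 - d]; on the last two [x <= 1] and the sine itself is bounded
   below. *)
pose m := Num.min (cos (pi / 4)) (Num.min (sin (pi / 4)) (sin (pi * (d / 2)))).
have m0 : 0 < m by rewrite !lt_min c4 s4.
have [m1 [m2 m3]] : m <= cos (pi / 4) /\ m <= sin (pi / 4) /\ m <= sin (pi * (d / 2)).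
  by rewrite /m !ge_min !lexx !orbT.
exists (m ^+ 2); first by rewrite exprn_gt0.
have key x : 0 <= x -> x <= 1 - d -> m * x <= sin (pi * x).
  move=> x0 xd; have [x4|x4] := leP x (1 / 4).
    have [->|xn0] := eqVneq x 0; first by rewrite !mulr0 sin0.
    have x0' : 0 < x by rewrite lt_def xn0.
    have [||c] := @MVT R sin cos 0 (pi * x).
    - by rewrite mulr_gt0.
    - by apply: continuous_subspaceT; exact: continuous_sin.
    rewrite in_itv/= sin0 subr0 => /andP[c0 cx] ->.
    have : cos (pi / 4) < cos c.
      rewrite ltr_cos ?in_itv/=; [nra| |]; apply/andP; split; nra.
    move=> /ltW cc.
    have k1 : m * x <= cos c * x by rewrite ler_wpM2r// (le_trans m1).
    have k2 : cos c * x <= cos c * (pi * x).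
      by rewrite ler_wpM2l ?(le_trans (ltW c4))//; nra.
    by rewrite subr0; exact: le_trans k1 k2.
  have [x2|x2] := leP x (1 / 2).
    have : sin (pi / 4) < sin (pi * x).
      rewrite ltr_sin ?in_itv/=; [nra| |]; apply/andP; split; nra.
    nra.
  have : sin (pi * (d / 2)) < sin (pi - pi * x).
    rewrite ltr_sin ?in_itv/=; [nra| |]; apply/andP; split; nra.
  rewrite sinB sinpi cospi mul0r sub0r mulN1r opprK; nra.
move=> x xd; rewrite -exprMn.
have -> : sin (pi * x) ^+ 2 = sin (pi * `|x|) ^+ 2.
  by case: (ger0P x) => // _; rewrite mulrN sinN sqrrN.
rewrite exprMn -(real_normK (num_real x)) -exprMn.
by rewrite ler_pXn2r ?nnegrE ?(le_trans _ (key _ _ _))// ?mulr_ge0// ?(ltW m0)// key.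
Qed.

End SineLowerBound.

(** * Fatou's theorem for scalar Poisson integrals *)

Section Fatou.
Context (R : realType).
Local Notation mu := (circle_measure R).
Local Notation leb := (@lebesgue_measure R).
Implicit Types (s t r : R) (u : R -> R).

(** The constant [2 + 4 / c] covers two bounds: [2 / (1 - r)], valid everywhere and used on the
    innermost ball, and [(4 / c) / (4 ^+ k.+1 * (1 - r))], valid at distance at least
    [2 ^+ k * (1 - r)]. *)
Lemma poisson_shells r t s (c : R) : 2^-1 <= r < 1 -> 0 < c ->
  c * (t - s) ^+ 2 <= sin (pi * (t - s)) ^+ 2 ->
  forall K, `|t - s| < 2 ^+ K * (1 - r) ->
  poisson r t s <= \sum_(k < K.+1) (2 + 4 / c) / (4 ^+ k * (1 - r)) * \1_(ball t (2 ^+ k * (1 - r))) s.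
Proof.
move=> /andP[r2 r1] c0 sx.
have r0 : 0 <= r by apply: le_trans r2; rewrite invr_ge0.
have r01 : 0 <= r < 1 by rewrite r0.
have e0 : 0 < 1 - r by rewrite subr_gt0.
have B0 : 0 <= 2 + 4 / c by rewrite addr_ge0// divr_ge0// ltW.
have ind k : `|t - s| < 2 ^+ k * (1 - r) -> \1_(ball t (2 ^+ k * (1 - r))) s = 1 :> R.
  by move=> ts; rewrite indicE mem_set//= -ball_normE.
elim=> [|K IH] ts.
  rewrite big_ord_recl big_ord0 addr0 ind// expr0 mul1r mulr1.
  apply: le_trans (poisson_le t s r01) _.
  by rewrite ler_pM2r ?invr_gt0// lerDl divr_ge0// ltW.
rewrite big_ord_recr/= ind// mulr1.
have [tsK|tsK] := ltP (`|t - s|) (2 ^+ K * (1 - r)).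
  apply: le_trans (IH tsK) _; rewrite lerDl divr_ge0// mulr_ge0 ?exprn_ge0// ltW//.
rewrite ler_wpDl//.
  by apply: sumr_ge0 => k _; rewrite mulr_ge0// divr_ge0// mulr_ge0 ?exprn_ge0// ltW.
have d0 : 0 < 2 ^+ K * (1 - r) by rewrite mulr_gt0// exprn_gt0.
have ts2 : (2 ^+ K * (1 - r)) ^+ 2 <= (t - s) ^+ 2.
  by rewrite -(real_normK (num_real (t - s))) ler_pXn2r ?nnegrE ?(ltW d0).
have x0 : 0 < c * (2 ^+ K * (1 - r)) ^+ 2 by rewrite mulr_gt0// exprn_gt0.
have xs : c * (2 ^+ K * (1 - r)) ^+ 2 <= sin (pi * (t - s)) ^+ 2.
  by apply: le_trans sx; rewrite ler_wpM2l// ltW.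
have rr : 2^-1 <= r < 1 by rewrite r2.
apply: le_trans (poisson_far rr x0 xs) _.
have E4 : 4 ^+ K = (2 ^+ K) ^+ 2 :> R by rewrite exprAC; congr (_ ^+ _); rewrite expr2 -natrM.
have -> : (1 - r) / (c * (2 ^+ K * (1 - r)) ^+ 2) = (4 / c) / (4 ^+ K.+1 * (1 - r)).
  rewrite [4 ^+ K.+1]exprS E4; have : 2 ^+ K != 0 :> R by rewrite expf_neq0// pnatr_eq0.
  by move=> K0; field; rewrite K0 !gt_eqF.
by rewrite ler_pM2r ?invr_gt0 ?mulr_gt0 ?exprn_gt0// lerDr.
Qed.

Lemma dyadic_scale (e d : R) : 0 < e -> e < d -> exists K, 2 ^+ K * e < d <= 2 ^+ K.+1 * e.
Proof.
move=> e0 ed.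
have ex : exists n, d <= 2 ^+ n.+1 * e.
  have [|N HN] := pow2_small (e := e / d); first by rewrite divr_gt0// (lt_trans e0).
  exists N; have := HN N.+1 (leqnSn N); have d0 := lt_trans e0 ed.
  by rewrite exprVn ltr_pdivlMr// ltr_pdivrMl ?exprn_gt0// => /ltW.
case: (ex_minnP ex) => K KP Kmin; exists K; rewrite KP andbT.
case: K KP Kmin => [|K] KP Kmin; first by rewrite expr0 mul1r.
by rewrite ltNge; apply/negP => /Kmin; rewrite ltnn.
Qed.

Lemma poisson_measurable r t : 0 <= r < 1 -> measurable_fun setT (poisson r t : measurableTypeR R -> R).
Proof.
move=> r01.
have -> : poisson r t = (fun s => (1 - r ^+ 2) * ((1 - r) ^+ 2 + 4 * r * sin (pi * (t - s)) ^+ 2)^-1).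
  by apply/funext => s; exact: poissonE.
apply: measurable_funM => //.
apply: continuous_measurable_fun => s.
apply: cvgV; first by rewrite gt_eqF// pois_den_gt0.
apply: cvgD; first exact: cvg_cst.
apply: cvgM; first exact: cvg_cst.
apply: (@cvg_comp _ _ _ (fun s => sin (pi * (t - s))) (fun x => x ^+ 2) _ (nbhs (sin (pi * (t - s))))); last exact: exprn_continuous.
apply: (@cvg_comp _ _ _ (fun s => pi * (t - s)) sin _ (nbhs (pi * (t - s)))); last exact: continuous_sin.
apply: cvgM; first exact: cvg_cst.
by apply: cvgB => //; exact: cvg_cst.
Qed.

(** The [k]-th ball has weight [(2 + 4 / c) / (4 ^+ k * (1 - r))] and mass at most
    [eta * 2 ^+ k * (1 - r)], so the contributions form a geometric series in 1/2. At distance at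
    least [d / 2] the kernel is bounded by the constant of the second term. *)
Lemma poisson_shell_integral u t (c eta d r : R) : measurable_fun setT (u : measurableTypeR R -> R) ->
  (forall s, 0 <= u s) -> 0 < t < 1 -> 0 < c -> 0 < eta -> 0 < d ->
  (forall x, `|x| <= 1 - Num.min t (1 - t) -> c * x ^+ 2 <= sin (pi * x) ^+ 2) ->
  (forall rho, 0 < rho < d -> (\int[mu]_s (\1_(ball t rho) s * u s)%:E <= (eta * rho)%:E)%E) ->
  2^-1 <= r < 1 -> 1 - r < d ->
  (\int[mu]_s (poisson r t s * u s)%:E <= (2 * (2 + 4 / c) * eta)%:E +
    (4 * (1 - r) / (c * d ^+ 2))%:E * \int[mu]_s (u s)%:E)%E.
Proof.
move=> mu_ u0 t01 c0 eta0 d0 cP H r12 rd; have /andP[r2 r1] := r12.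
have r0 : 0 <= r by apply: le_trans r2; rewrite invr_ge0.
have r01 : 0 <= r < 1 by rewrite r0.
have e0 : 0 < 1 - r by rewrite subr_gt0.
have [K /andP[Kd dK]] := dyadic_scale e0 rd.
pose a k := (2 + 4 / c) / (4 ^+ k * (1 - r)).
have a0 k : 0 <= a k by rewrite divr_ge0 ?addr_ge0 ?divr_ge0 ?mulr_ge0 ?exprn_ge0// ltW.
pose b := 4 * (1 - r) / (c * d ^+ 2).
have b0 : 0 <= b by rewrite !mulr_ge0// ?invr_ge0 ?mulr_ge0 ?exprn_ge0// ltW.
pose h k s := (\1_(ball t (2 ^+ k * (1 - r))) s * u s)%:E.
have h0 k s : (0 <= h k s)%E by rewrite lee_fin mulr_ge0.
have mh k : measurable_fun setT (h k : measurableTypeR R -> _).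
  apply/measurable_EFinP; apply: measurable_funM => //; apply: measurable_indic.
  exact: measurable_ball.
have muE : measurable_fun setT (fun s : measurableTypeR R => (u s)%:E) by exact/measurable_EFinP.
apply: (@le_trans _ _ (\int[mu]_s ((\sum_(k < K.+1) ((a k)%:E * h k s)) + b%:E * (u s)%:E)%E)%E).
  apply: ae_ge0_le_integral => //.
  - by move=> s _; rewrite lee_fin mulr_ge0// poisson_ge0.
  - by apply/measurable_EFinP; apply: measurable_funM => //; exact: poisson_measurable.
  - by move=> s _; apply: adde_ge0; [apply: sume_ge0 => k _|]; rewrite mule_ge0// lee_fin.
  - apply: emeasurable_funD; last exact: measurable_funeM.
    by apply: emeasurable_sum => k; exact: measurable_funeM.
  apply: circle_aeS (circle_ae_itv R) => s s01 _.
  have ts : `|t - s| <= 1 - Num.min t (1 - t).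
    rewrite ler_norml lerBrDl; move/andP: s01 => [s0 s1]; move/andP: t01 => [t0 t1].
    by case: (leP t (1 - t)) => h1; apply/andP; split; lra.
  have cs := cP _ ts.
  have -> : (\sum_(k < K.+1) ((a k)%:E * h k s) + b%:E * (u s)%:E)%E =
     ((\sum_(k < K.+1) a k * \1_(ball t (2 ^+ k * (1 - r))) s + b) * u s)%:E.
    rewrite mulrDl EFinD EFinM mulr_suml -sumEFin; congr (_ + _)%E.
    by apply: eq_bigr => k _; rewrite /h -EFinM mulrA.
  rewrite lee_fin ler_wpM2r//.
  have [tsK|tsK] := ltP (`|t - s|) (2 ^+ K * (1 - r)).
    by apply: le_trans (poisson_shells r12 c0 cs tsK) _; rewrite lerDl.
  rewrite ler_wpDl//.
    by apply: sumr_ge0 => k _; rewrite mulr_ge0.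
  have d2 : d / 2 <= `|t - s|.
    by apply: le_trans tsK; rewrite ler_pdivrMr// mulrAC -exprSr.
  have x0 : 0 < c * (d / 2) ^+ 2 by rewrite mulr_gt0// exprn_gt0// divr_gt0.
  have := @poisson_far R r t s _ r12 x0; rewrite /b.
  have -> : (1 - r) / (c * (d / 2) ^+ 2) = 4 * (1 - r) / (c * d ^+ 2).
    by field; rewrite !gt_eqF.
  apply; apply: le_trans cs; rewrite ler_wpM2l ?(ltW c0)//.
  by rewrite -(real_normK (num_real (t - s))) ler_pXn2r ?nnegrE ?divr_ge0 ?(ltW d0).
rewrite ge0_integralD//; last 4 first.
- by move=> s _; apply: sume_ge0 => k _; rewrite mule_ge0// lee_fin.
- by apply: emeasurable_sum => k; exact: measurable_funeM.
- by move=> s _; rewrite mule_ge0// lee_fin.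
- exact: measurable_funeM.
rewrite ge0_integralZl//; last by move=> s _; rewrite lee_fin.
apply: leeD => //.
rewrite ge0_integral_sum//; last 2 first.
- by move=> k; exact: measurable_funeM.
- by move=> k s _; rewrite mule_ge0// lee_fin.
apply: (@le_trans _ _ (\sum_(k < K.+1) ((2 + 4 / c) * eta * 2^-1 ^+ k)%:E)%E).
  apply: lee_sum => k _; rewrite ge0_integralZl//; last by rewrite lee_fin.
  have kK : 0 < 2 ^+ k * (1 - r) < d.
    rewrite mulr_gt0 ?exprn_gt0//=; apply: le_lt_trans Kd.
    by rewrite ler_pM2r// ler_weXn2l// ?ler1n// -ltnS.
  apply: le_trans (lee_wpmul2l _ (H _ kK)) _; first by rewrite lee_fin.
  rewrite -EFinM lee_fin /a le_eqVlt; apply/orP; left; apply/eqP.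
  have E4 : 4 ^+ k = (2 ^+ k) ^+ 2 :> R by rewrite exprAC; congr (_ ^+ _); rewrite expr2 -natrM.
  rewrite E4 exprVn; have : 2 ^+ k != 0 :> R by rewrite expf_neq0// pnatr_eq0.
  by move=> k0; field; rewrite k0 !gt_eqF.
rewrite sumEFin lee_fin -mulr_sumr.
have -> : \sum_(k < K.+1) (2^-1 ^+ k : R) = 2 - 2 * 2^-1 ^+ K.+1.
  elim: K.+1 => [|n IH]; first by rewrite big_ord0 expr0; lra.
  by rewrite big_ord_recr/= IH exprS; move: (_ ^+ n) => y; lra.
have p0 : 0 <= (2 + 4 / c) * eta by rewrite mulr_ge0 ?addr_ge0 ?divr_ge0// ltW.
by rewrite -[2 * _ * eta]mulrA [2 * ((_ + _) * _)]mulrC ler_wpM2l// gerBl mulr_ge0.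
Qed.

Lemma poisson_integrable_mul u r t : 0 <= r < 1 -> mu.-integrable setT (EFin \o u) ->
  mu.-integrable setT (EFin \o (fun s => poisson r t s * u s)).
Proof.
move=> r01 iu; have mp := poisson_measurable t r01.
have mu_ : measurable_fun setT (u : measurableTypeR R -> R) by apply/measurable_EFinP; case/integrableP: iu.
have iv := integrable_scale (2 / (1 - r)) (integrable_norm iu).
apply: (le_integrable measurableT _ _ iv).
  by apply/measurable_EFinP; apply: measurable_funM.
move=> s _ /=; rewrite lee_fin normrM [leRHS]normrM normr_id ler_wpM2r//.
by rewrite ger0_norm ?poisson_ge0// (le_trans (poisson_le t s r01))// ler_norm.
Qed.

Lemma lebesgue_pt_circle u t : mu.-integrable setT (EFin \o u) -> 0 < t < 1 ->
  lebesgue_pt (u \_ `[0, 1]%classic) t ->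
  forall eta, 0 < eta -> exists2 d, 0 < d &
   forall rho, 0 < rho < d -> (\int[mu]_s (\1_(ball t rho) s * `|u s - u t|)%:E <= (eta * rho)%:E)%E.
Proof.
move=> iu t01 pt eta eta0.
(* The average over a ball divides by its length [2 * rho], whence the factor 1/2. *)
have e2 : 0 < eta / 2 by rewrite divr_gt0.
have mu_ : measurable_fun setT (u : measurableTypeR R -> R) by apply/measurable_EFinP; case/integrableP: iu.
have t01' : t \in (`[0, 1]%classic : set R) by rewrite inE/= in_itv/=; move/andP: t01 => [t0 t1]; rewrite !ltW.
pose f := u \_ `[0, 1]%classic.
have mf : measurable_fun setT (f : measurableTypeR R -> R).
  by apply/(measurable_restrictT _ _).1 => //; exact: measurable_funTS.
have ft : f t = u t by rewrite /f patchE t01'.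
move/fine_cvgP : (pt) => [[d1 /= d10 H1] /cvgrPdist_lt /(_ _ e2) [d2 /= d20 H2]].
exists (Num.min d1 d2); first by rewrite lt_min d10.
move=> rho /andP[rho0]; rewrite lt_min => /andP[rd1 rd2].
have fn : davg f t rho \is a fin_num.
  by apply: H1 => //=; rewrite sub0r normrN gtr0_norm.
have := H2 rho; rewrite /= sub0r normrN gtr0_norm// => /(_ rd2 rho0).
rewrite sub0r normrN ger0_norm ?fine_ge0 ?davg_ge0// -lte_fin fineK//.
rewrite /davg /iavg (lebesgue_measure_ball _ (ltW rho0)).
have iv : mu.-integrable setT (EFin \o (fun s => \1_(ball t rho) s * `|u s - u t|)).
  have := integrableD measurableT (integrable_norm iu) (circle_integrable_cst `|u t|).
  apply: le_integrable => //.
    apply/measurable_EFinP; apply: measurable_funM; first by apply: measurable_indic; exact: measurable_ball.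
    by apply: measurableT_comp => //; exact: measurable_funB.
  move=> s _ /=; rewrite lee_fin normrM normr_id indicE.
  apply: (@le_trans _ _ (`|u s - u t|)); first by rewrite ler_piMl//; case: (_ \in _); rewrite ?normr1 ?normr0.
  by rewrite [leRHS]ger0_norm ?addr_ge0// ler_normB.
rewrite circle_integral//.
move=> lt1; apply: (@le_trans _ _ (\int[leb]_(s in ball t rho) `|(f s - f t)%:E|)%E).
  rewrite [leRHS]integral_mkcond.
  have -> : (\int[leb]_(s in `[0%R, 1%R]) (\1_(ball t rho) s * `|u s - u t|)%:E)%E =
     (\int[leb]_(s in `[0%R, 1%R]) ((fun s => `|(f s - f t)%:E|%E) \_ (ball t rho)) s)%E.
    apply: eq_integral => s s01; rewrite /= patchE indicE ft /f patchE s01.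
    by case: (_ \in _); rewrite ?mul1r ?mul0r.
  apply: ge0_subset_integral => //.
    apply/(measurable_restrictT _ _).1; first exact: measurable_ball.
    apply: measurable_funTS; apply: measurableT_comp => //.
    by apply/measurable_EFinP; exact: measurable_funB.
  by move=> s _; rewrite patchE; case: ifP.
move: lt1; rewrite inver gt_eqF ?mulrn_wgt0// lte_pdivrMl ?mulrn_wgt0// => /ltW /le_trans; apply.
rewrite -EFinM lee_fin -mulr_natl le_eqVlt; apply/orP; left; apply/eqP; by field.
Qed.

Lemma lebesgue_pt_ae u : mu.-integrable setT (EFin \o u) ->
  {ae mu, forall t, 0 < t < 1 /\ lebesgue_pt (u \_ `[0, 1]%classic) t}.
Proof.
move=> iu; apply: filterI; first exact: circle_ae_itv.
apply: circle_ae; apply: lebesgue_differentiation; apply: open_integrable_locally.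
  exact: openT.
have mu_ : measurable_fun setT (u : measurableTypeR R -> R) by apply/measurable_EFinP; case/integrableP: iu.
have iv := integrable_norm iu.
apply/integrableP; split.
  apply/measurable_EFinP; apply/(measurable_restrictT _ _).1 => //.
  exact: measurable_funTS.
have := circle_integral iv; case/integrableP: iu => _ + E.
under eq_integral do rewrite abse_EFin.
rewrite E => /(le_lt_trans _); apply.
rewrite [leRHS]integral_mkcond le_eqVlt; apply/orP; left; apply/eqP.
apply: eq_integral => s _; rewrite /= !patchE; case: ifP => //=; first by rewrite normr0.
Qed.

(* At a Lebesgue point t the Poisson kernel is dominated on the dyadic shells around
   t by its size on each of them, so that the means over small intervals control the
   Poisson integral. *)
Lemma scalar_fatou u : mu.-integrable setT (EFin \o u) ->
  {ae mu, forall t, forall e, 0 < e -> exists2 d, 0 < d & forall r, 1 - d < r < 1 ->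
    \int[mu]_s (poisson r t s * `|u s - u t|) < e}.
Proof.
move=> iu; apply: filterS (lebesgue_pt_ae iu) => t [t01 pt] e e0.
have mu_ : measurable_fun setT (u : measurableTypeR R -> R) by apply/measurable_EFinP; case/integrableP: iu.
have iv : mu.-integrable setT (EFin \o (fun s => `|u s - u t|)).
  apply: integrable_norm.
  have := integrableB measurableT iu (circle_integrable_cst (u t)).
  by apply: eq_integrable => // s _; rewrite /= EFinB.
have mv : measurable_fun setT ((fun s => `|u s - u t|) : measurableTypeR R -> R).
  by apply/measurable_EFinP; case/integrableP: iv.
have t0 : 0 < Num.min t (1 - t) by rewrite lt_min; move/andP: t01 => [-> ?]; rewrite subr_gt0.
have [c c0 cP] := sin_lower t0.
have B0 : 0 < 2 + 4 / c by rewrite addr_gt0// divr_gt0.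
(* With this [eta] the balls contribute [e / 2]; the constant [k] below makes the far part smaller
   than [e / 2], the [+ 1] keeping its denominator positive. *)
pose eta := e / (4 * (2 + 4 / c)).
have eta0 : 0 < eta by rewrite divr_gt0// mulr_gt0.
have [d d0 dP] := lebesgue_pt_circle iu t01 pt eta0.
pose V := \int[mu]_s `|u s - u t|.
have V0 : 0 <= V by apply: Rintegral_ge0.
pose k := e * (c * d ^+ 2) / (16 * (V + 1)).
have cd0 : 0 < c * d ^+ 2 by rewrite mulr_gt0// exprn_gt0.
have V1 : 0 < V + 1 by rewrite ltr_wpDl.
have k0 : 0 < k by rewrite !divr_gt0// ?mulr_gt0.
exists (Num.min 2^-1 (Num.min d k)); first by rewrite !lt_min invr_gt0 ltr0n/= d0.
move=> r /andP[]; rewrite ltrBlDr -ltrBlDl !lt_min => /andP[r2 /andP[rd rk]] r1.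
have r12 : 2^-1 <= r < 1 by rewrite r1 andbT; lra.
have r01 : 0 <= r < 1 by rewrite r1 andbT; lra.
have := poisson_shell_integral mv (fun s => normr_ge0 _) t01 c0 eta0 d0 cP dP r12 rd.
have iP := poisson_integrable_mul t r01 iv.
rewrite -[X in (X <= _)%E]fineK ?integrable_fin_num// -[X in (_ <= _ + _ * X)%E]fineK ?integrable_fin_num//.
rewrite -EFinM -EFinD lee_fin => /le_lt_trans; apply.
rewrite -/(Rintegral _ _ _) -/V.
have -> : 2 * (2 + 4 / c) * eta = e / 2.
  by rewrite /eta; move: (2 + 4 / c) B0 => B B1; field; rewrite gt_eqF.
suff : 4 * (1 - r) / (c * d ^+ 2) * V < e / 2 by lra.
rewrite mulrAC ltr_pdivrMr//.
apply: (@le_lt_trans _ _ (4 * k * (V + 1))).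
  by rewrite ler_pM ?mulr_ge0 ?subr_ge0 ?(ltW r1)// ?ler_pM2l ?(ltW rk)// lerDl.
have -> : 4 * k * (V + 1) = e / 4 * (c * d ^+ 2) by rewrite /k; field; rewrite gt_eqF.
by rewrite ltr_pM2r//; lra.
Qed.

End Fatou.

(** * Integrals of complex valued functions *)

Section ComplexIntegralTheory.
Context d (T : measurableType d) (R : realType).
Variable mu : {measure set T -> \bar R}.
Implicit Types f g k : T -> R[i].

Lemma cmeasurableM f g : cmeasurable f -> cmeasurable g -> cmeasurable (fun t => f t * g t).
Proof.
move=> [fr fi] [gr gi]; split.
  rewrite [X in measurable_fun _ X](_ : _ = (fun t => complex.Re (f t) * complex.Re (g t) -
     complex.Im (f t) * complex.Im (g t))); last first.
    by apply/funext => t; case: (f t) (g t) => ? ? [].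
  by apply: measurable_funB; apply: measurable_funM.
rewrite [X in measurable_fun _ X](_ : _ = (fun t => complex.Re (f t) * complex.Im (g t) +
   complex.Im (f t) * complex.Re (g t))); last first.
  by apply/funext => t; case: (f t) (g t) => ? ? [].
by apply: measurable_funD; apply: measurable_funM.
Qed.

Lemma cmeasurableD f g : cmeasurable f -> cmeasurable g -> cmeasurable (fun t => f t + g t).
Proof.
move=> [fr fi] [gr gi]; split; under eq_fun do rewrite raddfD/=; exact: measurable_funD.
Qed.

Lemma cmeasurable_cst (a : R[i]) : cmeasurable (fun _ : T => a).
Proof. by split; exact: measurable_cst. Qed.

Lemma cintegrable_cmeasurable f : cintegrable mu f -> cmeasurable f.
Proof. by move=> [/integrableP[mr _] /integrableP[mi _]]; split; exact/measurable_EFinP. Qed.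

Lemma cintegrable_abs f : cintegrable mu f ->
  mu.-integrable setT (EFin \o (fun t => `|complex.Re (f t)| + `|complex.Im (f t)|)).
Proof.
move=> [fr fi].
exact: (integrableD measurableT (integrable_norm fr) (integrable_norm fi)).
Qed.

Lemma cintegrable_bound f (K : R) g : cmeasurable f -> cintegrable mu g ->
  (forall t, cmod (f t) <= K * cmod (g t)) -> cintegrable mu f.
Proof.
move=> [mr mi] ig fg; have ia := integrable_scale `|K| (cintegrable_abs ig).
have key t : cmod (f t) <= `|K| * (`|complex.Re (g t)| + `|complex.Im (g t)|).
  apply: le_trans (fg t) _; apply: le_trans (ler_wpM2r (cmod_ge0 _) (ler_norm K)) _.
  by rewrite ler_wpM2l// cmod_le_ReIm.
split; apply: (le_integrable measurableT _ _ ia); try exact/measurable_EFinP.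
  by move=> t _ /=; rewrite lee_fin (le_trans (Re_le_cmod _))// (le_trans (key t))// ler_norm.
by move=> t _ /=; rewrite lee_fin (le_trans (Im_le_cmod _))// (le_trans (key t))// ler_norm.
Qed.

Lemma cintegrableM f k (K : R) : cmeasurable k -> (forall t, cmod (k t) <= K) ->
  cintegrable mu f -> cintegrable mu (fun t => k t * f t).
Proof.
move=> mk kK jf; apply: (cintegrable_bound (K := K) (g := f)) => //.
  by apply: cmeasurableM => //; exact: cintegrable_cmeasurable.
by move=> t; rewrite cmodM ler_wpM2r ?cmod_ge0.
Qed.

Lemma cintegrable0 : cintegrable mu (fun _ => 0).
Proof. by split; exact: integrable0. Qed.

Lemma cintegrableP (a : R[i]) f g : cintegrable mu f -> cintegrable mu g ->
  cintegrable mu (fun t => a * f t + g t).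
Proof.
move=> jf [gr gi]; have [fr fi] : cintegrable mu (fun t => a * f t).
  by apply: (cintegrableM (K := cmod a)) => //; exact: cmeasurable_cst.
split; under eq_fun do rewrite raddfD/= EFinD; exact: integrableD.
Qed.

Lemma cintegrable_sum (I : Type) (r : seq I) (h : I -> T -> R[i]) (a : I -> R[i]) :
  (forall i, cintegrable mu (h i)) -> cintegrable mu (fun t => \sum_(i <- r) a i * h i t).
Proof.
move=> mh; elim: r => [|i r IH].
  by under eq_fun do rewrite big_nil; exact: cintegrable0.
by under eq_fun do rewrite big_cons; exact: cintegrableP.
Qed.

Lemma cintegral0 : cintegral mu (fun _ => 0) = 0.
Proof. by rewrite /cintegral/= /Rintegral integral0. Qed.

Lemma cintegral_sum (I : Type) (r : seq I) (h : I -> T -> R[i]) (a : I -> R[i]) :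
  (forall i, cintegrable mu (h i)) ->
  cintegral mu (fun t => \sum_(i <- r) a i * h i t) = \sum_(i <- r) a i * cintegral mu (h i).
Proof.
move=> mh; elim: r => [|i r IH].
  by under eq_fun do rewrite big_nil; rewrite cintegral0 big_nil.
under eq_fun do rewrite big_cons; rewrite cintegralP ?IH ?big_cons//.
exact: cintegrable_sum.
Qed.

Lemma cintegralB f g : cintegrable mu f -> cintegrable mu g ->
  cintegral mu (fun t => f t - g t) = cintegral mu f - cintegral mu g.
Proof.
move=> jf jg; have := cintegralP (-1) jg jf; rewrite mulN1r addrC => <-.
by congr cintegral; apply/funext => t; rewrite mulN1r addrC.
Qed.

Lemma cintegralD f g : cintegrable mu f -> cintegrable mu g ->
  cintegral mu (fun t => f t + g t) = cintegral mu f + cintegral mu g.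
Proof.
move=> jf jg; have := cintegralP 1 jf jg; rewrite mul1r => <-.
by congr cintegral; apply/funext => t; rewrite mul1r.
Qed.

(** Multiplying by the conjugate phase [w] of the integral makes it real, so that only the real part
    of the integrand has to be bounded. *)
Lemma cmod_cintegral f (K : T -> R) : cintegrable mu f -> mu.-integrable setT (EFin \o K) ->
  (forall t, 0 <= K t) -> {ae mu, forall t, cmod (f t) <= K t} ->
  cmod (cintegral mu f) <= \int[mu]_t K t.
Proof.
move=> jf iK K0 fK; set z := cintegral mu f.
have [->|z0] := eqVneq (cmod z) 0; first exact: Rintegral_ge0.
have cz0 : 0 < cmod z by rewrite lt_def z0 cmod_ge0.
pose w := Num.conj z / (cmod z)%:C.
have w1 : cmod w = 1.
  rewrite /w cmodM cmod_conj cmodV cmod_real ger0_norm ?cmod_ge0// divff//.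
have wz : w * z = (cmod z)%:C.
  have c0 : (cmod z)%:C != 0 by rewrite -(rmorph0 (real_complex R)) (inj_eq (@complexI R)).
  apply: (mulfI c0); rewrite /w mulrA mulrCA divff// mulr1 -cmodE.
  by rewrite mulrC -[RHS]expr2 normCK.
have jwf : cintegrable mu (fun t => w * f t).
  by apply: (cintegrableM (K := 1)) jf => [|t]; [exact: cmeasurable_cst|rewrite w1].
have E : w * z = cintegral mu (fun t => w * f t).
  have := cintegralP w jf cintegrable0; rewrite cintegral0 addr0 => <-.
  by congr cintegral; apply/funext => t; rewrite addr0.
have -> : cmod z = \int[mu]_t complex.Re (w * f t).
  by have := congr1 (@complex.Re R) E; rewrite wz.
have [rwf _] := jwf.
apply: le_trans (ler_norm _) _; apply: le_trans (le_normr_Rintegral measurableT rwf) _.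
have irn := integrable_norm rwf.
rewrite -lee_fin /Rintegral !fineK ?integrable_fin_num//.
apply: ae_ge0_le_integral => //.
- by case/integrableP: irn.
- by move=> t _; rewrite lee_fin.
- by case/integrableP: iK.
apply: filterS fK => t ft _; rewrite lee_fin; apply: le_trans (Re_le_cmod _) _.
by rewrite cmodM w1 mul1r.
Qed.

End ComplexIntegralTheory.

(** * Fourier expansion of the Poisson integral and uniqueness of Fourier coefficients *)

Section PoissonExpansion.
Context (R : realType).
Local Notation mu := (circle_measure R).
Implicit Types (s t r : R) (h : R -> R[i]).

Definition pois_pos r t n : R[i] := (r%:C * circle_pt t) ^+ n.
Definition pois_neg r t n : R[i] := (r%:C * circle_pt (- t)) ^+ n.+1.

Lemma chi_neg (n : nat) s : chi (- n%:Z) s = circle_pt (- s) ^+ n.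
Proof. by rewrite chiN chi_nat rmorphXn/= -circle_ptN. Qed.

Lemma pois_sumE N r t s : pois_sum N r t s =
  \sum_(n < N) pois_pos r t n * chi (- n%:Z) s + \sum_(n < N) pois_neg r t n * chi n.+1%:Z s.
Proof.
rewrite /pois_sum /pois_q; congr (_ + _); apply: eq_bigr => n _.
  by rewrite /pois_pos chi_neg circle_ptD mulrA exprMn.
rewrite /pois_neg chi_nat rmorphM/= -circle_ptN opprB addrC circle_ptD mulrA exprMn.
by rewrite conj_Creal// complex_real.
Qed.

Lemma cintegrable_chi n h : cintegrable mu h -> cintegrable mu (fun s => chi n s * h s).
Proof.
by move=> jh; apply: (cintegrableM (K := 1)) jh => [|t]; [exact: chi_measurable|rewrite cmod_chi].
Qed.

Lemma poisson_cmeasurable r t : 0 <= r < 1 ->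
  @cmeasurable _ (measurableTypeR R) R (fun s => (poisson r t s)%:C).
Proof. by move=> r01; split; [exact: poisson_measurable|exact: measurable_cst]. Qed.

Lemma cintegrable_poisson r t h : 0 <= r < 1 -> cintegrable mu h ->
  cintegrable mu (fun s => (poisson r t s)%:C * h s).
Proof.
move=> r01 jh; apply: (cintegrableM (K := 2 / (1 - r))) jh => [|s].
  exact: poisson_cmeasurable.
by rewrite cmod_real ger0_norm ?poisson_ge0// poisson_le.
Qed.

Lemma poisson_expand r t h N : 0 <= r < 1 -> cintegrable mu h ->
  cmod (cintegral mu (fun s => (poisson r t s)%:C * h s) -
   (\sum_(n < N) pois_pos r t n * cintegral mu (fun s => chi (- n%:Z) s * h s) +
    \sum_(n < N) pois_neg r t n * cintegral mu (fun s => chi n.+1%:Z s * h s))) <=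
  2 * r ^+ N / (1 - r) * \int[mu]_s (`|complex.Re (h s)| + `|complex.Im (h s)|).
Proof.
move=> r01 jh; have /andP[r0 r1] := r01.
have K0 : 0 <= 2 * r ^+ N / (1 - r).
  by rewrite divr_ge0 ?mulr_ge0 ?exprn_ge0// subr_ge0 ltW.
have jc n : cintegrable mu (fun s => chi n s * h s) by exact: cintegrable_chi.
have jP := cintegrable_poisson t r01 jh.
have j1 := cintegrable_sum (index_enum 'I_N) (fun n : 'I_N => pois_pos r t n) (fun n : 'I_N => jc (- (n : nat)%:Z)).
have j2 := cintegrable_sum (index_enum 'I_N) (fun n : 'I_N => pois_neg r t n) (fun n : 'I_N => jc (n : nat).+1%:Z).
have j12 := cintegrableP 1 j1 j2.
rewrite -(cintegral_sum _ _ (fun n : 'I_N => jc (- (n : nat)%:Z))).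
rewrite -(cintegral_sum _ _ (fun n : 'I_N => jc (n : nat).+1%:Z)).
rewrite -cintegralD// -cintegralB//; last first.
  by move: j12; under eq_fun do rewrite mul1r.
rewrite -RintegralZl//; last exact: cintegrable_abs.
apply: cmod_cintegral.
- have := cintegrableP (-1) j12 jP.
  by under eq_fun do rewrite mul1r mulN1r addrC.
- by apply: integrable_scale; exact: cintegrable_abs.
- by move=> s; rewrite mulr_ge0.
apply: aeW => s.
have -> : (poisson r t s)%:C * h s -
   (\sum_(i < N) pois_pos r t i * (chi (- (i : nat)%:Z) s * h s) +
    \sum_(i < N) pois_neg r t i * (chi (i : nat).+1%:Z s * h s)) =
   ((poisson r t s)%:C - pois_sum N r t s) * h s.
  rewrite pois_sumE mulrBl mulrDl !mulr_suml; congr (_ - (_ + _)).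
    by apply: eq_bigr => i _; rewrite mulrA.
  by apply: eq_bigr => i _; rewrite mulrA.
rewrite cmodM ler_pM ?cmod_ge0//; last exact: cmod_le_ReIm.
exact: poisson_sum.
Qed.

Lemma geometric_small r (K e : R) : 0 <= r < 1 -> 0 < e ->
  exists N, forall n, (N <= n)%N -> r ^+ n * K < e.
Proof.
move=> /andP[r0 r1] e0.
have k0 : 0 < `|K| + 1 by rewrite ltr_wpDl.
have /cvgrPdist_lt/(_ (e / (`|K| + 1))) : (fun n => r ^+ n) @ \oo --> (0 : R).
  by apply: cvg_expr; rewrite ger0_norm.
rewrite divr_gt0// => /(_ isT)[N _ NP]; exists N => n /NP.
rewrite /= sub0r normrN ger0_norm ?exprn_ge0// ltr_pdivlMr//; apply: le_lt_trans.
by rewrite ler_wpM2l ?exprn_ge0// ler_wpDr// ler_norm.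
Qed.

Lemma cintegrable_one : cintegrable mu (fun=> 1).
Proof. by split; exact: circle_integrable_cst. Qed.

Lemma cintegral_chi1 n : cintegral mu (fun s => chi n s * 1) = (n == 0)%:R.
Proof. by rewrite -cintegral_chi; congr cintegral; apply/funext => s; rewrite mulr1. Qed.

Lemma poisson_expand_limit r t h (c : R[i]) : 0 <= r < 1 -> cintegrable mu h ->
  (forall N, \sum_(n < N.+1) pois_pos r t n * cintegral mu (fun s => chi (- n%:Z) s * h s) +
    \sum_(n < N.+1) pois_neg r t n * cintegral mu (fun s => chi n.+1%:Z s * h s) = c) ->
  cintegral mu (fun s => (poisson r t s)%:C * h s) = c.
Proof.
move=> r01 jh H; apply/eqP; rewrite -subr_eq0; apply/eqP/cmod_eq0_small => e e0.
pose M := \int[mu]_s (`|complex.Re (h s)| + `|complex.Im (h s)|).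
have [N NP] := geometric_small (2 / (1 - r) * M) r01 e0.
have := NP N.+1 (leqnSn N); apply: le_lt_trans.
have := poisson_expand t N.+1 r01 jh; rewrite H => /le_trans; apply.
by rewrite -/M (mulrC 2) -!mulrA.
Qed.

Lemma poisson_mass r t : 0 <= r < 1 -> \int[mu]_s poisson r t s = 1.
Proof.
move=> r01.
have := @poisson_expand_limit r t (fun=> 1) 1 r01 cintegrable_one.
have -> : cintegral mu (fun s => (poisson r t s)%:C * 1) = (\int[mu]_s poisson r t s)%:C.
  apply/eqP; rewrite eq_complex/=; apply/andP; split; apply/eqP.
    by apply: eq_Rintegral => s _; rewrite /= mulr1 mul0r subr0.
  rewrite (_ : (fun s => _) = cst 0) ?Rintegral_cst//= ?mul0r//.
  by apply/funext => s; rewrite /= mulr0 addr0.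
move=> H; apply: complexI; apply: H => N.
rewrite big_ord_recl /pois_pos expr0 mul1r cintegral_chi1 big1 => [|n _]; last first.
  by rewrite cintegral_chi1 lift0 oppr_eq0 mulr0.
by rewrite big1 ?addr0// => n _; rewrite cintegral_chi1 mulr0.
Qed.

Lemma poisson_cst r t (c : R) : 0 <= r < 1 -> \int[mu]_s (poisson r t s * c) = c.
Proof.
move=> r01; have iP : mu.-integrable setT (EFin \o poisson r t).
  have := poisson_integrable_mul t r01 (circle_integrable_cst 1).
  by apply: eq_integrable => // s _ /=; rewrite mulr1.
by under eq_Rintegral do rewrite mulrC; rewrite RintegralZl// poisson_mass// mulr1.
Qed.

Lemma poisson_ccst r t (w : R[i]) : 0 <= r < 1 ->
  cintegral mu (fun s => (poisson r t s)%:C * w) = w.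
Proof.
move=> r01; apply/eqP; rewrite eq_complex/=; apply/andP; split; apply/eqP.
  rewrite -[RHS](poisson_cst t _ r01); apply: eq_Rintegral => s _.
  by case: w => a b /=; rewrite mul0r subr0.
rewrite -[RHS](poisson_cst t _ r01); apply: eq_Rintegral => s _.
by case: w => a b /=; rewrite mul0r addr0.
Qed.

(** At almost every [t] the Poisson integrals of [u] tend to [u t] as [r] tends to 1. *)
Lemma poisson_null u : mu.-integrable setT (EFin \o u) ->
  (forall r t, 0 <= r < 1 -> \int[mu]_s (poisson r t s * u s) = 0) ->
  {ae mu, forall t, u t = 0}.
Proof.
move=> iu H; apply: filterS (scalar_fatou iu) => t tP.
apply/eqP; rewrite -normr_le0; apply/ler_addgt0Pr => e e0; rewrite add0r.
have [d d0 dP] := tP _ e0.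
pose r := 1 - Num.min d 1 / 2.
have m0 : 0 < Num.min d 1 by rewrite lt_min d0 ltr01.
have md : Num.min d 1 <= d by rewrite ge_min lexx.
have m1 : Num.min d 1 <= 1 by rewrite ge_min lexx orbT.
have rd : 1 - d < r < 1 by rewrite /r; apply/andP; split; lra.
have r01 : 0 <= r < 1 by rewrite /r; apply/andP; split; lra.
apply/ltW; apply: le_lt_trans (dP _ rd).
have iPu := poisson_integrable_mul t r01 iu.
have iPc := poisson_integrable_mul t r01 (circle_integrable_cst (u t)).
have iPB : mu.-integrable setT (EFin \o (fun s => poisson r t s * (u s - u t))).
  have := integrableB measurableT iPu iPc.
  by apply: eq_integrable => // s _ /=; rewrite mulrBr EFinB.
have -> : `|u t| = `|\int[mu]_s (poisson r t s * (u s - u t))|.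
  under eq_Rintegral do rewrite mulrBr.
  by rewrite RintegralB// H// poisson_cst// sub0r normrN.
apply: le_trans (le_normr_Rintegral measurableT iPB) _.
apply: le_Rintegral => //; first exact: integrable_norm.
  apply: poisson_integrable_mul => //; apply: integrable_norm.
  have := integrableB measurableT iu (circle_integrable_cst (u t)).
  by apply: eq_integrable => // s _ /=; rewrite EFinB.
by move=> s _; rewrite normrM ger0_norm ?poisson_ge0.
Qed.

(** The Poisson integrals are determined by the Fourier coefficients and recover the function almost
    everywhere. *)
Lemma fourier_unique h : cintegrable mu h ->
  (forall n, cintegral mu (fun s => chi n s * h s) = 0) ->
  {ae mu, forall t, h t = 0}.
Proof.
move=> jh H; have [hr hi] := jh.
have E r t : 0 <= r < 1 -> cintegral mu (fun s => (poisson r t s)%:C * h s) = 0.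
  move=> r01; apply: poisson_expand_limit => // N.
  by rewrite !big1 ?addr0// => n _; rewrite H mulr0.
have Re0 : {ae mu, forall t, complex.Re (h t) = 0}.
  apply: poisson_null => // r t r01; have := congr1 (@complex.Re R) (E r t r01).
  rewrite /= => <-; apply: eq_Rintegral => s _; case: (h s) => a b /=.
  by rewrite mul0r subr0.
have Im0 : {ae mu, forall t, complex.Im (h t) = 0}.
  apply: poisson_null => // r t r01; have := congr1 (@complex.Im R) (E r t r01).
  rewrite /= => <-; apply: eq_Rintegral => s _; case: (h s) => a b /=.
  by rewrite mul0r addr0.
by apply: filterS2 Re0 Im0 => t; case: (h t) => a b /= -> ->.
Qed.

Lemma fourier_const h : cintegrable mu h ->
  (forall n, n != 0 -> cintegral mu (fun s => chi n s * h s) = 0) ->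
  {ae mu, forall t, h t = cintegral mu h}.
Proof.
move=> jh H; set c := cintegral mu h.
have jc : cintegrable mu (fun=> c) by split; exact: circle_integrable_cst.
have jhc : cintegrable mu (fun s => h s - c).
  have := cintegrableP (-1) jc jh.
  by under eq_fun do rewrite mulN1r addrC.
have : {ae mu, forall t, h t - c = 0}.
  apply: fourier_unique => // n.
  under eq_fun do rewrite mulrBr.
  rewrite cintegralB; [|exact: cintegrable_chi|exact: cintegrable_chi].
  have -> : cintegral mu (fun t => chi n t * c) = c * (n == 0)%:R.
    rewrite -cintegral_chi; have := @cintegralP _ _ R mu c (chi n) (fun=> 0) _ (cintegrable0 _).
    rewrite cintegral0 addr0 => <-.
      by congr cintegral; apply/funext => s; rewrite addr0 mulrC.
    have := cintegrable_chi n cintegrable_one.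
    by under eq_fun do rewrite mulr1.
  have [->|n0] := eqVneq n 0; last by rewrite H// mulr0 subr0.
  rewrite mulr1; apply/eqP; rewrite subr_eq0; apply/eqP; congr cintegral.
  by apply/funext => s; rewrite chi0 mul1r.
by apply: filterS => t /eqP; rewrite subr_eq0 => /eqP.
Qed.

End PoissonExpansion.

(** * Fourier coefficients and Poisson extensions of vector valued functions *)

Section VectorFourier.
Context (R : realType) (E : sepHilbertType R).
Local Notation mu := (circle_measure R).
Implicit Types (s t r : R) (k : R -> R[i]) (f g : L2T E) (v : E).

Lemma inner_suml (V : preHilbertType R) (I : Type) (r : seq I) (u : I -> V) (v : V) :
  inner (\sum_(i <- r) u i) v = \sum_(i <- r) inner (u i) v.
Proof.
elim: r => [|i r IH]; first by rewrite !big_nil linear0l.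
by rewrite !big_cons innerDl IH.
Qed.

Lemma hn_dual (V : preHilbertType R) (x : V) (M : R) : 0 <= M ->
  (forall v : V, cmod (inner x v) <= M * hn v) -> hn x <= M.
Proof.
move=> M0 H; have [->//|x0] := eqVneq (hn x) 0.
have x1 : 0 < hn x by rewrite lt_def x0 hn_ge0.
rewrite -(ler_pM2r x1) -expr2 hn_sqr; apply: le_trans (H x).
exact: le_trans (ler_norm _) (Re_le_cmod _).
Qed.

Definition scalar_field k v : L2T E := L2of mu (fun s => k s *: v).

Definition bounded_kernel (M : R) k := @cmeasurable _ (measurableTypeR R) R k /\ forall s, cmod (k s) <= M.

Lemma bounded_kernel_ge0 M k : bounded_kernel M k -> 0 <= M.
Proof. by move=> [_ /(_ 0)]; apply: le_trans; exact: cmod_ge0. Qed.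

Lemma scalar_field_l2 M k v : bounded_kernel M k -> l2fun mu (fun s => k s *: v).
Proof.
move=> [mk bk]; apply: (l2fun_bound (G := fun=> M ^+ 2 * rdot v v)).
- by apply: wmeas_scale => //; exact: wmeas_cst.
- exact: circle_integrable_cst.
- apply: aeW => s; rewrite -!hn_sqr hnZ exprMn ler_wpM2r ?sqr_ge0//.
  by rewrite ler_pXn2r ?nnegrE ?cmod_ge0// (le_trans (cmod_ge0 _) (bk s)).
Qed.

Lemma l2_cst v : l2fun mu (fun=> v).
Proof.
have b1 : bounded_kernel 1 (fun=> 1) by split; [exact: cmeasurable_cst|move=> s; rewrite cmod1].
by have := scalar_field_l2 v b1; under eq_fun do rewrite scale1r.
Qed.

Lemma scalar_field_ae M k v : bounded_kernel M k -> {ae mu, forall s, scalar_field k v s = k s *: v}.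
Proof. by move=> bk; apply/aeE; apply: L2ofK; exact: scalar_field_l2 bk. Qed.

Lemma scalar_field_linear M k : bounded_kernel M k -> linear (scalar_field k).
Proof.
move=> bk a x y; apply/L2_eq/aeE.
apply: filterS3 (scalar_field_ae (a *: x + y) bk) (scalar_field_ae x bk) (filterI (scalar_field_ae y bk) (L2P_ae a (scalar_field k x) (scalar_field k y))).
by move=> s -> kx [ky ->]; rewrite kx ky scalerDr !scalerA mulrC.
Qed.

Lemma scalar_field_bounded M k : bounded_kernel M k -> hbounded M (scalar_field k).
Proof.
move=> bk v; have M0 := bounded_kernel_ge0 bk.
rewrite hn_le_sqr ?mulr_ge0 ?hn_ge0// exprMn hn_sqr.
have -> : M ^+ 2 * rdot v v = \int[mu]_s (M ^+ 2 * rdot v v).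
  by rewrite Rintegral_cst//= circle_measureT mulr1.
apply: L2_rdot_le; first exact: circle_integrable_cst.
case: bk (scalar_field_ae v bk) => mk bk; apply: filterS => s ->.
rewrite -!hn_sqr hnZ exprMn ler_wpM2r ?sqr_ge0//.
by rewrite ler_pXn2r ?nnegrE ?cmod_ge0.
Qed.

(** The integral of conj(k) g as a vector of [E], obtained as the adjoint of [v] |-> [k v]; no
    vector valued integration is involved. *)
Definition kernel_average k g : E := adjoint setT (scalar_field k) g.

Lemma inner_cintegrable f g : cintegrable mu (fun s => inner (f s) (g s)).
Proof. exact: l2fun_cintegrable (L2_reprP f) (L2_reprP g). Qed.

Lemma inner_cst_cintegrable g v : cintegrable mu (fun s => inner (g s) v).
Proof.
exact: l2fun_cintegrable (L2_reprP g) (l2_cst v).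
Qed.

Lemma inner_kavg M k g v : bounded_kernel M k ->
  inner (kernel_average k g) v = cintegral mu (fun s => Num.conj (k s) * inner (g s) v).
Proof.
move=> bk; rewrite inner_conj.
rewrite -(adjP (@sepHilbert_complete R E) (scalar_field_linear bk) (scalar_field_bounded bk)).
rewrite -inner_conj inner_L2E; apply: ae_cintegral.
- by case: (inner_cintegrable g (scalar_field k v)) => /integrableP[mr _] /integrableP[mi _]; split; exact/measurable_EFinP.
- case: bk => mk _; apply: cmeasurableM; first exact: cmeasurable_conj.
  exact: (cintegrable_cmeasurable (inner_cst_cintegrable g v)).
by apply: filterS (scalar_field_ae v bk) => s -> _; rewrite innerZr.
Qed.

Lemma kernel_average_linear M k : bounded_kernel M k -> linear (kernel_average k).
Proof.
move=> bk; exact: adj_linear (adjP (@sepHilbert_complete R E) (scalar_field_linear bk) (scalar_field_bounded bk)).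
Qed.

Lemma kernel_average_bounded M k : bounded_kernel M k -> hbounded M (kernel_average k).
Proof.
move=> bk; apply: (adj_bounded (bounded_kernel_ge0 bk)) (scalar_field_bounded bk).
exact: adjP (@sepHilbert_complete R E) (scalar_field_linear bk) (scalar_field_bounded bk).
Qed.

Lemma chi_bker n : bounded_kernel 1 (chi n).
Proof. by split; [exact: chi_measurable|move=> s; rewrite cmod_chi]. Qed.

Lemma poisson_bker r t : 0 <= r < 1 -> bounded_kernel (2 / (1 - r)) (fun s => (poisson r t s)%:C).
Proof.
move=> r01; split; first exact: poisson_cmeasurable.
by move=> s; rewrite cmod_real ger0_norm ?poisson_ge0// poisson_le.
Qed.

(* The n-th Fourier coefficient of g, and the Poisson extension of g at the point
   r%:C * circle_pt t of the disk. *)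
Definition fourier_coef n g : E := kernel_average (chi n) g.
Definition poisson_ext r t g : E := kernel_average (fun s => (poisson r t s)%:C) g.

Lemma inner_fourier_coef n g v : inner (fourier_coef n g) v = cintegral mu (fun s => chi (- n) s * inner (g s) v).
Proof.
rewrite /fourier_coef (inner_kavg _ _ (chi_bker n)); congr cintegral.
by apply/funext => s; rewrite chiN.
Qed.

Lemma inner_poisson_ext r t g v : 0 <= r < 1 ->
  inner (poisson_ext r t g) v = cintegral mu (fun s => (poisson r t s)%:C * inner (g s) v).
Proof.
move=> r01; rewrite /poisson_ext (inner_kavg _ _ (poisson_bker t r01)); congr cintegral.
by apply/funext => s; rewrite conj_Creal// complex_real.
Qed.

Lemma L2_fourier_unique g : (forall n, fourier_coef n g = 0) -> g = 0.
Proof.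
move=> H; have [s sd] := dense_seq E.
have /ae_foralln g0 : forall n, {ae mu, forall t, inner (g t) (s n) = 0}.
  move=> n; apply: fourier_unique; first exact: inner_cst_cintegrable.
  by move=> m; rewrite -[m]opprK -inner_fourier_coef H linear0l.
apply/L2_eq/aeE; have := L2Z_ae 0 (0 : L2T E); rewrite scale0r.
apply: filterS2 g0 => t gt ->; rewrite scale0r; apply: (dense_orth sd) => n.
exact: inner0C.
Qed.

Lemma fourier_coef_linear n : linear (fourier_coef n). Proof. exact: kernel_average_linear (chi_bker n). Qed.
Lemma fourier_coef_bounded n : hbounded 1 (fourier_coef n). Proof. exact: kernel_average_bounded (chi_bker n). Qed.

Lemma hn_integrable g c : mu.-integrable setT (EFin \o (fun s => hn (g s - c))).
Proof.
pose G s := rdot (g s - c) (g s - c).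
have lg : l2fun mu (fun s => g s - c).
  have := l2funP (-1) (l2_cst c) (L2_reprP g).
  by under eq_fun do rewrite scaleN1r addrC.
have iG : mu.-integrable setT (EFin \o (fun s => 1 + G s)).
  have [jG _] := l2fun_cintegrable lg lg.
  exact: (integrableD measurableT (circle_integrable_cst 1) jG).
apply: (le_integrable measurableT _ _ iG).
  apply/measurable_EFinP; apply: measurableT_comp; first by apply: continuous_measurable_fun; exact: sqrt_continuous.
  by apply: wmeas_rdot; case: lg.
move=> s _ /=; rewrite lee_fin ger0_norm ?hn_ge0// ger0_norm ?addr_ge0 ?rdot_ge0//.
rewrite /G -hn_sqr; have := sqr_ge0 (1 - hn (g s - c)); rewrite sqrrB expr1n mul1r.
by rewrite -mulr_natl; have := hn_ge0 (g s - c); nra.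
Qed.

(** The kernel is positive of mass one, so [c] is its own average. *)
Lemma poisson_ext_sub_le r t g c : 0 <= r < 1 ->
  hn (poisson_ext r t g - c) <= \int[mu]_s (poisson r t s * hn (g s - c)).
Proof.
move=> r01; have iP := poisson_integrable_mul t r01 (hn_integrable g c).
apply: hn_dual.
  by apply: Rintegral_ge0 => s _; rewrite mulr_ge0 ?poisson_ge0 ?hn_ge0.
move=> v; rewrite innerBl inner_poisson_ext//.
have jc : cintegrable mu (fun=> inner c v) by split; exact: circle_integrable_cst.
have jg := inner_cst_cintegrable g v.
rewrite -[inner c v](poisson_ccst t _ r01) -cintegralB; [|exact: cintegrable_poisson|exact: cintegrable_poisson].
rewrite [leRHS]mulrC -RintegralZl//; apply: cmod_cintegral.
- have := cintegrableP (-1) (cintegrable_poisson t r01 jc) (cintegrable_poisson t r01 jg).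
  by under eq_fun do rewrite mulN1r addrC.
- exact: integrable_scale.
- by move=> s; rewrite !mulr_ge0 ?poisson_ge0 ?hn_ge0.
apply: aeW => s; rewrite -mulrBr -innerBl cmodM cmod_real ger0_norm ?poisson_ge0//.
by rewrite mulrCA ler_wpM2l ?poisson_ge0// mulrC cinner_le.
Qed.

(** The scalar theorem is applied to the countably many functions [hn (g - s n)] with [s] dense. At
    a point good for all of them, [s n] is chosen within [e / 4] of [g t]; the Poisson mean of
    [hn (g - s n)] is then below [e / 2], and one more [e / 4] leads from [s n] to [g t]. *)
Lemma vector_fatou g : {ae mu, forall t, forall e, 0 < e -> exists2 d, 0 < d & forall r, 1 - d < r < 1 ->
  hn (poisson_ext r t g - g t) < e}.
Proof.
have [s sd] := dense_seq E.
have /ae_foralln H : forall n, {ae mu, forall t, forall e, 0 < e -> exists2 d, 0 < d &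
    forall r, 1 - d < r < 1 ->
    \int[mu]_x (poisson r t x * `|hn (g x - s n) - hn (g t - s n)|) < e}.
  by move=> n; apply: scalar_fatou; exact: hn_integrable.
apply: filterS H => t tP e e0.
have [|n sn] := sd (g t) (e / 4); first by rewrite divr_gt0.
have [|d d0 dP] := tP n (e / 4); first by rewrite divr_gt0.
exists (Num.min d 1); first by rewrite lt_min d0 ltr01.
move=> r /andP[dr r1].
have md : Num.min d 1 <= d by rewrite ge_min lexx.
have m1 : Num.min d 1 <= 1 by rewrite ge_min lexx orbT.
have r01 : 0 <= r < 1 by rewrite r1 andbT; lra.
have dr1 : 1 - d < r < 1 by rewrite r1 andbT; lra.
have := dP _ dr1 => h1.
apply: le_lt_trans (hn_tri (s n) _ _) _.
have h2 := poisson_ext_sub_le t g (s n) r01.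
have iu := hn_integrable g (s n).
have i1 := poisson_integrable_mul t r01 iu.
have i2 : mu.-integrable setT (EFin \o (fun x => `|hn (g x - s n) - hn (g t - s n)|)).
  apply: integrable_norm.
  have := integrableB measurableT iu (circle_integrable_cst (hn (g t - s n))).
  by apply: eq_integrable => // x _ /=; rewrite EFinB.
have i3 := poisson_integrable_mul t r01 i2.
have i4 := poisson_integrable_mul t r01 (circle_integrable_cst (hn (g t - s n))).
have h3 : \int[mu]_x (poisson r t x * hn (g x - s n)) <=
    \int[mu]_x (poisson r t x * `|hn (g x - s n) - hn (g t - s n)|) + hn (g t - s n).
  rewrite -[X in _ <= _ + X](poisson_cst t _ r01) -RintegralD//.
  apply: le_Rintegral => //; first exact: (integrableD measurableT i3 i4).
  move=> x _; rewrite -mulrDr ler_wpM2l ?poisson_ge0// -lerBlDr; exact: ler_norm.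
by rewrite hnC in h2 h3 *; move: h1 h2 h3 sn; rewrite ![hn (g t - s n)]hnC hnC; move=> *; lra.
Qed.

Definition poisson_ext_sum N r t g : E :=
  \sum_(n < N) pois_pos r t n *: fourier_coef n g + \sum_(n < N) pois_neg r t n *: fourier_coef (- n.+1%:Z) g.

Lemma poisson_ext_expand r t g N : 0 <= r < 1 ->
  hn (poisson_ext r t g - poisson_ext_sum N r t g) <= 4 * r ^+ N / (1 - r) * \int[mu]_s hn (g s - 0).
Proof.
move=> r01; have /andP[r0 r1] := r01; have iu := hn_integrable g 0.
have I0 : 0 <= \int[mu]_s hn (g s - 0) by apply: Rintegral_ge0 => s _; exact: hn_ge0.
apply: hn_dual.
  by rewrite !mulr_ge0 ?exprn_ge0 ?invr_ge0 ?subr_ge0 ?(ltW r1).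
move=> v; rewrite innerBl inner_poisson_ext//.
have -> : inner (poisson_ext_sum N r t g) v =
   \sum_(n < N) pois_pos r t n * cintegral mu (fun s => chi (- n%:Z) s * inner (g s) v) +
    \sum_(n < N) pois_neg r t n * cintegral mu (fun s => chi n.+1%:Z s * inner (g s) v).
  rewrite /poisson_ext_sum innerDl; congr (_ + _); rewrite inner_suml; apply: eq_bigr => n _.
    by rewrite innerZl inner_fourier_coef.
  by rewrite innerZl inner_fourier_coef opprK.
apply: le_trans (poisson_expand _ _ r01 (inner_cst_cintegrable g v)) _.
have -> : 4 * r ^+ N / (1 - r) * \int[mu]_s hn (g s - 0) * hn v =
    2 * r ^+ N / (1 - r) * (2 * hn v * \int[mu]_s hn (g s - 0)).
  by ring.
rewrite ler_wpM2l ?mulr_ge0 ?exprn_ge0 ?invr_ge0 ?subr_ge0 ?(ltW r1)//.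
rewrite -RintegralZl//; apply: le_Rintegral => //.
- by apply: cintegrable_abs; exact: inner_cst_cintegrable.
- exact: integrable_scale.
move=> s _; rewrite subr0 -mulrA mulrDl !mul1r lerD//.
  by rewrite mulrC (le_trans (Re_le_cmod _))// cinner_le.
by rewrite mulrC (le_trans (Im_le_cmod _))// cinner_le.
Qed.

Lemma poisson_ext_cvg r t g : 0 <= r < 1 -> hcvg (fun N => poisson_ext_sum N r t g) (poisson_ext r t g).
Proof.
move=> r01 e /(geometric_small (4 / (1 - r) * \int[mu]_s hn (g s - 0)) r01)[N NP].
exists N => n /NP; apply: le_lt_trans; rewrite hnC.
apply: le_trans (poisson_ext_expand t g n r01) _.
by rewrite (mulrC 4) -!mulrA.
Qed.

Lemma poisson_ext_le r t g M : 0 <= r < 1 -> 0 <= M -> {ae mu, forall s, hn (g s) <= M} ->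
  hn (poisson_ext r t g) <= M.
Proof.
move=> r01 M0 gM.
apply: hn_dual => // v; rewrite inner_poisson_ext//.
have iK := poisson_integrable_mul t r01 (circle_integrable_cst (M * hn v)).
rewrite -[leRHS](poisson_cst t _ r01); apply: cmod_cintegral => //.
- by apply: cintegrable_poisson => //; exact: inner_cst_cintegrable.
- by move=> s; rewrite !mulr_ge0 ?poisson_ge0 ?hn_ge0.
apply: filterS gM => s gs; rewrite cmodM cmod_real ger0_norm ?poisson_ge0//.
rewrite ler_wpM2l ?poisson_ge0//; apply: le_trans (cinner_le _ _) _.
by rewrite ler_wpM2r ?hn_ge0.
Qed.

Lemma poisson_ext_linear r t : 0 <= r < 1 -> linear (poisson_ext r t).
Proof. by move=> r01; exact: kernel_average_linear (poisson_bker t r01). Qed.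

End VectorFourier.

(** * Fourier series and the Hardy space *)

Section Shift.
Context (R : realType).
Local Notation mu := (circle_measure R).

Lemma field_chi n (E : sepHilbertType R) : cfield mu 1 (fun t (x : E) => chi n t *: x).
Proof.
apply: (@mfield_cfield _ (measurableTypeR R) R mu E E 1 _ (fun t (x : E) => chi n t *: x)); last exact: aeW.
split=> [t a x y|t x|x].
- by rewrite scalerDr !scalerA mulrC.
- by rewrite hnZ cmod_chi.
- by apply: wmeas_scale; [exact: chi_measurable|exact: wmeas_cst].
Qed.

Variable E : sepHilbertType R.
Implicit Types (f g : L2T E) (v : E) (n m : int).

Definition mz n : L2T E -> L2T E := mulop (fun t x => chi n t *: x).

Lemma MzetaE : @Mzeta R E = mz 1.
Proof.
by apply/funext => f; rewrite /Mzeta /mz; congr mulop; apply/funext => t; apply/funext => x; rewrite chi1.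
Qed.

Lemma mz_ae n f : {ae mu, forall t, mz n f t = chi n t *: f t}.
Proof. exact: mulop_ae (field_chi n E) f. Qed.

Lemma mz_linear n : linear (mz n).
Proof. exact: mulop_linear (field_chi n E). Qed.

Lemma mz_bounded n : hbounded 1 (mz n).
Proof. exact: mulop_bounded (field_chi n E). Qed.

Lemma ae_inner f g f' g' : {ae mu, forall t, inner (f t) (g t) = inner (f' t) (g' t)} ->
  inner f g = inner f' g'.
Proof.
move=> H; rewrite !inner_L2E; apply: ae_cintegral.
- exact: (l2fun_measurable (@l2fun_wmeas _ _ _ mu _ f) (@l2fun_wmeas _ _ _ mu _ g)).
- exact: (l2fun_measurable (@l2fun_wmeas _ _ _ mu _ f') (@l2fun_wmeas _ _ _ mu _ g')).
- by apply: filterS H => t.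
Qed.

Lemma mz_inner n f g : inner (mz n f) (mz n g) = inner f g.
Proof.
apply: ae_inner; apply: filterS2 (mz_ae n f) (mz_ae n g) => t -> ->.
by rewrite innerZl innerZr -chiN mulrA chiVK mul1r.
Qed.

Lemma mzD m n f : mz m (mz n f) = mz (m + n) f.
Proof.
apply/L2_eq/aeE; apply: filterS3 (mz_ae m (mz n f)) (mz_ae n f) (mz_ae (m + n) f).
by move=> t -> -> ->; rewrite scalerA chiD.
Qed.

Lemma mz0 f : mz 0 f = f.
Proof. by apply/L2_eq/aeE; apply: filterS (mz_ae 0 f) => t ->; rewrite chi0 scale1r. Qed.

Lemma mzK n f : mz n (mz (- n) f) = f. Proof. by rewrite mzD subrr mz0. Qed.
Lemma mz_adj n f g : inner (mz n f) g = inner f (mz (- n) g).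
Proof. by rewrite -(mz_inner n f) mzK. Qed.

Definition monomial n v : L2T E := scalar_field (chi n) v.

Lemma monomial_ae n v : {ae mu, forall t, monomial n v t = chi n t *: v}.
Proof. exact: scalar_field_ae (chi_bker R n). Qed.

Lemma monomial_linear n : linear (monomial n). Proof. exact: scalar_field_linear (chi_bker R n). Qed.

Lemma mz_monomial m n v : mz m (monomial n v) = monomial (m + n) v.
Proof.
apply/L2_eq/aeE; apply: filterS3 (mz_ae m (monomial n v)) (monomial_ae n v) (monomial_ae (m + n) v).
by move=> t -> -> ->; rewrite scalerA chiD.
Qed.

Lemma inner_fourier_coef_monomial n g v : inner (fourier_coef n g) v = inner g (monomial n v).
Proof.
rewrite inner_conj -(adjP (@sepHilbert_complete R E) (scalar_field_linear (chi_bker R n)) (scalar_field_bounded (chi_bker R n))).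
by rewrite -inner_conj.
Qed.

Lemma fourier_coef_mz n m f : fourier_coef n (mz m f) = fourier_coef (n - m) f.
Proof.
by apply: inner_ext => v; rewrite !inner_fourier_coef_monomial mz_adj mz_monomial addrC.
Qed.

Lemma inner_monomial m n (u v : E) : inner (monomial m u) (monomial n v) = (m == n)%:R * inner u v.
Proof.
rewrite inner_L2E.
have -> : cintegral mu (fun t => inner (monomial m u t) (monomial n v t)) =
    cintegral mu (fun t => inner u v * chi (m - n) t + 0).
  apply: ae_cintegral.
  - exact: (l2fun_measurable (@l2fun_wmeas _ _ _ mu _ (monomial m u)) (@l2fun_wmeas _ _ _ mu _ (monomial n v))).
  - apply: cmeasurableD; last exact: cmeasurable_cst.
    by apply: cmeasurableM; [exact: cmeasurable_cst|exact: chi_measurable].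
  apply: filterS2 (monomial_ae m u) (monomial_ae n v) => t -> -> _.
  by rewrite innerZl innerZr -chiN mulrA -chiD mulrC addr0.
rewrite cintegralP; last 2 first.
- by have := cintegrable_chi (m - n) (@cintegrable_one R); under eq_fun do rewrite mulr1.
- exact: cintegrable0.
by rewrite cintegral_chi cintegral0 addr0 mulrC subr_eq0.
Qed.

Lemma fourier_coef_monomial m n v : fourier_coef n (monomial m v) = (m == n)%:R *: v.
Proof. by apply: inner_ext => w; rewrite inner_fourier_coef_monomial inner_monomial innerZl. Qed.

Lemma L2_dense (S : set (L2T E)) : subsp S -> closed S -> (forall n v, S (monomial n v)) ->
  forall f, S f.
Proof.
move=> sS cS eS f.
have hS : hcomplete S by apply: (complete_closed (@L2_complete _ _ R mu E)).
have [y Sy yP] := projection f sS hS.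
suff /eqP : f - y = 0 by rewrite subr_eq0 => /eqP ->.
apply: L2_fourier_unique => n; apply: inner_ext => v.
by rewrite inner_fourier_coef_monomial yP// linear0l.
Qed.

End Shift.

(** * Separability from a countable total family *)

Section TotalSeparable.
Context (R : realType) (V : preHilbertType R) (I : countType) (e : I -> V).
Hypothesis cV : hcomplete [set: V].
Hypothesis te : forall x, (forall i, inner x (e i) = 0) -> x = 0.

Let q (c : rat * rat) : R[i] := ratr c.1 +i* ratr c.2.
Let comb (s : seq (I * (rat * rat))) : V := \sum_(p <- s) q p.2 *: e p.1.

Let rat_approx (a : R) (d : R) : 0 < d -> exists r : rat, `|ratr r - a| < d.
Proof.
move=> d0; have [|r] := @rat_in_itvoo R (a - d) (a + d).
  by rewrite ltrD2l; lra.
rewrite in_itv/= => /andP[h1 h2]; exists r.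
by rewrite ltr_norml; apply/andP; split; lra.
Qed.

Let q_approx (a : R[i]) (d : R) : 0 < d -> exists c, cmod (q c - a) < d.
Proof.
move=> d0; have d2 : 0 < d / 2 by rewrite divr_gt0.
have [r rP] := rat_approx (complex.Re a) d2; have [s sP] := rat_approx (complex.Im a) d2.
exists (r, s); apply: le_lt_trans (cmod_le_ReIm _) _.
by rewrite !raddfB/= [d](splitr d) ltrD.
Qed.

Let qM c d : exists c', q c * q d = q c'.
Proof.
exists (c.1 * d.1 - c.2 * d.2, c.1 * d.2 + c.2 * d.1); rewrite /q/=.
by rewrite rmorphB rmorphD !rmorphM.
Qed.

(* Finite combinations with rational coefficients are dense. *)
Lemma total_separable : exists s : nat -> V, hseparable s.
Proof.
pose S := range comb.
have S0 : S 0 by exists [::] => //; rewrite /comb big_nil.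
have SD x y : S x -> S y -> S (x + y).
  by move=> [s _ <-] [s' _ <-]; exists (s ++ s') => //; rewrite /comb big_cat.
have SZ c x : S x -> S (q c *: x).
  move=> [s _ <-]; have /choice[m mP] d := qM c d.
  exists [seq (p.1, m p.2) | p <- s] => //; rewrite /comb big_map/= scaler_sumr.
  by apply: eq_bigr => p _; rewrite scalerA mP.
have CD x y : closure S x -> closure S y -> closure S (x + y).
  move=> /closure_seq[u Su ux] /closure_seq[v Sv vy].
  by apply: seq_closure (hcvgD ux vy) => n; exact: SD.
have CZ a x : closure S x -> closure S (a *: x).
  move=> /closure_hn H; apply/closure_hn => d d0; have d2 : 0 < d / 2 by rewrite divr_gt0.
  have k0 : 0 < hn x + 1 by rewrite ltr_wpDl ?hn_ge0.
  have [c cP] := q_approx a (divr_gt0 d2 k0).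
  have c0 : 0 < cmod (q c) + 1 by rewrite ltr_wpDl ?cmod_ge0.
  have [y Sy yx] := H _ (divr_gt0 d2 c0).
  exists (q c *: y); first exact: SZ.
  apply: le_lt_trans (hn_tri (q c *: x) _ _) _.
  rewrite -scalerBr -scalerBl !hnZ [d](splitr d) ltrD//.
    apply: (@le_lt_trans _ _ ((cmod (q c) + 1) * hn (y - x))); first by rewrite ler_wpM2r ?hn_ge0// lerDl.
    by rewrite mulrC -ltr_pdivlMr.
  apply: (@le_lt_trans _ _ (cmod (q c - a) * (hn x + 1))); first by rewrite ler_wpM2l ?cmod_ge0// lerDl.
  by rewrite -ltr_pdivlMr.
have sC : subsp (closure S).
  by split; [exact: subset_closure|move=> a x y Sx Sy; apply: CD => //; exact: CZ].
have hC : hcomplete (closure S).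
  by apply: (complete_closed cV) => //; exact: closed_closure.
have eS i : closure S (e i).
  apply: subset_closure; exists [:: (i, (1, 0))] => //; rewrite /comb big_seq1 /q/=.
  by rewrite rmorph1 rmorph0 scale1r.
have CT x : closure S x.
  have [y Sy yP] := projection x sC hC.
  by have /eqP := te (fun i => yP _ (eS i)); rewrite subr_eq0 => /eqP ->.
exists (fun n => comb (odflt [::] (unpickle n))) => x d d0.
have [_ [s _ <-] sx] := (closure_hn S x).1 (CT x) _ d0.
by exists (pickle s); rewrite pickleK.
Qed.

End TotalSeparable.

Section HardySpace.
Context (R : realType) (E : sepHilbertType R).
Local Notation mu := (circle_measure R).
Implicit Types (f g : L2T E) (v : E) (a : nat -> E).

Definition poly_sum a N : L2T E := \sum_(n < N) monomial n%:Z (a n).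

Lemma fourier_coef_poly_sum a N (m : nat) : fourier_coef m%:Z (poly_sum a N) = if (m < N)%N then a m else 0.
Proof.
rewrite /poly_sum (op_sum (fourier_coef_linear m%:Z)).
under eq_bigr do rewrite fourier_coef_monomial eqz_nat.
case: ifPn => mN; last first.
  by rewrite big1// => i _; rewrite (_ : (i : nat) == m = false) ?scale0r//; apply: contraNF mN => /eqP <-.
rewrite (bigD1 (Ordinal mN))//= eqxx scale1r big1 ?addr0// => i im.
by rewrite (_ : (i : nat) == m = false) ?scale0r//; apply: contraNF im => /eqP im; apply/eqP/val_inj.
Qed.

Lemma fourier_coef_poly_sum_neg a N (m : nat) : fourier_coef (- m.+1%:Z) (poly_sum a N) = 0.
Proof.
rewrite /poly_sum (op_sum (fourier_coef_linear _)) big1// => n _; rewrite fourier_coef_monomial.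
by rewrite (_ : (n : nat)%:Z == - m.+1%:Z = false) ?scale0r//; apply/eqP; lia.
Qed.

Lemma poly_sumS a N : poly_sum a N.+1 = poly_sum a N + monomial N%:Z (a N).
Proof. by rewrite /poly_sum big_ord_recr. Qed.

Lemma inner_poly_sum a N g : inner (poly_sum a N) g = \sum_(n < N) inner (a n) (fourier_coef n%:Z g).
Proof.
rewrite /poly_sum inner_suml; apply: eq_bigr => n _.
by rewrite inner_conj -inner_fourier_coef_monomial -inner_conj.
Qed.

Lemma rdot_poly_sum a N : rdot (poly_sum a N) (poly_sum a N) = \sum_(n < N) rdot (a n) (a n).
Proof.
rewrite inner_poly_sum raddf_sum; apply: eq_bigr => n _.
by rewrite fourier_coef_poly_sum ltn_ord.
Qed.

Lemma rdot_poly_sum_sub a M N : rdot (poly_sum a (N + M) - poly_sum a N) (poly_sum a (N + M) - poly_sum a N) =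
  \sum_(n < N + M) rdot (a n) (a n) - \sum_(n < N) rdot (a n) (a n).
Proof.
rewrite rdotBB !rdot_poly_sum.
have -> : rdot (poly_sum a (N + M)) (poly_sum a N) = \sum_(n < N) rdot (a n) (a n).
  rewrite rdotC inner_poly_sum raddf_sum; apply: eq_bigr => n _.
  by rewrite fourier_coef_poly_sum (leq_trans (ltn_ord n)) ?leq_addr.
by lra.
Qed.

Lemma poly_sum_cauchy a (C : R) : (forall N, \sum_(n < N) rdot (a n) (a n) <= C) -> hcauchy (poly_sum a).
Proof.
move=> bC e e0; pose sg N := \sum_(n < N) rdot (a n) (a n).
have hs : has_sup (range sg) by split; [exists (sg 0%N), 0%N|exists C => _ [N _ <-]; exact: bC].
have e2 : 0 < (e / 2) ^+ 2 by rewrite exprn_gt0// divr_gt0.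
have [_ [N _ <-] HN] := sup_adherent e2 hs.
have sgle n : sg n <= sup (range sg) by apply: sup_upper_bound => //; exists n.
have key n : (N <= n)%N -> hn (poly_sum a n - poly_sum a N) < e / 2.
  move=> /subnKC <-; rewrite hn_lt ?divr_gt0// rdot_poly_sum_sub -/(sg _) -/(sg N).
  have := sgle (N + (n - N))%N; lra.
exists N => m n Nm Nn; apply: le_lt_trans (hn_tri (poly_sum a N) _ _) _.
rewrite [e](splitr e); apply: ltrD; first exact: key.
by rewrite (hnC (poly_sum a N)); exact: key.
Qed.

Lemma poly_sum_series a : series (fun n => L2of mu (fun t => circle_pt t ^+ n *: a n)) = poly_sum a.
Proof.
apply/funext => N; rewrite /series/= /poly_sum big_mkord; apply: eq_bigr => n _.
by rewrite /monomial /scalar_field; congr L2of; apply/funext => t; rewrite chi_nat.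
Qed.

Lemma series_cvg_bound a (C : R) : (forall N, \sum_(n < N) rdot (a n) (a n) <= C) ->
  cvgn (series (fun n => `|a n| ^+ 2)).
Proof.
move=> bC; pose sg N := \sum_(n < N) rdot (a n) (a n).
have cs : cvgn sg.
  apply: nondecreasing_is_cvgn.
    apply/nondecreasing_seqP => n; rewrite /sg big_ord_recr/= lerDl; exact: rdot_ge0.
  by exists C => _ [N _ <-]; exact: bC.
apply/cvg_ex; exists (limn sg)%:C; apply/cvgrPdist_lt => e /gt0_complex_real[{}e e0 ->].
have /cvgrPdist_lt/(_ _ e0) := cs; apply: filterS => N.
have -> : series (fun n => `|a n| ^+ 2) N = (sg N)%:C.
  rewrite /series/= big_mkord /sg rmorph_sum; apply: eq_bigr => n _.
  by rewrite norm_inner inner_rdot.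
by rewrite -rmorphB/= cmodE cmod_real ltcR.
Qed.

Lemma poly_sum_synthesis a (C : R) : (forall N, \sum_(n < N) rdot (a n) (a n) <= C) ->
  exists f, [/\ hcvg (poly_sum a) f, Hardy2 f, forall n : nat, fourier_coef n%:Z f = a n &
    forall n : nat, fourier_coef (- n.+1%:Z) f = 0].
Proof.
move=> bC; have [//|f _ af] := @L2_complete _ _ R mu E (poly_sum a) _ (poly_sum_cauchy bC).
have fcv n := hbounded_cvg (fourier_coef_linear n) (fourier_coef_bounded n) af.
exists f; split => // [|n|n].
- exists a; split; first exact: series_cvg_bound bC.
  by apply/cvgn_hn; rewrite poly_sum_series.
- apply: hcvg_unique (fcv n%:Z) _ => e e0; exists n.+1 => N nN.
  by rewrite /= fourier_coef_poly_sum nN subrr hn0.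
- apply: hcvg_unique (fcv (- n.+1%:Z)) _ => e e0; exists 0%N => N _.
  by rewrite /= fourier_coef_poly_sum_neg subrr hn0.
Qed.

Lemma L2_ext f g : (forall n, fourier_coef n f = fourier_coef n g) -> f = g.
Proof.
move=> H; apply/eqP; rewrite -subr_eq0; apply/eqP/L2_fourier_unique => n.
by rewrite (op_sub (fourier_coef_linear n)) H subrr.
Qed.

Lemma bessel f N : \sum_(n < N) rdot (fourier_coef n%:Z f) (fourier_coef n%:Z f) <= rdot f f.
Proof.
pose a (n : nat) := fourier_coef n%:Z f.
have := rdot_ge0 (f - poly_sum a N); rewrite rdotBB rdot_poly_sum.
have -> : rdot f (poly_sum a N) = \sum_(n < N) rdot (a n) (a n).
  by rewrite rdotC inner_poly_sum raddf_sum.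
by rewrite /a; lra.
Qed.

(** This trades the power series for a closed linear condition, stable under limits and under
    multiplication by z. *)
Lemma Hardy2P f : Hardy2 f <-> forall n : nat, fourier_coef (- n.+1%:Z) f = 0.
Proof.
split=> [[a [_ /cvgn_hn]]|H].
  rewrite poly_sum_series => af n.
  apply: hcvg_unique (hbounded_cvg (fourier_coef_linear _) (fourier_coef_bounded _) af) _ => e e0; exists 0%N => N _.
  by rewrite /= fourier_coef_poly_sum_neg subrr hn0.
have [g [_ gH g1 g2]] := poly_sum_synthesis (a := fun n => fourier_coef n%:Z f) (bessel f).
suff -> : f = g by [].
by apply: L2_ext => -[n|n]; [rewrite g1|rewrite NegzE g2 H].
Qed.

Lemma Hardy2_poly_sum f : Hardy2 f -> hcvg (poly_sum (fun n => fourier_coef n%:Z f)) f.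
Proof.
move=> /Hardy2P H; have [g [cg _ g1 g2]] := poly_sum_synthesis (a := fun n => fourier_coef n%:Z f) (bessel f).
have gf : g = f by apply: L2_ext => -[n|n]; [rewrite g1|rewrite NegzE g2 H].
by subst g.
Qed.

Lemma Hardy2_subsp : subsp (@Hardy2 R E).
Proof.
split; first by apply/Hardy2P => n; exact: op_zero (fourier_coef_linear _).
move=> c f g /Hardy2P Hf /Hardy2P Hg; apply/Hardy2P => n.
by rewrite fourier_coef_linear Hf Hg scaler0 addr0.
Qed.

Lemma Hardy2_closed : closed (@Hardy2 R E).
Proof.
apply/closed_hn => f H; apply/Hardy2P => n; apply: hn_eq0_small => e e0.
have [g /Hardy2P Hg fg] := H _ e0.
rewrite -[fourier_coef _ f]opprK hnN -[- fourier_coef _ f]add0r -(Hg n) -(op_sub (fourier_coef_linear _)).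
by apply: le_lt_trans (fourier_coef_bounded _ _) _; rewrite mul1r.
Qed.

Lemma Hardy2_complete : hcomplete (@Hardy2 R E).
Proof. exact: complete_closed (@L2_complete _ _ R mu E) _ Hardy2_closed. Qed.

Lemma Hardy2_monomial (n : nat) v : Hardy2 (monomial n%:Z v).
Proof.
by apply/Hardy2P => m; rewrite fourier_coef_monomial (_ : n%:Z == - m.+1%:Z = false) ?scale0r.
Qed.

Lemma Hardy2_mz (n : nat) f : Hardy2 f -> Hardy2 (mz n%:Z f).
Proof.
move=> /Hardy2P H; apply/Hardy2P => m; rewrite fourier_coef_mz.
by rewrite -opprD -PoszD addSn H.
Qed.

Lemma Hardy2_ind (S : set (L2T E)) : subsp S -> closed S ->
  (forall (n : nat) v, S (monomial n%:Z v)) -> forall f, Hardy2 f -> S f.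
Proof.
move=> sS cS eS f /Hardy2_poly_sum Hf; apply: (closed_seq cS _ Hf) => N.
by apply: subsp_sum => // n; exact: eS.
Qed.

End HardySpace.

(** * Boundary values of contractive analytic functions *)

Section RadialLimits.
Context (R : realType).
Local Notation mu := (circle_measure R).

Definition radial_cvg (V : preHilbertType R) (phi : R -> V) (l : V) :=
  forall e, 0 < e -> exists2 d, 0 < d & forall r, 1 - d < r < 1 -> hn (phi r - l) < e.

Definition radial_cauchy (V : preHilbertType R) (phi : R -> V) :=
  forall e, 0 < e -> exists2 d, 0 < d & forall r r', 1 - d < r < 1 -> 1 - d < r' < 1 ->
    hn (phi r - phi r') < e.

Lemma radial_cvg_lim (V : preHilbertType R) (phi : R -> V) l : radial_cvg phi l ->
  lim (phi r @[r --> (1 : R)^'-]) = l.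
Proof.
move=> H; apply: cvg_lim; first exact: norm_hausdorff.
apply/cvg_hn => e /H[d d0 dP].
have d1 : 1 - d < 1 :> R by rewrite ltrBlDr ltrDl.
near=> r; apply: dP; apply/andP; split; near: r; [exact: nbhs_left_gt|exact: nbhs_left_lt].
Unshelve. all: by end_near. Qed.

Lemma radial_cvg_unique (V : preHilbertType R) (phi : R -> V) l l' : radial_cvg phi l -> radial_cvg phi l' -> l = l'.
Proof. by move=> /radial_cvg_lim <- /radial_cvg_lim <-. Qed.

Lemma radial_lt (n : nat) : 0 <= (1 - n.+1%:R^-1 : R) < 1.
Proof.
by rewrite subr_ge0 invf_le1// ler1n/= ltrBlDr ltrDl invr_gt0.
Qed.

Lemma radial_cauchy_rcvg (V : preHilbertType R) (phi : R -> V) : hcomplete [set: V] ->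
  radial_cauchy phi -> exists l, radial_cvg phi l.
Proof.
move=> cV cphi; pose u n := phi (1 - n.+1%:R^-1).
have win (d : R) : 0 < d -> exists N, forall n, (N <= n)%N -> 1 - d < (1 - n.+1%:R^-1 : R) < 1.
  move=> /inv_nat_lt[N HN]; exists N => n /HN nd.
  apply/andP; split; last by case/andP: (radial_lt n).
  by move: nd; rewrite ltrD2l ltrN2.
have [//||l _ ul] := cV u.
  move=> e /cphi[d /win[N HN] dP]; exists N => m n Nm Nn.
  by apply: dP; exact: HN.
exists l => e e0; have e2 : 0 < e / 2 by rewrite divr_gt0.
have [d d0 dP] := cphi _ e2; have [N HN] := win _ d0; have [M HM] := ul _ e2.
exists d => // r rd; apply: le_lt_trans (hn_tri (u (maxn N M)) _ _) _.
rewrite [e](splitr e); apply: ltrD; last by apply: HM; rewrite leq_maxr.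
by apply: dP => //; apply: HN; rewrite leq_maxl.
Qed.

Lemma radial_cvg_rcauchy (V : preHilbertType R) (phi : R -> V) l : radial_cvg phi l -> radial_cauchy phi.
Proof.
move=> H e e0; have [|d d0 dP] := H (e / 2); first by rewrite divr_gt0.
exists d => // r r' rd rd'; apply: le_lt_trans (hn_tri l _ _) _.
rewrite [e](splitr e); apply: ltrD; first exact: dP.
by rewrite hnC; exact: dP.
Qed.

Lemma radial_window (d : R) : 0 < d -> exists2 d', 0 < d' &
  forall r, 1 - d' < r < 1 -> 1 - d < r < 1 /\ 0 <= r < 1.
Proof.
move=> d0; exists (Num.min d 1); first by rewrite lt_min d0 ltr01.
have m1 : Num.min d 1 <= d by rewrite ge_min lexx.
have m2 : Num.min d 1 <= 1 by rewrite ge_min lexx orbT.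
by move=> r /andP[dr ->]; rewrite !andbT; split; lra.
Qed.

(** The maps [Phi r] are contractions, so replacing [x] by a nearby [s n] costs at most [e / 3]
    uniformly in [r]. *)
Lemma radial_cvg_dense (E F : sepHilbertType R) (Phi : R -> E -> F) (s : nat -> E) :
  (forall r, 0 <= r < 1 -> linear (Phi r) /\ hbounded 1 (Phi r)) -> hseparable s ->
  (forall n, exists l, radial_cvg (Phi^~ (s n)) l) -> forall x, exists l, radial_cvg (Phi^~ x) l.
Proof.
move=> lb sd H x; apply: radial_cauchy_rcvg; first exact: sepHilbert_complete.
move=> e e0; have e3 : 0 < e / 3 by rewrite divr_gt0.
have [n sn] := sd x _ e3; have [l /radial_cvg_rcauchy/(_ _ e3)[d d0 dP]] := H n.
have [d' d'0 d'P] := radial_window d0; exists d' => // r r' /d'P[rd r01] /d'P[rd' r01'].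
have key r0 : 0 <= r0 < 1 -> hn (Phi r0 x - Phi r0 (s n)) < e / 3.
  move=> /lb[lr br]; rewrite -(op_sub lr); apply: le_lt_trans (br _) _.
  by rewrite mul1r hnC.
have h1 := key _ r01; have h2 := key _ r01'; have h3 := dP _ _ rd rd'.
apply: le_lt_trans (hn_tri (Phi r (s n)) _ _) _.
have h4 := hn_tri (Phi r' (s n)) (Phi r (s n)) (Phi r' x).
by rewrite hnC in h2; lra.
Qed.

Lemma radial_cvgP (V : preHilbertType R) (phi psi : R -> V) (a : R[i]) l m : radial_cvg phi l -> radial_cvg psi m ->
  radial_cvg (fun r => a *: phi r + psi r) (a *: l + m).
Proof.
move=> H K e e0; have k0 : 0 < cmod a + 1 by rewrite ltr_wpDl ?cmod_ge0.
have e2 : 0 < e / 2 by rewrite divr_gt0.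
have [d d0 dP] := H _ (divr_gt0 e2 k0); have [d' d'0 d'P] := K _ e2.
exists (Num.min d d'); first by rewrite lt_min d0.
move=> r /andP[dr r1].
have m1 : Num.min d d' <= d by rewrite ge_min lexx.
have m2 : Num.min d d' <= d' by rewrite ge_min lexx orbT.
have h1 : hn (phi r - l) < e / 2 / (cmod a + 1) by apply: dP; rewrite r1 andbT; lra.
have h2 : hn (psi r - m) < e / 2 by apply: d'P; rewrite r1 andbT; lra.
rewrite opprD addrACA -scalerBr; apply: le_lt_trans (hnD _ _) _.
rewrite hnZ [e](splitr e); apply: ltrD => //.
apply: (@le_lt_trans _ _ ((cmod a + 1) * hn (phi r - l))).
  by rewrite ler_wpM2r ?hn_ge0// lerDl.
by rewrite mulrC -ltr_pdivlMr.
Qed.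

Lemma radial_cvg_hn_le (V : preHilbertType R) (phi : R -> V) l (c : R) : radial_cvg phi l ->
  (forall r, 0 <= r < 1 -> hn (phi r) <= c) -> hn l <= c.
Proof.
move=> H b; apply/ler_addgt0Pr => e /H[d /radial_window[d' d'0 d'P] dP].
have d2 : 1 - d' < 1 - d' / 2 < 1 by apply/andP; split; lra.
have [rd r01] := d'P _ d2; have := dP _ rd => h1; have := b _ r01 => h2.
have := hn_tri (phi (1 - d' / 2)) l 0; rewrite !subr0 hnC; lra.
Qed.

(** For one vector the radial limit exists off a null set depending on that vector. A dense sequence
    gives a single null set, off which the limits exist for all vectors by contractivity; there the
    limit is linear and contractive as well. *)
Lemma pois_field (E F : sepHilbertType R) (Phi : R -> R -> E -> F) (T : E -> L2T F) :
  (forall t r, 0 <= r < 1 -> linear (Phi t r) /\ hbounded 1 (Phi t r)) ->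
  (forall t r x, 0 <= r < 1 -> Phi t r x = poisson_ext r t (T x)) ->
  let beta t x := lim (Phi t r x @[r --> (1 : R)^'-]) in
  [/\ cfield mu 1 beta, forall x, {ae mu, forall t, beta t x = T x t} &
    {ae mu, forall t, forall x, radial_cvg (Phi t ^~ x) (beta t x)}].
Proof.
move=> lb PT beta.
have TP x : {ae mu, forall t, radial_cvg (Phi t ^~ x) (T x t)}.
  apply: filterS (vector_fatou (T x)) => t H e /H[d /radial_window[d' d'0 d'P] dP].
  by exists d' => // r /d'P[rd r01]; rewrite PT//; exact: dP.
have bT x : {ae mu, forall t, beta t x = T x t}.
  by apply: filterS (TP x) => t /radial_cvg_lim.
have [s sd] := dense_seq E.
have bP : {ae mu, forall t, forall x, radial_cvg (Phi t ^~ x) (beta t x)}.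
  have /ae_foralln := fun n => TP (s n); apply: filterS => t tP x.
  have [|l lP] := radial_cvg_dense (lb t) sd _ x; first by move=> n; exists (T (s n) t).
  by rewrite /beta (radial_cvg_lim lP).
split=> //; split.
  apply: filterS bP => t tP; split=> [a x y|x].
    apply: (radial_cvg_unique (tP _)) => e /(radial_cvgP a (tP x) (tP y))[d /radial_window[d' d'0 d'P] dP].
    by exists d' => // r /d'P[rd /(lb t)[lr _]]; rewrite lr; exact: dP.
  by apply: (radial_cvg_hn_le (tP x)) => r /(lb t)[_]; exact.
move=> x; exists (T x : R -> F); first exact: l2fun_wmeas.
exact: bT.
Qed.

(** The classes [T x] come with unrelated representatives, not linear in [x] at a given point. The
    Poisson extensions are linear in [x] for all [r] and [t], and their radial limits are
    representatives that keep this linearity. *)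
Lemma field_of_map (E F : sepHilbertType R) (T : E -> L2T F) : linear T ->
  (forall x, {ae mu, forall t, hn (T x t) <= hn x}) ->
  exists2 beta, cfield mu 1 beta & forall x, {ae mu, forall t, beta t x = T x t}.
Proof.
move=> lT bT.
have [||cb bTx _] := @pois_field E F (fun t r x => poisson_ext r t (T x)) T; last 2 first.
- by [].
- by eexists; [exact: cb|exact: bTx].
move=> t r r01; split=> [a x y|x]; first by rewrite lT (poisson_ext_linear t r01).
by rewrite mul1r; apply: poisson_ext_le => //; exact: hn_ge0.
Qed.

End RadialLimits.

Section AnalyticFunctions.
Context (R : realType) (E F : sepHilbertType R).
Local Notation mu := (circle_measure R).

Lemma poisson_ext_Hardy (f : L2T F) (r t : R) : 0 <= r < 1 -> Hardy2 f ->
  hcvg (fun N => \sum_(n < N) (r%:C * circle_pt t) ^+ n *: fourier_coef n%:Z f) (poisson_ext r t f).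
Proof.
move=> r01 /Hardy2P H e /(poisson_ext_cvg t f r01)[N HN]; exists N => n /HN.
by rewrite /poisson_ext_sum [X in _ + X - _]big1 ?addr0// => i _; rewrite H scaler0.
Qed.

Lemma geometric_bound (q : R) N : 0 <= q < 1 -> \sum_(n < N) q ^+ n <= (1 - q)^-1.
Proof.
move=> /andP[q0 q1]; have d0 : 0 < 1 - q by rewrite subr_gt0.
rewrite -(ler_pM2r d0) mulVf ?gt_eqF// mulrC.
have := subrXX 1 q N; rewrite expr1n; under eq_bigr do rewrite expr1n mul1r.
by move=> <-; rewrite gerBl exprn_ge0.
Qed.

Lemma coeff_bound (A : nat -> F) (r : R) : 0 <= r < 1 ->
  (forall rho : R, 0 <= rho < 1 -> exists l, hcvg (fun N => \sum_(n < N) rho%:C ^+ n *: A n) l) ->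
  exists B, forall N, \sum_(n < N) rdot (r%:C ^+ n *: A n) (r%:C ^+ n *: A n) <= B.
Proof.
(* Any radius strictly between [r] and 1 would do: convergence at [rho] bounds the terms
   [rho ^+ n * hn (A n)], and a geometric series in [r / rho] remains. *)
move=> /andP[r0 r1] H; pose rho := (1 + r) / 2.
have rho1 : 0 <= rho < 1 by rewrite /rho; apply/andP; split; lra.
have rr : r < rho by rewrite /rho; lra.
have rho0 : 0 < rho by exact: le_lt_trans rr.
have [l /hcvg_cauchy cl] := H _ rho1; have [N HN] := cl 1 ltr01.
pose t n := rho ^+ n * hn (A n).
have t1 n : (N <= n)%N -> t n <= 1.
  move=> Nn; have := HN n.+1 n (leqW Nn) Nn.
  rewrite big_ord_recr/= addrAC subrr add0r hnZ cmodX cmod_real ger0_norm ?(ltW rho0)//.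
  exact: ltW.
have t0 n : 0 <= t n by rewrite mulr_ge0 ?exprn_ge0 ?(ltW rho0) ?hn_ge0.
pose B := 1 + \sum_(n < N) t n.
have tB n : t n <= B.
  have [nN|Nn] := ltnP n N.
    rewrite /B (bigD1 (Ordinal nN))//= addrCA lerDl addr_ge0//.
    by apply: sumr_ge0 => i _.
  by apply: le_trans (t1 _ Nn) _; rewrite /B lerDl; apply: sumr_ge0 => i _.
have q0 : 0 <= r / rho by rewrite divr_ge0// ltW.
pose q := (r / rho) ^+ 2.
have q1 : 0 <= q < 1.
  apply/andP; split; first exact: sqr_ge0.
  have q' : r / rho < 1 by rewrite ltr_pdivrMr// mul1r.
  by rewrite /q expr2 mulr_ilt1.
exists (B ^+ 2 * (1 - q)^-1) => M.
apply: (@le_trans _ _ (\sum_(n < M) B ^+ 2 * q ^+ n)); last first.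
  by rewrite -mulr_sumr ler_wpM2l ?sqr_ge0// geometric_bound.
apply: ler_sum => n _; rewrite -hn_sqr hnZ cmodX cmod_real ger0_norm//.
have -> : r ^+ n * hn (A n) = (r / rho) ^+ n * t n.
  by rewrite /t mulrA -exprMn divfK ?gt_eqF.
rewrite exprMn mulrC /q -!exprM mulnC; apply: ler_wpM2r; first exact: exprn_ge0.
by rewrite ler_pXn2r ?nnegrE// (le_trans (t0 n)).
Qed.

Lemma poly_sum_ae (a : nat -> F) N : {ae mu, forall t, poly_sum a N t = \sum_(n < N) chi n%:Z t *: a n}.
Proof.
elim: N => [|N IH].
  rewrite /poly_sum big_ord0; have := L2Z_ae 0 (0 : L2T F); rewrite scale0r.
  by apply: filterS => t ->; rewrite scale0r big_ord0.
rewrite poly_sumS; apply: filterS3 IH (L2D_ae (poly_sum a N) (monomial N%:Z (a N))) (monomial_ae N%:Z (a N)).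
by move=> t aN -> ->; rewrite aN big_ord_recr.
Qed.

(** On the circle of radius [r] the function is bounded by the norm of [x], so Bessel's inequality
    bounds the sum of [r ^+ (2 n)] times the squared norms of the coefficients. Letting [r] tend to
    1 makes the coefficients square summable, and they define [T x] in the Hardy space. *)
Lemma analytic_trace (Th : R[i] -> {linear E -> F}) : contractive_analytic Th ->
  exists T : E -> L2T F, [/\ linear T, forall x, Hardy2 (T x) &
    forall t r x, 0 <= r < 1 -> Th (r%:C * circle_pt t) x = poisson_ext r t (T x)].
Proof.
move=> [[A [cA AT]] cT].
have zl (r t : R) : 0 <= r < 1 -> `|r%:C * circle_pt t| < 1.
  move=> /andP[r0 r1]; rewrite cmodE cmodM cmod_circle_pt mulr1 cmod_real ger0_norm//.
  by rewrite ltcR.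
have Acv z x : `|z| < 1 -> hcvg (fun N => \sum_(n < N) z ^+ n *: A n x) (Th z x).
  move=> /(AT z x) /cvgn_hn H e /H[N HN]; exists N => n /HN.
  by rewrite /series/= big_mkord.
have bnd x N : \sum_(n < N) rdot (A n x) (A n x) <= rdot x x.
  have key r : 0 <= r < 1 -> \sum_(n < N) (r ^+ 2) ^+ n * rdot (A n x) (A n x) <= rdot x x.
    move=> r01; have /andP[r0 r1] := r01.
    pose a n := r%:C ^+ n *: A n x.
    have [|B BP] := @coeff_bound (A^~ x) r r01.
      by move=> rho rho01; exists (Th rho%:C x); apply: Acv; have := zl rho 0 rho01; rewrite circle_pt0 mulr1.
    (* As an element of L2, [f] is the function [t] |-> [Th (r%:C * circle_pt t) x], identified
       below along an almost everywhere convergent subsequence. *)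
    have [f [af _ fa _]] := poly_sum_synthesis (a := a) BP.
    have [phi pn phiP] := ae_subseq af.
    have /ae_foralln hs : forall n, {ae mu, forall t, poly_sum a (phi n) t = \sum_(k < phi n) chi k%:Z t *: a k}.
      by move=> n; exact: poly_sum_ae.
    have fx : {ae mu, forall t, rdot (f t) (f t) <= rdot x x}.
      apply: filterS2 hs phiP => t ht pt.
      have -> : f t = Th (r%:C * circle_pt t) x.
        apply: (hcvg_unique pt) => e /(hcvg_sub pn (Acv _ x (zl r t r01)))[M HM].
        exists M => n /HM /=; rewrite ht.
        suff -> : \sum_(k < phi n) chi k t *: a k = \sum_(k < phi n) (r%:C * circle_pt t) ^+ k *: A k x by [].
        by apply: eq_bigr => k _; rewrite scalerA chi_nat exprMn mulrC.
      have := cT _ (zl r t r01) x; rewrite !hnE lecR -!hn_sqr => h.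
      by rewrite ler_pXn2r ?nnegrE ?hn_ge0.
    apply: (@le_trans _ _ (rdot f f)).
      apply: le_trans (bessel f N); apply: ler_sum => n _; rewrite fa /a.
      by rewrite -!hn_sqr hnZ cmodX cmod_real ger0_norm// [leRHS]exprMn exprAC.
    apply: le_trans (L2_rdot_le (circle_integrable_cst _) fx) _.
    by rewrite Rintegral_cst//= circle_measureT mulr1.
  (* The left side is polynomial in [r], so the bound extends to [r = 1]. *)
  pose p (r : R) := \sum_(n < N) (r ^+ 2) ^+ n * rdot (A n x) (A n x).
  have pc : continuous p.
    have -> : p = (horner (\poly_(n < N) rdot (A n x) (A n x))) \o (fun r : R => r ^+ 2).
      by apply/funext => r; rewrite /p /= horner_poly; apply: eq_bigr => n _; rewrite mulrC.
    move=> r; apply: continuous_comp; [exact: exprn_continuous|exact: continuous_horner].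
  have -> : \sum_(n < N) rdot (A n x) (A n x) = p 1.
    by apply: eq_bigr => n _; rewrite !expr1n mul1r.
  apply: (cvgr_to_le (cvg_at_left_filter (pc 1))).
  near=> r; apply: key; apply/andP; split; first by apply: ltW; near: r; exact: nbhs_left_gt.
  by near: r; exact: nbhs_left_lt.
have Tx x := poly_sum_synthesis (a := A^~ x) (bnd x).
have [T TP] := choice Tx; exists T; split=> [a x y|x|t r x r01].
- apply: L2_ext => -[n|n]; have [_ _ h1 h2] := TP (a *: x + y);
    have [_ _ hx1 hx2] := TP x; have [_ _ hy1 hy2] := TP y.
    by rewrite fourier_coef_linear h1 hx1 hy1 linearP.
  by rewrite NegzE fourier_coef_linear h2 hx2 hy2 scaler0 addr0.
- by have [] := TP x.
- have [_ HT h1 _] := TP x; apply: (hcvg_unique (Acv _ x (zl r t r01))).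
  have := poisson_ext_Hardy t r01 HT; rewrite (_ : (fun N => _) = (fun N => \sum_(n < N) (r%:C * circle_pt t) ^+ n *: A n x))//.
  by apply/funext => N; apply: eq_bigr => n _; rewrite h1.
Unshelve. all: by end_near. Qed.

Lemma circle_polar (z : R[i]) : `|z| < 1 -> exists r t, 0 <= r < 1 /\ z = r%:C * circle_pt t.
Proof.
move=> z1; have r1 : cmod z < 1 by move: z1; rewrite cmodE ltcR.
have [z0|zN0] := eqVneq (cmod z) 0.
  by exists 0, 0; rewrite lexx ltr01; split=> //; rewrite mul0r; exact/cmod_eq0.
have r0 : 0 < cmod z by rewrite lt_def zN0 cmod_ge0.
set r := cmod z in r1 zN0 r0 *.
have zz : complex.Re z ^+ 2 + complex.Im z ^+ 2 = r ^+ 2.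
  by rewrite /r /cmod; case: (z) => a b /=; rewrite sqr_sqrtr// addr_ge0// sqr_ge0.
pose c := complex.Re z / r; pose s := complex.Im z / r.
have cs : c ^+ 2 + s ^+ 2 = 1.
  by rewrite /c /s !expr_div_n -mulrDl zz divff// expf_neq0.
have c1 : -1 <= c <= 1.
  rewrite -ler_norml -(@ler_pXn2r _ 2)// ?nnegrE// expr1n real_normK ?num_real// -cs.
  by rewrite lerDl sqr_ge0.
pose th := if 0 <= s then acos c else - acos c.
have cth : cos th = c.
  by rewrite /th; case: ifP => _; rewrite ?cosN acosK// in_itv.
have sth : sin th = s.
  have sac : sin (acos c) = `|s| by rewrite sin_acos// -cs addrAC subrr add0r sqrtr_sqr.
  rewrite /th; case: ifP => [s0|/negbT]; first by rewrite sac ger0_norm.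
  by rewrite -ltNge => s0; rewrite sinN sac ltr0_norm// opprK.
exists r, (th / (2 * pi)); split; first by rewrite ltW.
have pi0 : 2 * pi != 0 :> R by rewrite mulf_neq0// gt_eqF// pi_gt0.
rewrite /circle_pt [2 * pi * _]mulrC divfK// cth sth /c /s.
by case: (z) => a b; apply/eqP; rewrite eq_complex/= !mul0r subr0 addr0 ![r * _]mulrC !divfK// !eqxx.
Qed.

Lemma linear_pack (U V : lmodType R[i]) (f : U -> V) : linear f -> exists g : {linear U -> V}, g = f :> (U -> V).
Proof.
by move=> lf; pose g : {linear U -> V} := HB.pack f (GRing.isLinear.Build _ _ _ _ f lf); exists g.
Qed.

Lemma analytic_of (T : E -> L2T F) : linear T -> (forall x, Hardy2 (T x)) ->
  (forall x, {ae mu, forall t, hn (T x t) <= hn x}) ->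
  exists2 Th : R[i] -> {linear E -> F}, contractive_analytic Th &
    forall t r x, 0 <= r < 1 -> Th (r%:C * circle_pt t) x = poisson_ext r t (T x).
Proof.
move=> lT HT bT.
(* The value 0 off the disk keeps [f z] linear for every [z], as the type of [Th] requires. *)
pose f z x := if `|z| < 1 then xget 0 [set l | hcvg (fun N => \sum_(n < N) z ^+ n *: fourier_coef n%:Z (T x)) l] else 0.
have zl (r t : R) : 0 <= r < 1 -> `|r%:C * circle_pt t| < 1.
  move=> /andP[r0 r1]; rewrite cmodE cmodM cmod_circle_pt mulr1 cmod_real ger0_norm//.
  by rewrite ltcR.
have fP t r x : 0 <= r < 1 -> f (r%:C * circle_pt t) x = poisson_ext r t (T x).
  move=> r01; rewrite /f zl//.
  have H := poisson_ext_Hardy t r01 (HT x).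
  by case: xgetP => [l _ /hcvg_unique/(_ H)//|/(_ _ H)].
have lf z : linear (f z).
  have [/[dup] z1 /circle_polar[r [t [r01 zE]]]|z1] := boolP (`|z| < 1); last first.
    by move=> a x y; rewrite /f (negbTE z1) scaler0 addr0.
  by subst z => a x y; rewrite !fP// lT poisson_ext_linear.
have [Th ThE] := choice (fun z => linear_pack (lf z)).
have lA n : linear (fun x => fourier_coef n (T x)) by move=> a x y; rewrite lT fourier_coef_linear.
have bA n : hbounded 1 (fun x => fourier_coef n (T x)).
  move=> x; apply: le_trans (fourier_coef_bounded n _) _; rewrite !mul1r hn_le_sqr ?hn_ge0//.
  have /(L2_rdot_le (circle_integrable_cst _)) : {ae mu, forall t, rdot (T x t) (T x t) <= rdot x x}.
    by apply: filterS (bT x) => t; rewrite -!hn_sqr => h; rewrite ler_pXn2r ?nnegrE ?hn_ge0.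
  by rewrite Rintegral_cst//= circle_measureT mulr1 hn_sqr.
have [A AE] := choice (fun n : nat => linear_pack (lA n%:Z)).
exists Th; last by move=> t r x r01; rewrite ThE fP.
split; last first.
  move=> z /circle_polar[r [t [r01 ->]]]; apply/contractiveE => x.
  by rewrite ThE fP// mul1r; apply: poisson_ext_le => //; exact: hn_ge0.
exists A; split=> [n|z x /circle_polar[r [t [r01 ->]]]].
  by rewrite AE; exact: hbounded_continuous (lA _) (bA _).
apply/cvgn_hn; rewrite ThE fP//; have := poisson_ext_Hardy t r01 (HT x).
rewrite (_ : (fun N => _) = series (fun n => (r%:C * circle_pt t) ^+ n *: A n x))//.
by apply/funext => N; rewrite /series/= big_mkord; apply: eq_bigr => n _; rewrite AE.
Qed.

End AnalyticFunctions.

Section BoundaryValues.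
Context (R : realType).
Local Notation mu := (circle_measure R).
Implicit Types E F V : sepHilbertType R.

Lemma bdryP E F (Th : R[i] -> {linear E -> F}) : contractive_analytic Th ->
  exists T : E -> L2T F, [/\ linear T, forall x, Hardy2 (T x),
    forall t r x, 0 <= r < 1 -> Th (r%:C * circle_pt t) x = poisson_ext r t (T x) &
    [/\ cfield mu 1 (bdry Th), forall x, {ae mu, forall t, bdry Th t x = T x t} &
    {ae mu, forall t, forall x, radial_cvg (fun r => Th (r%:C * circle_pt t) x) (bdry Th t x)}]].
Proof.
move=> /[dup] cTh [_ bTh] ; have [T [lT HT TP]] := analytic_trace cTh; exists T; split=> //.
apply: pois_field => // t r r01; split; first exact: linearP.
apply/contractiveE; apply: bTh; move: r01 => /andP[r0 r1].
by rewrite cmodE cmodM cmod_circle_pt mulr1 cmod_real ger0_norm// ltcR.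
Qed.

Lemma bdry_field E F (Th : R[i] -> {linear E -> F}) : contractive_analytic Th -> cfield mu 1 (bdry Th).
Proof. by move=> /bdryP[T [_ _ _ []]]. Qed.

Lemma mulop_mz E F C (A : R -> E -> F) n f : 0 <= C -> cfield mu C A ->
  mulop A (mz n f) = mz n (mulop A f).
Proof.
move=> C0 cA; apply/L2_eq/aeE; have hA := mulop_ae C0 cA; have [lb _] := cA.
apply: filterS3 (hA (mz n f)) (hA f) (filterI lb (filterI (mz_ae n f) (mz_ae n (mulop A f)))).
by move=> t -> hf [[lA _] [-> ->]]; rewrite (op_scale lA) hf.
Qed.

Lemma closed_preimage (U V : preHilbertType R) C (A : U -> V) (S : set V) : linear A ->
  hbounded C A -> closed S -> closed (A @^-1` S).
Proof.
move=> lA bA cS x /closure_seq[u Su ux]; apply: closed_seq cS Su _; exact: hbounded_cvg lA bA ux.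
Qed.

Lemma subsp_preimage (U V : preHilbertType R) (A : U -> V) (S : set V) : linear A ->
  subsp S -> subsp (A @^-1` S).
Proof.
by move=> lA [S0 SP]; split=> [|a x y Sx Sy] /=; rewrite ?(op_zero lA) ?lA//; exact: SP.
Qed.

Lemma mulop_bdry_monomial0 E F (Th : R[i] -> {linear E -> F}) (T : E -> L2T F) v : contractive_analytic Th ->
  {ae mu, forall t, bdry Th t v = T v t} -> mulop (bdry Th) (monomial 0 v) = T v.
Proof.
move=> cTh bT; apply/L2_eq/aeE.
apply: filterS3 (mulop_ae ler01 (bdry_field cTh) (monomial 0 v)) (monomial_ae 0 v) bT => t -> -> <-.
by rewrite chi0 scale1r.
Qed.

Lemma bdry_Hardy E F (Th : R[i] -> {linear E -> F}) f : contractive_analytic Th ->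
  Hardy2 f -> Hardy2 (mulop (bdry Th) f).
Proof.
move=> cTh; have cf := bdry_field cTh; have lm := mulop_linear ler01 cf.
apply: (Hardy2_ind (S := mulop (bdry Th) @^-1` @Hardy2 R F)).
- exact: (subsp_preimage lm (@Hardy2_subsp R F)).
- exact: (closed_preimage lm (mulop_bounded ler01 cf) (@Hardy2_closed R F)).
move=> n v /=; have [T [_ HT _ [_ bT _]]] := bdryP cTh.
have -> : monomial n%:Z v = mz n%:Z (monomial 0 v) by rewrite mz_monomial addr0.
rewrite (mulop_mz _ _ ler01 cf); apply: Hardy2_mz.
rewrite (mulop_bdry_monomial0 cTh (bT v)); exact: HT.
Qed.

Lemma zlt (r t : R) : 0 <= r < 1 -> `|r%:C * circle_pt t| < 1.
Proof.
move=> /andP[r0 r1]; rewrite cmodE cmodM cmod_circle_pt mulr1 cmod_real ger0_norm//.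
by rewrite ltcR.
Qed.

Lemma poisson_ext_bounded E r t : 0 <= r < 1 -> exists C, hbounded C (fun f : L2T E => poisson_ext r t f).
Proof. by move=> r01; eexists; exact: kernel_average_bounded (poisson_bker t r01). Qed.

Lemma poisson_ext_mz1 E (r t : R) (g : L2T E) : 0 <= r < 1 -> Hardy2 g ->
  poisson_ext r t (mz 1 g) = (r%:C * circle_pt t) *: poisson_ext r t g.
Proof.
move=> r01 Hg; have H1 := poisson_ext_Hardy t r01 (Hardy2_mz 1 Hg).
apply: (hcvg_unique (hcvg_sub (phi := S) (fun n => leqnSn n) H1)).
have : hcvg (fun N => (r%:C * circle_pt t) *: \sum_(n < N) (r%:C * circle_pt t) ^+ n *: fourier_coef n g)
    ((r%:C * circle_pt t) *: poisson_ext r t g).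
  have := hcvgP (r%:C * circle_pt t) (poisson_ext_Hardy t r01 Hg) (hcvg_cst 0).
  by rewrite addr0; under [X in hcvg X]eq_fun do rewrite addr0.
rewrite (_ : (fun N => _ *: _) = (fun N => \sum_(n < N) (r%:C * circle_pt t) ^+ n *: fourier_coef n (mz 1 g)) \o S)//.
apply/funext => N /=; rewrite big_ord_recl fourier_coef_mz sub0r.
have /Hardy2P/(_ 0%N) -> := Hg; rewrite scaler0 add0r scaler_sumr; apply: eq_bigr => n _.
by rewrite fourier_coef_mz scalerA -exprS lift0 -addn1 PoszD addrK.
Qed.

Lemma poisson_ext_mz E (r t : R) (g : L2T E) (n : nat) : 0 <= r < 1 -> Hardy2 g ->
  poisson_ext r t (mz n%:Z g) = (r%:C * circle_pt t) ^+ n *: poisson_ext r t g.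
Proof.
move=> r01 Hg; elim: n => [|n IH]; first by rewrite mz0 expr0 scale1r.
have -> : mz n.+1%:Z g = mz 1 (mz n%:Z g) by rewrite mzD -PoszD.
by rewrite poisson_ext_mz1 ?IH ?scalerA ?exprS//; exact: Hardy2_mz.
Qed.

Lemma poisson_ext_monomial0 E (r t : R) (v : E) : 0 <= r < 1 -> poisson_ext r t (monomial 0 v) = v.
Proof.
move=> r01; have H1 := poisson_ext_Hardy t r01 (Hardy2_monomial 0 v).
apply: (hcvg_unique (hcvg_sub (phi := S) (fun n => leqnSn n) H1)).
rewrite (_ : _ \o S = fun=> v); first exact: hcvg_cst.
apply/funext => N /=; rewrite big_ord_recl fourier_coef_monomial expr0 !scale1r big1 ?addr0// => n _.
by rewrite fourier_coef_monomial lift0 scale0r scaler0.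
Qed.

Lemma analytic_bounded E F (Th : R[i] -> {linear E -> F}) (r t : R) : contractive_analytic Th ->
  0 <= r < 1 -> linear (Th (r%:C * circle_pt t)) /\ hbounded 1 (Th (r%:C * circle_pt t)).
Proof.
move=> [_ bTh] r01; split; first exact: linearP.
by apply/contractiveE; apply: bTh; exact: zlt.
Qed.

(** On the Hardy space the Poisson extension is evaluation of the power series, hence turns
    multiplication by z into a scalar factor; constants and continuity do the rest. It carries a
    factorization of boundary values into the disk. *)
Lemma poisson_ext_mulop E F (Th : R[i] -> {linear E -> F}) (r t : R) f : contractive_analytic Th ->
  0 <= r < 1 -> Hardy2 f -> poisson_ext r t (mulop (bdry Th) f) = Th (r%:C * circle_pt t) (poisson_ext r t f).
Proof.
move=> cTh r01; have cf := bdry_field cTh; have lm := mulop_linear ler01 cf.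
have bm := mulop_bounded ler01 cf; have [lT bT] := analytic_bounded t cTh r01.
have [C bp] := poisson_ext_bounded E t r01; have [C' bp'] := poisson_ext_bounded F t r01.
have lp := @poisson_ext_linear _ E r t r01; have lp' := @poisson_ext_linear _ F r t r01.
pose S := [set f | poisson_ext r t (mulop (bdry Th) f) = Th (r%:C * circle_pt t) (poisson_ext r t f)].
apply: (Hardy2_ind (S := S)) => [||n v].
- split=> [|a x y]; rewrite /S/=; first by rewrite (op_zero lm) (op_zero lp) (op_zero lp') (op_zero lT).
  by move=> xS yS; rewrite lm lp lp' lT xS yS.
- move=> x /closure_seq[u Su ux]; rewrite /S/=.
  apply: (hcvg_unique (hbounded_cvg lp' bp' (hbounded_cvg lm bm ux))).
  have := hbounded_cvg lT bT (hbounded_cvg lp bp ux).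
  rewrite (_ : _ \o _ = poisson_ext r t \o (mulop (bdry Th) \o u))//.
  by apply/funext => n; rewrite /= Su.
have [T [_ HT TP [_ bdT _]]] := bdryP cTh; rewrite /S/=.
have -> : monomial n%:Z v = mz n%:Z (monomial 0 v) by rewrite mz_monomial addr0.
rewrite (mulop_mz _ _ ler01 cf) (mulop_bdry_monomial0 cTh (bdT v)).
by rewrite !poisson_ext_mz// ?poisson_ext_monomial0 ?(op_scale lT) ?TP//; exact: (Hardy2_monomial 0).
Qed.

Lemma radial_cvg_comp E F V (Th1 : R -> E -> F) (Th2 : R -> F -> V) x y z :
  (forall r, 0 <= r < 1 -> linear (Th2 r) /\ hbounded 1 (Th2 r)) ->
  radial_cvg (Th1^~ x) y -> radial_cvg (Th2^~ y) z -> radial_cvg (fun r => Th2 r (Th1 r x)) z.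
Proof.
move=> lb H1 H2 e e0; have e2 : 0 < e / 2 by rewrite divr_gt0.
have [d1 d10 P1] := H1 _ e2; have [d2 d20 P2] := H2 _ e2.
have [d3 d30 P3] := @radial_window R (Num.min d1 d2) (ltac:(by rewrite lt_min d10)).
exists d3 => // r /P3[/andP[rd r1] r01].
have m1 : Num.min d1 d2 <= d1 by rewrite ge_min lexx.
have m2 : Num.min d1 d2 <= d2 by rewrite ge_min lexx orbT.
have [l2 b2] := lb r r01.
have h1 : hn (Th2 r (Th1 r x) - Th2 r y) < e / 2.
  rewrite -(op_sub l2); apply: le_lt_trans (b2 _) _; rewrite mul1r; apply: P1.
  by rewrite r1 andbT; lra.
have h2 : hn (Th2 r y - z) < e / 2 by apply: P2; rewrite r1 andbT; lra.
have := hn_tri (Th2 r y) (Th2 r (Th1 r x)) z; lra.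
Qed.

Lemma bdry_comp E F V (Th : R[i] -> {linear E -> V}) (Th2 : R[i] -> {linear F -> V})
    (Th1 : R[i] -> {linear E -> F}) :
  contractive_analytic Th -> contractive_analytic Th2 -> contractive_analytic Th1 ->
  (forall z x, `|z| < 1 -> Th z x = Th2 z (Th1 z x)) ->
  {ae mu, forall t, forall x, bdry Th t x = bdry Th2 t (bdry Th1 t x)}.
Proof.
move=> c0 c2 c1 fac; have [_ [_ _ _ [_ _ h0]]] := bdryP c0.
have [_ [_ _ _ [_ _ h1]]] := bdryP c1; have [_ [_ _ _ [_ _ h2]]] := bdryP c2.
apply: filterS3 h0 h1 h2 => t p0 p1 p2 x; apply: (radial_cvg_unique (p0 x)).
have := radial_cvg_comp (Th1 := fun r => Th1 (r%:C * circle_pt t)) (fun r => analytic_bounded t c2) (p1 x) (p2 _).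
move=> K e /K[d /radial_window[d' d'0 d'P] dP]; exists d' => // r /d'P[rd r01].
by rewrite fac ?zlt//; exact: dP.
Qed.

Lemma disk_comp E F V (Th : R[i] -> {linear E -> V}) (Th2 : R[i] -> {linear F -> V})
    (Th1 : R[i] -> {linear E -> F}) :
  contractive_analytic Th -> contractive_analytic Th2 -> contractive_analytic Th1 ->
  {ae mu, forall t, forall x, bdry Th t x = bdry Th2 t (bdry Th1 t x)} ->
  forall z x, `|z| < 1 -> Th z x = Th2 z (Th1 z x).
Proof.
move=> c0 c2 c1 fac z x /circle_polar[r [t [r01 ->]]].
have [T0 [_ _ P0 [_ b0 _]]] := bdryP c0; have [T1 [_ H1 P1 [_ b1 _]]] := bdryP c1.
rewrite P0// P1// -poisson_ext_mulop//; congr (poisson_ext r t _); apply/L2_eq/aeE.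
apply: filterS3 fac (mulop_ae ler01 (bdry_field c2) (T1 x)) (filterI (b0 x) (b1 x)).
by move=> s fs -> [<- <-].
Qed.

End BoundaryValues.

(** * Defect operators and factorizations *)

Lemma range_seq (A B : Type) (f : A -> B) (w : nat -> B) :
  (forall n, range f (w n)) -> exists u, w = f \o u.
Proof.
move=> Sw; have [u uw] := choice (fun n => let: ex_intro2 a _ e := Sw n in ex_intro (fun a => f a = w n) a e).
by exists u; apply/funext => n; rewrite /= uw.
Qed.

(** * Extension of an isometry from the range of an operator to its closure *)

Section IsometricExtension.
Context (R : realType) (E X Y : preHilbertType R) (d : E -> X) (v : E -> Y).
Hypotheses (ld : linear d) (lv : linear v).
Hypothesis dv : forall a b, inner (v a) (v b) = inner (d a) (d b).

(** The sequential form of being the continuous extension of [d a] |-> [v a]. Both the maps [Zfiber]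
    at a point and the operator [Zop] on L2 satisfy it, so its consequences are derived once for the
    two levels. *)
Definition extends (z : X -> Y) := forall u x, hcvg (d \o u) x -> hcvg (v \o u) (z x).

Lemma isometric_hn a b : hn (v a - v b) = hn (d a - d b).
Proof. by rewrite -(op_sub ld) -(op_sub lv) /hn dv. Qed.

Lemma nbhs_hn (V : preHilbertType R) (x : V) e : 0 < e -> nbhs x [set a | hn (a - x) < e].
Proof. by move=> e0; have /cvg_hn/(_ e e0) := @cvg_id _ (nbhs x). Qed.

(** An isometry sends convergent sequences to Cauchy sequences, so the closure of its graph meets
    each fibre over the closed domain in exactly one point. *)
Lemma closure_graph_extends : hcomplete [set: Y] ->
  extends (fun x => xget 0 [set y | closure [set (d a, v a) | a in setT] (x, y)]).
Proof.
move=> cY u x ux.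
have [//||l _ ul] := cY (v \o u).
  move=> e /(hcvg_cauchy ux)[N HN]; exists N => m n Nm Nn /=.
  by rewrite isometric_hn; exact: HN.
have lG : closure [set (d a, v a) | a in setT] (x, l).
  move=> B [[P Q] [/= xP lQ] PQ].
  have Pn : \forall n \near \oo, P (d (u n)) := (cvgn_hn _ _).2 ux _ xP.
  have Qn : \forall n \near \oo, Q (v (u n)) := (cvgn_hn _ _).2 ul _ lQ.
  have [n [{}Pn {}Qn]] := filter_ex (filterI Pn Qn).
  by exists (d (u n), v (u n)); split; [exists (u n)|exact: (PQ (_, _))].
case: xgetP => [y _ yG|/(_ l)//].
suff <- : l = y by [].
apply/eqP; rewrite -subr_eq0; apply/eqP/hn_eq0_small => e e0.
have e4 : 0 < e / 4 by rewrite divr_gt0.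
have [|_ [[a _ <-] [/= ax ay]]] := yG [set p | hn (p.1 - x) < e / 4 /\ hn (p.2 - y) < e / 4].
  exists ([set a | hn (a - x) < e / 4], [set b | hn (b - y) < e / 4]) => //.
  by split; exact: nbhs_hn.
have [N HN] := ux _ e4; have [M HM] := ul _ e4.
have /= h1 := HN _ (leq_maxl N M); have /= h2 := HM _ (leq_maxr N M).
set n := maxn N M in h1 h2.
have h3 := hn_tri (v (u n)) l y; have h4 := hn_tri (v a) (v (u n)) y.
have h5 := hn_tri x (d (u n)) (d a).
by rewrite isometric_hn in h4; rewrite hnC in h2; rewrite hnC in ax; move: ax ay h1 h2 h3 h4 h5; lra.
Qed.

Variable z : X -> Y.
Hypothesis zP : extends z.
Local Notation S := (closure (range d)).

Lemma extends_seq x : S x -> exists2 u, hcvg (d \o u) x & hcvg (v \o u) (z x).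
Proof.
by move=> /closure_seq[w /range_seq[u ->] wx]; exists u => //; exact: zP.
Qed.

Lemma extends_range a : z (d a) = v a.
Proof.
by apply: hcvg_unique (hcvg_cst (v a)); apply: (zP (u := fun=> a)); exact: hcvg_cst.
Qed.

Lemma subsp_range (U V : preHilbertType R) (A : U -> V) : linear A -> subsp (range A).
Proof.
move=> lA; split; first by exists 0 => //; rewrite (op_zero lA).
by move=> a _ _ [x _ <-] [y _ <-]; exists (a *: x + y); rewrite ?lA.
Qed.

Lemma extends_dom a x y : S x -> S y -> S (a *: x + y).
Proof. by move=> Sx Sy; apply: (subsp_closure (subsp_range ld)).2. Qed.

Lemma extends_closure x : S x -> closure (range v) (z x).
Proof.
by move=> /extends_seq[u _ uz]; apply: seq_closure uz => n; exists (u n).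
Qed.

Lemma extends_linear a x y : S x -> S y -> z (a *: x + y) = a *: z x + z y.
Proof.
move=> /extends_seq[u ux uz] /extends_seq[w wy wz].
apply: hcvg_unique (hcvgP a uz wz).
rewrite (_ : (fun n => _) = v \o (fun n => a *: u n + w n)); last by apply/funext => n /=; rewrite lv.
apply: zP; rewrite (_ : _ \o _ = fun n => a *: d (u n) + d (w n)); first exact: hcvgP.
by apply/funext => n /=; rewrite ld.
Qed.

(* Equality of inner products is orthogonality in the direct sum, where it passes
   to limits. *)
Lemma extends_inner x y : S x -> S y -> inner (z x) (z y) = inner x y.
Proof.
have orth (p q : X) (p' q' : Y) : inner (p ⊕ p') (q ⊕ - q') = 0 -> inner p' q' = inner p q.
  by rewrite inner_dsumE /= linearNr => /eqP; rewrite subr_eq0 => /eqP.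
have orthV (p q : X) (p' q' : Y) : inner p' q' = inner p q -> inner (p ⊕ p') (q ⊕ - q') = 0.
  by move=> e; apply/eqP; rewrite inner_dsumE /= linearNr subr_eq0; apply/eqP; exact: esym e.
move=> Sx /extends_seq[w wy wz].
have key b : inner (z x) (v b) = inner x (d b).
  have [u ux uz] := extends_seq Sx; apply: orth; apply: hcvg_orth (hcvg_dsum ux uz) _ => n.
  by apply: orthV; rewrite /= dv.
rewrite inner_conj [RHS]inner_conj; congr (_^* ); apply: orth.
by apply: hcvg_orth (hcvg_dsum wy wz) _ => n; apply: orthV; rewrite /= inner_conj key -inner_conj.
Qed.

Lemma extends_onto y : hcomplete [set: X] -> closure (range v) y -> exists2 x, S x & z x = y.
Proof.
move=> cX /closure_seq[w /range_seq[u ->] wy]; have [//||x _ ux] := cX (d \o u).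
  move=> e /(hcvg_cauchy wy)[N HN]; exists N => m n Nm Nn /=.
  by rewrite -isometric_hn; exact: HN.
exists x; first by apply: seq_closure ux => n; exists (u n).
exact: hcvg_unique (zP ux) wy.
Qed.

Lemma extends_inj x y : S x -> S y -> z x = z y -> x = y.
Proof.
move=> Sx Sy zxy; have Sxy : S (- 1 *: x + y) by exact: extends_dom.
have z0 : z (- 1 *: x + y) = 0 by rewrite extends_linear// zxy scaleN1r addNr.
have : rdot (- 1 *: x + y) (- 1 *: x + y) <= 0 by rewrite -extends_inner// z0 linear0l.
by move=> /rdot0; rewrite scaleN1r addrC => /eqP; rewrite subr_eq0 => /eqP.
Qed.

End IsometricExtension.

Section DefectOperator.
Context (R : realType).
Local Notation mu := (circle_measure R).
Implicit Types E F : sepHilbertType R.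

(** Measurability passes through each step of the iteration and through its pointwise limit. *)
Lemma psqrt_field E (T : R -> E -> E) : mfield 1 T ->
  (forall t x y, inner (T t x) y = inner x (T t y)) ->
  mfield 2 (fun t => psqrt_val (T t)).
Proof.
move=> [lT bT mT] sT; have cE := @sepHilbert_complete R E.
have mY n : mfield 1 (fun t => sqrt_iter (T t) n).
  elim: n => [|n IH].
    split=> [t|t x|x]; [exact: linear_cst0|by rewrite hn0 mul1r hn_ge0|exact: wmeas_cst].
  split=> [t|t|x].
  - exact: (sqrt_iter_linear (lT t)).
  - move=> x; apply: le_trans (sqrt_iter_bounded (bT t) n.+1 x) _.
    by rewrite ler_wpM2r ?hn_ge0//; case/andP: (sqrt_bnd_itv R n.+1).
  have [_ _ mYY] := mfield_comp ler01 IH IH.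
  have h := wmeas_comb 1 (mT x) (mYY x).
  have := wmeas_comb 2^-1%:C h (wmeas_cst _ (0 : E)).
  rewrite (_ : (fun t => _) = (fun t => sqrt_iter (T t) n.+1 x))//.
  by apply/funext => t; rewrite addr0 scale1r.
have [_ _ mL] := mfield_lim mY (fun t x => sqrt_limP cE (lT t) (bT t) x).
split=> [t|t|x]; [exact: (psqrt_val_linear cE (lT t) (bT t))|exact: (psqrt_val_bounded cE (lT t) (bT t))|].
have := wmeas_comb (-1) (mL x) (wmeas_cst _ x).
rewrite (_ : (fun t => _) = (fun t => psqrt_val (T t) x))//.
by apply/funext => t; rewrite scaleN1r addrC.
Qed.

Variables (E F : sepHilbertType R) (Th : R[i] -> {linear E -> F}).
Hypothesis cTh : contractive_analytic Th.

Lemma Delta_fibre : {ae mu, forall t, [/\ linear (Delta Th t),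
  forall x y, inner (Delta Th t x) y = inner x (Delta Th t y) &
  forall x y, inner (Delta Th t x) (Delta Th t y) = inner x y - inner (bdry Th t x) (bdry Th t y)]}.
Proof.
have [lb _] := bdry_field cTh; apply: filterS lb => t [lB bB].
have cE := @sepHilbert_complete R E; have aP := adjP cE lB bB.
have sT x y : inner (adjoint setT (bdry Th t) (bdry Th t x)) y =
    inner x (adjoint setT (bdry Th t) (bdry Th t y)).
  by rewrite inner_conj -aP -inner_conj aP.
have lT := linear_comp lB (adj_linear aP); have bT := hbounded_comp ler01 bB (adj_bounded ler01 aP bB).
rewrite mul1r in bT.
have -> : Delta Th t = psqrt_val (adjoint setT (bdry Th t) \o bdry Th t) by exact: psqrtE.
split; [exact: psqrt_val_linear|exact: psqrt_val_sa|].
by move=> x y; rewrite psqrt_val_sa// psqrt_valK// innerBr aP.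
Qed.

Lemma Delta_field : cfield mu 1 (Delta Th).
Proof.
(* Boundary values form a field only almost everywhere; the modified field [B] makes the adjoint
   times [B] a positive contraction at every point, to which the iteration applies. *)
have [B mB BE] := cfield_mfield ler01 (bdry_field cTh); have [lB bB _] := mB.
have cE := @sepHilbert_complete R E.
have sT t x y : inner (adjoint setT (B t) (B t x)) y = inner x (adjoint setT (B t) (B t y)).
  have aP := adjP cE (lB t) (bB t).
  by rewrite inner_conj -aP -inner_conj aP.
have mT := mfield_comp ler01 mB (mfield_adj ler01 mB); rewrite mul1r in mT.
have [_ _ mD] := psqrt_field mT sT; have [lT bT _] := mT.
split.
  apply: filterS Delta_fibre => t [lD _ iD]; split=> // x.
  by rewrite mul1r hn_le_sqr ?hn_ge0// hn_sqr iD raddfB/= lerBlDr lerDl rdot_ge0.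
move=> x; exists (fun t => psqrt_val (adjoint setT (B t) \o B t) x); first exact: mD.
apply: filterS BE => t Bt; rewrite /Delta Bt.
by have -> := psqrtE cE (lT t) (bT t) (sT t).
Qed.

Lemma Delta_mulop_inner f g :
  inner (mulop (bdry Th) f) (mulop (bdry Th) g) + inner (mulop (Delta Th) f) (mulop (Delta Th) g) =
  inner f g.
Proof.
rewrite !inner_L2E -cintegralD; [|exact: inner_cintegrable..].
apply: ae_cintegral.
- have h := inner_cintegrable (mulop (bdry Th) f) (mulop (bdry Th) g).
  apply: cmeasurableD; exact: (l2fun_measurable (@l2fun_wmeas _ _ _ mu _ _) (@l2fun_wmeas _ _ _ mu _ _)).
- exact: (l2fun_measurable (@l2fun_wmeas _ _ _ mu _ f) (@l2fun_wmeas _ _ _ mu _ g)).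
have hB := mulop_ae ler01 (bdry_field cTh); have hD := mulop_ae ler01 Delta_field.
apply: filterS3 Delta_fibre (filterI (hB f) (hB g)) (filterI (hD f) (hD g)).
by move=> t [_ _ iD] [-> ->] [-> ->] _; rewrite iD addrC subrK.
Qed.

Lemma DeltaL2_subsp : subsp (DeltaL2 Th).
Proof. exact: subsp_closure (subsp_range (mulop_linear ler01 Delta_field)). Qed.

Lemma DeltaL2_closed : closed (DeltaL2 Th). Proof. exact: closed_closure. Qed.

Lemma DeltaL2_complete : hcomplete (DeltaL2 Th).
Proof. exact: complete_closed (@L2_complete _ _ R mu E) _ DeltaL2_closed. Qed.

Lemma DeltaL2_range f : DeltaL2 Th (mulop (Delta Th) f).
Proof. by apply: subset_closure; exists f. Qed.

Lemma DeltaL2_mz n f : DeltaL2 Th f -> DeltaL2 Th (mz n f).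
Proof.
have /(_ f) H := closed_preimage (mz_linear n) (mz_bounded n) DeltaL2_closed.
move=> Df; apply: H; apply: closure_subset Df => _ [g _ <-] /=.
by rewrite -(mulop_mz _ _ ler01 Delta_field); exact: DeltaL2_range.
Qed.

Lemma DeltaL2_fibre f : DeltaL2 Th f -> {ae mu, forall t, closure (range (Delta Th t)) (f t)}.
Proof.
move=> /closure_seq[u /range_seq[g ->] uf]; have [phi _ up] := ae_subseq uf.
have /ae_foralln H := fun n => mulop_ae ler01 Delta_field (g n).
apply: filterS2 up H => t ut Ht; apply: seq_closure ut => n.
by exists (g (phi n) t) => //; rewrite -Ht.
Qed.

End DefectOperator.
Section PairsOnCircle.
Context (R : realType) (E F : sepHilbertType R).
Local Notation mu := (circle_measure R).
Local Notation X := (dsum (L2T E) (L2T F)).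
Implicit Types x y : X.

(** The power [U ^ n] of the coordinate multiplication, for every integer [n]. *)
Definition dmz (n : int) x : X := mz n x.1 ⊕ mz n x.2.

Lemma dmz_linear n : linear (dmz n).
Proof. by move=> a x y; rewrite /dmz !mz_linear. Qed.

Lemma dmz_inner n x y : inner (dmz n x) (dmz n y) = inner x y.
Proof. by rewrite !inner_dsumE !mz_inner. Qed.

Lemma dmz_hn n x : hn (dmz n x) = hn x. Proof. by rewrite /hn dmz_inner. Qed.

Lemma dmz_bounded n : hbounded 1 (dmz n).
Proof. by move=> x; rewrite dmz_hn mul1r. Qed.

Lemma dmzD m n x : dmz m (dmz n x) = dmz (m + n) x. Proof. by rewrite /dmz !mzD. Qed.

Lemma dmz0 x : dmz 0 x = x. Proof. by rewrite /dmz !mz0 -dsumE. Qed.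

Lemma dmzK n x : dmz n (dmz (- n) x) = x. Proof. by rewrite dmzD subrr dmz0. Qed.
Lemma dmzVK n x : dmz (- n) (dmz n x) = x. Proof. by rewrite dmzD addNr dmz0. Qed.

Lemma dmz_adj n x y : inner (dmz n x) y = inner x (dmz (- n) y).
Proof. by rewrite -[in LHS](dmzK n y) dmz_inner. Qed.

Lemma pair_complete : hcomplete [set: X].
Proof.
have := dsum_complete (@L2_complete _ _ R mu E) (@L2_complete _ _ R mu F).
by congr hcomplete; apply/seteqP; split.
Qed.

Definition pair_at x (t : R) : dsum E F := (x.1 : L2T E) t ⊕ (x.2 : L2T F) t.

Definition fdot x y (t : R) := inner (x.1 t) (y.1 t) + inner (x.2 t) (y.2 t).

Lemma fdot_cintegrable x y : cintegrable mu (fdot x y).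
Proof.
have := cintegrableP 1 (inner_cintegrable x.1 y.1) (inner_cintegrable x.2 y.2).
by rewrite (_ : (fun t => _) = fdot x y)//; apply/funext => t; rewrite mul1r.
Qed.

Lemma inner_fdot x y : inner x y = cintegral mu (fdot x y).
Proof. by rewrite inner_dsumE !inner_L2E -cintegralD//; exact: inner_cintegrable. Qed.

Lemma fdot_dmz n x y : {ae mu, forall t, fdot (dmz n x) y t = chi n t * fdot x y t}.
Proof.
apply: filterS2 (mz_ae n x.1) (mz_ae n x.2) => t; rewrite /fdot => -> ->.
by rewrite !innerZl mulrDr.
Qed.

(** Thus the numbers <U^n x, y> are the Fourier coefficients of the pointwise inner product, and
    orthogonality relations in L2 turn into pointwise ones. *)
Lemma inner_dmz n x y : inner (dmz n x) y = cintegral mu (fun t => chi n t * fdot x y t).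
Proof.
have [h1 h2] := fdot_cintegrable (dmz n x) y; have [h3 h4] := cintegrable_chi n (fdot_cintegrable x y).
rewrite inner_fdot; apply: ae_cintegral.
- by split; apply/measurable_EFinP; [case/integrableP: h1|case/integrableP: h2].
- by split; apply/measurable_EFinP; [case/integrableP: h3|case/integrableP: h4].
- by apply: filterS (fdot_dmz n x y) => t.
Qed.

Lemma fdot_eq0 x y : (forall n, inner (dmz n x) y = 0) -> {ae mu, forall t, fdot x y t = 0}.
Proof.
move=> H; apply: fourier_unique; first exact: fdot_cintegrable.
by move=> n; rewrite -inner_dmz.
Qed.

Lemma fdot_const x y : (forall n, n != 0 -> inner (dmz n x) y = 0) ->
  {ae mu, forall t, fdot x y t = inner x y}.
Proof.
move=> H; rewrite inner_fdot; apply: fourier_const; first exact: fdot_cintegrable.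
by move=> n /H; rewrite -inner_dmz.
Qed.

Lemma ae_subseq_pair (V : sepHilbertType R) (u : nat -> X) (w : nat -> L2T V) x (f : L2T V) :
  hcvg u x -> hcvg w f -> exists phi : nat -> nat,
  {ae mu, forall t, hcvg (fun n => pair_at (u (phi n)) t) (pair_at x t) /\
    hcvg (fun n => w (phi n) t) (f t)}.
Proof.
move=> ux wf; have [p1 p1n P1] := ae_subseq (hcvg_dsum1 ux).
have [p2 p2n P2] := ae_subseq (hcvg_sub p1n (hcvg_dsum2 ux)).
have p12 n : (n <= (p1 \o p2) n)%N by apply: leq_trans (p2n n) (p1n _).
have [p3 p3n P3] := ae_subseq (hcvg_sub p12 wf).
have p23 n : (n <= (p2 \o p3) n)%N by apply: leq_trans (p3n n) (p2n _).
exists (p1 \o p2 \o p3); apply: filterS3 P1 P2 P3 => t P1 P2 P3; split => //.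
apply: hcvg_dsum; [exact: (hcvg_sub p23 P1)|exact: (hcvg_sub p3n P2)].
Qed.

End PairsOnCircle.

(** * The isometry Z of a factorization, at a point and on L2 *)

Section FactorizationIsometry.
Context (R : realType) (D F Dstar : sepHilbertType R).
Local Notation mu := (circle_measure R).
Variables (Th : R[i] -> {linear D -> Dstar}) (Th2 : R[i] -> {linear F -> Dstar}).
Variable Th1 : R[i] -> {linear D -> F}.
Hypotheses (c0 : contractive_analytic Th) (c2 : contractive_analytic Th2).
Hypothesis c1 : contractive_analytic Th1.
Hypothesis fac : {ae mu, forall t, forall x, bdry Th t x = bdry Th2 t (bdry Th1 t x)}.

Local Notation Z := (Zop Th Th2 Th1).
Local Notation Zi := (Zinv Th Th2 Th1).

(** The vector to which Z sends [Delta Th t a]; [defect_op] is its counterpart on L2. *)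
Definition defect_fiber t (a : D) : dsum F D := Delta Th2 t (bdry Th1 t a) ⊕ Delta Th1 t a.
Definition defect_op (g : L2T D) : dsum (L2T F) (L2T D) :=
  mulop (Delta Th2) (mulop (bdry Th1) g) ⊕ mulop (Delta Th1) g.

Lemma Zfiber_extends : {ae mu, forall t, [/\ linear (Delta Th t), linear (defect_fiber t),
  forall a b, inner (defect_fiber t a) (defect_fiber t b) = inner (Delta Th t a) (Delta Th t b) &
  extends (Delta Th t) (defect_fiber t) (Zfiber Th Th2 Th1 t)]}.
Proof.
have [lb _] := bdry_field c1.
apply: filterS3 (Delta_fibre c0) (filterI (Delta_fibre c1) (Delta_fibre c2)) (filterI fac lb).
move=> t [lD _ iD] [[lD1 _ iD1] [lD2 _ iD2]] [ft [lB1 _]].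
have lV : linear (defect_fiber t) by move=> a x y; rewrite /defect_fiber dsumP lB1 lD1 lD2.
have iV a b : inner (defect_fiber t a) (defect_fiber t b) = inner (Delta Th t a) (Delta Th t b).
  by rewrite inner_dsumE/= iD iD1 iD2 !ft addrC addrA subrK.
split => //; apply: closure_graph_extends => //.
have := dsum_complete (@sepHilbert_complete R F) (@sepHilbert_complete R D).
by congr hcomplete; apply/seteqP; split.
Qed.

Lemma defect_op_linear : linear defect_op.
Proof.
move=> a x y; rewrite /defect_op dsumP (mulop_linear ler01 (bdry_field c1)).
by rewrite (mulop_linear ler01 (Delta_field c1)) (mulop_linear ler01 (Delta_field c2)).
Qed.

Lemma mulop_fac g : mulop (bdry Th2) (mulop (bdry Th1) g) = mulop (bdry Th) g.
Proof.
apply/L2_eq/aeE; apply: filterS3 (mulop_ae ler01 (bdry_field c2) (mulop (bdry Th1) g))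
  (filterI (mulop_ae ler01 (bdry_field c1) g) fac) (mulop_ae ler01 (bdry_field c0) g).
by move=> t -> [-> ->] ->.
Qed.

Lemma defect_op_inner f g : inner (defect_op f) (defect_op g) = inner (mulop (Delta Th) f) (mulop (Delta Th) g).
Proof.
have h0 := Delta_mulop_inner c0 f g; have h1 := Delta_mulop_inner c1 f g.
have := Delta_mulop_inner c2 (mulop (bdry Th1) f) (mulop (bdry Th1) g).
rewrite !mulop_fac inner_dsumE /= => h2.
by apply: (addrI (inner (mulop (bdry Th) f) (mulop (bdry Th) g))); rewrite h0 addrA h2 h1.
Qed.

Lemma defect_op_ae g : {ae mu, forall t, pair_at (defect_op g) t = defect_fiber t (g t)}.
Proof.
apply: filterS3 (mulop_ae ler01 (Delta_field c2) (mulop (bdry Th1) g))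
  (mulop_ae ler01 (bdry_field c1) g) (mulop_ae ler01 (Delta_field c1) g).
by move=> t; rewrite /pair_at /= => -> -> ->.
Qed.

Lemma defect_op_mz n g : defect_op (mz n g) = dmz n (defect_op g).
Proof.
rewrite /defect_op /dmz /= (mulop_mz _ _ ler01 (bdry_field c1)).
by rewrite (mulop_mz _ _ ler01 (Delta_field c1)) (mulop_mz _ _ ler01 (Delta_field c2)).
Qed.

(** Convergence in L2 gives almost everywhere convergence along a subsequence, where the extension
    property at each point identifies the limit. *)
Lemma Zop_extends : extends (mulop (Delta Th)) defect_op Z.
Proof.
move=> u f uf.
have lD := mulop_linear ler01 (Delta_field c0).
have [//||y _ uy] := pair_complete (u := defect_op \o u).
  move=> e /(hcvg_cauchy uf)[N HN]; exists N => m n Nm Nn /=.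
  by rewrite (isometric_hn lD defect_op_linear defect_op_inner); exact: HN.
suff -> : Z f = y by [].
have [phi P] := ae_subseq_pair uy uf.
have /ae_foralln hV := fun n => defect_op_ae (u n).
have /ae_foralln hD := fun n => mulop_ae ler01 (Delta_field c0) (u n).
have ZE : {ae mu, forall t, Zfiber Th Th2 Th1 t ((f : L2T D) t) = pair_at y t}.
  apply: filterS3 P Zfiber_extends (filterI hV hD) => t [p1 p3] [_ _ _ zP] [Vt Dt].
  have /zP : hcvg (Delta Th t \o (fun n => (u (phi n) : L2T D) t)) ((f : L2T D) t).
    by rewrite (_ : _ \o _ = fun n => mulop (Delta Th) (u (phi n)) t)//; apply/funext => n /=; rewrite Dt.
  move=> /hcvg_unique; apply; move: p1.
  rewrite (_ : (fun n => _) = defect_fiber t \o (fun n => (u (phi n) : L2T D) t))//.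
  by apply/funext => n /=; rewrite Vt.
rewrite [y]dsumE /Zop; congr (_ ⊕ _).
  by apply: L2of_ae; apply: filterS ZE => t ->.
by apply: L2of_ae; apply: filterS ZE => t ->.
Qed.

Lemma Zop_linear a f g : DeltaL2 Th f -> DeltaL2 Th g -> Z (a *: f + g) = a *: Z f + Z g.
Proof. exact: (extends_linear (mulop_linear ler01 (Delta_field c0)) defect_op_linear Zop_extends). Qed.

Lemma Zop_inner f g : DeltaL2 Th f -> DeltaL2 Th g -> inner (Z f) (Z g) = inner f g.
Proof. exact: (extends_inner defect_op_inner Zop_extends). Qed.

Lemma Zop_Delta g : Z (mulop (Delta Th) g) = defect_op g.
Proof. exact: (extends_range Zop_extends). Qed.

Lemma Zop_inj f g : DeltaL2 Th f -> DeltaL2 Th g -> Z f = Z g -> f = g.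
Proof.
exact: (extends_inj (mulop_linear ler01 (Delta_field c0)) defect_op_linear defect_op_inner Zop_extends).
Qed.

Lemma Zop_seq f : DeltaL2 Th f -> exists2 u, hcvg (mulop (Delta Th) \o u) f & hcvg (defect_op \o u) (Z f).
Proof. exact: (extends_seq Zop_extends). Qed.

Lemma Zop_mz n f : DeltaL2 Th f -> Z (mz n f) = dmz n (Z f).
Proof.
move=> /Zop_seq[u uf uz].
have h := hbounded_cvg (@dmz_linear R F D n) (@dmz_bounded R F D n) uz.
apply: hcvg_unique h.
rewrite (_ : _ \o (_ \o _) = defect_op \o (mz n \o u)); last by apply/funext => k; rewrite /= defect_op_mz.
apply: Zop_extends.
have := hbounded_cvg (@mz_linear R D n) (@mz_bounded R D n) uf.
rewrite (_ : mz n \o (mulop (Delta Th) \o u) = mulop (Delta Th) \o (mz n \o u))//.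
by apply/funext => k; exact: esym (mulop_mz n (u k) ler01 (Delta_field c0)).
Qed.

Lemma Zop_range f : DeltaL2 Th f -> DeltaL2 Th2 (Z f).1 /\ DeltaL2 Th1 (Z f).2.
Proof.
move=> /Zop_seq[u _ uz]; split.
  by apply: closed_seq (@DeltaL2_closed _ _ _ _) _ (hcvg_dsum1 uz) => n; exact: DeltaL2_range.
by apply: closed_seq (@DeltaL2_closed _ _ _ _) _ (hcvg_dsum2 uz) => n; exact: DeltaL2_range.
Qed.

(** Regularity seen on L2; the two lemmas that follow pass between this and surjectivity at almost
    every point. *)
Definition Zonto := forall p q, DeltaL2 Th2 p -> DeltaL2 Th1 q ->
  exists2 f, DeltaL2 Th f & Z f = p ⊕ q.

(** The component of [p ⊕ q] orthogonal to the range of Z is orthogonal to every [defect_op g], in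
    particular to all shifts of constants, hence pointwise orthogonal to the vectors
    [defect_fiber t a]. At a regular point these are dense in a space containing that component,
    which must vanish. *)
Lemma regular_onto : regular_factorization Th Th2 Th1 -> Zonto.
Proof.
move=> [_ reg] p q Dp Dq.
have lD := mulop_linear ler01 (Delta_field c0).
have sV := subsp_closure (subsp_range defect_op_linear).
have cV : hcomplete (closure (range defect_op)).
  exact: complete_closed (@pair_complete R F D) _ (@closed_closure _ _).
have [y Vy yP] := projection (p ⊕ q) sV cV.
have [f Df fy] := extends_onto lD defect_op_linear defect_op_inner Zop_extends (@L2_complete _ _ R mu D) Vy.
exists f => //; rewrite fy; apply/eqP; rewrite eq_sym -subr_eq0; apply/eqP.
set x := p ⊕ q - y in yP *.
have [Dy1 Dy2] := Zop_range Df; rewrite fy in Dy1 Dy2.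
have Dx1 : DeltaL2 Th2 x.1 by exact: subspB (DeltaL2_subsp c2) Dp Dy1.
have Dx2 : DeltaL2 Th1 x.2 by exact: subspB (DeltaL2_subsp c1) Dq Dy2.
have xV g : inner x (defect_op g) = 0 by apply: yP; apply: subset_closure; exists g.
have [s sd] := dense_seq D.
have /ae_foralln orths k : {ae mu, forall t, inner (pair_at x t) (defect_fiber t (s k)) = 0}.
  have /fdot_eq0 : forall n, inner (dmz n x) (defect_op (monomial 0 (s k))) = 0.
    by move=> n; rewrite dmz_adj -defect_op_mz xV.
  apply: filterS3 (defect_op_ae (monomial 0 (s k))) (monomial_ae 0 (s k)) => t; rewrite chi0 scale1r => Vt Et.
  by move: Vt; rewrite Et => <-.
have x0 : {ae mu, forall t, pair_at x t = 0}.
  have lb := ae_and (bdry_field c1).1 (ae_and (Delta_field c1).1 (Delta_field c2).1).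
  apply: filterS3 orths (filterI (DeltaL2_fibre c2 Dx1) (DeltaL2_fibre c1 Dx2))
    (filterI reg (filterI Zfiber_extends lb)).
  move=> t ot [d1 d2] [rt [[lDt lVt iVt zP] [[lB1 bB1] [[_ bD1] [lD2 bD2]]]]].
  have [w dw wE] := rt _ _ d1 d2.
  have zw := extends_closure zP dw; rewrite wE in zw.
  have bV : hbounded 2 (defect_fiber t).
    move=> a; apply: le_trans (hn_dsum_le _) _ => /=.
    have := bB1 a; have := bD1 a; have := bD2 (bdry Th1 t a); rewrite !mul1r => *; lra.
  have oV a : inner (defect_fiber t a) (pair_at x t) = 0.
    have [k kx] := dense_seq_cvg a sd; apply: hcvg_orth (hbounded_cvg lVt bV kx) _ => n /=.
    exact: inner0C.
  have [u /range_seq[v ->] ux] := closure_seq zw.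
  have : inner (pair_at x t) (pair_at x t) = 0 by apply: hcvg_orth ux _ => n; exact: oV.
  move=> o0; have /rdot0 h : rdot (pair_at x t) (pair_at x t) <= 0 by rewrite o0.
  exact: h.
have zero (E : sepHilbertType R) : {ae mu, forall t, (0 : L2T E) t = 0}.
  by have := L2Z_ae 0 (0 : L2T E); rewrite scale0r; apply: filterS => t ->; rewrite scale0r.
rewrite [x]dsumE; congr (_ ⊕ _).
  by apply/L2_eq/aeE; apply: filterS2 x0 (zero F) => t xt ->; exact: (congr1 fst xt).
by apply/L2_eq/aeE; apply: filterS2 x0 (zero D) => t xt ->; exact: (congr1 snd xt).
Qed.

(** Surjectivity is used on countably many pairs, built from constants running through dense
    sequences and with one component zero. Each gives a null set; off their union the range of Z
    contains a total family of the target. *)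
Lemma onto_regular : Zonto -> {ae mu, forall t, forall u v,
     closure (range (Delta Th2 t)) u -> closure (range (Delta Th1 t)) v ->
     exists2 x, closure (range (Delta Th t)) x & Zfiber Th Th2 Th1 t x = u ⊕ v}.
Proof.
move=> onto.
have ontoV p q : DeltaL2 Th2 p -> DeltaL2 Th1 q ->
    {ae mu, forall t, closure (range (defect_fiber t)) (pair_at (p ⊕ q) t)}.
  move=> Dp Dq; have [f /Zop_seq[u uf uz] zf] := onto _ _ Dp Dq.
  have [phi P] := ae_subseq_pair uz uf; have /ae_foralln hV := fun n => defect_op_ae (u n).
  apply: filterS2 P hV => t [p1 _] Vt; rewrite zf in p1.
  by apply: seq_closure p1 => n; exists ((u (phi n) : L2T D) t) => //; rewrite -Vt.
have zero (E : sepHilbertType R) : {ae mu, forall t, (0 : L2T E) t = 0}.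
  by have := L2Z_ae 0 (0 : L2T E); rewrite scale0r; apply: filterS => t ->; rewrite scale0r.
have D0 : DeltaL2 Th1 0 by case: (DeltaL2_subsp c1).
have D0' : DeltaL2 Th2 0 by case: (DeltaL2_subsp c2).
have [s sd] := dense_seq F; have [s' sd'] := dense_seq D.
have /ae_foralln h2 n : {ae mu, forall t, closure (range (defect_fiber t)) (Delta Th2 t (s n) ⊕ 0)}.
  have := ontoV _ _ (@DeltaL2_range _ _ _ Th2 (monomial 0 (s n))) D0.
  apply: filterS3 (mulop_ae ler01 (Delta_field c2) (monomial 0 (s n))) (filterI (zero D) (monomial_ae 0 (s n))).
  by move=> t; rewrite /pair_at /= => -> [-> ->]; rewrite chi0 scale1r.
have /ae_foralln h1 n : {ae mu, forall t, closure (range (defect_fiber t)) (0 ⊕ Delta Th1 t (s' n))}.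
  have := ontoV _ _ D0' (@DeltaL2_range _ _ _ Th1 (monomial 0 (s' n))).
  apply: filterS3 (mulop_ae ler01 (Delta_field c1) (monomial 0 (s' n))) (filterI (zero F) (monomial_ae 0 (s' n))).
  by move=> t; rewrite /pair_at /= => -> [-> ->]; rewrite chi0 scale1r.
have lb := ae_and (Delta_field c1).1 (Delta_field c2).1.
apply: filterS3 h1 h2 (filterI Zfiber_extends lb).
move=> t h1 h2 [[lDt lVt iVt zP] [[lD1 bD1] [lD2 bD2]]] u v cu cv.
have cS := @closed_closure _ (range (defect_fiber t)).
have p2 a : closure (range (defect_fiber t)) (Delta Th2 t a ⊕ 0).
  have [k kx] := dense_seq_cvg a sd.
  by apply: closed_seq cS _ (hcvg_dsum (hbounded_cvg lD2 bD2 kx) (hcvg_cst 0)) => n; exact: h2.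
have p1 a : closure (range (defect_fiber t)) (0 ⊕ Delta Th1 t a).
  have [k kx] := dense_seq_cvg a sd'.
  by apply: closed_seq cS _ (hcvg_dsum (hcvg_cst 0) (hbounded_cvg lD1 bD1 kx)) => n; exact: h1.
have q2 : closure (range (defect_fiber t)) (u ⊕ 0).
  have [w /range_seq[a ->] wu] := closure_seq cu.
  by apply: closed_seq cS _ (hcvg_dsum wu (hcvg_cst 0)) => n; exact: p2.
have q1 : closure (range (defect_fiber t)) (0 ⊕ v).
  have [w /range_seq[a ->] wu] := closure_seq cv.
  by apply: closed_seq cS _ (hcvg_dsum (hcvg_cst 0) wu) => n; exact: p1.
apply: (extends_onto lDt lVt iVt zP (@sepHilbert_complete R D)).
have := subspD (subsp_closure (subsp_range lVt)) q2 q1.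
by rewrite dsumD addr0 add0r.
Qed.

Hypothesis onto : Zonto.

Lemma ZinvP p q : DeltaL2 Th2 p -> DeltaL2 Th1 q ->
  DeltaL2 Th (Zi (p ⊕ q)) /\ Z (Zi (p ⊕ q)) = p ⊕ q.
Proof.
move=> Dp Dq; have [f Df zf] := onto Dp Dq.
by rewrite /Zinv; case: xgetP => [g _ //|/(_ f)[]].
Qed.

Lemma ZinvK f p q : DeltaL2 Th f -> Z f = p ⊕ q -> Zi (p ⊕ q) = f.
Proof.
move=> Df zf; have [Dp Dq] := Zop_range Df; rewrite zf in Dp Dq.
by have [Dg zg] := ZinvP Dp Dq; apply: Zop_inj => //; rewrite zg.
Qed.

Lemma Zinv_linear a p q p' q' : DeltaL2 Th2 p -> DeltaL2 Th1 q -> DeltaL2 Th2 p' ->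
  DeltaL2 Th1 q' -> Zi ((a *: p + p') ⊕ (a *: q + q')) = a *: Zi (p ⊕ q) + Zi (p' ⊕ q').
Proof.
move=> Dp Dq Dp' Dq'; have [Df zf] := ZinvP Dp Dq; have [Dg zg] := ZinvP Dp' Dq'.
apply: ZinvK; first by apply: (DeltaL2_subsp c0).2.
by rewrite Zop_linear// zf zg.
Qed.

Lemma Zinv_inner p q p' q' : DeltaL2 Th2 p -> DeltaL2 Th1 q -> DeltaL2 Th2 p' ->
  DeltaL2 Th1 q' -> inner (Zi (p ⊕ q)) (Zi (p' ⊕ q')) = inner p p' + inner q q'.
Proof.
move=> Dp Dq Dp' Dq'; have [Df zf] := ZinvP Dp Dq; have [Dg zg] := ZinvP Dp' Dq'.
by rewrite -Zop_inner// zf zg.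
Qed.

End FactorizationIsometry.

(** * The model space *)

Section SubspaceHilbert.
Context (R : realType) (X : preHilbertType R) (S : set X).
Hypotheses (sS : subsp S) (cS : hcomplete S).

Definition subH_pred : pred X := fun x => `[< S x >].

Let subH_submod : submod_closed subH_pred.
Proof.
split; first by apply/asboolP; case: sS.
by move=> a x y /asboolP Sx /asboolP Sy; apply/asboolP; apply: sS.2.
Qed.

HB.instance Definition _ := GRing.isSubmodClosed.Build R[i] X subH_pred subH_submod.

(** The statement asks for a space F with a type of its own, so the wandering subspace is made into
    one. Its separability comes from projecting a dense sequence of the ambient space. *)
Record subH := SubH {subH_val : X; subH_valP : subH_pred subH_val}.

HB.instance Definition _ := [isSub for subH_val].
HB.instance Definition _ := [Choice of subH by <:].
HB.instance Definition _ := [SubChoice_isSubLmodule of subH by <:].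

Lemma subH_val_linear : linear subH_val.
Proof. by move=> a x y; exact: (linearP (val : subH -> X)). Qed.

Definition subH_inner (x y : subH) : R[i] := inner (subH_val x) (subH_val y).

Let subH_inner_bilinear :
  bilinear_for (GRing.Scale.Law.clone _ _ *%R _)
    (GRing.Scale.Law.clone _ _ (@Num.conj R[i] \; *%R) _) subH_inner.
Proof.
split=> [z a x y|z a x y] /=; rewrite /subH_inner subH_val_linear.
  by rewrite linearPl.
by rewrite linearPr.
Qed.

HB.instance Definition _ :=
  bilinear_isBilinear.Build _ _ _ _ _ _ subH_inner subH_inner_bilinear.

Let subH_inner_herm x y : subH_inner x y = (-1) ^+ false * Num.conj (subH_inner y x).
Proof. by rewrite expr0 mul1r; exact: inner_conj. Qed.

HB.instance Definition _ :=
  isHermitianSesquilinear.Build _ _ _ _ subH_inner subH_inner_herm.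

Let subH_inner_gt0 x : x != 0 -> 0 < subH_inner x x.
Proof.
move=> x0; rewrite /subH_inner lt_def dnorm_ge0 andbT dnorm_eq0.
apply: contra x0 => /eqP v0; apply/eqP/val_inj => /=.
by rewrite v0; exact: esym (raddf0 (val : subH -> X)).
Qed.

HB.instance Definition _ := isDotProduct.Build _ _ subH_inner subH_inner_gt0.
HB.instance Definition _ := @Lmodule_hasInner.Build R subH subH_inner.

Lemma subH_complete : hcomplete [set: subH].
Proof.
move=> u _ cu; have [||l Sl ul] := cS (u := subH_val \o u).
- by move=> n; apply/asboolP; exact: subH_valP.
- move=> e /cu[N HN]; exists N => m n Nm Nn; have := HN m n Nm Nn.
  by rewrite /hn /= -(op_sub subH_val_linear).
exists (SubH (asboolT Sl)) => // e /ul[N HN]; exists N => n /HN //.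
Qed.

HB.instance Definition _ := Uniform_isComplete.Build subH (hcomplete_cvg subH_complete).

Hypothesis pX : exists s : nat -> X, hseparable s.

Let subH_separable : exists s : set subH, countable s /\ dense s.
Proof.
have [s sd] := pX.
have /choice[p pP] n : exists a : subH, forall b, inner (s n - subH_val a) (subH_val b) = 0.
  have [y Sy yP] := projection (s n) sS cS; exists (SubH (asboolT Sy)) => b.
  by apply: yP; apply/asboolP; exact: subH_valP.
exists (range p); split; first exact: sub_countable (card_image_le _ _) (countableP _).
move=> O [x Ox] oO.
have /nbhs_ballP[e /= /gt0_complex_real[{}e e0 ->] eO] := open_nbhs_nbhs (conj oO Ox).
have [n sn] := sd (subH_val x) _ e0.
exists (p n); split; last by exists n.
have hv a : hn a = hn (subH_val a) by [].
have key : hn (subH_val (p n - x)) <= hn (s n - subH_val x).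
  have -> : s n - subH_val x = (s n - subH_val (p n)) + subH_val (p n - x).
    by rewrite (op_sub subH_val_linear) addrA subrK.
  by rewrite hn_le_sqr ?hn_ge0// !hn_sqr rdot_pythagoras// lerDr rdot_ge0.
apply: eO; rewrite -ball_normE/= hnE ltcR; apply: le_lt_trans sn; apply: le_trans key.
by rewrite -hv hnC.
Qed.

HB.instance Definition _ := Topological_isSeparable.Build subH subH_separable.

Lemma subspace_sepHilbert : exists (F : sepHilbertType R) (io : F -> X),
  [/\ linear io, forall a b, inner (io a) (io b) = inner a b, forall a, S (io a) &
  forall x, S x -> exists a, io a = x].
Proof.
exists (subH : sepHilbertType R), subH_val; split=> // [a|x Sx].
- by apply/asboolP; exact: subH_valP.
- by exists (SubH (asboolT Sx)).
Qed.

End SubspaceHilbert.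

Section PairSeparable.
Context (R : realType) (E F : sepHilbertType R).
Local Notation mu := (circle_measure R).

Lemma pair_separable : exists s : nat -> dsum (L2T E) (L2T F), hseparable s.
Proof.
have [s sd] := dense_seq E; have [s' sd'] := dense_seq F.
pose e (i : int * nat + int * nat) : dsum (L2T E) (L2T F) :=
  match i with inl (n, k) => monomial n (s k) ⊕ 0 | inr (n, k) => 0 ⊕ monomial n (s' k) end.
apply: (@total_separable R _ _ e (@pair_complete R E F)) => x H.
rewrite [x]dsumE; congr (_ ⊕ _).
  apply: L2_fourier_unique => n; apply: (dense_orth sd) => k; apply: inner0C.
  by have := H (inl (n, k)); rewrite inner_dsumE /= linear0r addr0 inner_fourier_coef_monomial.
apply: L2_fourier_unique => n; apply: (dense_orth sd') => k; apply: inner0C.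
by have := H (inr (n, k)); rewrite inner_dsumE /= linear0r add0r inner_fourier_coef_monomial.
Qed.

End PairSeparable.
Section Subspaces.
Context (R : realType) (X : preHilbertType R).
Implicit Types (S T : set X) (x y : X).

Lemma orthoproj_eq S x y : subsp S -> S y -> (forall s, S s -> inner (x - y) s = 0) ->
  orthoproj S x = y.
Proof.
move=> sS Sy yP; rewrite /orthoproj; case: xgetP => [z _ [Sz zP]|/(_ y)[]//].
have Szy : S (z - y) by exact: subspB.
apply/eqP; rewrite -subr_eq0; apply/eqP/rdot0.
have -> : inner (z - y) (z - y) = inner (x - y) (z - y) - inner (x - z) (z - y).
  by rewrite -innerBl; congr (inner _ _); rewrite opprB [RHS]addrC addrA subrK.
by rewrite yP// zP// subrr.
Qed.

Lemma orthodiff_subsp S T : subsp S -> subsp (orthodiff S T).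
Proof.
move=> sS; split; first by split=> [|y _]; [case: sS|rewrite linear0l].
move=> a x y [Sx Tx] [Sy Ty]; split; first exact: sS.2.
by move=> z Tz; rewrite linearPl/= Tx// Ty// mulr0 addr0.
Qed.

Lemma orthodiff_closed S T : closed S -> closed (orthodiff S T).
Proof.
move=> cS x /closure_seq[u Su ux]; split.
  by apply: closed_seq cS _ ux => n; case: (Su n).
by move=> y Ty; apply: hcvg_orth ux _ => n; case: (Su n) => _; exact.
Qed.

Lemma orth_self x : inner x x = 0 -> x = 0.
Proof. by move=> x0; apply: rdot0; rewrite x0. Qed.

Lemma orth_decomp S T x : subsp S -> hcomplete S -> subsp T -> S `<=` T -> T x ->
  exists s d, [/\ S s, orthodiff T S d & x = d + s].
Proof.
move=> sS cS sT ST Tx; have [s Ss sP] := projection x sS cS.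
exists s, (x - s); split; rewrite ?subrK//; split => //.
by apply: subspB => //; exact: ST.
Qed.

(** By Pythagoras both components of a Cauchy sequence are Cauchy. *)
Lemma orth_sum_complete S T : subsp S -> subsp T -> hcomplete S -> hcomplete T ->
  (forall s t, S s -> T t -> inner s t = 0) -> hcomplete [set s + t | s in S & t in T].
Proof.
move=> sS sT cS cT ST u Su cu.
have /choice[v vP] n : exists p : X * X, [/\ S p.1, T p.2 & u n = p.1 + p.2].
  by have [s Ss [t Tt <-]] := Su n; exists (s, t).
have pyth m n : rdot (u m - u n) (u m - u n) = rdot ((v m).1 - (v n).1) ((v m).1 - (v n).1) +
    rdot ((v m).2 - (v n).2) ((v m).2 - (v n).2).
  have [Sm Tm um] := vP m; have [Sn Tn un] := vP n.
  have o : inner ((v m).1 - (v n).1) ((v m).2 - (v n).2) = 0 by apply: ST; exact: subspB.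
  by rewrite um un opprD addrACA; exact: rdot_pythagoras.
have [||s Ss us] := cS (fun n => (v n).1).
- by move=> n; case: (vP n).
- move=> e /cu[N HN]; exists N => m n Nm Nn; apply: le_lt_trans (HN m n Nm Nn).
  by rewrite hn_le_sqr ?hn_ge0// !hn_sqr pyth lerDl rdot_ge0.
have [||t Tt ut] := cT (fun n => (v n).2).
- by move=> n; case: (vP n).
- move=> e /cu[N HN]; exists N => m n Nm Nn; apply: le_lt_trans (HN m n Nm Nn).
  by rewrite hn_le_sqr ?hn_ge0// !hn_sqr pyth lerDr rdot_ge0.
exists (s + t); first by exists s => //; exists t.
have := hcvgD us ut; rewrite (_ : (fun n => _) = u)//.
by apply/funext => n; case: (vP n).
Qed.

Lemma subsp_sum2 S T : subsp S -> subsp T -> subsp [set s + t | s in S & t in T].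
Proof.
move=> sS sT; split; first by exists 0; [case: sS|exists 0; [case: sT|rewrite addr0]].
move=> a _ _ [s Ss [t Tt <-]] [s' Ss' [t' Tt' <-]].
exists (a *: s + s'); first exact: sS.2.
by exists (a *: t + t'); [exact: sT.2|rewrite scalerDr addrACA].
Qed.

Lemma adjoint_onP (V : preHilbertType R) S (A : X -> V) (y : V) :
  (exists x, S x /\ forall u, S u -> inner (A u) y = inner u x) ->
  S (adjoint S A y) /\ forall u, S u -> inner (A u) y = inner u (adjoint S A y).
Proof. by move=> [x xP]; rewrite /adjoint; case: xgetP => [z _ //|/(_ x)]. Qed.

(** The relative adjoint is the projection onto [S] of the full adjoint. *)
Lemma adjoint_on_bounded (V : preHilbertType R) S (C : R) (A : X -> V) (y : V) : hcomplete [set: X] ->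
  linear A -> hbounded C A -> subsp S -> hcomplete S ->
  S (adjoint S A y) /\ forall u, S u -> inner (A u) y = inner u (adjoint S A y).
Proof.
move=> cX lA bA sS cS; apply: adjoint_onP; have aP := adjP cX lA bA.
have [x Sx xP] := projection (adjoint setT A y) sS cS; exists x; split=> // u Su.
rewrite aP; apply/eqP; rewrite -subr_eq0 -innerBr; apply/eqP/inner0C; exact: xP.
Qed.

Lemma adjoint_on_unitary S (A : X -> X) y : unitary_on S A -> S y ->
  S (adjoint S A y) /\ forall u, S u -> inner (A u) y = inner u (adjoint S A y).
Proof.
move=> [_ _ iA oA] /oA[x Sx <-]; apply: adjoint_onP; exists x; split=> // u Su.
exact: iA.
Qed.

Lemma isometric_image_complete (U : preHilbertType R) (S : set U) (J : U -> X) : hcomplete S ->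
  linear J -> (forall f g, inner (J f) (J g) = inner f g) -> hcomplete [set J f | f in S].
Proof.
move=> cS lJ iJ u Su cu.
have /choice[v vP] n : exists f, S f /\ J f = u n by have [f Sf Jf] := Su n; exists f.
have uE : u = J \o v by apply/funext => n; case: (vP n).
subst u; have hJ f g : hn (f - g) = hn (J f - J g) by rewrite -(op_sub lJ) /hn iJ.
have [||f Sf vf] := cS v; first by move=> n; case: (vP n).
  by move=> e /cu[N HN]; exists N => m n Nm Nn; rewrite hJ; exact: HN.
exists (J f); first by exists f.
by move=> e /vf[N HN]; exists N => n /HN; rewrite hJ.
Qed.

Lemma isometric_image_subsp (U : preHilbertType R) (S : set U) (J : U -> X) : subsp S ->
  linear J -> subsp [set J f | f in S].
Proof.
move=> sS lJ; split; first by exists 0; [case: sS|rewrite (op_zero lJ)].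
by move=> a _ _ [f Sf <-] [g Sg <-]; exists (a *: f + g); [exact: sS.2|rewrite lJ].
Qed.

End Subspaces.

(** * The operators with symbol G1^* + z G2 and the ambient space of the model *)

Section Pencil.
Context (R : realType) (E : sepHilbertType R).
Local Notation mu := (circle_measure R).
Variables G1 G2 : {linear E -> E}.
Hypotheses (cG1 : contractive G1) (cG2 : contractive G2).

Let aG := adjP (@sepHilbert_complete R E) (linearP G1) ((contractiveE G1).1 cG1).

Lemma pencil_field : cfield mu 2 (fun t x => adjoint setT G1 x + circle_pt t *: G2 x).
Proof.
have lA := adj_linear aG; have bA := adj_bounded ler01 aG ((contractiveE G1).1 cG1).
have bG := (contractiveE G2).1 cG2.
apply: (@mfield_cfield _ (measurableTypeR R) R mu E E 2 _
  (fun t x => adjoint setT G1 x + circle_pt t *: G2 x)); last exact: aeW.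
split=> [t a x y|t x|x].
- by rewrite lA linearP scalerDr scalerDr !scalerA addrACA [_ * a]mulrC.
- apply: le_trans (hnD _ _) _; rewrite hnZ cmod_circle_pt mul1r.
  by have := bA x; have := bG x; rewrite !mul1r; lra.
- have := wmeas_comb 1 (wmeas_scale (chi_measurable R 1) (wmeas_cst _ (G2 x))) (wmeas_cst _ (adjoint setT G1 x)).
  rewrite (_ : (fun t => _) = (fun t => adjoint setT G1 x + circle_pt t *: G2 x))//.
  by apply/funext => t; rewrite scale1r addrC chi1.
Qed.

Lemma pencil_linear : linear (pencil G1 G2).
Proof. exact: mulop_linear pencil_field. Qed.

Lemma pencil_bounded : hbounded 2 (pencil G1 G2).
Proof. exact: mulop_bounded pencil_field. Qed.

Lemma pencil_ae f : {ae mu, forall t, pencil G1 G2 f t = adjoint setT G1 (f t) + circle_pt t *: G2 (f t)}.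
Proof. exact: (mulop_ae _ pencil_field). Qed.

Lemma pencil_mz n f : pencil G1 G2 (mz n f) = mz n (pencil G1 G2 f).
Proof. exact: (mulop_mz _ _ _ pencil_field). Qed.

Lemma pencil_monomial n v : pencil G1 G2 (monomial n v) = monomial n (adjoint setT G1 v) + monomial (n + 1) (G2 v).
Proof.
have lA := adj_linear aG.
apply/L2_eq/aeE; apply: filterS3 (pencil_ae (monomial n v)) (monomial_ae n v)
  (filterI (L2D_ae (monomial n (adjoint setT G1 v)) (monomial (n + 1) (G2 v)))
  (filterI (monomial_ae n (adjoint setT G1 v)) (monomial_ae (n + 1) (G2 v)))).
move=> t -> -> [-> [-> ->]].
by rewrite (op_scale lA) (op_scale (linearP G2)) scalerA addrC [n + 1]addrC chiD chi1 addrC.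
Qed.

Lemma pencil_Hardy f : Hardy2 f -> Hardy2 (pencil G1 G2 f).
Proof.
apply: (Hardy2_ind (S := pencil G1 G2 @^-1` @Hardy2 R E)).
- exact: (subsp_preimage pencil_linear (@Hardy2_subsp R E)).
- exact: (closed_preimage pencil_linear pencil_bounded (@Hardy2_closed R E)).
move=> n v /=; rewrite pencil_monomial; apply: subspD; first exact: Hardy2_subsp.
  exact: Hardy2_monomial.
by rewrite -PoszD; exact: Hardy2_monomial.
Qed.

End Pencil.

Lemma pencil_adj (R : realType) (E : sepHilbertType R) (G1 G2 : {linear E -> E}) f g :
  contractive G1 -> contractive G2 ->
  inner (pencil G1 G2 f) g = inner (mz 1 f) (pencil G2 G1 g).
Proof.
move=> cG1 cG2.
have a1 := adjP (@sepHilbert_complete R E) (linearP G1) ((contractiveE G1).1 cG1).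
have a2 := adjP (@sepHilbert_complete R E) (linearP G2) ((contractiveE G2).1 cG2).
apply: ae_inner; apply: filterS3 (pencil_ae cG1 cG2 f) (pencil_ae cG2 cG1 g) (mz_ae 1 f).
move=> t -> -> ->; rewrite chi1 innerDl innerDr !innerZl innerZr.
have -> : circle_pt t * (Num.conj (circle_pt t) * inner ((f : L2T E) t) (G1 ((g : L2T E) t))) =
    inner ((f : L2T E) t) (G1 ((g : L2T E) t)).
  by rewrite mulrA -chi1 -chiN mulrC mulrC -chiD subrr chi0 mul1r.
rewrite addrC a2; congr (_ + _).
by rewrite inner_conj -a1 -inner_conj.
Qed.
Lemma other_index (i : 'I_2) : exists j, i != j.
Proof. by exists (rev_ord i); case: i => -[|[|]]. Qed.

Section Model.
Context (R : realType) (D Dstar : sepHilbertType R).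
Local Notation mu := (circle_measure R).
Variables (Th : R[i] -> {linear D -> Dstar}) (G : 'I_2 -> {linear Dstar -> Dstar}).
Variable W : 'I_2 -> L2T D -> L2T D.
Hypotheses (c0 : contractive_analytic Th) (adm : admissible Th G W).
Local Notation X := (dsum (L2T Dstar) (L2T D)).
Local Notation K := (Kspace Th).
Local Notation Q := (Qspace Th).
Local Notation H := (Hspace Th).
Local Notation A i j := (osum (pencil (G i) (G j)) (W i)).

Lemma KspaceE (x : X) : K x <-> Hardy2 x.1 /\ DeltaL2 Th x.2.
Proof.
split=> [[u Hu [v Dv <-]]//|[Hu Dv]].
by exists x.1 => //; exists x.2 => //; rewrite -dsumE.
Qed.

Lemma Kspace_subsp : subsp K.
Proof.
split; first by apply/KspaceE; split; [case: (@Hardy2_subsp R Dstar)|case: (DeltaL2_subsp c0)].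
move=> a x y /KspaceE[h1 d1] /KspaceE[h2 d2]; apply/KspaceE; split.
  exact: (@Hardy2_subsp R Dstar).2.
exact: (DeltaL2_subsp c0).2.
Qed.

Definition graph_op (h : L2T D) : X := mulop (bdry Th) h ⊕ mulop (Delta Th) h.

Lemma graph_op_linear : linear graph_op.
Proof.
move=> a x y; rewrite /graph_op dsumP (mulop_linear ler01 (bdry_field c0)).
by rewrite (mulop_linear ler01 (Delta_field c0)).
Qed.

Lemma graph_op_inner f g : inner (graph_op f) (graph_op g) = inner f g.
Proof. by rewrite inner_dsumE /= Delta_mulop_inner. Qed.

Lemma Qspace_subsp : subsp Q.
Proof. exact: (isometric_image_subsp (@Hardy2_subsp R D) graph_op_linear). Qed.

Lemma Qspace_complete : hcomplete Q.
Proof. exact: (isometric_image_complete (@Hardy2_complete R D) graph_op_linear graph_op_inner). Qed.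

Lemma Qspace_sub : Q `<=` K.
Proof.
by move=> _ [h Hh <-]; apply/KspaceE; split; [exact: bdry_Hardy|exact: DeltaL2_range].
Qed.

Lemma Hspace_subsp : subsp H. Proof. exact: orthodiff_subsp Kspace_subsp. Qed.

(** Both sides equal W_i W_j W_i v. *)
Lemma W_Mzeta i v : DeltaL2 Th v -> W i (Mzeta v) = Mzeta (W i v).
Proof.
move=> Dv; have [j ij] := other_index i.
have [Wi _ _ _] := adm_W adm i.
have ji : j != i by rewrite eq_sym.
by rewrite -(adm_shift adm ij (Wi _ Dv)) -(adm_shift adm ji Dv).
Qed.

Variables i j : 'I_2.
Hypothesis ij : i != j.
Let ji : j != i. Proof. by rewrite eq_sym. Qed.

Lemma A_K x : K x -> K (A i j x).
Proof.
move=> /KspaceE[Hx Dx]; apply/KspaceE; split; first exact: (pencil_Hardy (adm_G adm i) (adm_G adm j)).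
by have [WD _ _ _] := adm_W adm i; exact: WD.
Qed.

Lemma A_linear a x y : K x -> K y -> A i j (a *: x + y) = a *: A i j x + A i j y.
Proof.
move=> /KspaceE[_ Dx] /KspaceE[_ Dy]; have [_ lW _ _] := adm_W adm i.
by rewrite /osum dsumP (pencil_linear (adm_G adm i) (adm_G adm j)) lW.
Qed.

Lemma A_sub x y : K x -> K y -> A i j (x - y) = A i j x - A i j y.
Proof. by move=> Kx Ky; rewrite addrC -scaleN1r A_linear// scaleN1r addrC. Qed.

Lemma A_hn x : K x -> hn (A i j x) <= hn x.
Proof. by move=> /(adm_contr adm ij); rewrite !hnE lecR. Qed.

Lemma A_cvg u x : (forall n, K (u n)) -> K x -> hcvg u x -> hcvg (A i j \o u) (A i j x).
Proof.
move=> Ku Kx ux e /ux[N HN]; exists N => n /HN; apply: le_lt_trans => /=.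
by rewrite -A_sub// A_hn//; exact: subspB Kspace_subsp _ _.
Qed.

Lemma dmz_K x : K x -> K (dmz 1 x).
Proof.
move=> /KspaceE[Hx Dx]; apply/KspaceE; split; first exact: (Hardy2_mz 1).
exact: DeltaL2_mz.
Qed.

Lemma A_dmz x : K x -> A i j (dmz 1 x) = dmz 1 (A i j x).
Proof.
move=> /KspaceE[_ Dx]; rewrite /osum /dmz /= (pencil_mz (adm_G adm i) (adm_G adm j)).
by have := W_Mzeta i Dx; rewrite MzetaE => ->.
Qed.

(* On the unit circle <(G_i^* + zeta G_j) x, y> = <zeta x, (G_j^* + zeta G_i) y>, and
   W_i is unitary with W_j W_i = M_zeta. *)
Lemma A_adj x y : K x -> K y -> inner (A i j x) y = inner (dmz 1 x) (A j i y).
Proof.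
move=> /KspaceE[_ Dx] /KspaceE[_ Dy]; rewrite !inner_dsumE /=.
rewrite (pencil_adj _ _ (adm_G adm i) (adm_G adm j)); congr (_ + _).
have [WiD _ _ _] := adm_W adm i; have [_ _ Wj _] := adm_W adm j.
by rewrite -Wj ?(adm_shift adm ji Dx) ?MzetaE//; exact: WiD.
Qed.

Lemma osum_adjoint_K y : K y -> let B := osum (adjoint (@Hardy2 R Dstar) (pencil (G i) (G j)))
    (adjoint (DeltaL2 Th) (W i)) in
  K (B y) /\ forall x, K x -> inner (A i j x) y = inner x (B y).
Proof.
move=> /KspaceE[Hy Dy] B.
have [a1 a2] := adjoint_on_bounded y.1 (@L2_complete _ _ R mu Dstar)
  (pencil_linear (adm_G adm i) (adm_G adm j)) (pencil_bounded (adm_G adm i) (adm_G adm j))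
  (@Hardy2_subsp R Dstar) (@Hardy2_complete R Dstar).
have [b1 b2] := adjoint_on_unitary (adm_W adm i) Dy.
split; first by apply/KspaceE.
by move=> x /KspaceE[Hx Dx]; rewrite !inner_dsumE /= a2// b2.
Qed.

Lemma osum_adjoint_Mzeta y : let B := osum (adjoint (@Hardy2 R Dstar) (@Mzeta R Dstar))
    (adjoint (DeltaL2 Th) (@Mzeta R D)) in
  forall x, K x -> inner (dmz 1 x) y = inner x (B y).
Proof.
move=> B x /KspaceE[Hx Dx]; rewrite /B !MzetaE.
have [_ a2] := adjoint_on_bounded y.1 (@L2_complete _ _ R mu Dstar)
  (@mz_linear R Dstar 1) (@mz_bounded R Dstar 1) (@Hardy2_subsp R Dstar) (@Hardy2_complete R Dstar).
have [_ b2] := adjoint_on_bounded y.2 (@L2_complete _ _ R mu D)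
  (@mz_linear R D 1) (@mz_bounded R D 1) (DeltaL2_subsp c0) (@DeltaL2_complete R D Dstar Th).
by rewrite !inner_dsumE /= a2// b2.
Qed.

Lemma model_opP x : K x -> exists2 q, Q q &
  H (model_op Th G W i j x) /\ A i j x = model_op Th G W i j x + q.
Proof.
move=> Kx; have [q [d [Qq Hd E]]] := orth_decomp Qspace_subsp Qspace_complete Kspace_subsp
  Qspace_sub (A_K Kx).
suff -> : model_op Th G W i j x = d by exists q.
have dP s : H s -> inner (d + q - d) s = 0.
  by move=> [_ sQ]; rewrite addrAC subrr add0r; apply/inner0C/sQ.
rewrite /model_op E; exact: (orthoproj_eq Hspace_subsp Hd dP).
Qed.

End Model.

(** * From a regular factorization to an invariant subspace *)

Section Sufficiency.
Context (R : realType) (D F Dstar : sepHilbertType R).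
Local Notation mu := (circle_measure R).
Variables (Th : R[i] -> {linear D -> Dstar}) (G : 'I_2 -> {linear Dstar -> Dstar}).
Variable W : 'I_2 -> L2T D -> L2T D.
Hypotheses (c0 : contractive_analytic Th) (adm : admissible Th G W).
Variables (Th2 : R[i] -> {linear F -> Dstar}) (Th1 : R[i] -> {linear D -> F}).
Hypotheses (c2 : contractive_analytic Th2) (c1 : contractive_analytic Th1).
Hypothesis reg : regular_factorization Th Th2 Th1.
Variables (G' : 'I_2 -> {linear F -> F}) (W' : 'I_2 -> L2T D -> L2T D).
Hypotheses (cG' : forall i, contractive (G' i)) (uW' : forall i, unitary_on (DeltaL2 Th1) (W' i)).

Local Notation Zi := (Zinv Th Th2 Th1).
Local Notation L' := [set mulop (bdry Th2) f ⊕ Zi (mulop (Delta Th2) f ⊕ g)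
         | f in @Hardy2 R F & g in DeltaL2 Th1].

Hypothesis intertwine : forall f g, Hardy2 f -> DeltaL2 Th1 g -> forall i j : 'I_2, i != j ->
      osum (pencil (G i) (G j)) (W i) (mulop (bdry Th2) f ⊕ Zi (mulop (Delta Th2) f ⊕ g)) =
      mulop (bdry Th2) (pencil (G' i) (G' j) f) ⊕
      Zi (mulop (Delta Th2) (pencil (G' i) (G' j) f) ⊕ W' i g).

(** The intertwining relation makes L' invariant under A_i, and L' contains Q because Z^{-1} sends
    Delta'' Theta' h ⊕ Delta' h to Delta h. Compressing A_i x to the model space subtracts an
    element of Q, so the result stays in L'. *)
Lemma regular_invariant i j x : i != j ->
  orthodiff L' (Qspace Th) `<=` Hspace Th -> orthodiff L' (Qspace Th) x ->
  orthodiff L' (Qspace Th) (model_op Th G W i j x).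
Proof.
move=> ij HH [L'x Qx]; have fac := bdry_comp c0 c2 c1 reg.1.
have onto := regular_onto c0 c2 c1 fac reg.
have sL' : subsp L'.
  have lB := mulop_linear ler01 (bdry_field c2); have lD := mulop_linear ler01 (Delta_field c2).
  have [D0 DP] := DeltaL2_subsp c1; have [H0 HP] := @Hardy2_subsp R F.
  have [E0 EP] := DeltaL2_subsp c2.
  have ZP a p q p' q' : DeltaL2 Th2 p -> DeltaL2 Th1 q -> DeltaL2 Th2 p' ->
      DeltaL2 Th1 q' -> Zi ((a *: p + p') ⊕ (a *: q + q')) = a *: Zi (p ⊕ q) + Zi (p' ⊕ q').
    exact: (Zinv_linear c0 c2 c1 fac onto).
  split.
    exists 0 => //; exists 0 => //; rewrite (op_zero lB) (op_zero lD).
    have := ZP (-1) 0 0 0 0 E0 D0 E0 D0; rewrite !scaler0 !addr0 scaleN1r addNr => ->.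
    by [].
  move=> a _ _ [f Hf [g Dg <-]] [f' Hf' [g' Dg' <-]].
  exists (a *: f + f'); first exact: HP.
  exists (a *: g + g'); first exact: DP.
  by rewrite dsumP lB lD ZP//; exact: DeltaL2_range.
have QL' : Qspace Th `<=` L'.
  move=> _ [h Hh <-]; exists (mulop (bdry Th1) h); first exact: bdry_Hardy.
  exists (mulop (Delta Th1) h); first exact: DeltaL2_range.
  rewrite (mulop_fac c0 c2 c1 fac); congr (_ ⊕ _).
  by apply: (ZinvK c0 c2 c1 fac onto); [exact: DeltaL2_range|rewrite (Zop_Delta c0 c2 c1 fac)].
have AL' y : L' y -> L' (osum (pencil (G i) (G j)) (W i) y).
  move=> [f Hf [g Dg <-]]; rewrite intertwine//.
  exists (pencil (G' i) (G' j) f); first exact: pencil_Hardy.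
  by exists (W' i g) => //; case: (uW' i) => + _ _ _; exact.
have Kx : Kspace Th x by case: (HH x (conj L'x Qx)).
have [q Qq [[_ oQ] AE]] := model_opP c0 adm i j Kx.
split=> //; have -> : model_op Th G W i j x = osum (pencil (G i) (G j)) (W i) x - q by rewrite AE addrK.
by apply: subspB => //; [exact: AL'|exact: QL'].
Qed.

End Sufficiency.

(** * The wandering subspace of an invariant subspace *)

Section BoundaryTraces.
Context (R : realType) (E F : sepHilbertType R).
Local Notation mu := (circle_measure R).

Lemma bdry_trace (Th : R[i] -> {linear E -> F}) (T : E -> L2T F) : contractive_analytic Th ->
  (forall t r x, 0 <= r < 1 -> Th (r%:C * circle_pt t) x = poisson_ext r t (T x)) ->
  forall x, {ae mu, forall t, bdry Th t x = T x t}.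
Proof.
move=> cTh TP; have [|_ bT _] := pois_field (Phi := fun t r x => Th (r%:C * circle_pt t) x) _ TP.
  by move=> t r; exact: analytic_bounded.
exact: bT.
Qed.

Lemma mulop_monomial0 C (A : R -> E -> F) v (f : L2T F) : 0 <= C -> cfield mu C A ->
  {ae mu, forall t, A t v = f t} -> mulop A (monomial 0 v) = f.
Proof.
move=> C0 cA Av; apply/L2_eq/aeE.
by apply: filterS3 (mulop_ae C0 cA (monomial 0 v)) (monomial_ae 0 v) Av => t -> ->; rewrite chi0 scale1r.
Qed.

Lemma mulop_monomial C (A : R -> E -> F) n v (f : L2T F) : 0 <= C -> cfield mu C A ->
  {ae mu, forall t, A t v = f t} -> mulop A (monomial n v) = mz n f.
Proof.
move=> C0 cA Av; have -> : monomial n v = mz n (monomial 0 v) by rewrite mz_monomial addr0.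
by rewrite (mulop_mz _ _ C0 cA) (mulop_monomial0 C0 cA Av).
Qed.

Lemma L2_dense_eq (V : preHilbertType R) C C' (M N : L2T E -> V) : linear M -> linear N ->
  hbounded C M -> hbounded C' N -> (forall n v, M (monomial n v) = N (monomial n v)) -> forall f, M f = N f.
Proof.
move=> lM lN bM bN MN; apply: (L2_dense (S := [set f | M f = N f])) => //.
- split=> [|a x y /= ex ey]; first by rewrite /= (op_zero lM) (op_zero lN).
  by rewrite lM lN ex ey.
move=> x /closure_seq[u Su ux] /=.
apply: hcvg_unique (hbounded_cvg lM bM ux) _.
rewrite (_ : M \o u = N \o u); first exact: hbounded_cvg lN bN ux.
by apply/funext => n; exact: Su.
Qed.

Lemma L2_dense_orth (V : preHilbertType R) C (M : L2T E -> V) y : linear M -> hbounded C M ->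
  (forall n v, inner (M (monomial n v)) y = 0) -> forall f, inner (M f) y = 0.
Proof.
move=> lM bM MN; apply: (L2_dense (S := [set f | inner (M f) y = 0])) => //.
- split=> [|a x z /= ex ez]; first by rewrite /= (op_zero lM) linear0l.
  by rewrite lM linearPl/= ex ez mulr0 addr0.
by move=> x /closure_seq[u Su ux] /=; apply: hcvg_orth (hbounded_cvg lM bM ux) _ => n; exact: Su.
Qed.

End BoundaryTraces.

Section LinearSums.
Context (R : realType) (U V : preHilbertType R).

Lemma linear_addACA (a : R[i]) (x y z w : V) : a *: (x + y) + (z + w) = (a *: x + z) + (a *: y + w).
Proof. by rewrite scalerDr addrACA. Qed.

Lemma linear_plus (f g : U -> V) : linear f -> linear g -> linear (fun x => f x + g x).
Proof. by move=> lf lg a x y; rewrite lf lg linear_addACA. Qed.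

Lemma linear_o (T : preHilbertType R) (f : U -> V) (g : V -> T) : linear f -> linear g ->
  linear (fun x => g (f x)).
Proof. by move=> lf lg a x y; rewrite lf lg. Qed.

End LinearSums.

Section Wandering.
Context (R : realType) (D Dstar : sepHilbertType R).
Local Notation mu := (circle_measure R).
Variable Th : R[i] -> {linear D -> Dstar}.
Hypothesis c0 : contractive_analytic Th.
Local Notation X := (dsum (L2T Dstar) (L2T D)).
Local Notation K := (Kspace Th).
Variable L : set X.
Hypotheses (sL : subsp L) (cL : hcomplete L) (LK : L `<=` K).
Hypothesis UL : forall x, L x -> L (dmz 1 x).

Definition wandering := orthodiff L [set dmz 1 x | x in L].

Lemma wandering_subsp : subsp wandering. Proof. exact: orthodiff_subsp. Qed.

Lemma wandering_complete : hcomplete wandering.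
Proof.
apply: (complete_closed cL) => [x []//|].
exact: orthodiff_closed (closed_complete cL).
Qed.

Lemma L_dmz (k : nat) x : L x -> L (dmz k%:Z x).
Proof.
move=> Lx; elim: k => [|k IH]; first by rewrite dmz0.
by have := UL IH; rewrite dmzD -PoszD.
Qed.

Lemma wandering_orth n x y : n != 0 -> wandering x -> wandering y -> inner (dmz n x) y = 0.
Proof.
have key (k : nat) u v : wandering u -> wandering v -> inner (dmz k.+1%:Z u) v = 0.
  move=> [Lu _] [_ ov]; apply/inner0C/ov; exists (dmz k%:Z u); first exact: L_dmz.
  by rewrite dmzD -PoszD.
case: n => [[//|k]|k] _ wx wy; first exact: key.
by rewrite NegzE dmz_adj opprK; apply/inner0C/key.
Qed.

(** Since U is isometric, U L is complete, and L is the orthogonal sum of U L and the wandering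
    subspace. *)
Lemma wandering_cover x : L x -> (forall d, wandering d -> inner x d = 0) ->
  exists2 y, L y & x = dmz 1 y.
Proof.
move=> Lx ox.
have sU := isometric_image_subsp sL (@dmz_linear R Dstar D 1).
have cU := isometric_image_complete cL (@dmz_linear R Dstar D 1) (@dmz_inner R Dstar D 1).
have UL' : [set dmz 1 x | x in L] `<=` L by move=> _ [y Ly <-]; exact: UL.
have [_ [d [[y Ly <-] wd xE]]] := orth_decomp sU cU sL UL' Lx.
exists y => //; suff d0 : d = 0 by rewrite xE d0 add0r.
have yd : inner (dmz 1 y) d = 0 by have [_ od] := wd; apply/inner0C/od; exists y.
by apply: orth_self; have := ox _ wd; rewrite xE innerDl yd addr0.
Qed.

Variables (F : sepHilbertType R) (io : F -> X).
Hypotheses (lio : linear io) (iio : forall a b, inner (io a) (io b) = inner a b).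
Hypotheses (ioL : forall a, wandering (io a)) (ioS : forall x, wandering x -> exists a, io a = x).

Lemma io_fdot a b : {ae mu, forall t, fdot (io a) (io b) t = inner a b}.
Proof. by rewrite -iio; apply: fdot_const => n n0; exact: wandering_orth. Qed.

Lemma io_bounds a : {ae mu, forall t, hn ((io a).1 t : Dstar) <= hn a /\ hn ((io a).2 t : D) <= hn a}.
Proof.
apply: filterS (io_fdot a a) => t /(congr1 (@complex.Re R)); rewrite /fdot raddfD /= => h.
have h1 := rdot_ge0 ((io a).1 t : Dstar); have h2 := rdot_ge0 ((io a).2 t : D).
by split; rewrite hn_le_sqr ?hn_ge0// hn_sqr -h ?lerDl ?lerDr.
Qed.

Lemma io_analytic : exists2 Th2 : R[i] -> {linear F -> Dstar}, contractive_analytic Th2 &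
  forall a, {ae mu, forall t, bdry Th2 t a = ((io a).1 : L2T Dstar) t}.
Proof.
have [|||Th2 c2 P2] := @analytic_of R F Dstar (fun a => (io a).1).
- by move=> a x y; rewrite lio.
- by move=> a; have [/LK/KspaceE[]] := ioL a.
- by move=> a; apply: filterS (io_bounds a) => t [].
by exists Th2 => //; exact: bdry_trace.
Qed.

Lemma io_field : exists2 Y : R -> F -> D, cfield mu 1 Y &
  forall a, {ae mu, forall t, Y t a = ((io a).2 : L2T D) t}.
Proof.
apply: (field_of_map (T := fun a => (io a).2)) => [a x y|a]; first by rewrite lio.
by apply: filterS (io_bounds a) => t [].
Qed.

Variables (Th2 : R[i] -> {linear F -> Dstar}) (Y : R -> F -> D).
Hypotheses (c2 : contractive_analytic Th2) (cY : cfield mu 1 Y).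
Hypothesis Th2E : forall a, {ae mu, forall t, bdry Th2 t a = ((io a).1 : L2T Dstar) t}.
Hypothesis YE : forall a, {ae mu, forall t, Y t a = ((io a).2 : L2T D) t}.

(** On H2(F) this is the isometry onto the sum of the spaces U^n F with n >= 0. Defining it on all
    of L2(F) lets it commute with the inverse of U too. *)
Definition wold_op (f : L2T F) : X := mulop (bdry Th2) f ⊕ mulop Y f.

Lemma wold_op_linear : linear wold_op.
Proof.
move=> a x y; rewrite /wold_op dsumP (mulop_linear ler01 (bdry_field c2)).
by rewrite (mulop_linear ler01 cY).
Qed.

Lemma wold_op_emb n a : wold_op (monomial n a) = dmz n (io a).
Proof.
rewrite /wold_op /dmz (mulop_monomial _ ler01 (bdry_field c2) (Th2E a)).
by rewrite (mulop_monomial _ ler01 cY (YE a)).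
Qed.

Lemma wold_op_mz n f : wold_op (mz n f) = dmz n (wold_op f).
Proof. by rewrite /wold_op /dmz /= (mulop_mz _ _ ler01 (bdry_field c2)) (mulop_mz _ _ ler01 cY). Qed.

Lemma wold_op_bounded : hbounded 2 wold_op.
Proof.
move=> f; apply: le_trans (hn_dsum_le _) _ => /=.
have := mulop_bounded ler01 (bdry_field c2) f; have := mulop_bounded ler01 cY f.
by rewrite !mul1r; lra.
Qed.

Lemma wold_op_inner f g : inner (wold_op f) (wold_op g) = inner f g.
Proof.
(* Preservation of inner products is rephrased as orthogonality of [wold_op f ⊕ f] to
   [wold_op g ⊕ - g], so that the density of monomials can be used in one variable at a time. *)
have lp : linear (fun f : L2T F => wold_op f ⊕ f).
  by move=> a x y; rewrite wold_op_linear.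
have bp : hbounded 3 (fun f : L2T F => wold_op f ⊕ f).
  by move=> x; apply: le_trans (hn_dsum_le _) _ => /=; have := wold_op_bounded x; lra.
have orth (u v : X) (u' v' : L2T F) : inner (u ⊕ u') (v ⊕ - v') = 0 -> inner u v = inner u' v'.
  by rewrite inner_dsumE /= linearNr => /eqP; rewrite subr_eq0 => /eqP.
have orthV (u v : X) (u' v' : L2T F) : inner u v = inner u' v' -> inner (u ⊕ u') (v ⊕ - v') = 0.
  by move=> e; apply/eqP; rewrite inner_dsumE /= linearNr subr_eq0; apply/eqP.
have key n a f' : inner (wold_op f') (wold_op (monomial n a)) = inner f' (monomial n a).
  apply: orth; move: f'; apply: (L2_dense_orth lp bp) => m b; apply: orthV.
  rewrite !wold_op_emb inner_monomial dmz_adj dmzD.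
  have [->|mn] := eqVneq m n; first by rewrite addNr dmz0 iio mul1r.
  rewrite mul0r; apply: inner0C; apply: wandering_orth => //.
  by rewrite addrC subr_eq0 eq_sym.
apply/orth/inner0C.
have lq : linear (fun f : L2T F => wold_op f ⊕ - f).
  by move=> a x y; rewrite wold_op_linear dsumP opprD -scalerN.
have bq : hbounded 3 (fun f : L2T F => wold_op f ⊕ - f).
  by move=> x; apply: le_trans (hn_dsum_le _) _ => /=; rewrite hnN; have := wold_op_bounded x; lra.
move: g; apply: (L2_dense_orth lq bq) => m b; apply: inner0C; apply: orthV; exact: key.
Qed.

(** [Y] and [Delta Th2] both complement the boundary values of [Th2] to an isometry on L2. *)
Lemma mulop_Y_inner f g : inner (mulop Y f) (mulop Y g) = inner (mulop (Delta Th2) f) (mulop (Delta Th2) g).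
Proof.
apply: (addrI (inner (mulop (bdry Th2) f) (mulop (bdry Th2) g))).
by rewrite Delta_mulop_inner// -wold_op_inner.
Qed.

Lemma mulop_Y_Delta f : DeltaL2 Th (mulop Y f).
Proof.
have lY := mulop_linear ler01 cY.
apply: (L2_dense (S := mulop Y @^-1` DeltaL2 Th)).
- exact: (subsp_preimage lY (DeltaL2_subsp c0)).
- exact: (closed_preimage lY (mulop_bounded ler01 cY) (@DeltaL2_closed _ _ _ _)).
move=> n a /=; rewrite (mulop_monomial _ ler01 cY (YE a)); apply: DeltaL2_mz => //.
by have [/LK/KspaceE[]] := ioL a.
Qed.

Lemma wold_op_L f : Hardy2 f -> L (wold_op f).
Proof.
apply: (Hardy2_ind (S := wold_op @^-1` L)).
- exact: (subsp_preimage wold_op_linear sL).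
- exact: (closed_preimage wold_op_linear wold_op_bounded (closed_complete cL)).
by move=> n a /=; rewrite wold_op_emb; apply: L_dmz; have [] := ioL a.
Qed.

Local Notation JH := [set wold_op f | f in @Hardy2 R F].

Lemma JH_subsp : subsp JH.
Proof. exact: (isometric_image_subsp (@Hardy2_subsp R F) wold_op_linear). Qed.

Lemma JH_complete : hcomplete JH.
Proof. exact: (isometric_image_complete (@Hardy2_complete R F) wold_op_linear wold_op_inner). Qed.

(* The unitary part of the Wold decomposition of M_z on L. *)
Definition unitary_part := orthodiff L JH.

Lemma unitary_part_subsp : subsp unitary_part. Proof. exact: orthodiff_subsp. Qed.

Lemma unitary_part_closed : closed unitary_part.
Proof. exact: orthodiff_closed (closed_complete cL). Qed.

Lemma Wold x : L x -> exists f r, [/\ Hardy2 f, unitary_part r & x = wold_op f + r].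
Proof.
have JL : JH `<=` L by move=> _ [f Hf <-]; exact: wold_op_L.
move=> Lx; have [_ [d [[f Hf <-] ud ->]]] := orth_decomp JH_subsp JH_complete sL JL Lx.
by exists f, d; rewrite addrC.
Qed.

Lemma unitary_part_shift x : unitary_part x -> unitary_part (dmz 1 x).
Proof.
move=> [Lx ox]; split; first exact: UL.
move=> _ [f Hf <-]; apply: inner0C.
apply: (Hardy2_ind (S := [set f | inner (wold_op f) (dmz 1 x) = 0])) Hf.
- split=> [|a u v /= eu ev]; first by rewrite /= (op_zero wold_op_linear) linear0l.
  by rewrite wold_op_linear linearPl/= eu ev mulr0 addr0.
- by move=> u /closure_seq[w Sw wu] /=; apply: hcvg_orth (hbounded_cvg wold_op_linear wold_op_bounded wu) _.
move=> [|n] a /=.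
  by rewrite wold_op_emb dmz0; have [_] := ioL a; apply; exists x.
have -> : monomial n.+1%:Z a = mz 1 (monomial n%:Z a) by rewrite mz_monomial -PoszD.
rewrite wold_op_mz dmz_inner; apply/inner0C/ox.
by exists (monomial n%:Z a) => //; exact: Hardy2_monomial.
Qed.

(** A vector of the unitary part is orthogonal to the wandering subspace, so it is U y with y in
    L. *)
Lemma unitary_part_back x : unitary_part x -> unitary_part (dmz (- 1) x).
Proof.
move=> [Lx ox].
have [|y Ly xE] := wandering_cover Lx.
  move=> d /ioS[a <-]; apply: ox; exists (monomial 0 a); first exact: (Hardy2_monomial 0).
  by rewrite wold_op_emb dmz0.
rewrite xE dmzVK; split=> // _ [f Hf <-].
rewrite -(dmz_inner 1) -wold_op_mz -xE; apply: ox; exists (mz 1 f) => //; exact: (Hardy2_mz 1).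
Qed.

Lemma unitary_part_dmz n x : unitary_part x -> unitary_part (dmz n x).
Proof.
move=> ux; case: n => n.
  elim: n => [|n IH]; first by rewrite dmz0.
  by have := unitary_part_shift IH; rewrite dmzD -PoszD.
rewrite NegzE; elim: n => [|n IH]; first exact: unitary_part_back.
by have := unitary_part_back IH; rewrite dmzD -opprD -PoszD.
Qed.

(* Vectors divisible by all powers of z have no Hardy space component. *)
Lemma unitary_part_fst x : unitary_part x -> x.1 = 0.
Proof.
move=> ux; apply: L2_fourier_unique => n.
have [/LK/KspaceE[/Hardy2P + _] _] := unitary_part_dmz (- (`|n|%N.+1%:Z)) ux.
(* The coefficient of index [n] of [x] is that of index [n - |n| - 1], which is negative, of z^{-|n|
   - 1} x, a vector still in the ambient space. *)
have [k kE] : exists k : nat, k%:Z = `|n|%N%:Z - n by exists (absz ((absz n)%:Z - n)); lia.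
have e : - k.+1%:Z - - (`|n|%N.+1%:Z) = n by lia.
by move=> /(_ k); rewrite fourier_coef_mz e.
Qed.

(* The unitary part of L is contained in 0 ⊕ L2 (unitary_part_fst). *)
Definition residual (v : L2T D) := unitary_part (0 ⊕ v).

Lemma dmz_dsum0 n (v : L2T D) : dmz n ((0 : L2T Dstar) ⊕ v) = 0 ⊕ mz n v.
Proof. by rewrite /dmz /= (op_zero (@mz_linear _ _ n)). Qed.

Lemma dsum0_linear : linear (fun v : L2T D => (0 : L2T Dstar) ⊕ v).
Proof. by move=> a u v; rewrite dsumP scaler0 addr0. Qed.

Lemma dsum0_bounded : hbounded 1 (fun v : L2T D => (0 : L2T Dstar) ⊕ v).
Proof. by move=> v; apply: le_trans (hn_dsum_le _) _ => /=; rewrite hn0 add0r mul1r. Qed.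

Lemma residual_subsp : subsp residual.
Proof. exact: (subsp_preimage dsum0_linear unitary_part_subsp). Qed.

Lemma residual_closed : closed residual.
Proof. exact: (closed_preimage dsum0_linear dsum0_bounded unitary_part_closed). Qed.

Lemma residual_mz n v : residual v -> residual (mz n v).
Proof. by move=> /(unitary_part_dmz n); rewrite dmz_dsum0. Qed.

Lemma residual_Delta v : residual v -> DeltaL2 Th v.
Proof. by move=> [/LK/KspaceE[]]. Qed.

Lemma unitary_partE x : unitary_part x -> x = 0 ⊕ x.2 /\ residual x.2.
Proof.
move=> ux; have xE : x = 0 ⊕ x.2 by rewrite {1}[x]dsumE unitary_part_fst.
split; [exact: xE|rewrite /residual -xE; exact: ux].
Qed.

Lemma residual_orth v f : residual v -> inner (wold_op f) (0 ⊕ v) = 0.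
Proof.
move=> Rv; apply: (L2_dense_orth wold_op_linear wold_op_bounded) => n a.
rewrite wold_op_emb dmz_adj dmz_dsum0; have [_ o] := residual_mz (- n) Rv; apply/inner0C/o.
by exists (monomial 0 a); [exact: (Hardy2_monomial 0)|rewrite wold_op_emb dmz0].
Qed.

Lemma residual_Y v f : residual v -> inner (mulop Y f) v = 0.
Proof. by move=> /(residual_orth f); rewrite inner_dsumE /= linear0r add0r. Qed.

Lemma wold_op_RR_inner f v f' v' : residual v -> residual v' ->
  inner (wold_op f + (0 ⊕ v)) (wold_op f' + (0 ⊕ v')) = inner f f' + inner v v'.
Proof.
move=> Rv Rv'; rewrite innerDl !innerDr wold_op_inner residual_orth// (inner0C (residual_orth f' Rv)).
by rewrite add0r addr0 inner_dsumE /= linear0l add0r.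
Qed.

Lemma wold_op_RR_inj f v f' v' : residual v -> residual v' ->
  wold_op f + (0 ⊕ v) = wold_op f' + (0 ⊕ v') -> f = f' /\ v = v'.
Proof.
move=> Rv Rv' E.
have E0 : wold_op (f - f') + (0 ⊕ (v - v')) = 0.
  rewrite (op_sub wold_op_linear) (op_sub dsum0_linear) addrACA -opprD E; exact: subrr.
have Rd : residual (v - v') by exact: subspB residual_subsp Rv Rv'.
have h0 := wold_op_RR_inner (f - f') (f - f') Rd Rd.
have : rdot (f - f') (f - f') + rdot (v - v') (v - v') = 0.
  by rewrite -raddfD -h0 E0 linear0l.
have h1 := rdot_ge0 (f - f'); have h2 := rdot_ge0 (v - v') => h3.
split; apply/eqP; rewrite -subr_eq0; apply/eqP/rdot0; lra.
Qed.

(** * The factor Theta' and the regularity of the factorization *)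

Hypothesis QL : Qspace Th `<=` L.

(* T1 h represents z |-> Theta' z h. *)
Lemma trace_ex : exists T1 : D -> L2T F, exists rho : D -> L2T D,
  forall h, [/\ Hardy2 (T1 h), residual (rho h) & graph_op Th (monomial 0 h) = wold_op (T1 h) + (0 ⊕ rho h)].
Proof.
have /choice[p pP] h : exists p : L2T F * L2T D,
    [/\ Hardy2 p.1, residual p.2 & graph_op Th (monomial 0 h) = wold_op p.1 + (0 ⊕ p.2)].
  have [|f [r [Hf ur E]]] := @Wold (graph_op Th (monomial 0 h)).
    by apply: QL; exists (monomial 0 h) => //; exact: (Hardy2_monomial 0).
  by have [rE Rr] := unitary_partE ur; exists (f, r.2); rewrite /= -rE.
by exists (fun h => (p h).1), (fun h => (p h).2).
Qed.

Variables (T1 : D -> L2T F) (rho : D -> L2T D).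
Hypothesis TP : forall h, [/\ Hardy2 (T1 h), residual (rho h) & graph_op Th (monomial 0 h) = wold_op (T1 h) + (0 ⊕ rho h)].

(** The Wold decomposition of a vector is unique. *)
Lemma trace_linear a x y : T1 (a *: x + y) = a *: T1 x + T1 y /\ rho (a *: x + y) = a *: rho x + rho y.
Proof.
have [_ R0 E0] := TP (a *: x + y); have [_ R1 E1] := TP x; have [_ R2 E2] := TP y.
have Rc : residual (a *: rho x + rho y) := residual_subsp.2 a _ _ R1 R2.
apply: (wold_op_RR_inj R0 Rc).
rewrite -E0 monomial_linear (graph_op_linear c0) E1 E2 wold_op_linear dsum0_linear; exact: linear_addACA.
Qed.

Lemma graph_op_mz n g : graph_op Th (mz n g) = dmz n (graph_op Th g).
Proof.
by rewrite /graph_op /dmz /= (mulop_mz _ _ ler01 (bdry_field c0)) (mulop_mz _ _ ler01 (Delta_field c0)).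
Qed.

Lemma trace_monomial n h : graph_op Th (monomial n h) = wold_op (mz n (T1 h)) + (0 ⊕ mz n (rho h)).
Proof.
have [_ _ E] := TP h; have -> : monomial n h = mz n (monomial 0 h) by rewrite mz_monomial addr0.
by rewrite graph_op_mz E (op_add (@dmz_linear _ _ _ n)) dmz_dsum0 wold_op_mz.
Qed.

(** The decomposition is isometric and commutes with U, so the inner products of the shifts of
    [T1 h ⊕ rho h] with itself are those of the constant [h]. They vanish for nonzero exponents, and
    the pointwise norm of the pair is constant, equal to that of [h]. *)
Lemma trace_bounds h : {ae mu, forall t, hn (T1 h t) <= hn h /\ hn (rho h t) <= hn h}.
Proof.
have [_ Rh E] := TP h; pose x : dsum (L2T F) (L2T D) := T1 h ⊕ rho h.
have ix n : inner (dmz n x) x = inner (monomial n h) (monomial 0 h).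
  rewrite -(graph_op_inner c0) trace_monomial E (wold_op_RR_inner _ _ (residual_mz n Rh) Rh); exact: inner_dsumE.
have : {ae mu, forall t, fdot x x t = inner x x}.
  by apply: fdot_const => n n0; rewrite ix inner_monomial (negbTE n0) mul0r.
have := ix 0; rewrite dmz0 inner_monomial eqxx mul1r => ->.
apply: filterS => t /(congr1 (@complex.Re R)); rewrite /fdot raddfD /= => e.
have h1 := rdot_ge0 (T1 h t); have h2 := rdot_ge0 (rho h t).
by split; rewrite hn_le_sqr ?hn_ge0// hn_sqr -e ?lerDl ?lerDr.
Qed.

Lemma trace_analytic : exists2 Th1 : R[i] -> {linear D -> F}, contractive_analytic Th1 &
  forall h, {ae mu, forall t, bdry Th1 t h = T1 h t}.
Proof.
have [|||Th1 c1 P1] := @analytic_of R D F T1.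
- by move=> a x y; have [] := trace_linear a x y.
- by move=> h; have [] := TP h.
- by move=> h; apply: filterS (trace_bounds h) => t [].
by exists Th1 => //; exact: bdry_trace.
Qed.

Lemma trace_field : exists2 P : R -> D -> D, cfield mu 1 P &
  forall h, {ae mu, forall t, P t h = rho h t}.
Proof.
apply: field_of_map => [a x y|h]; first by have [] := trace_linear a x y.
by apply: filterS (trace_bounds h) => t [].
Qed.

Variables (Th1 : R[i] -> {linear D -> F}) (P : R -> D -> D).
Hypotheses (c1 : contractive_analytic Th1) (cP : cfield mu 1 P).
Hypothesis Th1E : forall h, {ae mu, forall t, bdry Th1 t h = T1 h t}.
Hypothesis PE : forall h, {ae mu, forall t, P t h = rho h t}.

Lemma graph_op_split g : graph_op Th g = wold_op (mulop (bdry Th1) g) + (0 ⊕ mulop P g).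
Proof.
have l1 := mulop_linear ler01 (bdry_field c1); have lP := mulop_linear ler01 cP.
have b1 := mulop_bounded ler01 (bdry_field c1); have bP := mulop_bounded ler01 cP.
apply: (@L2_dense_eq _ _ _ 1 3 (graph_op Th) (fun g => wold_op (mulop (bdry Th1) g) + (0 ⊕ mulop P g))).
- exact: graph_op_linear.
- apply: linear_plus; [exact: (linear_o l1 wold_op_linear)|exact: (linear_o lP dsum0_linear)].
- by move=> x; rewrite mul1r /hn (graph_op_inner c0).
- move=> x; apply: le_trans (hnD _ _) _.
  have h1 := wold_op_bounded (mulop (bdry Th1) x); have h2 := b1 x; have h3 := bP x.
  by have h4 := dsum0_bounded (mulop P x); rewrite !mul1r in h2 h3 h4; lra.
move=> n h; rewrite trace_monomial (mulop_monomial _ ler01 (bdry_field c1) (Th1E h)).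
by rewrite (mulop_monomial _ ler01 cP (PE h)).
Qed.

Lemma mulop_bdry_split g : mulop (bdry Th) g = mulop (bdry Th2) (mulop (bdry Th1) g).
Proof. by have /(congr1 fst) /= := graph_op_split g; rewrite addr0. Qed.

Lemma mulop_Delta_split g : mulop (Delta Th) g = mulop Y (mulop (bdry Th1) g) + mulop P g.
Proof. by have /(congr1 snd) := graph_op_split g. Qed.

Lemma bdry_split : {ae mu, forall t, forall x, bdry Th t x = bdry Th2 t (bdry Th1 t x)}.
Proof.
have [s sd] := dense_seq D.
have /ae_foralln H k : {ae mu, forall t, bdry Th t (s k) = bdry Th2 t (bdry Th1 t (s k))}.
  have h0 := mulop_ae ler01 (bdry_field c0) (monomial 0 (s k)).
  have h1 := mulop_ae ler01 (bdry_field c1) (monomial 0 (s k)).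
  have h2 := mulop_ae ler01 (bdry_field c2) (mulop (bdry Th1) (monomial 0 (s k))).
  rewrite -mulop_bdry_split in h2; apply: filterS3 (monomial_ae 0 (s k)) h0 (ae_and h1 h2).
  by move=> t -> h0t []; rewrite h0t chi0 scale1r => ->.
apply: filterS3 H (bdry_field c0).1 (ae_and (bdry_field c1).1 (bdry_field c2).1).
move=> t st [l0 b0] [[l1 b1] [l2 b2]] x; have [k kx] := dense_seq_cvg x sd.
apply: hcvg_unique (hbounded_cvg l0 b0 kx) _.
have := hbounded_cvg l2 b2 (hbounded_cvg l1 b1 kx).
rewrite (_ : bdry Th2 t \o _ = bdry Th t \o (s \o k))//.
by apply/funext => n /=; rewrite st.
Qed.

Lemma residual_P g : residual (mulop P g).
Proof.
have lP := mulop_linear ler01 cP.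
apply: (L2_dense (S := mulop P @^-1` residual)).
- exact: (subsp_preimage lP residual_subsp).
- exact: (closed_preimage lP (mulop_bounded ler01 cP) residual_closed).
by move=> n h /=; rewrite (mulop_monomial _ ler01 cP (PE h)); apply: residual_mz; have [] := TP h.
Qed.

(** [P] and [Delta Th1] both complement the boundary values of [Th1] to an isometry on L2. *)
Lemma mulop_P_inner f g : inner (mulop P f) (mulop P g) = inner (mulop (Delta Th1) f) (mulop (Delta Th1) g).
Proof.
apply: (addrI (inner (mulop (bdry Th1) f) (mulop (bdry Th1) g))).
rewrite (Delta_mulop_inner c1) -[RHS](graph_op_inner c0) !graph_op_split.
by rewrite (wold_op_RR_inner _ _ (residual_P f) (residual_P g)).
Qed.

Local Notation Z := (Zop Th Th2 Th1).
Local Notation Zi := (Zinv Th Th2 Th1).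
Local Notation V := (defect_op Th2 Th1).

(* The vector Z y - a is orthogonal to the range of the isometry, which contains Z y
   in its closure, and Z y and a have the same norm. *)
Lemma Zop_match y a : DeltaL2 Th y -> (forall g, inner y (mulop (Delta Th) g) = inner a (V g)) ->
  inner y y = inner a a -> Z y = a.
Proof.
move=> Dy ya yy; set z := Z y.
have zz : inner z z = inner a a by rewrite /z (Zop_inner c0 c2 c1 bdry_split).
have oV g : inner (V g) (z - a) = 0.
  apply: inner0C; rewrite innerBl -ya -(Zop_Delta c0 c2 c1 bdry_split).
  by rewrite (Zop_inner c0 c2 c1 bdry_split)// ?subrr//; exact: DeltaL2_range.
have [u _ uz] := Zop_seq c0 c2 c1 bdry_split Dy.
have oz : inner z (z - a) = 0 by apply: hcvg_orth uz _ => n; exact: oV.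
apply/eqP; rewrite -subr_eq0; apply/eqP/orth_self; rewrite innerBl oz sub0r.
have az : inner z a = inner a a by apply/eqP; rewrite -zz eq_sym -subr_eq0 -innerBr oz.
rewrite innerBr -[inner a z]conjCK; have -> : Num.conj (inner a z) = inner a a by rewrite -az [RHS]inner_conj.
have -> : Num.conj (inner a a) = inner a a by rewrite [RHS]inner_conj.
by rewrite subrr oppr0.
Qed.

(** Delta g = Y Theta' g + P g, and P g is orthogonal to the range of Y; so pairing Y f with Delta g
    gives the pairing of Delta'' f with Delta'' Theta' g. *)
Lemma Zop_Y f : Z (mulop Y f) = mulop (Delta Th2) f ⊕ 0.
Proof.
apply: Zop_match => [|g|]; first exact: mulop_Y_Delta.
  rewrite mulop_Delta_split innerDr mulop_Y_inner (residual_Y _ (residual_P g)) inner_dsumE /=.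
  by rewrite linear0l.
by rewrite mulop_Y_inner inner_dsumE /= linear0l addr0.
Qed.

Lemma Zop_P g : Z (mulop P g) = 0 ⊕ mulop (Delta Th1) g.
Proof.
apply: Zop_match => [|h|]; first exact: residual_Delta (residual_P g).
  rewrite mulop_Delta_split innerDr (inner0C (residual_Y _ (residual_P g))) mulop_P_inner inner_dsumE /=.
  by rewrite linear0l.
by rewrite mulop_P_inner inner_dsumE /= linear0l add0r.
Qed.

Lemma wandering_onto : Zonto Th Th2 Th1.
Proof.
move=> p q Dp Dq.
have lD := mulop_linear ler01 (Delta_field c0); have lV := defect_op_linear c2 c1.
have sV := subsp_closure (subsp_range lV); have cV := @closed_closure _ (range V).
have zP := Zop_extends c0 c2 c1 bdry_split.
apply: (extends_onto lD lV (defect_op_inner c0 c2 c1 bdry_split) zP (@L2_complete _ _ R mu D)).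
have Vp : closure (range V) (p ⊕ 0).
  have [w /range_seq[f ->] fp] := closure_seq Dp.
  apply: closed_seq cV _ (hcvg_dsum fp (hcvg_cst 0)) => n /=.
  by rewrite -Zop_Y; apply: (extends_closure zP); exact: mulop_Y_Delta.
have Vq : closure (range V) (0 ⊕ q).
  have [w /range_seq[f ->] fq] := closure_seq Dq.
  apply: closed_seq cV _ (hcvg_dsum (hcvg_cst 0) fq) => n /=.
  by rewrite -Zop_P; apply: (extends_closure zP); exact: residual_Delta (residual_P _).
by have := subspD sV Vp Vq; rewrite dsumD addr0 add0r.
Qed.

Lemma wandering_regular : regular_factorization Th Th2 Th1.
Proof.
split; first exact: disk_comp bdry_split.
exact: (onto_regular c0 c2 c1 bdry_split wandering_onto).
Qed.

Lemma Zinv_Y f : Zi (mulop (Delta Th2) f ⊕ 0) = mulop Y f.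
Proof. exact: (ZinvK c0 c2 c1 bdry_split wandering_onto (@mulop_Y_Delta f) (Zop_Y f)). Qed.

(** Approximating [g] by vectors [Delta' u] exhibits the preimage as a limit of vectors [P u], all
    in a closed space. *)
Lemma residual_Zinv g : DeltaL2 Th1 g -> residual (Zi (0 ⊕ g)).
Proof.
move=> Dg; have [w /range_seq[u ->] ug] := closure_seq Dg.
have D0 : DeltaL2 Th2 0 by case: (DeltaL2_subsp c2).
have zu n : Zi (0 ⊕ mulop (Delta Th1) (u n)) = mulop P (u n).
  exact: (ZinvK c0 c2 c1 bdry_split wandering_onto (residual_Delta (residual_P _)) (Zop_P _)).
apply: (closed_seq (u := fun n => mulop P (u n)) residual_closed) => [n|]; first exact: residual_P.
move=> e /ug[N HN]; exists N => n /HN; rewrite -zu.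
have Du := @DeltaL2_range _ _ _ Th1 (u n).
have := Zinv_linear c0 c2 c1 bdry_split wandering_onto (-1) D0 Dg D0 Du.
rewrite scaler0 addr0 !scaleN1r => E.
rewrite [X in hn X < e -> _]addrC [X in _ -> hn X < e]addrC -E /hn.
by rewrite (Zinv_inner c0 c2 c1 bdry_split wandering_onto) ?linear0l ?add0r//;
  rewrite addrC; exact: subspB (DeltaL2_subsp c1) _ _.
Qed.

(** [v] is orthogonal to the range of [Y], which Z carries onto a dense part of the first
    summand. *)
Lemma Zop_RR v : residual v -> exists2 g, DeltaL2 Th1 g & Z v = 0 ⊕ g.
Proof.
move=> Rv; have Dv := residual_Delta Rv.
have [Dp Dq] := Zop_range c0 c2 c1 bdry_split Dv; exists (Z v).2 => //.
rewrite {1}[Z v]dsumE; congr (_ ⊕ _).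
have o f : inner (mulop (Delta Th2) f) (Z v).1 = 0.
  have := Zop_inner c0 c2 c1 bdry_split (@mulop_Y_Delta f) Dv.
  by rewrite residual_Y// Zop_Y inner_dsumE /= linear0l addr0.
have [w /range_seq[u ->] uz] := closure_seq Dp.
by apply: orth_self; apply: hcvg_orth uz _ => n; exact: o.
Qed.

(** * The operators G'_i and W'_i *)

Variables (G : 'I_2 -> {linear Dstar -> Dstar}) (W : 'I_2 -> L2T D -> L2T D).
Hypothesis adm : admissible Th G W.
Local Notation A i j := (osum (pencil (G i) (G j)) (W i)).
Hypothesis AL : forall i j, i != j -> forall x, L x -> L (A i j x).

Lemma io_K a : K (io a). Proof. by have [/LK] := ioL a. Qed.

Lemma io_bounded : hbounded 1 io. Proof. by move=> a; rewrite mul1r /hn iio. Qed.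

Let ioP := adjP (@sepHilbert_complete R F) lio io_bounded.
Local Notation proj := (adjoint setT io).

Definition compression (i j : 'I_2) (a : F) : F := proj (A i j (io a)).

Lemma compression_inner i j a b : inner (compression i j a) b = inner (A i j (io a)) (io b).
Proof. by rewrite inner_conj -ioP -inner_conj. Qed.

Lemma compression_linear i j : linear (compression i j).
Proof.
move=> c a b; rewrite /compression lio (A_linear adm i j c (io_K a) (io_K b)).
exact: (adj_linear ioP).
Qed.

Lemma compression_bounded i j : i != j -> hbounded 1 (compression i j).
Proof.
move=> ij a; apply: le_trans (adj_bounded ler01 ioP io_bounded _) _.
rewrite !mul1r; apply: le_trans (A_hn adm ij (io_K a)) _.
by have := io_bounded a; rewrite mul1r.
Qed.

(** Let d = U y be the component of A_i a orthogonal to F. Then <y, U l> = <d, U^2 l> = <A_i a, U^2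
    l> = <U a, U^2 A_j l> = <a, U A_j l> = 0 for l in L, since a is wandering and A_j l lies in L.
    Hence y is wandering too. *)
Lemma wandering_split i j a : i != j ->
  exists p q, A i j (io a) = io p + dmz 1 (io q).
Proof.
move=> ij; have ji : j != i by rewrite eq_sym.
have FL : wandering `<=` L by move=> x [].
have [s [d [ws [Ld od] E]]] := orth_decomp wandering_subsp wandering_complete sL FL (AL ij (ioL a).1).
have [p pE] := ioS ws; have [y Ly dE] := wandering_cover Ld od.
have wy : wandering y.
  split=> // _ [l Ll <-]; rewrite -(dmz_inner 1) -dE.
  have -> : d = A i j (io a) - s by rewrite E addrK.
  rewrite innerBl; have [_ os] := ws; rewrite (os (dmz 1 (dmz 1 l))) ?subr0; last first.
    by exists (dmz 1 l) => //; exact: UL.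
  have Kl := LK Ll; have KUl := LK (UL Ll).
  rewrite (A_adj adm ij (io_K a) (LK (UL (UL Ll)))) (A_dmz adm j i KUl) (A_dmz adm j i Kl) dmz_inner.
  by have [_ oa] := ioL a; apply: oa; exists (A j i l) => //; exact: AL.
have [q qE] := ioS wy; exists p, q.
by rewrite E dE pE qE addrC.
Qed.

(** With A_i a = p + U q, pairing with b in F gives p as the compression, and <q, b> = <A_i a, U b>
    = <U a, U A_j b> = <a, A_j b> identifies q. *)
Lemma A_io i j a : i != j ->
  A i j (io a) = io (compression i j a) + dmz 1 (io (adjoint setT (compression j i) a)).
Proof.
move=> ij; have ji : j != i by rewrite eq_sym.
have [p [q E]] := wandering_split a ij.
have orth u v : inner (dmz 1 (io u)) (io v) = 0 by exact: wandering_orth.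
suff [-> ->] : compression i j a = p /\ adjoint setT (compression j i) a = q by [].
have cA := adjP (@sepHilbert_complete R F) (@compression_linear j i) (compression_bounded ji).
split; apply: inner_ext => b.
  by rewrite compression_inner E innerDl iio orth addr0.
rewrite [LHS]inner_conj -cA compression_inner -inner_conj -iio -(dmz_inner 1 (io q)).
have -> : dmz 1 (io q) = A i j (io a) - io p by rewrite E [io p + _]addrC addrK.
rewrite innerBl (inner0C (orth b p)) subr0 (A_adj adm ij (io_K a) (dmz_K c0 (io_K b))).
by rewrite (A_dmz adm j i (io_K b)) dmz_inner.
Qed.

Lemma A_dmzn i j (n : nat) x : L x -> A i j (dmz n%:Z x) = dmz n%:Z (A i j x).
Proof.
move=> Lx; elim: n => [|n IH]; first by rewrite !dmz0.
have E y : dmz n.+1%:Z y = dmz 1 (dmz n%:Z y) by rewrite dmzD -PoszD.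
by rewrite !E (A_dmz adm i j (LK (L_dmz n Lx))) IH.
Qed.

Lemma pencil_ex : exists2 G' : 'I_2 -> {linear F -> F}, forall i, contractive (G' i) &
  forall i j, i != j -> forall f, Hardy2 f -> A i j (wold_op f) = wold_op (pencil (G' i) (G' j) f).
Proof.
have rev (i j : 'I_2) : i != j -> j = rev_ord i.
  by move=> ij; apply: val_inj; case: i j ij => -[|[|]]// ? [[|[|]]//].
have revN (i : 'I_2) : i != rev_ord i by case: i => -[|[|]].
have cA i := adjP (@sepHilbert_complete R F) (@compression_linear i (rev_ord i)) (compression_bounded (revN i)).
(* The first entry of a pencil enters through its adjoint, so [G' i] is the adjoint of the
   compression of A_i; [rev_ord i] is the other index. *)
have [G' G'E] := choice (fun i => linear_pack (adj_linear (cA i))).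
have bG i : hbounded 1 (G' i).
  by rewrite G'E; exact: (adj_bounded ler01 (cA i) (compression_bounded (revN i))).
have cG i : contractive (G' i) by apply/contractiveE.
exists G' => // i j ij f Hf.
have ji : j != i by rewrite eq_sym.
have aG : adjoint setT (G' i) = compression i j.
  rewrite (rev _ _ ij) G'E; apply: adj_unique => u y.
  by rewrite inner_conj -cA -inner_conj.
have G'jE : G' j = adjoint setT (compression j i) :> (F -> F) by rewrite (rev _ _ ji) G'E.
have lp := pencil_linear (cG i) (cG j); have bp := pencil_bounded (cG i) (cG j).
(* Membership in the Hardy space is carried along because W_i, and with it A_i, is known to be
   linear only on the ambient space [K]. *)
pose S := [set f | Hardy2 f /\ A i j (wold_op f) = wold_op (pencil (G' i) (G' j) f)].
suff [] : S f by [].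
apply: (Hardy2_ind (S := S)) Hf => [||n a].
- split; first split; first by case: (@Hardy2_subsp R F).
    rewrite (op_zero lp) (op_zero wold_op_linear) /osum /= (op_zero (pencil_linear (adm_G adm i) (adm_G adm j))).
    have [_ lW _ _] := adm_W adm i; have [D0 _] := DeltaL2_subsp c0.
    by have := lW (-1) 0 0 D0 D0; rewrite scaler0 addr0 scaleN1r addNr => ->.
  move=> c x y [Hx Ex] [Hy Ey]; split; first exact: (@Hardy2_subsp R F).2.
  rewrite wold_op_linear (A_linear adm i j c (LK (wold_op_L Hx)) (LK (wold_op_L Hy))) Ex Ey.
  by rewrite lp wold_op_linear.
- move=> x /closure_seq[u Su ux]; have Hx : Hardy2 x.
    by apply: closed_seq (@Hardy2_closed R F) _ ux => n; case: (Su n).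
  split=> //.
  have h1 := hbounded_cvg wold_op_linear wold_op_bounded ux.
  have h2 : hcvg (A i j \o (wold_op \o u)) (A i j (wold_op x)).
    by apply: (A_cvg c0 adm ij) h1 => [n|]; apply/LK/wold_op_L => //; case: (Su n).
  apply: hcvg_unique h2 _.
  have := hbounded_cvg wold_op_linear wold_op_bounded (hbounded_cvg lp bp ux).
  rewrite (_ : A i j \o (wold_op \o u) = wold_op \o (pencil (G' i) (G' j) \o u))//.
  by apply/funext => n /=; case: (Su n).
split; first exact: Hardy2_monomial.
rewrite wold_op_emb (A_dmzn i j n (ioL a).1) (A_io a ij) (pencil_monomial (cG i) (cG j)) aG.
rewrite (op_add wold_op_linear) !wold_op_emb (op_add (@dmz_linear _ _ _ n)) dmzD G'jE.
by [].
Qed.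

Lemma A_dsum0 i j v : A i j (0 ⊕ v) = 0 ⊕ W i v.
Proof. by rewrite /osum /= (op_zero (pencil_linear (adm_G adm i) (adm_G adm j))). Qed.

(** For a residual vector v, <A_i v, J f> = <U v, A_j J f>, where J is [wold_op]; A_j maps the range
    of J on H2(F) into itself and U v is orthogonal to it. *)
Lemma residual_W i v : residual v -> residual (W i v).
Proof.
have [G' cG' GE] := pencil_ex.
have [j ij] := other_index i.
have ji : j != i by rewrite eq_sym.
move=> Rv; rewrite /residual -(A_dsum0 i j); have [Lv _] := Rv.
split; first exact: AL.
move=> _ [f Hf <-]; rewrite (A_adj adm ij (LK Lv) (LK (wold_op_L Hf))) GE//.
have [_ o] := unitary_part_shift Rv; apply: o; exists (pencil (G' j) (G' i) f) => //.
exact: pencil_Hardy.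
Qed.

Let onto := wandering_onto.
Let D20 : DeltaL2 Th2 0. Proof. by case: (DeltaL2_subsp c2). Qed.

Lemma Zinv_RR g : DeltaL2 Th1 g -> Z (Zi (0 ⊕ g)) = 0 ⊕ g.
Proof. by move=> Dg; have [_] := ZinvP onto D20 Dg. Qed.

(** The operator W'_i: W_i conjugated by Z, on the second summand. *)
Definition transported (i : 'I_2) (g : L2T D) : L2T D := (Z (W i (Zi (0 ⊕ g)))).2.

Lemma transportedP i g : DeltaL2 Th1 g ->
  [/\ DeltaL2 Th1 (transported i g), Z (W i (Zi (0 ⊕ g))) = 0 ⊕ transported i g &
   Zi (0 ⊕ transported i g) = W i (Zi (0 ⊕ g))].
Proof.
move=> Dg; have Rv := residual_W i (residual_Zinv Dg); have [g' Dg' E] := Zop_RR Rv.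
have tE : transported i g = g' by rewrite /transported E.
rewrite tE; split=> //.
exact: (ZinvK c0 c2 c1 bdry_split onto (residual_Delta Rv) E).
Qed.

Lemma Zinv0_linear c g g' : DeltaL2 Th1 g -> DeltaL2 Th1 g' ->
  Zi (0 ⊕ (c *: g + g')) = c *: Zi (0 ⊕ g) + Zi (0 ⊕ g').
Proof.
move=> Dg Dg'; have := Zinv_linear c0 c2 c1 bdry_split onto c D20 Dg D20 Dg'.
by rewrite scaler0 addr0.
Qed.

Lemma transported_shift i j g : i != j -> DeltaL2 Th1 g ->
  transported i (transported j g) = Mzeta g.
Proof.
move=> ij Dg; have [_ _ E] := transportedP j Dg; have Dv := residual_Delta (residual_Zinv Dg).
rewrite /transported E (adm_shift adm ij Dv) MzetaE (Zop_mz c0 c2 c1 bdry_split _ Dv).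
by rewrite Zinv_RR// MzetaE.
Qed.

Lemma transported_unitary i : unitary_on (DeltaL2 Th1) (transported i).
Proof.
have [WD lW iW _] := adm_W adm i.
split=> [g Dg|c g g' Dg Dg'|g g' Dg Dg'|g Dg].
- by have [] := transportedP i Dg.
- have Dv := residual_Delta (residual_Zinv Dg); have Dv' := residual_Delta (residual_Zinv Dg').
  rewrite /transported Zinv0_linear// lW//.
  by rewrite (Zop_linear c0 c2 c1 bdry_split c (WD _ Dv) (WD _ Dv')).
- have Dv := residual_Delta (residual_Zinv Dg); have Dv' := residual_Delta (residual_Zinv Dg').
  have [_ E _] := transportedP i Dg; have [_ E' _] := transportedP i Dg'.
  have dsum0I (u v : L2T D) : inner ((0 : L2T F) ⊕ u) (0 ⊕ v) = inner u v.
    by rewrite inner_dsumE /= linear0l add0r.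
  rewrite -dsum0I -E -E' (Zop_inner c0 c2 c1 bdry_split (WD _ Dv) (WD _ Dv')) iW//.
  by rewrite (Zinv_inner c0 c2 c1 bdry_split onto D20 Dg D20 Dg') linear0l add0r.
have [j ij] := other_index i.
(* Since W_i W_j is multiplication by zeta, the preimage is obtained by applying W_j to zeta^{-1}
   times the vector. *)
have Rv := residual_mz (- 1) (residual_Zinv Dg); have Ru := residual_W j Rv.
have [g' Dg' E] := Zop_RR Ru; exists g' => //.
rewrite /transported (ZinvK c0 c2 c1 bdry_split onto (residual_Delta Ru) E).
by rewrite (adm_shift adm ij (residual_Delta Rv)) MzetaE mzK Zinv_RR.
Qed.

Lemma model_vectorE f g : DeltaL2 Th1 g ->
  mulop (bdry Th2) f ⊕ Zi (mulop (Delta Th2) f ⊕ g) = wold_op f + (0 ⊕ Zi (0 ⊕ g)).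
Proof.
move=> Dg; have [D10 _] := DeltaL2_subsp c1.
have := Zinv_linear c0 c2 c1 bdry_split onto 1 (@DeltaL2_range _ _ _ Th2 f) D10 D20 Dg.
rewrite !scale1r addr0 add0r Zinv_Y => ->.
by rewrite /wold_op dsumD addr0.
Qed.

Lemma invariant_subspaceE : L = [set mulop (bdry Th2) f ⊕ Zi (mulop (Delta Th2) f ⊕ g)
         | f in @Hardy2 R F & g in DeltaL2 Th1].
Proof.
apply/seteqP; split=> [x Lx|_ [f Hf [g Dg <-]]]; last first.
  by rewrite model_vectorE//; apply: (subspD sL); [exact: wold_op_L|case: (residual_Zinv Dg)].
have [f [r [Hf ur xE]]] := Wold Lx; have [rE Rr] := unitary_partE ur.
have [g Dg E] := Zop_RR Rr; exists f => //; exists g => //.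
by rewrite model_vectorE// (ZinvK c0 c2 c1 bdry_split onto (residual_Delta Rr) E) xE {2}rE.
Qed.

(** Z carries the residual part of L onto the second summand. Orthogonality to it kills the second
    entry of Z, and orthogonality to the rest of L is orthogonality to the vectors Theta'' f ⊕ Y
    f. *)
Lemma invariant_complementE : orthodiff K L = orthodiff
      [set u ⊕ Zi (w ⊕ 0) | u in @Hardy2 R Dstar & w in DeltaL2 Th2]
      [set mulop (bdry Th2) f ⊕ Zi (mulop (Delta Th2) f ⊕ 0) | f in @Hardy2 R F].
Proof.
have [D10 _] := DeltaL2_subsp c1.
apply/seteqP; split=> [x [/KspaceE[Hu Dv] xL]|x [[u Hu [w Dw xE]] xJ]].
  split; last by move=> _ [f Hf <-]; rewrite Zinv_Y; apply: xL; exact: wold_op_L.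
  have [Dp Dq] := Zop_range c0 c2 c1 bdry_split Dv.
  have q0 : (Z x.2).2 = 0.
    apply: orth_self.
    have := Zop_inner c0 c2 c1 bdry_split Dv (residual_Delta (residual_Zinv Dq)).
    rewrite Zinv_RR// inner_dsumE /= linear0r add0r => ->.
    by have [LZ _] := residual_Zinv Dq; have := xL _ LZ; rewrite inner_dsumE /= linear0r add0r.
  exists x.1 => //; exists (Z x.2).1 => //.
  have zE : Z x.2 = (Z x.2).1 ⊕ 0 by rewrite {1}[Z x.2]dsumE q0.
  by rewrite (ZinvK c0 c2 c1 bdry_split onto Dv zE) -dsumE.
have [Dz zE] := ZinvP onto Dw D10.
split; first by apply/KspaceE; rewrite -xE.
move=> l /Wold[f [r [Hf ur ->]]]; have [rE Rr] := unitary_partE ur.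
have [g Dg E] := Zop_RR Rr.
rewrite innerDr (xJ (wold_op f)) ?add0r; last by exists f => //; rewrite Zinv_Y.
rewrite rE -xE inner_dsumE /= linear0r add0r.
rewrite -(Zop_inner c0 c2 c1 bdry_split Dz (residual_Delta Rr)) zE E inner_dsumE /=.
by rewrite linear0r linear0l addr0.
Qed.

Lemma model_intertwining (G' : 'I_2 -> {linear F -> F}) :
  (forall i j, i != j -> forall f, Hardy2 f -> A i j (wold_op f) = wold_op (pencil (G' i) (G' j) f)) ->
  forall f g, Hardy2 f -> DeltaL2 Th1 g -> forall i j : 'I_2, i != j ->
    A i j (mulop (bdry Th2) f ⊕ Zi (mulop (Delta Th2) f ⊕ g)) =
    mulop (bdry Th2) (pencil (G' i) (G' j) f) ⊕
    Zi (mulop (Delta Th2) (pencil (G' i) (G' j) f) ⊕ transported i g).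
Proof.
move=> GE f g Hf Dg i j ij; have [Dt _ tE] := transportedP i Dg.
have [Lv _] := residual_Zinv Dg.
rewrite !model_vectorE// tE -GE// -(A_dsum0 i j).
have := A_linear adm i j 1 (LK (wold_op_L Hf)) (LK Lv).
by rewrite !scale1r.
Qed.

End Wandering.

(** * Invariant subspaces of the model *)

Section InvariantSubspace.
Context (R : realType) (D Dstar : sepHilbertType R).
Variables (Th : R[i] -> {linear D -> Dstar}) (G : 'I_2 -> {linear Dstar -> Dstar}).
Variable W : 'I_2 -> L2T D -> L2T D.
Hypotheses (c0 : contractive_analytic Th) (adm : admissible Th G W).
Local Notation X := (dsum (L2T Dstar) (L2T D)).
Variable H' : set X.
Hypotheses (cH : closed_subspace H') (HH : H' `<=` Hspace Th).
Local Notation Q := (Qspace Th).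
Local Notation K := (Kspace Th).

Definition lifted : set X := [set s + t | s in H' & t in Q].
Local Notation L := lifted.

Let sH : subsp H'. Proof. by have [] := (closed_subspaceE H').1 cH. Qed.

Let orthHQ s t : H' s -> Q t -> inner s t = 0.
Proof. by move=> /HH[_ +]; exact. Qed.

Lemma lifted_subsp : subsp L.
Proof. exact: (subsp_sum2 sH (Qspace_subsp c0)). Qed.

Lemma lifted_complete : hcomplete L.
Proof.
have [_ clH] := (closed_subspaceE H').1 cH.
apply: (orth_sum_complete sH (Qspace_subsp c0) _ (Qspace_complete c0) orthHQ).
exact: (complete_closed (@pair_complete R Dstar D) _ clH).
Qed.

Lemma lifted_K : L `<=` K.
Proof.
move=> _ [s /HH[Ks _] [t Qt <-]].
exact: (subspD (Kspace_subsp c0) Ks (Qspace_sub c0 Qt)).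
Qed.

Lemma lifted_Q : Q `<=` L.
Proof. by move=> t Qt; exists 0; [case: sH|exists t; rewrite ?add0r]. Qed.

Lemma lifted_H : H' `<=` L.
Proof. by move=> s Hs; exists s => //; exists 0; [case: (Qspace_subsp c0)|rewrite addr0]. Qed.

Lemma liftedE : H' = orthodiff L Q.
Proof.
apply/seteqP; split=> [s Hs|_ [[s Hs [t Qt <-]] oQ]].
  by split=> [|t Qt]; [exact: lifted_H|exact: orthHQ].
suff -> : t = 0 by rewrite addr0.
by apply: orth_self; have := oQ t Qt; rewrite innerDl orthHQ// add0r.
Qed.

Lemma lifted_complement : orthodiff (Hspace Th) H' = orthodiff K L.
Proof.
apply/seteqP; split=> x.
  by move=> [[Kx oQ] oH]; split=> // _ [s Hs [t Qt <-]]; rewrite innerDr oH// oQ// addr0.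
by move=> [Kx oL]; split=> [|s /lifted_H/oL//]; split=> // t /lifted_Q/oL.
Qed.

Hypothesis invH : forall i j : 'I_2, i != j -> forall x, H' x -> H' (model_op Th G W i j x).

Lemma lifted_A i j x : i != j -> L x -> L (osum (pencil (G i) (G j)) (W i) x).
Proof.
move=> ij [s Hs [t Qt <-]]; have [Ks _] := HH Hs.
have := A_linear adm i j 1 Ks (Qspace_sub c0 Qt); rewrite !scale1r => ->.
have [q Qq [_ ->]] := model_opP c0 adm i j Ks.
exists (model_op Th G W i j s); first exact: invH.
exists (q + osum (pencil (G i) (G j)) (W i) t); last by rewrite addrA.
by apply: (subspD (Qspace_subsp c0)) => //; exact: (adm_inv adm ij).
Qed.

(* The component d of zx orthogonal to L lies in the model space, where the adjoint
   of multiplication by z factors through the adjoints of the two operators. *)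
Lemma lifted_shift x : L x -> L (dmz 1 x).
Proof.
move=> Lx; have Kx := lifted_K Lx.
have [l [d [Ll [Kd oL] E]]] := orth_decomp lifted_subsp lifted_complete (Kspace_subsp c0)
  lifted_K (dmz_K c0 Kx).
suff d0 : d = 0 by rewrite E d0 add0r.
have Hd : Hspace Th d by split=> // t /lifted_Q/oL.
have [j ij] := other_index ord0; have ji : j != ord0 by rewrite eq_sym.
apply: orth_self; have -> : inner d d = inner (dmz 1 x) d.
  by rewrite E innerDl (inner0C (oL l Ll)) addr0.
rewrite (osum_adjoint_Mzeta c0 d Kx) -(adm_adj adm ij Hd).
have [KB BP] := osum_adjoint_K adm j ord0 Kd.
have [_ CP] := osum_adjoint_K adm ord0 j KB.
rewrite -CP// -BP; last exact: lifted_K (lifted_A ij Lx).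
by apply/inner0C/oL; apply: lifted_A ji _; exact: lifted_A ij Lx.
Qed.

End InvariantSubspace.

Theorem theorem5p2 (R : realType) (D Dstar : sepHilbertType R)
    (Θ : R[i] -> {linear D -> Dstar})
    (G : 'I_2 -> {linear Dstar -> Dstar})
    (W : 'I_2 -> L2T D -> L2T D)
    (H' : set (dsum (L2T Dstar) (L2T D))) :
  contractive_analytic Θ -> purely_contractive Θ -> admissible Θ G W ->
  closed_subspace H' -> H' `<=` Hspace Θ ->
  (forall i j : 'I_2, i != j -> forall x, H' x -> H' (model_op Θ G W i j x))
  <->
  exists (F : sepHilbertType R)
    (Θ' : R[i] -> {linear D -> F}) (Θ'' : R[i] -> {linear F -> Dstar})
    (G' : 'I_2 -> {linear F -> F}) (W' : 'I_2 -> L2T D -> L2T D),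
    contractive_analytic Θ' /\ contractive_analytic Θ'' /\
    regular_factorization Θ Θ'' Θ' /\
    (forall i, contractive (G' i)) /\
    (forall i, unitary_on (DeltaL2 Θ') (W' i)) /\
    (forall i j : 'I_2, i != j -> forall v, DeltaL2 Θ' v ->
       W' i (W' j v) = Mzeta v) /\
    H' = orthodiff
      [set mulop (bdry Θ'') f ⊕ Zinv Θ Θ'' Θ' (mulop (Delta Θ'') f ⊕ g)
         | f in @Hardy2 R F & g in DeltaL2 Θ']
      [set mulop (bdry Θ) h ⊕ mulop (Delta Θ) h | h in @Hardy2 R D] /\
    orthodiff (Hspace Θ) H' = orthodiff
      [set u ⊕ Zinv Θ Θ'' Θ' (w ⊕ 0) | u in @Hardy2 R Dstar & w in DeltaL2 Θ'']
      [set mulop (bdry Θ'') f ⊕ Zinv Θ Θ'' Θ' (mulop (Delta Θ'') f ⊕ 0)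
         | f in @Hardy2 R F] /\
    forall f g, Hardy2 f -> DeltaL2 Θ' g -> forall i j : 'I_2, i != j ->
      osum (pencil (G i) (G j)) (W i)
        (mulop (bdry Θ'') f ⊕ Zinv Θ Θ'' Θ' (mulop (Delta Θ'') f ⊕ g)) =
      mulop (bdry Θ'') (pencil (G' i) (G' j) f) ⊕
      Zinv Θ Θ'' Θ'
        (mulop (Delta Θ'') (pencil (G' i) (G' j) f) ⊕ W' i g).
Proof.
move=> c0 _ adm cH HH; split=> [invH|]; last first.
  move=> [F [Th1 [Th2 [G' [W' [c1 [c2 [reg [cG' [uW' [_ [HE [_ IT]]]]]]]]]]]]] i j ij x.
  by rewrite HE => Hx; apply: (regular_invariant c0 adm c2 c1 reg cG' uW' IT ij) Hx; rewrite -HE.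
pose L := lifted Θ H'.
have sL : subsp L := lifted_subsp c0 cH.
have cL : hcomplete L := lifted_complete c0 cH HH.
have LK : L `<=` Kspace Θ := lifted_K c0 HH.
have QL : Qspace Θ `<=` L := lifted_Q cH.
have AL := lifted_A c0 adm HH invH.
have UL : forall x, L x -> L (dmz 1 x) := lifted_shift c0 adm cH HH invH.
have [F [io [lio iio ioL ioS]]] := subspace_sepHilbert (wandering_subsp sL)
  (wandering_complete cL) (@pair_separable R Dstar D).
have [Th2 c2 Th2E] := io_analytic LK UL lio iio ioL.
have [Y cY YE] := io_field UL lio iio ioL.
have [T1 [rho TP]] := trace_ex sL cL LK UL iio ioL ioS c2 cY Th2E YE QL.
have [Th1 c1 Th1E] := trace_analytic c0 sL cL UL iio ioL ioS c2 cY Th2E YE TP.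
have [P cP PE] := trace_field c0 sL cL UL iio ioL ioS c2 cY Th2E YE TP.
have AL' i j (ij : i != j) x Lx := AL i j x ij Lx.
have [G' cG' GE] := pencil_ex c0 sL cL LK UL lio iio ioL ioS c2 cY Th2E YE adm AL'.
exists F, Th1, Th2, G', (transported Θ Th2 Th1 W).
split=> //; split=> //; split.
  exact: (wandering_regular c0 sL cL LK UL iio ioL ioS c2 cY Th2E YE TP c1 cP Th1E PE).
split=> //; split.
  exact: (transported_unitary c0 sL cL LK UL lio iio ioL ioS c2 cY Th2E YE TP c1 cP Th1E PE adm AL').
split.
  move=> i j ij v Dv.
  exact: (transported_shift c0 sL cL LK UL lio iio ioL ioS c2 cY Th2E YE TP c1 cP Th1E PE adm AL' ij Dv).
split.
  rewrite [LHS](liftedE c0 HH) -/L.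
  by rewrite [in LHS](invariant_subspaceE c0 sL cL LK UL iio ioL ioS c2 cY Th2E YE TP c1 cP Th1E PE).
split.
  rewrite (lifted_complement c0 cH) -/L.
  exact: (invariant_complementE c0 sL cL LK UL iio ioL ioS c2 cY Th2E YE TP c1 cP Th1E PE).
exact: (model_intertwining c0 sL cL LK UL lio iio ioL ioS c2 cY Th2E YE TP c1 cP Th1E PE adm AL' GE).
Qed.
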